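(* Let $d\geq 2$ and let $m\in\mathscr{M}(\dot{W}^1_1(\mathbb{R}^d),\dot{W}^1_1(\mathbb{R}^d))$ be a Fourier multiplier on the homogeneous Sobolev space $\dot{W}^1_1(\mathbb{R}^d)$. Then $m\in C_b(\mathbb{R}^d)$, i.e. $m$ is a bounded continuous function on $\mathbb{R}^d$.
   Context: $\mathscr{F}$ denotes the Fourier transform on tempered distributions, $\mathscr{F}(f)(\xi)=\int_{\mathbb{R}^d}f(x)e^{-2\pi i\langle x,\xi\rangle}\,dx$ for integrable $f$. The homogeneous Sobolev space is $\dot{W}^1_1(\mathbb{R}^d)=\{f\in\mathscr{D}'(\mathbb{R}^d): \partial_j f\in L^1(\mathbb{R}^d),\ j=1,\dots,d\}$, taken modulo constant functions, with norm $\|f\|_{\dot{W}^1_1(\mathbb{R}^d)}=\sum_{j=1}^d\|\partial_j f\|_{L^1(\mathbb{R}^d)}$ ($\partial_j$ are distributional derivatives); it is a Banach space. A function $m\in L^\infty(\mathbb{R}^d)$ is a Fourier multiplier on $X=\dot{W}^1_1(\mathbb{R}^d)$, written $m\in\mathscr{M}(X,X)$, if there is a bounded linear operator $T:X\to X$ such that $\mathscr{F}(Tf)=m\,\mathscr{F}(f)$ for all $f$ in the Schwartz space $\mathscr{S}(\mathbb{R}^d)$ (as $Tf$ is a class modulo constants, this means that $\mathscr{F}^{-1}(m\mathscr{F}(f))$ is a representative of $Tf$). As usual, elements of $L^\infty$ are identified when they agree almost everywhere, so ''$m\in C_b(\mathbb{R}^d)$'' means that $m$ agrees a.e. with a bounded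 continuous function on $\mathbb{R}^d$. *)

(* Defs.v *)
From HB Require Import structures.
From mathcomp Require Import all_boot all_order all_algebra.
From mathcomp Require Import complex.
From mathcomp Require Import all_classical all_reals all_analysis.

Set Implicit Arguments.
Unset Strict Implicit.
Unset Printing Implicit Defensive.

Import Order.TTheory GRing.Theory Num.Theory.
Import numFieldNormedType.Exports.

Local Open Scope classical_set_scope.
Local Open Scope ring_scope.

(* [Rcomplex R] is R[i] with its modulus taken in R and with scalars in R; the
   instances below make it a real normed module, so that the topology and the
   (real) differential calculus of the library apply to complex-valued maps. *)
Section complex_normed_module.
Variable R : realType.

HB.instance Definition _ :=
  PseudoMetric.copy (Rcomplex R) (pseudoMetric_normed (Rcomplex R)).
HB.instance Definition _ := isPointed.Build (Rcomplex R) 0.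
HB.instance Definition _ :=
  NormedZmod_PseudoMetric_eq.Build R (Rcomplex R) erefl.

Let normrZ_complex (l : R) (z : Rcomplex R) : `|l *: z| = `|l| * `|z|.
Proof.
case: z => a b; rewrite /Num.norm /= !exprMn -mulrDr sqrtrM ?sqr_ge0//.
by rewrite sqrtr_sqr.
Qed.

HB.instance Definition _ :=
  PseudoMetricNormedZmod_Lmodule_isNormedModule.Build R (Rcomplex R)
    normrZ_complex.

End complex_normed_module.

Definition rV_display : measure_display -> measure_display.
Proof. exact. Qed.

(* The sigma-algebra on R^n generated by the coordinates, i.e. the Borel one. *)
Section measurable_rV.
Variables (R : realType) (n : nat).

Let coord (i : 'I_n) (x : 'rV[R]_n) : R := x ord0 i.

Let rV_set0 : g_sigma_preimage coord set0.
Proof. exact: sigma_algebra0. Qed.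

Let rV_setC A : g_sigma_preimage coord A -> g_sigma_preimage coord (~` A).
Proof. exact: sigma_algebraC. Qed.

Let rV_bigcup (F : (set 'rV[R]_n)^nat) :
  (forall i, g_sigma_preimage coord (F i)) ->
  g_sigma_preimage coord (\bigcup_i (F i)).
Proof. exact: sigma_algebra_bigcup. Qed.

HB.instance Definition _ := @isMeasurable.Build (rV_display default_measure_display)
  'rV[R]_n (g_sigma_preimage coord) rV_set0 rV_setC rV_bigcup.

Lemma measurable_coord (i : 'I_n) :
  measurable_fun [set: 'rV[R]_n] (fun x => x ord0 i).
Proof.
move=> _ Y mY; rewrite setTI; apply: sub_sigma_algebra => /=.
rewrite -bigcup_seq/=; exists i => /=; first by rewrite mem_index_enum.
by exists Y => //; rewrite setTI.
Qed.

End measurable_rV.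

Lemma measurable_fun_coordP (R : realType) d (T : measurableType d) n
    (f : T -> 'rV[R]_n) :
  (forall i, measurable_fun [set: T] (fun t => f t ord0 i)) ->
  measurable_fun [set: T] f.
Proof.
move=> mf.
suff : g_sigma_preimage (fun i => (fun x : 'rV[R]_n => x ord0 i) \o f)
    `<=` measurable.
  rewrite g_sigma_preimage_comp => prefS _ A mA.
  by apply: prefS; exists A.
apply: smallest_sub; first exact: sigma_algebra_measurable.
case: n f mf => [|k] f mf; first by rewrite big_ord0.
rewrite -bigcup_mkord_ord; apply: bigcup_sub => i Ii.
by move=> A [B mB <-]; exact: mf.
Qed.

(* Lebesgue measure on R^n, by recursion: the image of the product of the
   one-dimensional Lebesgue measure and of that of R^(n-1) under the
   identification R * R^(n-1) = R^n. *)
Section lebesgue_rV.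
Variable R : realType.

Definition consrV n (p : R * 'rV[R]_n) : 'rV[R]_n.+1 :=
  \row_i if unlift ord0 i is Some j then p.2 ord0 j else p.1.

Lemma consrV0 n (p : R * 'rV[R]_n) : consrV p ord0 ord0 = p.1.
Proof. by rewrite mxE unlift_none. Qed.

Lemma consrVS n (p : R * 'rV[R]_n) i :
  consrV p ord0 (lift ord0 i) = p.2 ord0 i.
Proof. by rewrite mxE liftK. Qed.

Lemma measurable_consrV n : measurable_fun setT (@consrV n).
Proof.
apply: measurable_fun_coordP => i.
case: (unliftP ord0 i) => [j ->|->].
- under eq_fun do rewrite consrVS.
  exact: (measurableT_comp (measurable_coord j) measurable_snd).
- by under eq_fun do rewrite consrV0; exact: measurable_fst.
Qed.

Lemma measurable_unconsrV n :
  measurable_fun setT (fun x : 'rV[R]_n.+1 => \row_i x ord0 (lift ord0 i)).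
Proof.
apply: measurable_fun_coordP => i; under eq_fun do rewrite mxE.
exact: measurable_coord.
Qed.

Section step.
Local Open Scope ereal_scope.
Variables (n : nat) (mu : {sigma_finite_measure set 'rV[R]_n -> \bar R}).

Definition lebesgue_rV_succ : set 'rV[R]_n.+1 -> \bar R :=
  pushforward (lebesgue_measure \x mu) (@consrV n).

Let succ_preimage (A : set 'rV[R]_n.+1) :
  measurable A -> measurable (@consrV n @^-1` A).
Proof. by move=> mA; rewrite -[X in measurable X]setTI; exact: measurable_consrV. Qed.

Let succ0 : lebesgue_rV_succ set0 = 0.
Proof. by rewrite /lebesgue_rV_succ /pushforward preimage_set0 measure0. Qed.

Let succ_ge0 A : 0 <= lebesgue_rV_succ A.
Proof. by rewrite /lebesgue_rV_succ /pushforward; exact: measure_ge0. Qed.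

Let succ_sigma_additive : semi_sigma_additive lebesgue_rV_succ.
Proof.
move=> F mF tF mUF; rewrite /lebesgue_rV_succ /pushforward preimage_bigcup.
apply: measure_semi_sigma_additive.
- by move=> k; exact: succ_preimage.
- apply/trivIsetP => /= i j _ _ ij; rewrite -preimage_setI.
  by move/trivIsetP : tF => /(_ _ _ _ _ ij) ->//; rewrite preimage_set0.
- by rewrite -preimage_bigcup; exact: succ_preimage.
Qed.

HB.instance Definition _ := isMeasure.Build _ _ _ lebesgue_rV_succ
  succ0 succ_ge0 succ_sigma_additive.

Let succ_sigma_finite : sigma_finite setT lebesgue_rV_succ.
Proof.
pose g := fun x : 'rV[R]_n.+1 =>
  (x ord0 ord0, \row_i x ord0 (lift ord0 i)) : R * 'rV[R]_n.
have consrVK : cancel (@consrV n) g.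
  move=> [a v]; rewrite /g consrV0; congr (_, _).
  by apply/rowP => i; rewrite mxE consrVS.
have mg : measurable_fun setT g.
  apply/measurable_fun_pair => /=; first exact: measurable_coord.
  exact: measurable_unconsrV.
have /sigma_finiteP[F [TF ndF Foo]] := sigma_finiteT (@lebesgue_measure R).
have /sigma_finiteP[G [TG ndG Goo]] := sigma_finiteT mu.
exists (fun k => g @^-1` (F k `*` G k)).
  rewrite -preimage_bigcup -(preimage_setT g); congr (_ @^-1` _).
  rewrite -setXTT TF TG predeqE => -[x y]; split.
    move=> [/= [i _ Fix] [j _ Gjy]]; exists (maxn i j) => //; split.
    - by move: x Fix; exact/subsetPset/ndF/leq_maxl.
    - by move: y Gjy; exact/subsetPset/ndG/leq_maxr.
  by move=> [i _ []/= ? ?]; split; exists i.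
move=> k; have [? ?] := Foo k; have [? ?] := Goo k.
split; first by rewrite -[X in measurable X]setTI; apply: mg => //; exact: measurableX.
rewrite /lebesgue_rV_succ /pushforward -comp_preimage.
rewrite (_ : g \o _ = id) ?preimage_id; last exact/funext/consrVK.
by rewrite product_measure1E// lte_mul_pinfty// ge0_fin_numE.
Qed.

HB.instance Definition _ := Measure_isSigmaFinite.Build _ _ _ lebesgue_rV_succ
  succ_sigma_finite.

End step.

Fixpoint lebesgue_rV n : {sigma_finite_measure set 'rV[R]_n -> \bar R} :=
  match n with
  | 0 => dirac (0 : 'rV[R]_0)
  | k.+1 => lebesgue_rV_succ (lebesgue_rV k)
  end.

Lemma measurable_box n (A : 'I_n -> set R) : (forall i, measurable (A i)) ->
  measurable [set x : 'rV[R]_n | forall i, A i (x ord0 i)].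
Proof.
move=> mA; rewrite (_ : [set x | _] = \bigcap_(i in [set: 'I_n])
    ((fun x : 'rV[R]_n => x ord0 i) @^-1` A i)); last first.
  by apply/seteqP; split => x /= h => [i _|i]; exact: h.
apply: fin_bigcap_measurable; first exact: finite_finset.
move=> i _; rewrite -[X in measurable X]setTI.
exact: measurable_coord.
Qed.

Lemma lebesgue_rV_box n (A : 'I_n -> set R) : (forall i, measurable (A i)) ->
  lebesgue_rV n [set x | forall i, A i (x ord0 i)] =
  (\prod_(i < n) lebesgue_measure (A i))%E.
Proof.
elim: n A => [A _|n IH A mA] /=.
  by rewrite big_ord0 diracE mem_set//= => -[].
rewrite /lebesgue_rV_succ /pushforward.
rewrite (_ : _ @^-1` _ =
  A ord0 `*` [set x : 'rV[R]_n | forall i, A (lift ord0 i) (x ord0 i)]).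
  rewrite big_ord_recl -IH; last by move=> i; exact: mA.
  apply: product_measure1E; first exact: mA.
  by apply: (@measurable_box n (fun i => A (lift ord0 i))) => i; exact: mA.
apply/seteqP; split => -[a v] /= => [h|[h0 h] i].
  split; first by have := h ord0; rewrite consrV0.
  by move=> i; have := h (lift ord0 i); rewrite consrVS.
by case: (unliftP ord0 i) => [j ->|->]; rewrite ?consrVS ?consrV0.
Qed.

End lebesgue_rV.

Section fourier_multipliers.
Variables (R : realType) (d : nat).
Local Notation E := 'rV[R]_d.
Local Notation C := (Rcomplex R).
Local Notation mu := (lebesgue_rV R d).
Implicit Types (f g phi psi : E -> C) (K : set E).

Definition cintegrable f :=
  mu.-integrable setT (fun x => (complex.Re (f x))%:E) /\
  mu.-integrable setT (fun x => (complex.Im (f x))%:E).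

Definition cintegral f : C :=
  Complex (\int[mu]_x complex.Re (f x)) (\int[mu]_x complex.Im (f x)).

Definition essentially_bounded f :=
  (fun x => complex.Re (f x)) \in Lfun mu +oo%E /\
  (fun x => complex.Im (f x)) \in Lfun mu +oo%E.

Definition partial (j : 'I_d) f : E -> C := 'D_(delta_mx ord0 j) f.

Definition iter_partial (s : seq 'I_d) f : E -> C := foldr partial f s.

(* C^oo: partial derivatives of all orders exist and are differentiable *)
Definition smooth f := forall s x, differentiable (iter_partial s f) x.

Definition schwartz f :=
  smooth f /\
  forall (k : nat) s, exists M : R,
    forall x, `|x| ^+ k * `|iter_partial s f x| <= M.

Definition vanishes_off K f := forall x, ~ K x -> f x = 0.

Definition test_function phi :=
  smooth phi /\ exists2 K, compact K & vanishes_off K phi.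

(* Distributions are represented by functionals on all functions E -> C, whose
   values outside the space of test functions are irrelevant: distributions are
   only ever compared through [eq_dist] and [eq_mod_cst] below. *)
Definition functional := (E -> C) -> C.
Implicit Types u v : functional.

Definition distribution u :=
  (forall (a : C) phi psi, test_function phi -> test_function psi ->
    u (fun x => a * phi x + psi x) = a * u phi + u psi) /\
  (forall K, compact K -> exists (N : nat) (M : R),
    forall phi, test_function phi -> vanishes_off K phi ->
    forall B : R,
      (forall s x, (size s <= N)%N -> `|iter_partial s phi x| <= B) ->
      `|u phi| <= M * B).

Definition eq_dist u v := forall phi, test_function phi -> u phi = v phi.

Definition regular g : functional := fun phi => cintegral (fun x => g x * phi x).

Definition eq_mod_cst u v :=
  exists c : C, eq_dist u (fun phi => v phi + regular (fun=> c) phi).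

Definition dpartial (j : 'I_d) u : functional := fun phi => - u (partial j phi).

Definition L1_density u g := cintegrable g /\ eq_dist u (regular g).

Definition homogeneous_sobolev u :=
  distribution u /\ forall j, exists g, L1_density (dpartial j u) g.

(* The density is unique up to a null set, so the choice made by [xget] does
   not affect the norm. *)
Definition weak_partial (j : 'I_d) u : E -> C :=
  xget (fun=> 0) [set g | L1_density (dpartial j u) g].

Definition homogeneous_sobolev_norm u : R :=
  \sum_(j < d) \int[mu]_x `|weak_partial j u x|.

(* Bounded linear operators on the quotient of the homogeneous Sobolev space by
   the constants, given by their action on representatives. *)
Definition bounded_linear_operator (T : functional -> functional) :=
  [/\ forall u, homogeneous_sobolev u -> homogeneous_sobolev (T u),
      forall u v, homogeneous_sobolev u -> homogeneous_sobolev v ->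
        eq_mod_cst u v -> eq_mod_cst (T u) (T v),
      forall (a : C) u v, homogeneous_sobolev u -> homogeneous_sobolev v ->
        eq_mod_cst (T (fun phi => a * u phi + v phi))
                   (fun phi => a * T u phi + T v phi) &
      exists M : R, forall u, homogeneous_sobolev u ->
        homogeneous_sobolev_norm (T u) <= M * homogeneous_sobolev_norm u].

Definition dot (x y : E) : R := \sum_(j < d) x ord0 j * y ord0 j.

Definition cis (t : R) : C := Complex (cos t) (sin t).

Definition fourier f : E -> C :=
  fun xi => cintegral (fun x => f x * cis (- (2 * pi * dot x xi))).

Definition inverse_fourier f : E -> C :=
  fun x => cintegral (fun xi => f xi * cis (2 * pi * dot x xi)).

(* For f Schwartz and m essentially bounded, m F(f) is integrable, so that its
   inverse Fourier transform is given by the integral formula. *)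
Definition sobolev_fourier_multiplier (m : E -> C) :=
  essentially_bounded m /\
  exists T, bounded_linear_operator T /\
    forall f, schwartz f ->
      eq_mod_cst (T (regular f))
                 (regular (inverse_fourier (fun xi => m xi * fourier f xi))).

End fourier_multipliers.

(* Main.v *)
(* Let f = (trigonometric polynomial P) * (wide Gaussian).  Testing the multiplier
   on f against (trigonometric polynomial Q) * (Gaussian), and letting the
   Gaussians flatten, gives a discrete inequality (predicate [bohr]): if
   |d_l P| <= Re S pointwise for all l, and |Q| <= K, then the sum of
   p q m(xi) xi_l over the terms p e(x.xi) of P and q e(-x.xi) of Q is at most
   c K (mean of S).  The same pairing with P = 1 shows that m xi_l is a.e. equal
   to a continuous function for each l, hence so is m away from 0, and only the
   existence of a limit at 0 remains.

   Frequencies tending to 0 along a direction v, chosen lacunary, turn P and Q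
   into functions of independent phases s_j: the gradient of P becomes a
   martingale with increments v cos(s_j) A_j (lemma [transfer]), where A_j depends
   on the phases before s_j only, and m is sampled at one chosen frequency a_j for
   each j.  The odd part of m tends to 0: with the Riesz products
   A_j = prod_(i < j) (1 + cos s_i) the martingale is bounded in L1, whereas the
   test function Im prod (1 + i sin(s_j) / sqrt N) sees a sum of order sqrt N.
   For the even part suppose that m tends to beta along a direction e2 and to
   gamma <> beta along w, not parallel to e2; here d >= 2 enters.  Increments
   along w, along e1 = w - e2 and along -e2 can be combined into a process which
   stays bounded in L1 by cancellation, while the multiplier weights the
   increments along w and e2 differently and makes a component of the sum grow
   without bound. *)

Require Import Defs.
From mathcomp Require Import all_boot all_order all_algebra.
From mathcomp Require Import complex.
From mathcomp Require Import all_classical all_reals all_analysis.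
From mathcomp Require Import measurable_realfun ess_sup_inf.
From mathcomp Require Import ring lra zify.
Set Implicit Arguments.
Unset Strict Implicit.
Unset Printing Implicit Defensive.
Import Order.TTheory GRing.Theory Num.Theory.
Import numFieldNormedType.Exports.
Local Open Scope classical_set_scope.
Local Open Scope ring_scope.

(** The delicate point is the even part. The piece [ypart] of a Riesz product pairs to something
    large with a bounded function, so it cannot itself be bounded in L1. It is therefore used with a
    tiny factor [kap], for which [1 - kap * ypart] is nonnegative, and all later moves are
    multiplied by this number: the component along e2 then telescopes to a nonnegative process of
    mean one, minus 1. A block yields a signal of order [kap] times the large pairing, and an L1
    cost [2 * kap] along e1, so [1 / kap] blocks are run. A bounded test function must see all of
    them, and this rests on two laws for the opening moves of a block. Under their Riesz density the
    weight [stop] has mean [1 - 1 / (9 n)]; as [n] is also the number of blocks, the chain goes on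
    to the end with probability at least 8 / 9. Under the uniform law [1 - stop] has mean at least 1
    / 9, and the block after the tested one is uniform in the relevant term, so that the test is
    really switched on. Means over phases are averages over finite grids, exact for trigonometric
    polynomials of small degree. *)

Section complex_basics.
Variable R : realType.
Local Notation C := (Rcomplex R).
Local Notation nC z := (`|(z : C)|).
Implicit Types z w : C.

Lemma normCE z : `|z| = Num.sqrt (complex.Re z ^+ 2 + complex.Im z ^+ 2).
Proof. by case: z. Qed.

Lemma normC_mul z w : nC (z * w) = nC z * nC w.
Proof. exact: ComplexField.Normc.normcM. Qed.

Lemma normC_Re z : `|complex.Re z| <= `|z|.
Proof.
rewrite normCE -sqrtr_sqr ler_sqrt ?addr_ge0 ?sqr_ge0//.
by rewrite lerDl sqr_ge0.
Qed.

Lemma normC_Im z : `|complex.Im z| <= `|z|.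
Proof.
rewrite normCE -sqrtr_sqr ler_sqrt ?addr_ge0 ?sqr_ge0//.
by rewrite lerDr sqr_ge0.
Qed.

Lemma normC_ReIm z : `|z| <= `|complex.Re z| + `|complex.Im z|.
Proof.
rewrite normCE -[leRHS]ger0_norm ?addr_ge0// -sqrtr_sqr ler_sqrt ?sqr_ge0//.
rewrite sqrrD !real_normK ?num_real// -addrA lerD2l lerDr.
by rewrite mulrn_wge0// mulr_ge0.
Qed.

Definition rC (x : R) : C := Complex x 0.

Lemma normC_real x : `|rC x| = `|x|.
Proof. by rewrite normCE /= expr0n addr0 sqrtr_sqr. Qed.

Lemma rCD x y : rC (x + y) = rC x + rC y.
Proof. by congr Complex; rewrite /= addr0. Qed.
Lemma rCM x y : rC (x * y) = rC x * rC y.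
Proof. by rewrite /rC; congr Complex; rewrite /=; ring. Qed.
Lemma rCN x : rC (- x) = - rC x.
Proof. by congr Complex; rewrite oppr0. Qed.
Lemma rC_sum (I : Type) (r : seq I) (F : I -> R) :
  rC (\sum_(i <- r) F i) = \sum_(i <- r) rC (F i).
Proof. exact: (big_morph rC rCD (erefl : rC 0 = 0)). Qed.

Lemma Re_sum (I : Type) (r : seq I) (F : I -> C) :
  complex.Re (\sum_(i <- r) F i) = \sum_(i <- r) complex.Re (F i).
Proof. by apply: (big_morph (@complex.Re R)) => // -[? ?] [? ?]. Qed.
Lemma Im_sum (I : Type) (r : seq I) (F : I -> C) :
  complex.Im (\sum_(i <- r) F i) = \sum_(i <- r) complex.Im (F i).
Proof. by apply: (big_morph (@complex.Im R)) => // -[? ?] [? ?]. Qed.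

Lemma Re_add z w : complex.Re (z + w) = complex.Re z + complex.Re w.
Proof. by case: z; case: w. Qed.
Lemma Im_add z w : complex.Im (z + w) = complex.Im z + complex.Im w.
Proof. by case: z; case: w. Qed.
Lemma Re_mul z w : complex.Re (z * w) =
  complex.Re z * complex.Re w - complex.Im z * complex.Im w.
Proof. by case: z; case: w. Qed.
Lemma Im_mul z w : complex.Im (z * w) =
  complex.Re z * complex.Im w + complex.Im z * complex.Re w.
Proof. by case: z; case: w. Qed.
Lemma C_eqP z w : complex.Re z = complex.Re w -> complex.Im z = complex.Im w ->
  z = w.
Proof. by case: z => a b; case: w => a' b' /= -> ->. Qed.

Lemma cisD (s t : R) : cis (s + t) = cis s * cis t.
Proof. by apply: C_eqP; rewrite /= ?cosD ?sinD//; ring. Qed.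

Lemma cis0 : cis 0 = 1 :> C.
Proof. by apply: C_eqP; rewrite /= ?cos0 ?sin0. Qed.

Lemma normC_cis (t : R) : `|cis t| = 1.
Proof. by rewrite normCE /= cos2Dsin2 sqrtr1. Qed.

Lemma cis_natM (n : nat) (t : R) : cis (n%:R * t) = cis t ^+ n.
Proof.
elim: n => [|n IH]; first by rewrite mul0r cis0.
by rewrite exprS -IH -cisD; congr cis; rewrite -natr1; ring.
Qed.

Lemma cis_2pi_int (k : int) : cis (2 * pi * k%:~R) = 1 :> C.
Proof.
have natcase (n : nat) : cis (2 * pi * n%:R) = 1 :> C.
  rewrite mulrC cis_natM (_ : cis _ = 1) ?expr1n//.
  by apply: C_eqP; rewrite /= mulrC mulr_natr ?cos2pi ?sin2pi.
case: k => n; first exact: natcase.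
rewrite NegzE mulrNz mulrN.
have := cisD (2 * pi * n.+1%:R) (- (2 * pi * n.+1%:R)).
by rewrite subrr cis0 natcase mul1r => <-.
Qed.

End complex_basics.

(** * Means over independent phases, as finite averages over roots of unity *)

Section grid_average.
Variable R : realType.
Local Notation C := (Rcomplex R).
Implicit Types (A B : seq R -> R) (s : seq R).

(** For trigonometric polynomials of degree below [q] in each phase this average is exactly the mean
    over the torus, while its positivity and its Fubini theorem are those of finite sums. *)
Fixpoint gridE (q N : nat) (A : seq R -> R) : R :=
  if N is N'.+1 then
    q%:R^-1 * \sum_(i < q) gridE q N' (fun s => A (2 * pi * (i%:R / q%:R) :: s))
  else A [::].

Lemma gridE_le q N A B : (forall s, size s = N -> A s <= B s) ->
  gridE q N A <= gridE q N B.
Proof.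
elim: N A B => [|N IH] A B AB /=; first exact: AB.
rewrite ler_wpM2l ?invr_ge0//; apply: ler_sum => i _.
by apply: IH => s sN; apply: AB; rewrite /= sN.
Qed.

Lemma eq_gridE q N A B : (forall s, size s = N -> A s = B s) ->
  gridE q N A = gridE q N B.
Proof.
by move=> AB; apply/eqP; rewrite eq_le !gridE_le// => s sN; rewrite AB.
Qed.

Lemma gridE_lin q N A B (a b : R) :
  gridE q N (fun s => a * A s + b * B s) = a * gridE q N A + b * gridE q N B.
Proof.
elim: N A B => [//|N IH] A B /=.
under eq_bigr do rewrite (IH (fun s => A (_ :: s)) (fun s => B (_ :: s))).
by rewrite big_split /= -!mulr_sumr; ring.
Qed.

Lemma gridED q N A B : gridE q N (fun s => A s + B s) = gridE q N A + gridE q N B.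
Proof.
rewrite -[RHS]/(_ + _) -(mul1r (gridE q N A)) -(mul1r (gridE q N B)) -gridE_lin.
by apply: eq_gridE => s _; rewrite !mul1r.
Qed.

Lemma gridEZ q N A a : gridE q N (fun s => a * A s) = a * gridE q N A.
Proof.
rewrite -[RHS]addr0 -(mul0r (gridE q N A)) -gridE_lin.
by apply: eq_gridE => s _; rewrite mul0r addr0.
Qed.

Lemma gridE0 q N : gridE q N (fun=> 0) = 0.
Proof. by have := @gridEZ q N (fun=> 0) 0; rewrite !mul0r. Qed.

Lemma gridE_sum (I : Type) (r : seq I) q N (F : I -> seq R -> R) :
  gridE q N (fun s => \sum_(i <- r) F i s) = \sum_(i <- r) gridE q N (F i).
Proof.
elim: r => [|i r IH].
  by rewrite big_nil -[RHS](gridE0 q N); apply: eq_gridE => s _; rewrite big_nil.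
rewrite big_cons -IH -gridED; apply: eq_gridE => s _.
by rewrite big_cons.
Qed.

Lemma gridE_cst q N (a : R) : (0 < q)%N -> gridE q N (fun=> a) = a.
Proof.
move=> q0; elim: N => [//|N IH] /=.
rewrite IH sumr_const card_ord -[a *+ q]mulr_natl mulrA mulVf ?mul1r//.
by rewrite pnatr_eq0 -lt0n.
Qed.

Lemma gridE_cat q N M A :
  gridE q (N + M) A = gridE q N (fun s => gridE q M (fun t => A (s ++ t))).
Proof.
elim: N A => [//|N IH] A; rewrite addSn /=.
by congr (_ * _); apply: eq_bigr => i _; rewrite IH.
Qed.

Lemma gridE_prod q N M A B :
  gridE q N (fun s => gridE q M (fun t => A s * B t)) =
  gridE q N A * gridE q M B.
Proof.
under eq_gridE do rewrite gridEZ.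
by rewrite mulrC -gridEZ; apply: eq_gridE => s _; rewrite mulrC.
Qed.

(** A geometric sum whose ratio is a [q]-th root of unity; the condition on [k] keeps the ratio
    different from 1. *)
Lemma cis_grid_sum (q : nat) (k : int) : (0 < q)%N -> k != 0 ->
  (`|k| < q)%N ->
  \sum_(i < q) cis (k%:~R * (2 * pi * (i%:R / q%:R))) = 0 :> C.
Proof.
move=> q0 k0 kq.
have qN0 : q%:R != 0 :> R by rewrite pnatr_eq0 -lt0n.
pose t : R := k%:~R * (2 * pi / q%:R).
have E i : cis (k%:~R * (2 * pi * (i%:R / q%:R))) = cis t ^+ i :> C.
  by rewrite -cis_natM; congr cis; rewrite /t; ring.
under eq_bigr do rewrite E.
have tq : cis t ^+ q = 1.
  rewrite -cis_natM -(cis_2pi_int R k); congr cis.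
  by rewrite /t; field.
have t1 : cis t != 1.
  apply/eqP => /(congr1 (@complex.Re R)) /= ct1.
  (* Half angle: a ratio with cosine 1 would force [sin h = 0], impossible for [h] strictly between
     0 and pi in absolute value. *)
  pose h : R := pi * (k%:~R / q%:R).
  have hk : t = h + h by rewrite /t /h; ring.
  move: ct1; rewrite hk cosD => ct1.
  have : sin h = 0.
    apply/eqP; rewrite -sqrf_eq0; apply/eqP.
    by have := cos2Dsin2 h; move: ct1; rewrite -!expr2; lra.
  have key (x : R) : 0 < x -> x < 1 -> sin (pi * x) != 0.
    move=> x0 x1; rewrite gt_eqF// sin_gt0_pi// mulr_gt0 ?pi_gt0//=.
    by rewrite gtr_pMr// pi_gt0.
  have : (`|k| < q)%N by [].
  rewrite /h.
  have [kp|kn] : k < 0 \/ 0 < k by lia.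
    have -> : pi * (k%:~R / q%:R) = - (pi * ((- k)%:~R / q%:R)) :> R.
      by rewrite mulrNz; ring.
    move=> lq; rewrite sinN => /eqP; rewrite oppr_eq0; apply/negP/key.
      by rewrite divr_gt0 ?ltr0z ?ltr0n// oppr_gt0.
    rewrite ltr_pdivrMr ?ltr0n// mul1r (pmulrn 1 q) ltr_int.
    lia.
  move=> lq; apply/eqP/key; first by rewrite divr_gt0 ?ltr0z ?ltr0n.
  rewrite ltr_pdivrMr ?ltr0n// mul1r (pmulrn 1 q) ltr_int; lia.
have := subrX1 (cis t) q.
rewrite tq subrr => /eqP; rewrite eq_sym mulf_eq0 subr_eq0 (negbTE t1)/=.
by move=> /eqP.
Qed.

(** The constant [c] serves twice: the induction absorbs into it the character of the first phase,
    and its values 1 and -i recover real and imaginary parts from a real-valued average. *)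
Lemma gridE_cis q N (f : nat -> int) (c : C) : (0 < q)%N ->
  (forall i, (i < N)%N -> (`|f i| < q)%N) ->
  gridE q N (fun s => complex.Re (c * cis (\sum_(i < N) (f i)%:~R * s`_i))) =
  if all (fun i => f i == 0) (iota 0 N) then complex.Re c else 0.
Proof.
move=> q0; elim: N f c => [|N IH] f c fq.
  by rewrite /= big_ord0 cis0 mulr1.
rewrite /=.
have E (i : 'I_q) : gridE q N (fun s => complex.Re (c * cis (\sum_(j < N.+1)
     (f j)%:~R * (2 * pi * (i%:R / q%:R) :: s)`_j))) =
   if all (fun i => f i.+1 == 0) (iota 0 N) then
     complex.Re (c * cis ((f 0%N)%:~R * (2 * pi * (i%:R / q%:R)))) else 0.
  rewrite -(IH (f \o succn)); last by move=> j jN; apply: fq.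
  apply: eq_gridE => s _; rewrite big_ord_recl cisD mulrA.
  by congr (complex.Re (_ * _)).
under eq_bigr do rewrite E.
have -> : all (fun i => f i == 0) (iota 1 N) = all (fun i => f i.+1 == 0) (iota 0 N).
  by rewrite -[1%N]addn0 iotaDl all_map.
case: (all _ (iota 0 N)); last by rewrite andbF sumr_const mul0rn mulr0.
rewrite andbT -Re_sum -mulr_sumr.
case: ifPn => [/eqP f0|f0]; last first.
  by rewrite cis_grid_sum ?mulr0 ?fq//= mulr0.
rewrite f0; under eq_bigr do rewrite mul0r cis0.
rewrite mulr_sumr Re_sum; under eq_bigr do rewrite mulr1.
rewrite sumr_const card_ord.
by rewrite -[complex.Re c *+ q]mulr_natl mulrA mulVf ?mul1r// pnatr_eq0 -lt0n.
Qed.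

End grid_average.

(** * Trigonometric polynomials, their frequencies, and the discrete inequality *)

Section transfer.
Variables (R : realType) (d : nat).
Local Notation C := (Rcomplex R).
Local Notation E := 'rV[R]_d.
Local Notation nC z := (`|(z : C)|).

Definition trig (P : seq (C * E)) (x : E) : C :=
  \sum_(p <- P) p.1 * cis (2 * pi * dot x p.2).

Definition dtrig (l : 'I_d) (P : seq (C * E)) : seq (C * E) :=
  [seq (rC (p.2 ord0 l) * p.1, p.2) | p : C * E <- P].

(* The right-hand side is the mean value of [trig S], which replaces the L1 norm
   of the gradient of the almost periodic function [trig P]. *)
Definition bohr (c : R) (M : E -> C) := forall (P Q S : seq (C * E)) (K : R),
  (forall x l, nC (trig (dtrig l P) x) <= complex.Re (trig S x)) ->
  (forall x, nC (trig Q x) <= K) ->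
  forall l : 'I_d,
  nC (\sum_(p <- P) \sum_(g <- Q)
     if p.2 + g.2 == 0 then p.1 * g.1 * (M p.2 * rC (p.2 ord0 l)) else 0) <=
  c * K * complex.Re (\sum_(s <- S | s.2 == 0) s.1).

Definition kdot N (k : {poly int}) (s : seq R) : R :=
  \sum_(i < N) (k`_i)%:~R * s`_i.

(* Integer frequency vectors are coded as integer polynomials. *)
Definition tpoly N (A : seq R -> R) (l : seq (C * {poly int})) :=
  all (fun p : C * {poly int} => (size p.2 <= N)%N) l /\
  forall s, size s = N -> rC (A s) = \sum_(p <- l) p.1 * cis (kdot N p.2 s).

Lemma kdotD N (k k' : {poly int}) s : kdot N (k + k') s = kdot N k s + kdot N k' s.
Proof.
rewrite /kdot -big_split; apply: eq_bigr => i _.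
by rewrite coefD intrD mulrDl.
Qed.

Lemma kdotN N (k : {poly int}) s : kdot N (- k) s = - kdot N k s.
Proof.
rewrite /kdot -sumrN; apply: eq_bigr => i _.
by rewrite coefN mulrNz mulNr.
Qed.

Lemma kdotXn N j s : (j < N)%N -> kdot N 'X^j s = s`_j.
Proof.
move=> jN; rewrite /kdot (bigD1 (Ordinal jN)) //= coefXn eqxx mul1r.
rewrite big1 ?addr0// => i /negP ij; rewrite coefXn.
by case: eqP => [e|_]; rewrite ?mul0r//; case: ij; apply/eqP/val_inj.
Qed.

Lemma kdot0 N s : kdot N 0 s = 0.
Proof. by rewrite /kdot big1// => i _; rewrite coef0 mul0r. Qed.

Lemma kdot_take N j (k : {poly int}) s : (size k <= j)%N -> (j <= N)%N ->
  kdot j k (take j s) = kdot N k s.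
Proof.
move=> kj jN; rewrite /kdot (big_ord_widen N (fun i => (k`_i)%:~R * (take j s)`_i))//.
rewrite big_mkcond; apply: eq_bigr => i _ /=.
case: ifPn => ij; first by rewrite nth_take.
by rewrite nth_default ?mul0r// (leq_trans kj)// leqNgt.
Qed.

(** Orthogonality on the grid leaves only the zero frequency, since all coefficients are below [q]
    in absolute value. Again [c] selects the real or the imaginary part. *)
Lemma gridE_mean q N (l : seq (C * {poly int})) (c : C) : (0 < q)%N ->
  all (fun p : C * {poly int} => (size p.2 <= N)%N) l ->
  (forall (p : C * {poly int}) i, p \in l -> (`|((p.2 : {poly int})`_i)%R| < q)%N) ->
  gridE q N (fun s => complex.Re (c * \sum_(p <- l) p.1 * cis (kdot N p.2 s))) =
  complex.Re (c * \sum_(p <- l | p.2 == 0) p.1).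
Proof.
move=> q0 /allP sl lq.
rewrite big_mkcond !mulr_sumr Re_sum.
rewrite (@eq_gridE _ q N _ (fun s => \sum_(p <- l)
   complex.Re (c * p.1 * cis (kdot N p.2 s)))); last first.
  by move=> s _; rewrite mulr_sumr Re_sum; under eq_bigr do rewrite mulrA.
rewrite gridE_sum big_seq [RHS]big_seq; apply: eq_bigr => p pl.
rewrite (@gridE_cis R q N (fun i => (p.2 : {poly int})`_i) (c * p.1))//; last by move=> i _; apply: lq.
rewrite (_ : all _ _ = (p.2 == 0)); first by case: ifP; rewrite ?mulr0.
apply/allP/eqP => [h|-> i _]; last by rewrite coef0.
apply/polyP => i; rewrite coef0; have [iN|Ni] := ltnP i N.
  by apply/eqP/h; rewrite mem_iota.
by rewrite nth_default// (leq_trans (sl _ pl)).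
Qed.

(** The character with integer vector [k] in the phases [2 pi x.a_i] of a point [x] has this
    frequency in space, see [kdot_phases]. *)
Definition freq N (a : nat -> E) (k : {poly int}) : E :=
  \sum_(i < N) (k`_i)%:~R *: a i.

Definition phases N (a : nat -> E) (x : E) : seq R :=
  mkseq (fun i => 2 * pi * dot x (a i)) N.

Lemma dotD x y z : @dot R d x (y + z) = dot x y + dot x z.
Proof. by rewrite /dot -big_split; apply: eq_bigr => i _; rewrite mxE mulrDr. Qed.
Lemma dotZ x t y : @dot R d x (t *: y) = t * dot x y.
Proof. by rewrite /dot mulr_sumr; apply: eq_bigr => i _; rewrite mxE; ring. Qed.
Lemma dot0 x : @dot R d x 0 = 0.
Proof. by rewrite /dot big1// => i _; rewrite mxE mulr0. Qed.
Lemma dot_sum x (I : Type) (r : seq I) (F : I -> E) :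
  dot x (\sum_(i <- r) F i) = \sum_(i <- r) dot x (F i).
Proof. exact: (big_morph (dot x) (dotD x) (dot0 x)). Qed.

Lemma kdot_phases N a k x : kdot N k (phases N a x) = 2 * pi * dot x (freq N a k).
Proof.
rewrite /kdot /freq dot_sum mulr_sumr; apply: eq_bigr => i _.
by rewrite nth_mkseq// dotZ; ring.
Qed.

Lemma freqD N a k k' : freq N a (k + k') = freq N a k + freq N a k'.
Proof.
rewrite /freq -big_split; apply: eq_bigr => i _.
by rewrite coefD intrD scalerDl.
Qed.
Lemma freqN N a k : freq N a (- k) = - freq N a k.
Proof.
rewrite /freq -sumrN; apply: eq_bigr => i _.
by rewrite coefN mulrNz scaleNr.
Qed.
Lemma freqXn N a j : (j < N)%N -> freq N a 'X^j = a j.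
Proof.
move=> jN; rewrite /freq (bigD1 (Ordinal jN)) //= coefXn eqxx scale1r.
rewrite big1 ?addr0// => i /negP ij; rewrite coefXn.
by case: eqP => [e|_]; rewrite ?scale0r//; case: ij; apply/eqP/val_inj.
Qed.

Lemma ler_entry (x : E) l : `|x ord0 l| <= `|x|.
Proof.
rewrite [`|x|]/Num.norm /= mx_normrE.
exact: (le_bigmax 0 (fun i : 'I_1 * 'I_d => `|x i.1 i.2|) (ord0, l)).
Qed.

Lemma freq_small N a (k : {poly int}) (j D : nat) (rho : R) :
  (size k <= j)%N -> (forall i, (`|(k`_i)%R| <= D)%N) -> (j <= N)%N ->
  (forall i, (i < j)%N -> `|a i| <= rho) -> 0 <= rho ->
  `|freq N a k| <= (N * D)%:R * rho.
Proof.
move=> kj kD jN arho rho0; apply: (le_trans (ler_norm_sum _ _ _)).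
apply: (@le_trans _ _ (\sum_(i < N) D%:R * rho)); last first.
  by rewrite sumr_const card_ord natrM -[leLHS]mulr_natl mulrA.
apply: ler_sum => i _; rewrite normrZ.
have [ij|ji] := ltnP i j; last first.
  by rewrite nth_default ?(leq_trans kj)// normr0 mul0r mulr_ge0.
apply: ler_pM => //; last exact: arho.
rewrite -intr_norm -[D%:R]/(D%:R) (pmulrn 1 D) ler_int.
by have := kD i; lia.
Qed.

(** Lacunarity makes the top nonzero coefficient dominate: it contributes at least [|a j|] in norm,
    and all smaller indices together at most [(N * D)%:R * rho j], which is less. Hence resonance in
    space is the same as resonance of independent phases. *)
Lemma freq_inj N a (k : {poly int}) (D : nat) (rho : nat -> R) :
  (size k <= N)%N -> (forall i, (`|(k`_i)%R| <= D)%N) ->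
  (forall j i, (i < j < N)%N -> `|a i| <= rho j) ->
  (forall j, (j < N)%N -> 0 <= rho j /\ (N * D)%:R * rho j < `|a j|) ->
  (freq N a k == 0) = (k == 0).
Proof.
move=> kN kD arho ra; apply/eqP/eqP => [h|->]; last first.
  by rewrite /freq big1// => i _; rewrite coef0 scale0r.
apply/eqP; rewrite -size_poly_eq0 -leqn0 leqNgt; apply/negP => k0.
pose j := (size k).-1.
have jN : (j < N)%N by rewrite /j prednK.
have [rj raj] := ra _ jN.
have lk : lead_coef k != 0 by rewrite lead_coef_eq0 -size_poly_gt0.
pose k1 := k - (lead_coef k)%:P * 'X^j.
have k1j : (size k1 <= j)%N.
  apply/leq_sizeP => i ji; rewrite coefB coefCM coefXn.
  case: eqP => [->|/eqP ij]; first by rewrite mulr1 /lead_coef subrr.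
  have : (j < i)%N by rewrite ltn_neqAle eq_sym ij.
  by rewrite /= mulr0 subr0 /j prednK// => ki; rewrite nth_default.
have kE : k = k1 + (lead_coef k)%:P * 'X^j by rewrite subrK.
have k1D i : (`|(k1`_i)%R| <= D)%N.
  rewrite coefB coefCM coefXn; case: eqP => [->|_].
    by rewrite mulr1 /lead_coef subrr.
  by rewrite mulr0 subr0.
have fl : freq N a ((lead_coef k)%:P * 'X^j) = (lead_coef k)%:~R *: a j.
  rewrite /freq (bigD1 (Ordinal jN)) //= coefCM coefXn eqxx mulr1.
  rewrite big1 ?addr0// => i /negP ij; rewrite coefCM coefXn.
  by case: eqP => [e|_]; rewrite ?mulr0 ?scale0r//; case: ij; apply/eqP/val_inj.
have := @freq_small N a k1 j D (rho j) k1j k1D (ltnW jN).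
move=> /(_ _ rj) h1.
have {h1} : `|freq N a k1| <= (N * D)%:R * rho j.
  by apply: h1 => i ij; apply: arho; rewrite ij.
move: h; rewrite {1}kE freqD fl => /eqP; rewrite addr_eq0 => /eqP ->.
rewrite normrN normrZ => h; have := le_lt_trans h raj.
by apply/negP; rewrite -leNgt ler_peMl// -intr_norm ler1z; move: lk; lia.
Qed.

End transfer.

(** Element [j] dictates through [rho j] how small its predecessors must be. So the last one is
    chosen first, and the induction goes on below [min tau rho]. *)
Lemma lacunary_choice (R : realType) (T : Type) (nm : T -> R) (N : nat)
    (Q : nat -> T -> R -> Prop) :
  (forall j, (j < N)%N -> forall tau, 0 < tau ->
    exists a, nm a < tau /\ exists2 rho, 0 < rho & Q j a rho) ->
  (0 < N)%N ->
  forall tau, 0 < tau ->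
  exists a : nat -> T, exists rho : nat -> R, forall j, (j < N)%N ->
   [/\ Q j (a j) (rho j), 0 < rho j, nm (a j) < tau &
       forall i, (i < j)%N -> nm (a i) < rho j].
Proof.
elim: N => [//|N IH] H _ tau tau0.
have [a [atau [rho rho0 Qa]]] := H N (ltnSn N) _ tau0.
have [N0|N0] := posnP N.
  subst N; by exists (fun=> a), (fun=> rho) => -[|//] _; split.
have m0 : 0 < Num.min tau rho by rewrite lt_min tau0.
have H1 j : (j < N)%N -> forall tau, 0 < tau ->
    exists a, nm a < tau /\ exists2 rho, 0 < rho & Q j a rho.
  by move=> jN; apply: H; rewrite ltnS ltnW.
have [a' [rho' H']] := IH H1 N0 _ m0.
exists (fun j => if (j < N)%N then a' j else a).
exists (fun j => if (j < N)%N then rho' j else rho) => j.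
rewrite ltnS leq_eqVlt => /orP[/eqP ->|jN].
  rewrite ltnn; split => // i iN; rewrite iN.
  by have [_ _] := H' _ iN; rewrite lt_min => /andP[].
rewrite jN; have [Qj rj aj aij] := H' _ jN; split => //.
  by move: aj; rewrite lt_min => /andP[].
by move=> i ij; rewrite (ltn_trans ij jN); apply: aij.
Qed.

(** * From independent phases to lacunary frequencies *)

Section transfer_lemma.
Variables (R : realType) (d : nat).
Local Notation C := (Rcomplex R).
Local Notation E := 'rV[R]_d.
Local Notation nC z := (`|(z : C)|).

Lemma rC_cos (t : R) : rC (cos t) = rC (2^-1) * (cis t + cis (- t)) :> C.
Proof. by apply: C_eqP; rewrite /= cosN sinN; field. Qed.

Lemma list_bound (l : seq (C * {poly int})) : exists D, forall (p : C * {poly int}) i,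
  p \in l -> (`|((p.2 : {poly int})`_i)%R| <= D)%N.
Proof.
elim: l => [|p l [D HD]]; first by exists 0%N.
pose D' := (\max_(i < size p.2) `|((p.2 : {poly int})`_i)%R|)%N.
exists (maxn D D') => p' i; rewrite inE => /orP[/eqP ->|]; last first.
  by move=> /HD h; rewrite leq_max h.
rewrite leq_max; have [ip|pi] := ltnP i (size p.2); last first.
  by rewrite nth_default// absz0 leq0n.
apply/orP; right.
exact: (@leq_bigmax _ (fun i : 'I_(size p.2) => `|((p.2 : {poly int})`_i)%R|%N) (Ordinal ip)).
Qed.

(** The pairs of total frequency zero make up the constant term of the product of [A], an
    exponential of [s_j] or of [- s_j], and [G]; the mean of this product collects them. Its
    frequencies have coefficients at most [2 D + 1], whence the condition on [q]. *)
Lemma pair_mean q N j (A G : seq R -> R) (lA lG : seq (C * {poly int})) (D : nat)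
    (b : bool) :
  (j < N)%N -> tpoly j A lA -> tpoly N G lG ->
  (forall (p : C * {poly int}) i, p \in lA -> (`|((p.2 : {poly int})`_i)%R| <= D)%N) ->
  (forall (p : C * {poly int}) i, p \in lG -> (`|((p.2 : {poly int})`_i)%R| <= D)%N) ->
  (D.*2.+1 < q)%N ->
  \sum_(p <- lA) \sum_(g <- lG)
    (if p.2 + (-1) ^+ b * 'X^j + g.2 == 0 then p.1 * g.1 else 0) =
  Complex (gridE q N (fun s => cos (s`_j) * A (take j s) * G s))
    ((-1) ^+ b * gridE q N (fun s => sin (s`_j) * A (take j s) * G s)) :> C.
Proof.
move=> jN [/allP sA EA] [/allP sG EG] DA DG Dq.
have q0 : (0 < q)%N by rewrite (leq_trans _ Dq).
pose L := [seq (p.1 * g.1 : C, p.2 + (-1) ^+ b * 'X^j + g.2 : {poly int}) |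
   p : C * {poly int} <- lA, g : C * {poly int} <- lG].
have LE (F : C * {poly int} -> C) : \sum_(x <- L) F x = \sum_(p <- lA) \sum_(g <- lG)
    F (p.1 * g.1, p.2 + (-1) ^+ b * 'X^j + g.2).
  by rewrite /L big_allpairs_dep.
have -> : \sum_(p <- lA) \sum_(g <- lG)
    (if p.2 + (-1) ^+ b * 'X^j + g.2 == 0 then p.1 * g.1 else 0) =
    \sum_(x <- L | x.2 == 0) x.1.
  by rewrite [RHS]big_mkcond LE.
have sL : all (fun p : C * {poly int} => (size p.2 <= N)%N) L.
  apply/allP => x /allpairsP[[p g] /= [pA gG ->]] /=.
  rewrite (leq_trans (size_polyD _ _))// geq_max sG// andbT.
  rewrite (leq_trans (size_polyD _ _))// geq_max (leq_trans (sA _ pA) (ltnW jN))/=.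
  by rewrite -signr_odd; case: (odd b); rewrite ?expr1 ?expr0 ?mulN1r ?mul1r ?size_polyN size_polyXn.
have qL (p : C * {poly int}) i : p \in L -> (`|((p.2 : {poly int})`_i)%R| < q)%N.
  move=> /allpairsP[[p' g] /= [pA gG ->]] /=.
  rewrite !coefD.
  have h : (`|(((-1) ^+ b * 'X^j : {poly int})`_i)%R| <= 1)%N.
    by case: b {LE sL L}; rewrite ?expr1 ?expr0 ?mulN1r ?mul1r ?coefN coefXn; case: eqP.
  have := DA _ i pA; have := DG _ i gG; move: h Dq; set u := _`_i; set v := _`_i; set w := _`_i.
  by lia.
have fE s : size s = N -> \sum_(x <- L) x.1 * cis (kdot N x.2 s) =
    cis ((-1) ^+ b * s`_j) * rC (A (take j s)) * rC (G s).
  move=> sN; rewrite LE EA ?EG ?size_takel// ?sN ?(ltnW jN)//.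
  rewrite -mulrA mulr_suml mulr_sumr big_seq [RHS]big_seq; apply: eq_bigr => p pA.
  rewrite !mulr_sumr; apply: eq_bigr => g _ /=.
  rewrite !kdotD (@kdot_take R N j _ s (sA _ pA) (ltnW jN)).
  have -> : kdot N ((-1) ^+ b * 'X^j) s = (-1) ^+ b * s`_j.
    by case: b {LE sL qL L}; rewrite ?expr1 ?expr0 ?mulN1r ?mul1r ?kdotN kdotXn.
  by rewrite !cisD; ring.
have mE := @gridE_mean R q N L _ q0 sL qL.
apply: C_eqP; rewrite [RHS]/=.
- have := mE 1; rewrite mul1r => <-; apply: eq_gridE => s sN; rewrite mul1r fE//.
  rewrite !Re_mul /= !mulr0 !subr0; congr (_ * _ * _).
  by case: b {LE sL qL mE fE L}; rewrite ?expr1 ?expr0 ?mulN1r ?mul1r ?cosN.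
- have := mE (Complex 0 (-1)); rewrite Re_mul mul0r sub0r mulN1r opprK => <-.
  rewrite -gridEZ; apply: eq_gridE => s sN; rewrite Re_mul mul0r sub0r mulN1r opprK fE//.
  have -> : (-1) ^+ b * (sin s`_j * A (take j s) * G s) =
      sin ((-1) ^+ b * s`_j) * A (take j s) * G s.
    by case: b {LE sL qL mE fE L}; rewrite ?expr1 ?expr0 ?mulN1r ?mul1r ?sinN; ring.
  by rewrite !Im_mul !Re_mul /=; ring.
Qed.

Lemma normC_sumE (I : Type) (r : seq I) (P : pred I) (F : I -> C) (b : I -> R) :
  (forall i, P i -> nC (F i) <= b i) ->
  nC (\sum_(i <- r | P i) F i) <= \sum_(i <- r | P i) b i.
Proof. by move=> h; apply: (le_trans (ler_norm_sum _ _ _)); apply: ler_sum. Qed.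

Lemma dotN (x y : E) : dot x (- y) = - dot x y.
Proof. by rewrite /dot -sumrN; apply: eq_bigr => i _; rewrite mxE mulrN. Qed.

Lemma entryD (y z : E) l : (y + z) ord0 l = y ord0 l + z ord0 l.
Proof. by rewrite mxE. Qed.

Lemma entryB (y z : E) l : (y - z) ord0 l = y ord0 l - z ord0 l.
Proof. by rewrite !mxE. Qed.

Lemma cis_dotD (x y z : E) : cis (2 * pi * dot x (y + z)) =
  cis (2 * pi * dot x y) * cis (2 * pi * dot x z) :> C.
Proof. by rewrite dotD (mulrDr (2 * pi)) cisD. Qed.

Lemma cis_dotB (x y z : E) : cis (2 * pi * dot x (y - z)) =
  cis (2 * pi * dot x y) * cis (- (2 * pi * dot x z)) :> C.
Proof. by rewrite dotD dotN (mulrDr (2 * pi)) (mulrN (2 * pi)) cisD. Qed.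

(** Exactly, the two exponentials give [p1 * cis u] times [(al / r) cos t + i (fl / r) sin t]. The
    frequency [fl] of the coefficient is negligible at scale [r], and [al / r] is close to [v]. *)
Lemma deriv_term (p1 : C) (fl al v r delta u t : R) : 0 < r ->
  `|al / r - v| <= delta -> `|fl / r| <= delta ->
  nC (rC (fl + al) * (rC ((2 * r)^-1) * p1) * (cis u * cis t) +
      rC (fl - al) * (- rC ((2 * r)^-1) * p1) * (cis u * cis (- t)) -
      rC (v * cos t) * (p1 * cis u)) <= 2 * delta * nC p1.
Proof.
move=> r0 av fr.
have -> : rC (fl + al) * (rC ((2 * r)^-1) * p1) * (cis u * cis t) +
      rC (fl - al) * (- rC ((2 * r)^-1) * p1) * (cis u * cis (- t)) -
      rC (v * cos t) * (p1 * cis u) =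
   p1 * cis u * (rC ((al / r - v) / 2) * (cis t + cis (- t)) +
                 rC (fl / r / 2) * (cis t - cis (- t))) :> C.
  rewrite rCM rC_cos.
  have -> : (2 * r)^-1 = r^-1 / 2 by rewrite invfM mulrC.
  by rewrite !(rCD, rCM, rCN); ring.
rewrite normC_mul normC_mul normC_cis mulr1 mulrC ler_wpM2r//.
rewrite (le_trans (ler_normD _ _))// !normC_mul !normC_real !normrM.
have c1 : nC (cis t + cis (- t)) <= 2.
  by rewrite (le_trans (ler_normD _ _))// !normC_cis.
have c2 : nC (cis t - cis (- t)) <= 2.
  by rewrite (le_trans (ler_normB _ _))// !normC_cis.
have h2 : `|2^-1| = 2^-1 :> R by rewrite ger0_norm.
rewrite -!normrM in av fr *.
have -> : 2 * delta = delta / 2 * 2 + delta / 2 * 2 by field.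
apply: lerD; apply: ler_pM => //.
  by rewrite normrM h2 ler_wpM2r.
by rewrite normrM h2 ler_wpM2r.
Qed.

(** The sign [(-1) ^+ b] stands in the coefficient and again in front of [al], so it cancels: both
    signs approach half of [p1 * g1 * (m0 * v)]. *)
Lemma pair_term (p1 g1 m m0 : C) (fl al v r delta B : R) (b : bool) : 0 < r ->
  `|al / r - v| <= delta -> `|fl / r| <= delta ->
  nC (m - m0) <= delta -> nC m <= B ->
  nC ((-1) ^+ b * rC ((2 * r)^-1) * p1 * g1 * (m * rC (fl + (-1) ^+ b * al)) -
      rC (2^-1) * p1 * g1 * (m0 * rC v)) <=
  (2 * B + `|v|) * delta * (nC p1 * nC g1) / 2.
Proof.
move=> r0 av fr mm mB.
have -> : (-1) ^+ b * rC ((2 * r)^-1) * p1 * g1 * (m * rC (fl + (-1) ^+ b * al)) -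
      rC (2^-1) * p1 * g1 * (m0 * rC v) =
  p1 * g1 * (m * rC ((-1) ^+ b * (fl / r) + (al / r - v)) + (m - m0) * rC v) *
     rC (2^-1) :> C.
  have -> : (2 * r)^-1 = r^-1 / 2 by rewrite invfM mulrC.
  by case: b; rewrite ?expr1 ?expr0 ?mulN1r ?mul1r !(rCD, rCM, rCN); ring.
rewrite !normC_mul !normC_real [`|2^-1|]ger0_norm// ler_wpM2r//.
rewrite [leRHS]mulrC ler_wpM2l ?mulr_ge0//.
rewrite (le_trans (ler_normD _ _))// !normC_mul !normC_real.
have B0 : 0 <= B by rewrite (le_trans _ mB).
have -> : (2 * B + `|v|) * delta = B * (delta + delta) + delta * `|v| by ring.
apply: lerD; apply: ler_pM => //.
rewrite (le_trans (ler_normD _ _))// lerD//.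
by rewrite normrM normrX normrN1 expr1n mul1r.
Qed.

(* The frequencies [a j] are chosen from the last one to the first one, each so
   small with respect to its successors that the only resonances between the
   resulting trigonometric polynomials are those of independent phases. *)
Lemma transfer (c B : R) (M : E -> C) : bohr c M -> 0 <= c ->
  (forall x, nC (M x) <= B) ->
  (forall a, a != 0 -> forall e, 0 < e -> exists2 h, 0 < h &
     forall z, `|z| < h -> nC (M (a + z) - M a) < e) ->
  forall (N : nat) (v : nat -> E) (A G S : seq R -> R) (K : R),
  (forall j, (j < N)%N -> exists l, tpoly j A l) ->
  (exists l, tpoly N G l) -> (exists l, tpoly N S l) ->
  (forall s, size s = N -> `|G s| <= K) ->
  (forall l s, size s = N ->
     `|\sum_(j < N) v j ord0 l * cos s`_j * A (take j s)| <= S s) ->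
  exists q0, forall q, (q0 <= q)%N -> forall e, 0 < e ->
  forall Lam : nat -> set E,
  (forall j, (j < N)%N -> forall tau, 0 < tau -> exists a r,
     [/\ Lam j a, a != 0, 0 < r, `|a| < tau & `|r^-1 *: a - v j| < tau]) ->
  exists a : nat -> E,
    (forall j, (j < N)%N -> Lam j (a j)) /\
    forall l : 'I_d,
      nC (\sum_(j < N) rC (v j ord0 l / 2) *
       (M (a j) * Complex (gridE q N (fun s => cos s`_j * A (take j s) * G s))
                          (gridE q N (fun s => sin s`_j * A (take j s) * G s)) +
        M (- a j) * Complex (gridE q N (fun s => cos s`_j * A (take j s) * G s))
                        (- gridE q N (fun s => sin s`_j * A (take j s) * G s))))
      <= c * K * gridE q N S + e.
Proof.
move=> bM c0 MB Mc N v A G S K tA [lG tG] [lS tS] GK FS.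
have /boolp.choice[lA {}tA] : forall j : 'I_N, exists l, tpoly j A l.
  by move=> j; apply: tA.
have [D0 [DA DG DS]] : exists D0, [/\
   forall (j : 'I_N) (p : C * {poly int}) i, p \in lA j -> (`|((p.2 : {poly int})`_i)%R| <= D0)%N,
   forall (p : C * {poly int}) i, p \in lG -> (`|((p.2 : {poly int})`_i)%R| <= D0)%N &
   forall (p : C * {poly int}) i, p \in lS -> (`|((p.2 : {poly int})`_i)%R| <= D0)%N].
  have [D1 H1] := list_bound (flatten [seq lA j | j <- enum 'I_N]).
  have [D2 H2] := list_bound lG; have [D3 H3] := list_bound lS.
  exists (maxn D1 (maxn D2 D3)); split => [j p i pl|p i pl|p i pl]; rewrite !leq_max.
  - rewrite H1//; apply/flattenP; exists (lA j) => //.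
    by apply: map_f; rewrite mem_enum.
  - by rewrite H2// orbT.
  - by rewrite H3// !orbT.
(* A product of [A j], one exponential of [s_j] and [G] has coefficients up to [D0 + 1 + D0]. *)
pose D := D0.*2.+1.
have D0D : (D0 <= D)%N by rewrite /D; lia.
exists D.+1 => q Dq e e0 Lam LamP.
have q0 : (0 < q)%N by rewrite (leq_trans _ Dq).
have [N0|Npos] := posnP N.
  subst N; exists (fun=> 0); split => // l.
  rewrite big_ord0 normr0 /=.
  have K0 : 0 <= K by rewrite (le_trans _ (GK [::] erefl)).
  have S0 : 0 <= S [::] by rewrite (le_trans _ (FS l [::] erefl)).
  by rewrite addr_ge0 ?mulr_ge0// ltW.
pose kap := \sum_(j < N) \sum_(p <- lA j) nC p.1.
pose KG := \sum_(g <- lG) nC g.1.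
pose V := \sum_(j < N) `|v j|.
(* The total error is at most [delta * tot]: enlarging the majorant [S] costs
   [c * K * (2 * delta * kap)], replacing the multiplier and the increments by their limits costs
   the second term, and the 1 keeps [tot] positive. *)
pose tot := c * K * (2 * kap) + (2 * B + V) * kap * KG + 1.
have sN0 : size (nseq N (0 : R)) = N by rewrite size_nseq.
have K0 : 0 <= K by rewrite (le_trans _ (GK _ sN0)).
have B0 : 0 <= B by rewrite (le_trans _ (MB 0)).
have kap0 : 0 <= kap by apply: sumr_ge0 => j _; apply: sumr_ge0.
have KG0 : 0 <= KG by apply: sumr_ge0.
have V0 : 0 <= V by apply: sumr_ge0.
have tot0 : 0 < tot.
  by rewrite ltr_wpDl ?addr_ge0// !mulr_ge0// addr_ge0// mulr_ge0.
pose delta := e / tot.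
have delta0 : 0 < delta by rewrite divr_gt0.
pose LL : R := (N * D)%:R.
have LL0 : 0 <= LL by rewrite /LL.
(* [rho] bounds the frequencies of smaller index. Their combinations have norm at most [LL * rho],
   and must change [M] by less than [delta] near plus or minus [t.1], stay below [|t.1|], and be at
   most [delta] when divided by the scale [t.2]. *)
pose Q j (t : E * R) rho :=
  [/\ Lam j t.1, 0 < t.2 & `|t.2^-1 *: t.1 - v j| < delta] /\
  [/\ forall z, `|z| <= LL * rho -> nC (M (t.1 + z) - M t.1) < delta /\
                   nC (M (- t.1 + z) - M (- t.1)) < delta,
      LL * rho < `|t.1| & LL * rho <= delta * t.2].
have HQ j : (j < N)%N -> forall tau, 0 < tau ->
    exists a : E * R, `|a.1| < tau /\ exists2 rho, 0 < rho & Q j a rho.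
  move=> jN tau tau0.
  have m0 : 0 < Num.min tau delta by rewrite lt_min tau0.
  have [a [r [La a0 r0 at_ av]]] := LamP _ jN _ m0.
  move: at_ av; rewrite !lt_min => /andP[at_ _] /andP[_ av].
  exists (a, r); split => //=.
  have [h1 h10 H1] := Mc _ a0 _ delta0.
  have [|h2 h20 H2] := Mc (- a) _ _ delta0; first by rewrite oppr_eq0.
  pose mn := Num.min (Num.min h1 h2) (Num.min `|a| (delta * r)).
  have mn0 : 0 < mn by rewrite !lt_min h10 h20 normr_gt0 a0 mulr_gt0.
  have mnlt : LL * (mn / (LL + 1)) < mn.
    rewrite mulrCA gtr_pMr// ltr_pdivrMr ?mul1r ?ltrDl//.
    by rewrite ltr_wpDl.
  move: (mnlt); rewrite {2}/mn !lt_min => /andP[/andP[l1 l2] /andP[l3 l4]].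
  exists (mn / (LL + 1)); first by rewrite divr_gt0// ltr_wpDl.
  split; split => //=; last exact: ltW.
  by move=> z zl; split; [apply: H1|apply: H2]; apply: le_lt_trans zl _.
have [a [rho H]] := @lacunary_choice R (E * R) (fun t => `|t.1|) N Q HQ Npos 1 ltr01.
exists (fun j => (a j).1); split; first by move=> j /H[[[]]].
pose f := freq N (fun j => (a j).1).
(* Up to small errors and the factor [2 pi i] that [dtrig] omits, the pair [T false], [T true] is an
   antiderivative of [v j * cos s_j * A j]: the division by the scale makes its derivative of size
   [a / r], close to [v j]. *)
pose T (b : bool) (j : 'I_N) (p : C * {poly int}) : C * E :=
  ((-1) ^+ b * rC ((2 * (a j).2)^-1) * p.1, f (p.2 + (-1) ^+ b * 'X^j)).
pose P : seq (C * E) := flatten [seq flatten [seq [:: T false j p; T true j p] |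
   p : C * {poly int} <- lA j] | j <- index_enum 'I_N].
have PE (F : C * E -> C) : \sum_(p <- P) F p =
    \sum_(j < N) \sum_(p <- lA j) (F (T false j p) + F (T true j p)).
  rewrite /P big_flatten big_map; apply: eq_bigr => j _.
  rewrite big_flatten big_map; apply: eq_bigr => p _.
  by rewrite big_cons big_seq1.
pose Qs : seq (C * E) := [seq (g.1, f g.2) | g : C * {poly int} <- lG].
(* The added constant term absorbs the errors of [deriv_term], whose sum is at most
   [2 * delta * kap]. *)
pose Ss : seq (C * E) := (rC (2 * delta * kap), 0) ::
  [seq (g.1, f g.2) | g : C * {poly int} <- lS].
pose th x := phases N (fun j => (a j).1) x.
have szth x : size (th x) = N by rewrite size_mkseq.
have trigE (L : seq (C * {poly int})) x (F : seq R -> R) : tpoly N F L ->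
   trig [seq (g.1, f g.2) | g : C * {poly int} <- L] x = rC (F (th x)).
  move=> [_ ->//]; rewrite /trig big_map; apply: eq_bigr => g _ /=.
  by rewrite kdot_phases.
have fT (b : bool) (j : 'I_N) (k : {poly int}) : f (k + (-1) ^+ b * 'X^j) = f k + (-1) ^+ b *: (a j).1.
  rewrite /f freqD; congr (_ + _).
  by case: b; rewrite ?expr1 ?expr0 ?mulN1r ?mul1r ?freqN freqXn// ?scaleN1r ?scale1r.
have T2f (j : 'I_N) p : (T false j p).2 = f p.2 + (a j).1.
  by rewrite -[LHS]/(f (p.2 + (-1) ^+ false * 'X^j)) fT expr0 scale1r.
have T2t (j : 'I_N) p : (T true j p).2 = f p.2 - (a j).1.
  by rewrite -[LHS]/(f (p.2 + (-1) ^+ true * 'X^j)) fT expr1 scaleN1r.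
have T1f (j : 'I_N) p : (T false j p).1 = rC ((2 * (a j).2)^-1) * p.1.
  by rewrite /T /= expr0 mul1r.
have T1t (j : 'I_N) p : (T true j p).1 = - rC ((2 * (a j).2)^-1) * p.1.
  by rewrite /T /= expr1 mulN1r.
have fsmall (j : 'I_N) (p : C * {poly int}) : p \in lA j -> `|f p.2| <= LL * rho j.
  move=> pl; have [_ rj _ aij] := H _ (ltn_ord j).
  apply: (@freq_small _ _ N _ _ j) => //.
  - by have [/allP sA _] := tA j; apply: sA.
  - by move=> i; apply: leq_trans (DA _ _ i pl) D0D.
  - by rewrite ltnW.
  - by move=> i ij; apply/ltW/aij.
  - exact: ltW.
have finj (k : {poly int}) : (size k <= N)%N ->
    (forall i, (`|(k`_i)%R| <= D)%N) -> (f k == 0) = (k == 0).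
  move=> kN kD; apply: (freq_inj (D := D) (rho := rho)) => //.
    move=> j i /andP[ij jN]; have [_ _ _ aij] := H _ jN; exact/ltW/aij.
  by move=> j jN; have [[_ [_ ? _]] ? _ _] := H _ jN; split => //; apply: ltW.
have eaj (j : 'I_N) l : `|(a j).1 ord0 l / (a j).2 - v j ord0 l| <= delta.
  have [[[_ _ h] _] _ _ _] := H _ (ltn_ord j).
  apply: le_trans (ltW h); apply: le_trans (ler_entry _ l).
  by rewrite !mxE mulrC.
have efj (j : 'I_N) (p : C * {poly int}) l : p \in lA j ->
    `|f p.2 ord0 l / (a j).2| <= delta.
  move=> pl; have [[[_ r0 _] [_ _ h]] _ _ _] := H _ (ltn_ord j).
  rewrite normrM normfV (gtr0_norm r0) ler_pdivrMr//.
  exact: le_trans (le_trans (ler_entry _ _) (fsmall _ _ pl)) h.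
have r0 (j : 'I_N) : 0 < (a j).2 by have [[[_ ? _] _] _ _ _] := H _ (ltn_ord j).
have B1 x l : nC (trig (dtrig l P) x) <= complex.Re (trig Ss x).
  have -> : complex.Re (trig Ss x) = 2 * delta * kap + S (th x).
    rewrite /trig big_cons -/(trig _ x) (trigE _ _ _ tS) Re_add /=.
    by rewrite dot0 mulr0 cos0 sin0 mulr1 mulr0 subr0.
  pose FF := \sum_(j < N) v j ord0 l * cos (th x)`_j * A (take j (th x)).
  apply: le_trans (_ : nC (trig (dtrig l P) x - rC FF) + nC (rC FF) <= _).
    by rewrite -{1}(subrK (rC FF) (trig (dtrig l P) x)) ler_normD.
  apply: lerD; last by rewrite normC_real; apply: FS.
  have -> : trig (dtrig l P) x - rC FF = \sum_(j < N) \sum_(p <- lA j)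
     (rC (f p.2 ord0 l + (a j).1 ord0 l) * (rC ((2 * (a j).2)^-1) * p.1) *
        (cis (2 * pi * dot x (f p.2)) * cis (2 * pi * dot x (a j).1)) +
      rC (f p.2 ord0 l - (a j).1 ord0 l) * (- rC ((2 * (a j).2)^-1) * p.1) *
        (cis (2 * pi * dot x (f p.2)) * cis (- (2 * pi * dot x (a j).1))) -
      rC (v j ord0 l * cos (2 * pi * dot x (a j).1)) *
        (p.1 * cis (2 * pi * dot x (f p.2)))).
    rewrite /trig big_map /= PE /FF rC_sum -sumrB; apply: eq_bigr => j _.
    rewrite rCM; have [/allP sA EA] := tA j.
    rewrite EA ?size_takel ?szth ?(ltnW (ltn_ord j))// mulr_sumr -sumrB.
    rewrite big_seq [RHS]big_seq; apply: eq_bigr => p pl.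
    rewrite (@kdot_take R N j _ (th x) (sA _ pl) (ltnW (ltn_ord j))) kdot_phases.
    rewrite nth_mkseq// T1f T1t T2f T2t cis_dotD cis_dotB.
    by rewrite entryD entryB -/f.
  rewrite /kap [leRHS]mulr_sumr; apply: normC_sumE => j _.
  rewrite [leRHS]mulr_sumr big_seq [leRHS]big_seq; apply: normC_sumE => p pl.
  by apply: deriv_term => //; exact: efj.
have B2 x : nC (trig Qs x) <= K.
  by rewrite (trigE _ _ _ tG) normC_real; apply: GK.
move=> l; have := bM P Qs Ss K B1 B2 l.
have -> : complex.Re (\sum_(s <- Ss | s.2 == 0) s.1) = 2 * delta * kap + gridE q N S.
  rewrite big_cons eqxx Re_add big_map /=; congr (_ + _).
  have [sS ES] := tS.
  have qS (p : C * {poly int}) i : p \in lS -> (`|((p.2 : {poly int})`_i)%R| < q)%N.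
    by move=> pl; apply: leq_ltn_trans (DS _ i pl) (leq_ltn_trans D0D Dq).
  have := @gridE_mean R q N lS 1 q0 sS qS; rewrite mul1r => mS.
  have <- : gridE q N (fun s => complex.Re (1 * \sum_(p <- lS) p.1 * cis (kdot N p.2 s))) =
      gridE q N S by apply: eq_gridE => s sN; rewrite mul1r -ES.
  rewrite mS big_seq_cond [in RHS]big_seq_cond; congr (complex.Re _); apply: eq_bigl => p.
  case pl : (p \in lS) => //=; apply: finj; first exact: (allP sS).
  by move=> i; apply: leq_trans (DS _ i pl) D0D.
set W := \sum_(p <- P) _ => WB.
set Z := \sum_(j < N) _.
(* By [finj] both sums run over the same resonant pairs, so they are compared term by term; the two
   signs share the bound equally. *)
have WZ : nC (W - Z) <= delta * ((2 * B + V) * kap * KG).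
  pose sg (b : bool) : R := (-1) ^+ b.
  pose Wt (b : bool) j p (g : C * {poly int}) : C :=
    if (T b j p).2 + f g.2 == 0 then
      (T b j p).1 * g.1 * (M (T b j p).2 * rC ((T b j p).2 ord0 l)) else 0.
  pose Zt (b : bool) (j : 'I_N) (p g : C * {poly int}) : C :=
    if p.2 + (-1) ^+ b * 'X^j + g.2 == 0 then
      rC (2^-1) * p.1 * g.1 * (M (sg b *: (a j).1) * rC (v j ord0 l)) else 0.
  have WE : W = \sum_(j < N) \sum_(p <- lA j) (\sum_(g <- lG) Wt false j p g +
     \sum_(g <- lG) Wt true j p g).
    by rewrite /W PE; apply: eq_bigr => j _; apply: eq_bigr => p _; rewrite /Qs !big_map.
  have ZE : Z = \sum_(j < N) \sum_(p <- lA j) (\sum_(g <- lG) Zt false j p g +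
     \sum_(g <- lG) Zt true j p g).
    rewrite /Z; apply: eq_bigr => j _.
    have pm b := pair_mean b (ltn_ord j) (tA j) tG (DA j) DG Dq.
    set Ec := gridE q N (fun s => cos _ * _ * _); set Es := gridE q N (fun s => sin _ * _ * _).
    have X0 : Complex Ec Es = \sum_(p <- lA j) \sum_(g <- lG)
        (if p.2 + (-1) ^+ false * 'X^j + g.2 == 0 then p.1 * g.1 else 0) :> C.
      by rewrite pm expr0 mul1r.
    have X1 : Complex Ec (- Es) = \sum_(p <- lA j) \sum_(g <- lG)
        (if p.2 + (-1) ^+ true * 'X^j + g.2 == 0 then p.1 * g.1 else 0) :> C.
      by rewrite pm expr1 mulN1r.
    rewrite X0 X1.
    rewrite big_split mulrDr; congr (_ + _).
      rewrite mulrA mulr_sumr; apply: eq_bigr => p _; rewrite mulr_sumr.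
      apply: eq_bigr => g _; rewrite /Zt /sg expr0 scale1r; case: ifP => _; last by rewrite mulr0.
      by rewrite rCM; ring.
    rewrite mulrA mulr_sumr; apply: eq_bigr => p _; rewrite mulr_sumr.
    apply: eq_bigr => g _; rewrite /Zt /sg expr1 scaleN1r; case: ifP => _; last by rewrite mulr0.
    by rewrite rCM; ring.
  have bd b (j : 'I_N) (p g : C * {poly int}) : p \in lA j -> g \in lG ->
      nC (Wt b j p g - Zt b j p g) <= (2 * B + V) * delta * (nC p.1 * nC g.1) / 2.
    move=> pl gl.
    have pos : 0 <= (2 * B + V) * delta * (nC p.1 * nC g.1) / 2.
      have BV0 : 0 <= 2 * B + V by rewrite addr_ge0// mulr_ge0.
      apply: mulr_ge0 => //; apply: mulr_ge0; last exact: mulr_ge0.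
      by apply: mulr_ge0 => //; exact: ltW.
    have sz : (size (p.2 + (-1) ^+ b * 'X^j + g.2)%R <= N)%N.
      have [/allP sA _] := tA j; have [/allP sG _] := tG.
      rewrite (leq_trans (size_polyD _ _))// geq_max sG// andbT.
      rewrite (leq_trans (size_polyD _ _))// geq_max (leq_trans (sA _ pl) (ltnW (ltn_ord j)))/=.
      by case: (b); rewrite ?expr1 ?expr0 ?mulN1r ?mul1r ?size_polyN size_polyXn.
    have cf i : (`|(((p.2 + (-1) ^+ b * 'X^j + g.2 : {poly int})%R)`_i)%R| <= D)%N.
      rewrite !coefD.
      have h : (`|(((-1) ^+ b * 'X^j : {poly int})`_i)%R| <= 1)%N.
        by case: (b); rewrite ?expr1 ?expr0 ?mulN1r ?mul1r ?coefN coefXn; case: eqP.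
      have := DA _ _ i pl; have := DG _ i gl; move: h.
      rewrite /D; set u := _`_i; set v0 := _`_i; set w := _`_i.
      by clearbody u v0 w; clear; lia.
    rewrite /Wt /Zt -/f -freqD -/f (finj _ sz cf).
    case: ifP => _; last by rewrite subr0 normr0.
    have [[_ [HM _ _]] _ _ _] := H _ (ltn_ord j).
    apply: le_trans (_ : (2 * B + `|v j ord0 l|) * delta * (nC p.1 * nC g.1) / 2 <= _); last first.
      rewrite ler_wpM2r// ler_wpM2r ?mulr_ge0// ler_wpM2r ?(ltW delta0)// lerD2l.
      apply: le_trans (ler_entry _ _) _.
      by rewrite /V (bigD1 j)//= lerDl sumr_ge0.
    have -> : (T b j p).2 ord0 l = f p.2 ord0 l + (-1) ^+ b * (a j).1 ord0 l.
      by rewrite /T /= fT entryD mxE.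
    apply: pair_term => //; first exact: efj.
    have [Hp Hm] := HM _ (fsmall _ _ pl).
    apply: ltW; case: (b); rewrite /sg ?expr1 ?expr0 ?scaleN1r ?scale1r.
      by rewrite T2t [f _ - _]addrC.
    by rewrite T2f [f _ + _]addrC.
  have -> : delta * ((2 * B + V) * kap * KG) = \sum_(j < N) \sum_(p <- lA j)
     \sum_(g <- lG) (2 * B + V) * delta * (nC p.1 * nC g.1).
    rewrite (_ : delta * _ = (2 * B + V) * delta * (kap * KG)); last by ring.
    rewrite [kap * KG]mulr_suml [LHS]mulr_sumr; apply: eq_bigr => j _.
    rewrite [X in _ * X = _]mulr_suml [LHS]mulr_sumr; apply: eq_bigr => p _.
    by rewrite [X in _ * X = _]mulr_sumr [LHS]mulr_sumr.
  rewrite WE ZE -sumrB; apply: normC_sumE => j _; rewrite -sumrB.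
  rewrite big_seq [leRHS]big_seq; apply: normC_sumE => p pl.
  rewrite opprD addrACA -!sumrB.
  apply: le_trans (_ : \sum_(g <- lG) (2 * B + V) * delta * (nC p.1 * nC g.1) / 2 +
     \sum_(g <- lG) (2 * B + V) * delta * (nC p.1 * nC g.1) / 2 <= _); last first.
    by rewrite -big_split ler_sum// => g _ /=; rewrite -splitr.
  by rewrite (le_trans (ler_normD _ _))// lerD// big_seq [leRHS]big_seq; apply: normC_sumE => g gl; apply: bd.
apply: le_trans (_ : nC W + nC (W - Z) <= _).
  by rewrite -{1}(subKr W Z) (le_trans (ler_normB _ _)).
apply: le_trans (lerD WB WZ) _.
have de : delta * tot = e by rewrite /delta divfK// gt_eqF.
rewrite -de /tot (_ : c * K * (2 * delta * kap + gridE q N S) +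
   delta * ((2 * B + V) * kap * KG) = c * K * gridE q N S + delta * (c * K * (2 * kap) +
   (2 * B + V) * kap * KG)); last by ring.
by rewrite lerD2l ler_wpM2l ?(ltW delta0)// lerDl.
Qed.

End transfer_lemma.

Arguments gridE : simpl never.

(** * Closure properties of trigonometric polynomials in the phases, and one-phase moments *)

Section trig_poly_closure.
Variable R : realType.
Local Notation C := (Rcomplex R).
Local Notation nC z := (`|(z : C)|).
Implicit Types (F G : seq R -> C).

(** Complex values make the class stable under products and conjugation, from which stability under
    real and imaginary parts follows. *)
Definition tpC N F := exists2 l : seq (C * {poly int}),
  all (fun p : C * {poly int} => (size p.2 <= N)%N) l &
  forall s, size s = N -> F s = \sum_(p <- l) p.1 * cis (kdot N p.2 s).

Lemma tpC_tpoly N (A : seq R -> R) : tpC N (fun s => rC (A s)) -> exists l, tpoly N A l.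
Proof. by move=> [l h1 h2]; exists l; split. Qed.

Lemma eq_tpC N F G : (forall s, size s = N -> F s = G s) -> tpC N F -> tpC N G.
Proof. by move=> FG [l h1 h2]; exists l => // s sN; rewrite -FG// h2. Qed.

Lemma tpC_cst N (c : C) : tpC N (fun=> c).
Proof.
exists [:: (c, 0)]; first by rewrite /= size_poly0.
by move=> s _; rewrite big_seq1 /= kdot0 cis0 mulr1.
Qed.

Lemma tpCD N F G : tpC N F -> tpC N G -> tpC N (fun s => F s + G s).
Proof.
move=> [l h1 h2] [l' h1' h2']; exists (l ++ l'); first by rewrite all_cat h1.
by move=> s sN; rewrite big_cat h2// h2'.
Qed.

Lemma tpCM N F G : tpC N F -> tpC N G -> tpC N (fun s => F s * G s).
Proof.
move=> [l /allP h1 h2] [l' /allP h1' h2'].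
exists [seq (p.1 * g.1 : C, p.2 + g.2 : {poly int}) |
   p : C * {poly int} <- l, g : C * {poly int} <- l'].
  apply/allP => x /allpairsP[[p g] /= [pl gl ->]] /=.
  by rewrite (leq_trans (size_polyD _ _))// geq_max h1// h1'.
move=> s sN; rewrite big_allpairs_dep h2// h2'// mulr_suml; apply: eq_bigr => p _.
rewrite mulr_sumr; apply: eq_bigr => g _ /=.
by rewrite kdotD cisD; ring.
Qed.

Lemma tpC_conj N F : tpC N F -> tpC N (fun s => conjc (F s) : C).
Proof.
move=> [l /allP h1 h2].
exists [seq (conjc p.1 : C, - p.2 : {poly int}) | p : C * {poly int} <- l].
  by apply/allP => x /mapP[p pl ->] /=; rewrite size_polyN h1.
move=> s sN; rewrite big_map h2// (big_morph (@conjc R) (rmorphD _) (rmorph0 _)).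
apply: eq_bigr => p _ /=; rewrite kdotN rmorphM; congr (_ * _).
by apply: C_eqP; rewrite /= ?cosN ?sinN.
Qed.

Lemma tpC_Re N F : tpC N F -> tpC N (fun s => rC (complex.Re (F s))).
Proof.
move=> tF; apply: eq_tpC (tpCM (tpC_cst N (rC (2^-1))) (tpCD tF (tpC_conj tF))) => s _.
by case: (F s) => a b; apply: C_eqP => /=; [field|ring].
Qed.

Lemma tpC_Im N F : tpC N F -> tpC N (fun s => rC (complex.Im (F s))).
Proof.
move=> tF; have h := tpC_Re (tpCM (tpC_cst N (Complex 0 (-1))) tF).
by apply: eq_tpC h => s _; case: (F s) => a b; congr rC => /=; ring.
Qed.

Lemma tpC_cis N j : (j < N)%N -> tpC N (fun s => cis s`_j).
Proof.
move=> jN; exists [:: (1, 'X^j)]; first by rewrite /= size_polyXn jN.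
by move=> s _; rewrite big_seq1 /= kdotXn// mul1r.
Qed.

Lemma tpC_cos N j : (j < N)%N -> tpC N (fun s => rC (cos s`_j)).
Proof. by move=> jN; exact: tpC_Re (tpC_cis jN). Qed.

Lemma tpC_sin N j : (j < N)%N -> tpC N (fun s => rC (sin s`_j)).
Proof. by move=> jN; exact: tpC_Im (tpC_cis jN). Qed.

Lemma tpC_sum N (I : Type) (r : seq I) (P : pred I) (F : I -> seq R -> C) :
  (forall i, P i -> tpC N (F i)) -> tpC N (fun s => \sum_(i <- r | P i) F i s).
Proof.
move=> h; elim: r => [|i r IH].
  by apply: eq_tpC (tpC_cst N 0) => s _; rewrite big_nil.
case Pi : (P i); last by apply: eq_tpC IH => s _; rewrite big_cons Pi.
by apply: eq_tpC (tpCD (h _ Pi) IH) => s _; rewrite big_cons Pi.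
Qed.

Lemma tpC_prod N (I : Type) (r : seq I) (P : pred I) (F : I -> seq R -> C) :
  (forall i, P i -> tpC N (F i)) -> tpC N (fun s => \prod_(i <- r | P i) F i s).
Proof.
move=> h; elim: r => [|i r IH].
  by apply: eq_tpC (tpC_cst N 1) => s _; rewrite big_nil.
case Pi : (P i); last by apply: eq_tpC IH => s _; rewrite big_cons Pi.
by apply: eq_tpC (tpCM (h _ Pi) IH) => s _; rewrite big_cons Pi.
Qed.

Lemma tpC_take N j F : (j <= N)%N -> tpC j F -> tpC N (fun s => F (take j s)).
Proof.
move=> jN [l h1 h2]; exists l.
  by apply: sub_all h1 => p pj; rewrite (leq_trans pj).
move=> s sN; rewrite h2 ?size_takel ?sN// big_seq [RHS]big_seq.
apply: eq_bigr => p pl; rewrite (@kdot_take R N j)//.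
exact: (allP h1).
Qed.

(** Multiplying the coding polynomial by ['X^N] shifts the frequency vector past the first [N]
    phases. *)
Lemma tpC_drop N M F : tpC M F -> tpC (N + M) (fun s => F (drop N s)).
Proof.
move=> [l /allP h1 h2].
exists [seq (p.1, p.2 * 'X^N : {poly int}) | p : C * {poly int} <- l].
  apply/allP => x /mapP[p pl ->] /=.
  have [->|p0] := eqVneq p.2 0; first by rewrite mul0r size_poly0.
  by rewrite size_mulXn// leq_add2l h1.
move=> s sN; rewrite big_map h2; last by rewrite size_drop sN addKn.
apply: eq_bigr => p _ /=; congr (_ * cis _).
rewrite /kdot [RHS]big_split_ord /= [X in _ = X + _]big1 ?add0r; last first.
  by move=> i _; rewrite coefMXn ltn_ord mul0r.
by apply: eq_bigr => i _; rewrite coefMXn ltnNge leq_addr /= addKn nth_drop.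
Qed.

Definition gridEC q N F : C :=
  Complex (gridE q N (fun s => complex.Re (F s))) (gridE q N (fun s => complex.Im (F s))).

Lemma eq_gridEC q N F G : (forall s, size s = N -> F s = G s) ->
  gridEC q N F = gridEC q N G.
Proof. by move=> h; congr Complex; apply: eq_gridE => s sN; rewrite h. Qed.

Lemma gridECZ q N (c : C) F : gridEC q N (fun s => c * F s) = c * gridEC q N F.
Proof.
apply: C_eqP; rewrite ?Re_mul ?Im_mul /=.
  rewrite -[RHS]addr0 -mulNr -!gridE_lin addr0; apply: eq_gridE => s _.
  by rewrite Re_mul mulNr.
by rewrite -gridE_lin; apply: eq_gridE => s _; rewrite Im_mul.
Qed.

Lemma gridEC_cat q N M F :
  gridEC q (N + M) F = gridEC q N (fun s => gridEC q M (fun t => F (s ++ t))).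
Proof. by apply: C_eqP => /=; rewrite gridE_cat. Qed.

Lemma gridEC_prod q N M F G :
  gridEC q N (fun s => gridEC q M (fun t => F s * G t)) =
  gridEC q N F * gridEC q M G.
Proof.
under eq_gridEC do rewrite gridECZ.
by rewrite mulrC -gridECZ; apply: eq_gridEC => s _; rewrite mulrC.
Qed.

Lemma gridEC_real q N (A : seq R -> R) : (0 < q)%N ->
  gridEC q N (fun s => rC (A s)) = rC (gridE q N A).
Proof. by move=> q0; apply: C_eqP => //=; rewrite gridE_cst. Qed.

(** Source of the moments below: the powers and products of cosine and sine in question are
    combinations of characters with [|k|] at most 3. *)
Lemma grid1_cis q (k : int) : (`|k| < q)%N ->
  gridEC q 1 (fun s => cis (k%:~R * s`_0)) = if k == 0 then 1 else 0.
Proof.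
move=> kq; have q0 : (0 < q)%N by rewrite (leq_trans _ kq).
have h (c : C) := @gridE_cis R q 1 (fun=> k) c q0 (fun _ _ => kq).
have h1 := h 1; have h2 := h (Complex 0 (-1)).
apply: C_eqP; rewrite [LHS]/=.
  transitivity (complex.Re (if k == 0 then 1 else 0 : C)); last by [].
  rewrite (_ : complex.Re (if _ then _ else _) =
    if all (fun=> k == 0) (iota 0 1) then complex.Re (1 : C) else 0); last first.
    by rewrite /= andbT; case: ifP.
  by rewrite -h1; apply: eq_gridE => s _; rewrite mul1r big_ord1.
rewrite (_ : complex.Im (if _ then _ else _) =
    if all (fun=> k == 0) (iota 0 1) then complex.Re (Complex 0 (-1) : C) else 0); last first.
  by rewrite /= andbT; case: ifP.
by rewrite -h2; apply: eq_gridE => s _; rewrite big_ord1 /=; ring.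
Qed.

Lemma grid1_cos q : (1 < q)%N -> gridE q 1 (fun s : seq R => cos s`_0) = 0.
Proof.
move=> q1; have /(congr1 (@complex.Re R)) /= := @grid1_cis q 1 q1.
by under eq_gridE do rewrite mul1r.
Qed.

Lemma grid1_sin q : (1 < q)%N -> gridE q 1 (fun s : seq R => sin s`_0) = 0.
Proof.
move=> q1; have /(congr1 (@complex.Im R)) /= := @grid1_cis q 1 q1.
by under eq_gridE do rewrite mul1r.
Qed.

Lemma cos2xE (x : R) : cos (2%:~R * x) = 2 * cos x ^+ 2 - 1.
Proof.
have -> : 2%:~R * x = x + x by rewrite (_ : 2%:~R = 1 + 1 :> R)// mulrDl mul1r.
rewrite cosD -!expr2; have := cos2Dsin2 x; lra.
Qed.

Lemma grid1_cos2 q : (2 < q)%N -> gridE q 1 (fun s : seq R => cos s`_0 ^+ 2) = 2^-1.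
Proof.
move=> q2; have /(congr1 (@complex.Re R)) /= := @grid1_cis q 2 q2.
under eq_gridE do rewrite cos2xE -[- 1]mulr1.
rewrite gridE_lin gridE_cst ?(leq_trans _ q2)//; lra.
Qed.

Lemma grid1_sin2 q : (2 < q)%N -> gridE q 1 (fun s : seq R => sin s`_0 ^+ 2) = 2^-1.
Proof.
move=> q2; have := grid1_cos2 q2.
rewrite (@eq_gridE _ q 1 _ (fun s => 1 * 1 + -1 * sin s`_0 ^+ 2)); last first.
  by move=> s _; have := cos2Dsin2 s`_0; lra.
rewrite gridE_lin gridE_cst ?(leq_trans _ q2)//; lra.
Qed.

Lemma grid1_cos_sin q : (2 < q)%N -> gridE q 1 (fun s : seq R => cos s`_0 * sin s`_0) = 0.
Proof.
move=> q2; have /(congr1 (@complex.Im R)) /= := @grid1_cis q 2 q2.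
rewrite (@eq_gridE _ q 1 _ (fun s => 2 * (cos s`_0 * sin s`_0))); last first.
  move=> s _; have -> : 2%:~R * s`_0 = s`_0 + s`_0.
    by rewrite (_ : 2%:~R = 1 + 1 :> R)// mulrDl mul1r.
  by rewrite sinD; ring.
rewrite gridEZ; lra.
Qed.

Lemma grid1_cos3 q : (3 < q)%N -> gridE q 1 (fun s : seq R => cos s`_0 ^+ 3) = 0.
Proof.
move=> q3; have /(congr1 (@complex.Re R)) /= := @grid1_cis q 3 q3.
rewrite (@eq_gridE _ q 1 _ (fun s => 4 * cos s`_0 ^+ 3 + (- 3) * cos s`_0)); last first.
  move=> s _; have -> : 3%:~R * s`_0 = 2%:~R * s`_0 + s`_0.
    by ring.
  have -> : cos (2%:~R * s`_0 + s`_0) = cos (2%:~R * s`_0) * cos s`_0 -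
      (sin s`_0 * cos s`_0 + cos s`_0 * sin s`_0) * sin s`_0.
    by rewrite cosD (_ : 2%:~R * s`_0 = s`_0 + s`_0) ?sinD// (_ : 2%:~R = 1 + 1 :> R)// mulrDl mul1r.
  rewrite cos2xE.
  have -> : (sin s`_0 * cos s`_0 + cos s`_0 * sin s`_0) * sin s`_0 =
    2 * cos s`_0 * sin s`_0 ^+ 2 by ring.
  have -> : sin s`_0 ^+ 2 = 1 - cos s`_0 ^+ 2 by have := cos2Dsin2 s`_0; lra.
  ring.
rewrite gridE_lin grid1_cos ?(leq_trans _ q3)//; lra.
Qed.

End trig_poly_closure.

(** * Riesz products and their moments against product test functions *)

Section riesz_products.
Variable R : realType.
Local Notation C := (Rcomplex R).
Local Notation nC z := (`|(z : C)|).

Definition riesz (s : seq R) : R := \prod_(c <- s) (1 + cos c).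

Lemma riesz_cat s t : riesz (s ++ t) = riesz s * riesz t.
Proof. by rewrite /riesz big_cat. Qed.

Lemma riesz_nil : riesz [::] = 1. Proof. by rewrite /riesz big_nil. Qed.

Lemma riesz_rcons s c : riesz (rcons s c) = riesz s * (1 + cos c).
Proof. by rewrite -cats1 riesz_cat /riesz big_seq1. Qed.

Lemma riesz_ge0 s : 0 <= riesz s.
Proof. by apply: prodr_ge0 => c _; rewrite -lerBlDl sub0r cos_geN1. Qed.

Lemma riesz_le s : riesz s <= 2 ^+ size s.
Proof.
elim: s => [|c s IH]; first by rewrite riesz_nil.
rewrite -cat1s riesz_cat {1}/riesz big_seq1 exprS.
have c0 : 0 <= 1 + cos c by rewrite -lerBlDl sub0r cos_geN1.
apply: ler_pM => //; first exact: riesz_ge0.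
by rewrite -[2]/(1 + 1) lerD2l cos_le1.
Qed.

Lemma riesz_idx s : riesz s = \prod_(i < size s) (1 + cos s`_i).
Proof. by rewrite /riesz (big_nth 0) big_mkord. Qed.

(** Each summand is the increment of the partial product when the factor [1 + cos s_j] is added. *)
Lemma riesz_telescope s :
  \sum_(j < size s) cos s`_j * riesz (take j s) = riesz s - 1.
Proof.
elim/last_ind: s => [|s c IH]; first by rewrite big_ord0 riesz_nil subrr.
rewrite size_rcons big_ord_recr /= nth_rcons ltnn eqxx -cats1 take_cat ltnn subnn.
rewrite take0 cats0 cats1 riesz_rcons mulrDr mulr1 addrAC -IH mulrC; congr (_ + _).
apply: eq_bigr => i _; rewrite nth_rcons ltn_ord -cats1 take_cat ltn_ord.
by [].
Qed.

Lemma tpC_riesz N n : (n <= N)%N -> tpC N (fun s => rC (riesz (take n s))).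
Proof.
move=> nN; apply: (@tpC_take _ _ n (fun s => rC (riesz s))) => //.
apply: (@eq_tpC _ _ (fun s => \prod_(i < n) (1 + rC (cos s`_i)))).
  move=> s sn; rewrite riesz_idx sn; apply: esym.
  rewrite (big_morph (@rC R) (@rCM R) (erefl _)).
  by apply: eq_bigr => i _; rewrite rCD.
by apply: tpC_prod => i _; apply: tpCD; [exact: tpC_cst|exact: tpC_cos].
Qed.

Lemma gridEC_prodidx q N (f : nat -> R -> C) :
  gridEC q N (fun s => \prod_(i < N) f i s`_i) =
  \prod_(i < N) gridEC q 1 (fun s => f i s`_0).
Proof.
elim: N f => [|N IH] f.
  by rewrite big_ord0; apply: C_eqP; rewrite /= /gridE big_ord0.
rewrite -add1n gridEC_cat big_ord_recl -(IH (f \o succn)) -gridEC_prod.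
apply: eq_gridEC => -[//|c [|//]] _; apply: eq_gridEC => t _.
by rewrite big_ord_recl.
Qed.

(** Independence factorises the mean: phases before [j] see the density [1 + cos], phase [j] the
    increment [h], and later phases the uniform law. *)
Lemma gridEC_moment q N (j : 'I_N) (h : R -> R) (f : nat -> R -> C) :
  gridEC q N (fun s => rC (h s`_j * riesz (take j s)) * \prod_(i < N) f i s`_i) =
  \prod_(i < N) if (i < j)%N then gridEC q 1 (fun s => rC (1 + cos s`_0) * f i s`_0)
    else if i == j then gridEC q 1 (fun s => rC (h s`_0) * f i s`_0)
    else gridEC q 1 (fun s => f i s`_0).
Proof.
pose f' i c : C := if (i < j)%N then rC (1 + cos c) * f i c
  else if i == j :> nat then rC (h c) * f i c else f i c.
rewrite (@eq_gridEC R q N _ (fun s => \prod_(i < N) f' i s`_i)); last first.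
  move=> s sN; rewrite mulrC rCM.
  have -> : rC (riesz (take j s)) = \prod_(i < N) (if (i < j)%N then rC (1 + cos s`_i) else 1) :> C.
    rewrite riesz_idx size_takel ?sN ?(ltnW (ltn_ord j))//.
    rewrite (big_ord_widen N (fun i => 1 + cos (take j s)`_i)) ?(ltnW (ltn_ord j))//.
    rewrite (big_morph (@rC R) (@rCM R) (erefl _)) big_mkcond.
    by apply: eq_bigr => i _; case: ifP => // ij; rewrite nth_take.
  have -> : rC (h s`_j) = \prod_(i < N) (if i == j then rC (h s`_i) else 1) :> C.
    by rewrite -big_mkcond big_pred1_eq.
  rewrite -!big_split; apply: eq_bigr => i _; rewrite /f' /=.
  have [ij|ji] := ltnP i j.
    by rewrite (_ : (i == j) = false) ?mul1r 1?mulrC// -val_eqE ltn_eqF.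
  by rewrite -val_eqE; case: ifP => _; rewrite ?mulr1 ?mul1r// mulrC.
rewrite gridEC_prodidx; apply: eq_bigr => i _; rewrite /f' -val_eqE.
by case: ifP => // _; case: ifP.
Qed.

Lemma nC_prod (I : Type) (r : seq I) (F : I -> C) :
  nC (\prod_(i <- r) F i) = \prod_(i <- r) nC (F i).
Proof.
apply: (big_morph (fun z : C => `|z|) (@normC_mul R)).
by rewrite normCE /= expr1n expr0n addr0 sqrtr1.
Qed.

Lemma nC_1i (x dl : R) : `|x| <= dl -> nC (Complex 1 x) <= 1 + dl ^+ 2.
Proof.
move=> xd; have d0 : 0 <= dl by apply: le_trans xd.
have x2 : x ^+ 2 <= dl ^+ 2 by rewrite -(real_normK (num_real x)) ler_pXn2r.
rewrite normCE /= expr1n -[leRHS]ger0_norm ?addr_ge0 ?sqr_ge0//.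
rewrite -sqrtr_sqr ler_sqrt ?sqr_ge0//.
have := sqr_ge0 (dl ^+ 2); nra.
Qed.

(** Each factor has modulus at most [1 + 1 / k], hence at most [exp (1 / k)], and there are at most
    [2 k] factors. *)
Lemma nC_prod_1i (N k : nat) (f : nat -> R) (dl : R) : (N <= k * 2)%N ->
  (0 < k)%N -> (forall i, `|f i| <= dl) -> dl ^+ 2 = k%:R^-1 ->
  nC (\prod_(i < N) Complex 1 (f i)) <= expR 2.
Proof.
move=> Nk k0 fd dk; rewrite nC_prod.
apply: (@le_trans _ _ (\prod_(i < N) expR (k%:R^-1))).
  apply: ler_prod => i _; rewrite normr_ge0/=.
  by rewrite (le_trans (nC_1i (fd _)))// dk expR_ge1Dx.
rewrite prodr_const card_ord -expRM_natl ler_expR.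
rewrite -ler_pdivlMr ?invr_gt0 ?ltr0n// invrK -natrM ler_nat; lia.
Qed.

End riesz_products.

(** * Moments of the Riesz process against the sine and cosine test functions *)

Section odd_part.
Variable R : realType.
Local Notation C := (Rcomplex R).
Local Notation nC z := (`|(z : C)|).

Lemma prod_before_at (N : nat) (j : 'I_N) (a : nat -> C) (b : C) :
  \prod_(i < N) (if (i < j)%N then a i else if i == j then b else 1) =
  (\prod_(i < j) a i) * b.
Proof.
rewrite (bigD1 j)//= ltnn eqxx mulrC; congr (_ * _).
rewrite (big_ord_widen N a (ltnW (ltn_ord j))) [LHS]big_mkcond [RHS]big_mkcond.
apply: eq_bigr => i _; rewrite -val_eqE /=.
by case: ltngtP.
Qed.

Lemma gridE_riesz q N : (2 < q)%N -> gridE q N (@riesz R) = 1.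
Proof.
move=> q2; have := @gridEC_prodidx R q N (fun _ c => rC (1 + cos c)).
rewrite big1; last first.
  move=> i _; rewrite gridEC_real ?(leq_trans _ q2)// gridED gridE_cst ?(leq_trans _ q2)//.
  by rewrite grid1_cos ?addr0// (leq_trans _ q2).
move=> /(congr1 (@complex.Re R)) /= <-; apply: eq_gridE => s sN.
rewrite riesz_idx sN.
by rewrite -(big_morph (@rC R) (@rCM R) (erefl _)).
Qed.

Lemma gridE_cos_riesz q N (j : 'I_N) : (2 < q)%N ->
  gridE q N (fun s : seq R => cos s`_j * riesz (take j s)) = 0.
Proof.
move=> q2; have q0 : (0 < q)%N by rewrite (leq_trans _ q2).
have := @gridEC_moment R q N j cos (fun _ _ => 1).
rewrite [X in _ = X -> _](bigD1 j)//= ltnn eqxx (@eq_gridEC R q 1 _ (fun s => rC (cos s`_0))); last first.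
  by move=> s _; rewrite mulr1.
rewrite gridEC_real// grid1_cos ?(leq_trans _ q2)// mul0r.
move=> /(congr1 (@complex.Re R)) h; rewrite -[RHS]h; apply: eq_gridE => s _.
by rewrite big1// mulr1.
Qed.

(** Under the density [1 + cos] the factor [1 + i dl sin] still has mean one, because sine and
    cosine times sine have mean zero. Phase [j] gives [i dl / 2]. *)
Lemma gridE_sin_moment q N (j : 'I_N) (dl : R) : (2 < q)%N ->
  gridE q N (fun s => sin s`_j * riesz (take j s) *
    complex.Im (\prod_(i < N) Complex 1 (dl * sin s`_i) : C)) = dl / 2.
Proof.
move=> q2; have q0 : (0 < q)%N by rewrite (leq_trans _ q2).
have q1 : (1 < q)%N by rewrite (leq_trans _ q2).
have := @gridEC_moment R q N j sin (fun _ c => Complex 1 (dl * sin c)).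
have E1 : gridEC q 1 (fun s : seq R => rC (1 + cos s`_0) * Complex 1 (dl * sin s`_0)) = 1.
  apply: C_eqP => /=.
    rewrite (@eq_gridE R q 1 _ (fun s => 1 + cos s`_0)); last by move=> s _; ring.
    by rewrite gridED gridE_cst// grid1_cos// addr0.
  rewrite (@eq_gridE R q 1 _ (fun s => dl * sin s`_0 + dl * (cos s`_0 * sin s`_0))); last first.
    by move=> s _; ring.
  by rewrite gridE_lin grid1_sin// grid1_cos_sin// !mulr0 addr0.
have E2 : gridEC q 1 (fun s : seq R => rC (sin s`_0) * Complex 1 (dl * sin s`_0)) =
    Complex 0 (dl / 2).
  apply: C_eqP => /=.
    rewrite (@eq_gridE R q 1 _ (fun s => sin s`_0)); last by move=> s _; ring.
    by rewrite grid1_sin.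
  rewrite (@eq_gridE R q 1 _ (fun s => dl * sin s`_0 ^+ 2)); last by move=> s _; ring.
  by rewrite gridEZ grid1_sin2.
have E3 : gridEC q 1 (fun s : seq R => Complex 1 (dl * sin s`_0) : C) = 1.
  by apply: C_eqP => /=; rewrite ?gridE_cst// gridEZ grid1_sin// mulr0.
rewrite E1 E2 E3 (prod_before_at j (fun=> 1)) big1// mul1r.
move=> /(congr1 (@complex.Im R)) /= <-; apply: eq_gridE => s _.
by rewrite Im_mul mul0r addr0.
Qed.

(** Under the density [1 + cos] a factor has mean [1 + i dl / 2] or [1 - i dl / 2] according to the
    parity of its index. The alternating signs combine neighbours into the positive number
    [1 + dl ^ 2 / 4], so that the argument of the product does not drift. For odd [j] one factor
    [1 - i dl / 2] is left over; times [i dl / 2] its imaginary part is still [dl / 2]. *)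
Lemma gridE_cos_moment q k (j : 'I_(k * 2)) (dl : R) : (2 < q)%N -> odd j -> 0 <= dl ->
  dl / 2 <= gridE q (k * 2) (fun s => cos s`_j * riesz (take j s) *
    complex.Im (\prod_(i < k * 2) Complex 1 (dl * (-1) ^+ (~~ odd i) * cos s`_i) : C)).
Proof.
move=> q2 oj dl0; have q0 : (0 < q)%N by rewrite (leq_trans _ q2).
have q1 : (1 < q)%N by rewrite (leq_trans _ q2).
have := @gridEC_moment R q _ j cos (fun i c => Complex 1 (dl * (-1) ^+ (~~ odd i) * cos c)).
have E1 i : gridEC q 1 (fun s : seq R => rC (1 + cos s`_0) *
     Complex 1 (dl * (-1) ^+ (~~ odd i) * cos s`_0)) = Complex 1 (dl * (-1) ^+ (~~ odd i) / 2).
  set e := (-1) ^+ _; apply: C_eqP => /=.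
    rewrite (@eq_gridE R q 1 _ (fun s => 1 + cos s`_0)); last by move=> s _; ring.
    by rewrite gridED gridE_cst// grid1_cos// addr0.
  rewrite (@eq_gridE R q 1 _ (fun s => (dl * e) * cos s`_0 + (dl * e) * cos s`_0 ^+ 2)); last first.
    by move=> s _; ring.
  by rewrite gridE_lin grid1_cos// grid1_cos2// mulr0 add0r.
have E2 : gridEC q 1 (fun s : seq R => rC (cos s`_0) *
     Complex 1 (dl * (-1) ^+ (~~ odd j) * cos s`_0)) = Complex 0 (dl / 2).
  rewrite oj expr0 mulr1; apply: C_eqP => /=.
    rewrite (@eq_gridE R q 1 _ (fun s => cos s`_0)); last by move=> s _; ring.
    by rewrite grid1_cos.
  rewrite (@eq_gridE R q 1 _ (fun s => dl * cos s`_0 ^+ 2)); last by move=> s _; ring.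
  by rewrite gridEZ grid1_cos2.
have E3 i : gridEC q 1 (fun s : seq R => Complex 1 (dl * (-1) ^+ (~~ odd i) * cos s`_0) : C) = 1.
  by apply: C_eqP => /=; rewrite ?gridE_cst// gridEZ grid1_cos// mulr0.
rewrite (eq_bigr (fun i : 'I_(k * 2) => if (i < j)%N then Complex 1 (dl * (-1) ^+ (~~ odd i) / 2)
   else if i == j then Complex 0 (dl / 2) else 1)); last first.
  move=> i _; rewrite E1; case: ifP => // _; case: eqP => [->|_]; first by rewrite E2.
  by rewrite E3.
rewrite (prod_before_at j (fun i => Complex 1 (dl * (-1) ^+ (~~ odd i) / 2))).
have jE : nat_of_ord j = (j./2 * 2).+1 by have := odd_double_half j; rewrite oj -muln2 add1n => ->.
have PE m : \prod_(i < m * 2) Complex 1 (dl * (-1) ^+ (~~ odd i) / 2) =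
    rC ((1 + dl ^+ 2 / 4) ^+ m) :> C.
  elim: m => [|m IH]; first by rewrite big_ord0.
  rewrite (_ : (m.+1 * 2 = (m * 2).+2)%N)// !big_ord_recr /= IH [_ ^+ m.+1]exprSr [RHS]rCM.
  rewrite oddM andbF /= expr0 expr1 -mulrA; congr (_ * _).
  by apply: C_eqP => /=; field.
have -> : \prod_(i < j) Complex 1 (dl * (-1) ^+ (~~ odd i) / 2) =
    rC ((1 + dl ^+ 2 / 4) ^+ j./2) * Complex 1 (- (dl / 2)) :> C.
  move: (j./2) jE => m jE; rewrite jE big_ord_recr /= PE oddM andbF /= expr1.
  by congr (_ * Complex 1 _); ring.
move=> /(congr1 (@complex.Im R)) h.
have -> : gridE q (k * 2) (fun s => cos s`_j * riesz (take j s) *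
    complex.Im (\prod_(i < k * 2) Complex 1 (dl * (-1) ^+ (~~ odd i) * cos s`_i) : C)) =
    (1 + dl ^+ 2 / 4) ^+ j./2 * (dl / 2).
  transitivity (complex.Im (rC ((1 + dl ^+ 2 / 4) ^+ j./2) * Complex 1 (- (dl / 2)) *
    Complex 0 (dl / 2) : C)); last by rewrite /=; ring.
  by rewrite -h; apply: eq_gridE => s _; rewrite Im_mul mul0r addr0.
by rewrite ler_peMl ?divr_ge0// exprn_ege1// lerDl divr_ge0// sqr_ge0.
Qed.

End odd_part.

(** * The odd part along a direction *)

Section odd_limit.
Variables (R : realType) (d : nat).
Local Notation C := (Rcomplex R).
Local Notation E := 'rV[R]_d.
Local Notation nC z := (`|(z : C)|).

Definition cont_off0 (M : E -> C) := forall a : E, a != 0 -> forall e, 0 < e ->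
  exists2 h, 0 < h & forall z, `|z| < h -> nC (M (a + z) - M a) < e.

(** Membership of [v] in the contingent cone of [L] at 0. The scale [r] is kept explicit because
    [transfer] divides the frequencies by it. *)
Definition tangent (L : set E) (v : E) := forall tau, 0 < tau -> exists a r,
  [/\ L a, a != 0, 0 < r, `|a| < tau & `|r^-1 *: a - v| < tau].

Lemma entry_neq0 (v : E) : v != 0 -> exists l, v ord0 l != 0.
Proof.
move=> v0; apply/existsP; apply: contraNT v0 => /existsPn h.
by apply/eqP/rowP => l; rewrite mxE; apply/eqP; have := h l; rewrite negbK.
Qed.

Lemma nC_Re_ge (z : C) (x : R) : x <= complex.Re z -> x <= nC z.
Proof. by move=> h; apply: le_trans h _; apply: le_trans (ler_norm _) (normC_Re _). Qed.

(** For odd [M] the cosine moments cancel and the sine moments add, so each frequency contributes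
    [i v_l dl / 2] times [M]. The real parts of [M] cannot compensate each other, being at least
    [e0], and the sum exceeds a bound that does not depend on the number of phases. *)
Lemma odd_tangent (c B : R) (M : E -> C) : bohr c M -> 0 <= c ->
  (forall x, nC (M x) <= B) -> cont_off0 M -> (forall x, M (- x) = - M x) ->
  forall (v : E) (e0 : R), v != 0 -> 0 < e0 ->
  tangent [set a | e0 <= complex.Re (M a)] v -> False.
Proof.
move=> bM c0 MB Mc Modd v e0 v0 e00 vtan.
have [l vl] := entry_neq0 v0.
pose cst := c * expR 2 * (`|v| * 2) + 1.
have cst0 : 0 <= cst by rewrite addr_ge0// !mulr_ge0// expR_ge0.
have vl0 : 0 < `|v ord0 l| by rewrite normr_gt0.
pose n := (Num.bound (cst / (`|v ord0 l| / 2 * e0))).+1.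
have nbig : cst < `|v ord0 l| / 2 * e0 * n%:R.
  rewrite mulrC -ltr_pdivrMr ?mulr_gt0 ?divr_gt0//.
  rewrite (lt_trans (archi_boundP _))// ?divr_ge0 ?mulr_ge0 ?divr_ge0// ?(ltW e00)//.
  by rewrite ltr_nat.
(* With [dl = 1 / n] this gives [N * dl ^ 2 = 1], which keeps the test function bounded, while the
   sum is of order [N * dl = n]. *)
pose N := (n ^ 2)%N.
pose dl : R := n%:R^-1.
have n0 : n%:R != 0 :> R by rewrite pnatr_eq0.
pose G s := complex.Im (\prod_(i < N) Complex 1 (dl * sin s`_i) : C).
have [|||||q0 H] := @transfer R d c B M bM c0 MB Mc N (fun=> v) (@riesz R) G
  (fun s => `|v| * (riesz s + 1)) (expR 2).
- move=> j _; apply: tpC_tpoly; have := @tpC_riesz R j j (leqnn j).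
  by apply: eq_tpC => s sj; rewrite take_oversize ?sj.
- apply: tpC_tpoly; apply: tpC_Im; apply: tpC_prod => i _.
  apply: (@eq_tpC _ _ (fun s => 1 + Complex 0 dl * rC (sin s`_i))).
    by move=> s _; apply: C_eqP => /=; ring.
  by apply: tpCD; [exact: tpC_cst|apply: tpCM; [exact: tpC_cst|exact: tpC_sin]].
- apply: tpC_tpoly.
  apply: (@eq_tpC _ _ (fun s => rC `|v| * (rC (riesz (take N s)) + 1))).
    by move=> s sN; rewrite take_oversize ?sN// -[1 in LHS]/(rC 1) -rCD -rCM.
  by apply: tpCM; [exact: tpC_cst|apply: tpCD; [exact: tpC_riesz|exact: tpC_cst]].
- move=> s sN; apply: le_trans (normC_Im _) _.
  apply: (@nC_prod_1i R N N (fun i => dl * sin s`_i) dl).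
  + by rewrite muln2 -addnn leq_addr.
  + by rewrite expn_gt0.
  + move=> i; rewrite normrM [`|dl|]ger0_norm ?invr_ge0// ler_piMr ?invr_ge0//.
    by rewrite ler_norml sin_geN1 sin_le1.
  + by rewrite /dl /N natrX exprVn.
- move=> l' s sN; under eq_bigr do rewrite -mulrA.
  rewrite -mulr_sumr -sN riesz_telescope normrM.
  apply: ler_pM => //; first exact: ler_entry.
  by rewrite (le_trans (ler_normB _ _))// normr1 ger0_norm ?riesz_ge0.
pose q := maxn q0 3.
have q2 : (2 < q)%N by rewrite leq_max orbT.
have [a [La /(_ l)]] := H q (leq_maxl _ _) 1 ltr01 (fun=> [set a | e0 <= complex.Re (M a)])
  (fun _ _ => vtan).
apply/negP; rewrite -ltNge.
have -> : \sum_(j < N) rC (v ord0 l / 2) *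
       (M (a j) * Complex (gridE q N (fun s => cos s`_j * riesz (take j s) * G s))
                          (gridE q N (fun s => sin s`_j * riesz (take j s) * G s)) +
        M (- a j) * Complex (gridE q N (fun s => cos s`_j * riesz (take j s) * G s))
                        (- gridE q N (fun s => sin s`_j * riesz (take j s) * G s))) =
    Complex 0 (v ord0 l / 2 * dl) * \sum_(j < N) M (a j) :> C.
  rewrite mulr_sumr; apply: eq_bigr => j _.
  rewrite gridE_sin_moment// Modd; set x := gridE _ _ _.
  by case: (M (a j)) => u w; apply: C_eqP => /=; field.
have -> : gridE q N (fun s => `|v| * (riesz s + 1)) = `|v| * 2.
  by rewrite gridEZ gridED gridE_riesz// gridE_cst// (leq_trans _ q2).
apply: lt_le_trans nbig _; rewrite normC_mul.
have -> : nC (Complex 0 (v ord0 l / 2 * dl)) = `|v ord0 l| / 2 * dl.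
  rewrite normCE /= expr0n add0r sqrtr_sqr !normrM [`|dl|]ger0_norm ?invr_ge0//.
  by rewrite [`|2^-1|]ger0_norm.
have -> : `|v ord0 l| / 2 * e0 * n%:R = `|v ord0 l| / 2 * dl * (N%:R * e0).
  by rewrite /N natrX /dl; field.
rewrite ler_wpM2l//; first by rewrite mulr_ge0 ?divr_ge0 ?invr_ge0.
apply: nC_Re_ge; rewrite Re_sum.
apply: (@le_trans _ _ (\sum_(j < N) e0)).
  by rewrite sumr_const card_ord mulr_natl.
by apply: ler_sum => j _; exact: (La j (ltn_ord j)).
Qed.

End odd_limit.

(** * Processes built from independent blocks by a multiplicative recursion *)

Section block_process.
Variable R : realType.
Local Notation C := (Rcomplex R).
Variables (n m : nat).
Local Notation Lb := (n + m)%N.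

Implicit Types (a Z : seq R -> seq R -> R) (s t : seq R).

(* The variables come in blocks of [n + m], and the first block is treated first. *)
Fixpoint block_rec a Z (c : R) B s : R :=
  if B is B'.+1 then
    let f := take n s in let p := take m (drop n s) in
    a f p + Z f p * block_rec a Z c B' (drop Lb s)
  else c.

Lemma block_rec_cat a Z c B f p t : size f = n -> size p = m ->
  block_rec a Z c B.+1 (f ++ p ++ t) = a f p + Z f p * block_rec a Z c B t.
Proof.
move=> fn pm /=.
rewrite take_size_cat// drop_size_cat// take_size_cat//.
by rewrite catA drop_size_cat// size_cat fn pm.
Qed.

Lemma tpC_block_rec a Z c B :
  tpC Lb (fun s => rC (a (take n s) (take m (drop n s)))) ->
  tpC Lb (fun s => rC (Z (take n s) (take m (drop n s)))) ->
  tpC (B * Lb) (fun s => rC (block_rec a Z c B s)).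
Proof.
move=> ta tZ; elim: B => [|B IH]; first exact: (tpC_cst _ (rC c)).
have E s : take n s = take n (take Lb s) /\
    take m (drop n s) = take m (drop n (take Lb s)).
  split; first by rewrite take_takel// leq_addr.
  by rewrite !take_drop addnC take_takel.
apply: (@eq_tpC _ _ (fun s => rC (a (take n (take Lb s)) (take m (drop n (take Lb s)))) +
    rC (Z (take n (take Lb s)) (take m (drop n (take Lb s)))) *
    rC (block_rec a Z c B (drop Lb s)))).
  by move=> s _; have [e1 e2] := E s; rewrite -e1 -e2 -rCM -rCD.
have LbS : (Lb <= B.+1 * Lb)%N by rewrite mulSn leq_addr.
apply: tpCD; first exact: (tpC_take LbS ta).
apply: tpCM; first exact: (tpC_take LbS tZ).
by rewrite mulSn; exact: (tpC_drop Lb IH).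
Qed.

Lemma gridE_block q B (F : seq R -> R) :
  gridE q (B.+1 * Lb) F = gridE q n (fun f => gridE q m (fun p =>
    gridE q (B * Lb) (fun t => F (f ++ p ++ t)))).
Proof.
rewrite mulSn -addnA gridE_cat; apply: eq_gridE => f _.
by rewrite gridE_cat.
Qed.

Lemma gridE_prod3 q N M L (a b c : seq R -> R) :
  gridE q N (fun f => gridE q M (fun p => gridE q L (fun t => a f * b p * c t))) =
  gridE q N a * gridE q M b * gridE q L c.
Proof.
rewrite -gridE_prod mulrC -gridEZ; apply: eq_gridE => f _.
rewrite -gridEZ; apply: eq_gridE => p _.
by rewrite gridEZ mulrC.
Qed.

(** The coefficient of the increment at time [j], as a function of the first [j] phases: one factor
    [Z] for each completed block, then [a] on the unfinished one. The time is encoded as the length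
    of [s]. *)
Definition proc_rec (a Z : seq R -> seq R -> R) :=
  fix pr B s : R := if B is B'.+1 then
    if (size s < Lb)%N then a (take n s) (drop n s)
    else Z (take n s) (take m (drop n s)) * pr B' (drop Lb s) else 0.

(** The weights have the length of a block as period. After the first block there remains the same
    sum over the other phases, multiplied by [Z] of the first block. *)
Lemma proc_sum (w : nat -> R) a0 a Z B s : (0 < Lb)%N ->
  (forall j, w (Lb + j)%N = w j) ->
  (forall f p, size f = n -> size p = m ->
     \sum_(j < Lb) w j * cos (f ++ p)`_j *
       a0 (take n (take j (f ++ p))) (drop n (take j (f ++ p))) = a f p) ->
  size s = (B * Lb)%N ->
  \sum_(j < B * Lb) w j * cos s`_j * proc_rec a0 Z B (take j s) =
  block_rec a Z 0 B s.
Proof.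
move=> Lb0 wL aE; elim: B s => [|B IH] s sN; first by rewrite big_ord0.
pose f := take n s; pose p := take m (drop n s); pose t := drop Lb s.
have LbN : (Lb <= size s)%N by rewrite sN mulSn leq_addr.
have fn : size f = n by rewrite size_takel// (leq_trans (leq_addr _ _) LbN).
have pm : size p = m.
  by rewrite size_takel// size_drop leq_subRL ?(leq_trans (leq_addr _ _) LbN).
have sE : s = f ++ p ++ t.
  by rewrite /t /p /f (addnC n m) -drop_drop !cat_take_drop.
have tN : size t = (B * Lb)%N by rewrite size_drop sN mulSn addKn.
rewrite [in RHS]sE block_rec_cat// -(IH t tN) -(aE f p fn pm).
have -> : \sum_(j < B.+1 * Lb) w j * cos s`_j * proc_rec a0 Z B.+1 (take j s) =
   \sum_(j < Lb + B * Lb) w j * cos s`_j * proc_rec a0 Z B.+1 (take j s).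
  by rewrite mulSn.
have fpL : size (f ++ p) = Lb by rewrite size_cat fn pm.
rewrite big_split_ord /=; congr (_ + _).
  apply: eq_bigr => j _.
  have jL := ltn_ord j.
  have js : (j < size s)%N by rewrite (leq_trans jL).
  rewrite size_takel ?(ltnW js)// jL {1}sE catA nth_cat fpL jL.
  by rewrite {1 2}sE catA takel_cat// fpL ltnW.
rewrite mulr_sumr; apply: eq_bigr => j _.
have jN : (Lb + j <= size s)%N.
  by rewrite sN mulSn leq_add2l ltnW.
rewrite size_takel// ltnNge leq_addr /= wL.
have -> : take n (take (Lb + j) s) = f by rewrite take_takel// -addnA leq_addr.
have -> : take m (drop n (take (Lb + j) s)) = p.
  by rewrite /p !take_drop (addnC m) take_takel ?leq_addr.
have -> : drop Lb (take (Lb + j) s) = take j t by rewrite (addnC Lb) -take_drop.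
rewrite sE catA nth_cat fpL ltnNge leq_addr /= addKn.
ring.
Qed.

Lemma tpC_proc_rec a0 Z B j : (0 < Lb)%N ->
  (forall i, (i < Lb)%N -> tpC i (fun s => rC (a0 (take n s) (drop n s)))) ->
  tpC Lb (fun s => rC (Z (take n s) (take m (drop n s)))) ->
  (j < B * Lb)%N -> tpC j (fun s => rC (proc_rec a0 Z B s)).
Proof.
move=> Lb0 ta tZ; elim: B j => [|B IH] j; first by rewrite mul0n.
move=> jN; have [jL|Lj] := ltnP j Lb.
  apply: eq_tpC (ta _ jL) => s sj.
  by rewrite /= sj jL.
have E s : take n s = take n (take Lb s) /\
    take m (drop n s) = take m (drop n (take Lb s)).
  split; first by rewrite take_takel// leq_addr.
  by rewrite !take_drop addnC take_takel.
apply: (@eq_tpC _ _ (fun s => rC (Z (take n (take Lb s)) (take m (drop n (take Lb s)))) *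
    rC (proc_rec a0 Z B (drop Lb s)))).
  by move=> s sj; have [e1 e2] := E s; rewrite -e1 -e2 -rCM /= sj ltnNge Lj.
apply: tpCM; first exact: (tpC_take Lj tZ).
rewrite -(subnKC Lj); apply: (tpC_drop Lb (F := fun s => rC (proc_rec a0 Z B s))).
by apply: IH; rewrite ltn_subLR// -mulSn.
Qed.

End block_process.

(** * The process and the test function for the even part *)

Section even_process.
Variable R : realType.
Local Notation C := (Rcomplex R).
Local Notation nC z := (`|(z : C)|).
Variables (n k : nat) (kap dl : R).
Local Notation m := (k * 2)%N.
Local Notation Lb := (n + m)%N.
Implicit Types f p s t : seq R.

(* A block has [n] moves along e1 + e2, with coefficients the partial products of
   [riesz f], then [m] moves alternating between e1 and -e2, with coefficients
   [kap * riesz f] times the partial products of [riesz p].  As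
   [xpart p + ypart p = riesz p - 1], the process equals
   e1 (YY - 1 + bounded) + e2 (YY - 1), where YY >= 0 has mean one, whereas [gtest]
   makes the mean of [ypart] large.  The factors [stop] and [1 - stop] in [GG] are
   the weights of a stopping time, whence [GG <= sup gtest]; since [stop f] has
   mean close to one for the density [riesz f], all the blocks contribute. *)
Definition ypart p : R := \sum_(j < m) (odd j)%:R * cos p`_j * riesz (take j p).
Definition xpart p : R := \sum_(j < m) (~~ odd j)%:R * cos p`_j * riesz (take j p).
Definition sigma f : R := \sum_(c <- f) (cos c - 2^-1).
Definition stop f : R := 1 - 4 / 9 / n%:R ^+ 2 * sigma f ^+ 2.
Definition gtest p : R :=
  complex.Im (\prod_(i < m) Complex 1 (dl * (-1) ^+ (~~ odd i) * cos p`_i) : C).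
Definition Zb f p : R := riesz f * (1 - kap * ypart p).
Definition coef0 f p : R :=
  if (size f < n)%N then riesz f else riesz f * (kap * riesz p).
Definition wgt (wt wx wy : R) (j : nat) : R :=
  let i := (j %% Lb)%N in
  if (i < n)%N then wt else if odd (i - n) then wy else wx.
Definition incr (wt wx wy : R) f p : R :=
  wt * (riesz f - 1) + riesz f * (kap * (wx * xpart p + wy * ypart p)).
Definition TT wt wx wy B s := block_rec n m (incr wt wx wy) Zb 0 B s.
Definition YY B s := block_rec n m (fun _ _ => 0) Zb 1 B s.
Definition DD B s := block_rec n m (fun f p => kap * riesz f * (riesz p + 1)) Zb 0 B s.
Definition uhead B t : R := if B is 0 then 0 else stop (take n t).
Fixpoint GG B s : R := if B is B'.+1 then
    let t := drop Lb s in
    stop (take n s) * (gtest (take m (drop n s)) * (1 - uhead B' t) + GG B' t)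
  else 0.

Lemma xypart p : size p = m -> xpart p + ypart p = riesz p - 1.
Proof.
move=> pm; rewrite -riesz_telescope pm -big_split; apply: eq_bigr => j _ /=.
by case: (odd j) => /=; ring.
Qed.

Lemma wgtD wt wx wy j : wgt wt wx wy (Lb + j) = wgt wt wx wy j.
Proof. by rewrite /wgt modnDl. Qed.

Lemma block_sum wt wx wy f p : size f = n -> size p = m ->
  \sum_(j < Lb) wgt wt wx wy j * cos (f ++ p)`_j *
    coef0 (take n (take j (f ++ p))) (drop n (take j (f ++ p))) = incr wt wx wy f p.
Proof.
move=> fn pm; rewrite big_split_ord /=; congr (_ + _).
  rewrite -riesz_telescope fn mulr_sumr; apply: eq_bigr => j _.
  have jn := ltn_ord j.
  rewrite /wgt modn_small ?jn; last by rewrite ltn_addr.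
  rewrite nth_cat fn jn takel_cat ?fn ?(ltnW jn)// /coef0.
  rewrite take_oversize ?size_takel ?fn ?(ltnW jn)// jn.
  by rewrite mulrA.
rewrite /xpart /ypart !mulr_sumr -big_split !mulr_sumr; apply: eq_bigr => j _ /=.
have jm := ltn_ord j.
rewrite /wgt modn_small ?ltn_add2l// ltnNge leq_addr /= addKn.
rewrite nth_cat fn ltnNge leq_addr /= addKn.
have tE : take (n + j) (f ++ p) = f ++ take j p by rewrite take_cat fn ltnNge leq_addr /= addKn.
rewrite tE take_size_cat// drop_size_cat// /coef0 fn ltnn.
by case: (odd j) => /=; ring.
Qed.

Lemma TT_sum wt wx wy B s : (0 < Lb)%N -> size s = (B * Lb)%N ->
  \sum_(j < B * Lb) wgt wt wx wy j * cos s`_j * proc_rec n m coef0 Zb B (take j s) =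
  TT wt wx wy B s.
Proof.
move=> L0 sN; apply: proc_sum => //; first by move=> j; rewrite wgtD.
exact: block_sum.
Qed.

Lemma block_split s : (Lb <= size s)%N -> exists f p, 
  [/\ size f = n, size p = m & s = f ++ p ++ drop Lb s].
Proof.
move=> LbN; exists (take n s), (take m (drop n s)); split.
- by rewrite size_takel// (leq_trans (leq_addr _ _) LbN).
- by rewrite size_takel// size_drop leq_subRL ?(leq_trans (leq_addr _ _) LbN).
- by rewrite (addnC n m) -drop_drop !cat_take_drop.
Qed.

Lemma block_ind (P : nat -> seq R -> Prop) :
  (forall s, size s = 0%N -> P 0%N s) ->
  (forall B f p t, size f = n -> size p = m -> size t = (B * Lb)%N ->
     P B t -> P B.+1 (f ++ p ++ t)) ->
  forall B s, size s = (B * Lb)%N -> P B s.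
Proof.
move=> P0 PS; elim=> [|B IH] s sN; first exact: P0.
have [|f [p [fn pm sE]]] := @block_split s; first by rewrite sN mulSn leq_addr.
have tN : size (drop Lb s) = (B * Lb)%N by rewrite size_drop sN mulSn addKn.
by rewrite sE; apply: PS => //; apply: IH.
Qed.

Lemma TT_lin wt wx wy B s : size s = (B * Lb)%N ->
  TT wt wx wy B s = wt * TT 1 0 0 B s + wx * TT 0 1 0 B s + wy * TT 0 0 1 B s.
Proof.
move: B s; apply: block_ind => [s _|B f p t fn pm _ IH]; first by rewrite /TT /=; ring.
by rewrite /TT !block_rec_cat// -!/(TT _ _ _ _ _) IH /incr; ring.
Qed.

(** In one block the two increments differ by [Zb f p - 1], so the sum telescopes into the product
    of the factors [Zb]. *)
Lemma TT_YY B s : size s = (B * Lb)%N -> TT 1 0 0 B s - TT 0 0 1 B s = YY B s - 1.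
Proof.
move: B s; apply: block_ind => [s _|B f p t fn pm _ IH]; first by rewrite /TT /YY /=; ring.
rewrite /TT /YY !block_rec_cat// -!/(TT _ _ _ _ _) -!/(YY _ _).
have -> : YY B t = TT 1 0 0 B t - TT 0 0 1 B t + 1 by rewrite IH; ring.
by rewrite /incr /Zb; ring.
Qed.

Hypothesis kap0 : 0 <= kap.
Hypothesis kapy : forall p, size p = m -> kap * `|ypart p| <= 1.

Lemma Zb_ge0 f p : size p = m -> 0 <= Zb f p.
Proof.
move=> pm; rewrite mulr_ge0 ?riesz_ge0// subr_ge0 (le_trans _ (kapy pm))//.
by rewrite ler_wpM2l// ler_norm.
Qed.

Lemma YY_ge0 B s : size s = (B * Lb)%N -> 0 <= YY B s.
Proof.
move: B s; apply: block_ind => [s _|B f p t fn pm _ IH]; first by rewrite /YY /= ler01.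
by rewrite /YY !block_rec_cat// add0r mulr_ge0// Zb_ge0.
Qed.

(** With equal weights the large parts of [xpart] and [ypart] cancel: a block contributes only
    [kap * riesz f * (riesz p - 1)]. *)
Lemma TT_DD B s : size s = (B * Lb)%N -> `|TT 0 1 1 B s| <= DD B s.
Proof.
move: B s; apply: block_ind => [s _|B f p t fn pm _ IH]; first by rewrite /TT /DD /= normr0.
rewrite /TT /DD !block_rec_cat// (le_trans (ler_normD _ _))// lerD//.
  rewrite /incr mul0r add0r !mul1r xypart// mulrA [riesz f * kap]mulrC normrM.
  rewrite ger0_norm; last by rewrite mulr_ge0// riesz_ge0.
  rewrite ler_wpM2l//; first by rewrite mulr_ge0// riesz_ge0.
  by rewrite (le_trans (ler_normB _ _))// normr1 ger0_norm// riesz_ge0.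
by rewrite normrM ger0_norm ?Zb_ge0// ler_wpM2l// Zb_ge0.
Qed.

Lemma sigma_le f : `|sigma f| <= 3 / 2 * (size f)%:R.
Proof.
rewrite /sigma (le_trans (ler_norm_sum _ _ _))//.
apply: (@le_trans _ _ (\sum_(c <- f) 3 / 2)).
  apply: ler_sum => c _; rewrite ler_norml; have := cos_geN1 c; have := cos_le1 c; lra.
by rewrite big_const_seq count_predT iter_addr_0 mulr_natr.
Qed.

(** Each [cos c - 1 / 2] is at most 3 / 2 in absolute value; the constant 4 / 9 in [stop] is the
    inverse square of this bound. *)
Lemma stop_bounds f : (0 < n)%N -> size f = n -> 0 <= stop f <= 1.
Proof.
move=> n0 fn; have := sigma_le f; rewrite fn.
have nR : 0 < n%:R :> R by rewrite ltr0n.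
rewrite /stop => h.
have h2 : sigma f ^+ 2 <= (3 / 2 * n%:R) ^+ 2.
  by rewrite -(real_normK (num_real (sigma f))) ler_pXn2r// nnegrE mulr_ge0// ltW.
have -> : 4 / 9 / n%:R ^+ 2 * sigma f ^+ 2 = sigma f ^+ 2 / (3 / 2 * n%:R) ^+ 2.
  by field; rewrite gt_eqF.
have p0 : 0 < (3 / 2 * n%:R) ^+ 2 :> R by rewrite exprn_gt0// mulr_gt0.
rewrite subr_ge0 ler_pdivrMr// mul1r h2/= lerBlDr lerDl divr_ge0 ?sqr_ge0//.
Qed.

(** The factor [uhead] is what the induction needs: the weights [1 - uhead] of testing now and
    [uhead] of testing later add up to one. *)
Lemma GG_le K B s : (0 < n)%N -> 0 <= K ->
  (forall p, size p = m -> `|gtest p| <= K) ->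
  size s = (B * Lb)%N -> `|GG B s| <= K * uhead B s.
Proof.
move=> n0 K0 gK; move: B s; apply: block_ind => [s _|B f p t fn pm tN IH].
  by rewrite /= normr0 mulr0.
rewrite /= take_size_cat// drop_size_cat// take_size_cat// catA drop_size_cat; last first.
  by rewrite size_cat fn pm.
have /andP[s0 s1] := stop_bounds n0 fn.
rewrite normrM ger0_norm// mulrC ler_wpM2r//.
have uh : 0 <= uhead B t <= 1.
  case: B tN {IH} => [|B] tN /=; first by rewrite lexx ler01.
  apply: stop_bounds => //; rewrite size_takel// tN mulSn -addnA leq_addr//.
rewrite (le_trans (ler_normD _ _))// normrM [`|1 - _|]ger0_norm ?subr_ge0; last by case/andP: uh.
apply: (@le_trans _ _ (K * (1 - uhead B t) + K * uhead B t)); last by rewrite -mulrDr subrK mulr1.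
rewrite lerD// ler_wpM2r ?gK// subr_ge0; by case/andP: uh.
Qed.

Variable q : nat.
Hypothesis q3 : (3 < q)%N.

Let q2 : (2 < q)%N. Proof. exact: leq_trans q3. Qed.
Let q1 : (1 < q)%N. Proof. exact: leq_trans q3. Qed.
Let q0 : (0 < q)%N. Proof. exact: leq_trans q3. Qed.

Lemma E_ypart : gridE q m ypart = 0.
Proof.
rewrite /ypart gridE_sum big1// => j _.
under eq_gridE do rewrite -mulrA.
by rewrite gridEZ gridE_cos_riesz// mulr0.
Qed.

Lemma E_1ky : gridE q m (fun p => 1 - kap * ypart p) = 1.
Proof.
rewrite (@eq_gridE R q m _ (fun p => 1 * 1 + - kap * ypart p)); last by move=> p _; ring.
by rewrite gridE_lin gridE_cst// E_ypart; ring.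
Qed.

Lemma E_YY B : gridE q (B * Lb) (YY B) = 1.
Proof.
elim: B => [|B IH]; first by rewrite /YY /= gridE_cst.
have := gridE_prod3 q n m (B * Lb) (@riesz R) (fun p => 1 - kap * ypart p) (YY B).
rewrite gridE_riesz// E_1ky IH !mulr1 gridE_block => <-.
apply: eq_gridE => f fn; apply: eq_gridE => p pm; apply: eq_gridE => t tN.
by rewrite /YY block_rec_cat// /Zb add0r.
Qed.

(** Each block adds [2 * kap], because both Riesz products and the factor [1 - kap * ypart] have
    mean one. *)
Lemma E_DD B : gridE q (B * Lb) (DD B) = 2 * kap * B%:R.
Proof.
elim: B => [|B IH]; first by rewrite /DD /= gridE_cst// mulr0.
rewrite gridE_block.
rewrite (@eq_gridE R q n _ (fun f => gridE q m (fun p => gridE q (B * Lb) (fun t =>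
    riesz f * (kap * (riesz p + 1)) * 1)) + gridE q m (fun p => gridE q (B * Lb) (fun t =>
    riesz f * (1 - kap * ypart p) * DD B t)))); last first.
  move=> f fn; rewrite -gridED; apply: eq_gridE => p pm.
  rewrite -gridED; apply: eq_gridE => t tN.
  by rewrite /DD block_rec_cat// /Zb; ring.
rewrite gridED !gridE_prod3 IH E_1ky gridE_riesz// gridEZ gridED gridE_riesz// !gridE_cst//.
by rewrite -natr1; ring.
Qed.

Lemma E_TTy0 B : gridE q (B * Lb) (TT 0 0 1 B) = 0.
Proof.
elim: B => [|B IH]; first by rewrite /TT /= gridE_cst.
rewrite gridE_block.
rewrite (@eq_gridE R q n _ (fun f => gridE q m (fun p => gridE q (B * Lb) (fun t =>
    riesz f * (kap * ypart p) * 1)) + gridE q m (fun p => gridE q (B * Lb) (fun t =>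
    riesz f * (1 - kap * ypart p) * TT 0 0 1 B t)))); last first.
  move=> f fn; rewrite -gridED; apply: eq_gridE => p pm.
  rewrite -gridED; apply: eq_gridE => t tN.
  by rewrite /TT block_rec_cat// /Zb /incr; ring.
by rewrite gridED !gridE_prod3 IH gridEZ E_ypart; ring.
Qed.

(** [uhead] depends only on the opening moves of the head block, whereas [ypart] and the
    contribution of the later blocks have mean zero and are independent of these moves. *)
Lemma E_TTy_uhead B : gridE q (B * Lb) (fun s => TT 0 0 1 B s * (1 - uhead B s)) = 0.
Proof.
case: B => [|B]; first by rewrite /TT /= gridE_cst// mul0r.
rewrite gridE_block.
rewrite (@eq_gridE R q n _ (fun f => gridE q m (fun p => gridE q (B * Lb) (fun t =>
    riesz f * (1 - stop f) * (kap * ypart p) * 1)) + gridE q m (fun p => gridE q (B * Lb) (fun t =>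
    riesz f * (1 - stop f) * (1 - kap * ypart p) * TT 0 0 1 B t)))); last first.
  move=> f fn; rewrite -gridED; apply: eq_gridE => p pm.
  rewrite -gridED; apply: eq_gridE => t tN.
  by rewrite /TT block_rec_cat// /Zb /incr /= take_size_cat//; ring.
by rewrite gridED !gridE_prod3 E_TTy0 gridEZ E_ypart; ring.
Qed.

Lemma sigma_cons c f : sigma (c :: f) = cos c - 2^-1 + sigma f.
Proof. by rewrite /sigma big_cons. Qed.

Lemma riesz_cons c (f : seq R) : riesz (c :: f) = (1 + cos c) * riesz f.
Proof. by rewrite -cat1s riesz_cat /riesz big_seq1. Qed.

Lemma gridE_S N (F : seq R -> R) :
  gridE q N.+1 F = gridE q 1 (fun c => gridE q N (fun f => F (c`_0 :: f))).
Proof. by rewrite -add1n gridE_cat; apply: eq_gridE => -[//|c [|//]] _. Qed.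

Lemma E_sigma N : gridE q N sigma = - (N%:R / 2).
Proof.
elim: N => [|N IH]; first by rewrite /gridE /sigma big_nil mul0r oppr0.
rewrite gridE_S (@eq_gridE R q 1 _ (fun c => 1 * cos c`_0 + 1 * (- 2^-1 - N%:R / 2))).
  by rewrite gridE_lin grid1_cos// gridE_cst// -natr1; by field.
move=> c _; under eq_gridE do rewrite sigma_cons.
by rewrite gridED gridE_cst// IH; field.
Qed.

Lemma E_sigma2 N : gridE q N (fun f => sigma f ^+ 2) = N%:R / 2 + N%:R ^+ 2 / 4.
Proof.
elim: N => [|N IH]; first by rewrite /gridE /sigma big_nil; field.
rewrite gridE_S (@eq_gridE R q 1 _ (fun c => (1 * cos c`_0 ^+ 2 + (-1 - N%:R) * cos c`_0) +
   (4^-1 + N%:R / 2 + N%:R / 2 + N%:R ^+ 2 / 4))).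
  rewrite gridED gridE_lin grid1_cos// grid1_cos2// gridE_cst// -natr1; by field.
move=> c _.
rewrite (@eq_gridE R q N _ (fun f => ((cos c`_0 - 2^-1) ^+ 2 +
   2 * (cos c`_0 - 2^-1) * sigma f) + sigma f ^+ 2)); last first.
  by move=> f _; rewrite sigma_cons; ring.
by rewrite !gridED gridE_cst// gridEZ E_sigma IH; field.
Qed.

Lemma E_riesz_sigma N : gridE q N (fun f => riesz f * sigma f) = 0.
Proof.
elim: N => [|N IH]; first by rewrite /gridE /sigma big_nil mulr0.
rewrite gridE_S (@eq_gridE R q 1 _ (fun c => (1 * cos c`_0 ^+ 2 + 2^-1 * cos c`_0) - 2^-1)).
  rewrite gridED gridE_lin grid1_cos// grid1_cos2// gridE_cst//; by field.
move=> c _.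
rewrite (@eq_gridE R q N _ (fun f => (1 + cos c`_0) * (cos c`_0 - 2^-1) * riesz f +
   (1 + cos c`_0) * (riesz f * sigma f))); last first.
  by move=> f _; rewrite sigma_cons riesz_cons; ring.
by rewrite gridE_lin gridE_riesz// IH; field.
Qed.

(** Under the density [1 + cos] a cosine has mean 1 / 2 and variance 1 / 4. The 1 / 2 subtracted in
    [sigma] centres it for this law. *)
Lemma E_riesz_sigma2 N : gridE q N (fun f => riesz f * sigma f ^+ 2) = N%:R / 4.
Proof.
elim: N => [|N IH]; first by rewrite /gridE /sigma big_nil; field.
rewrite gridE_S (@eq_gridE R q 1 _ (fun c => (1 * cos c`_0 ^+ 3 + (- 3 / 4 + N%:R / 4) * cos c`_0) +
   (4^-1 + N%:R / 4))).
  rewrite gridED gridE_lin grid1_cos// grid1_cos3// gridE_cst// -natr1; by field.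
move=> c _.
rewrite (@eq_gridE R q N _ (fun f => ((1 + cos c`_0) * (cos c`_0 - 2^-1) ^+ 2 * riesz f +
   (1 + cos c`_0) * 2 * (cos c`_0 - 2^-1) * (riesz f * sigma f)) +
   (1 + cos c`_0) * (riesz f * sigma f ^+ 2))); last first.
  by move=> f _; rewrite sigma_cons riesz_cons; ring.
by rewrite gridED gridE_lin gridE_riesz// E_riesz_sigma gridEZ IH; field.
Qed.

Lemma E_riesz_stop : (0 < n)%N ->
  gridE q n (fun f => riesz f * stop f) = 1 - (9 * n%:R)^-1.
Proof.
move=> n0; have nR : n%:R != 0 :> R by rewrite pnatr_eq0 -lt0n.
rewrite (@eq_gridE R q n _ (fun f => 1 * riesz f + - (4 / 9 / n%:R ^+ 2) * (riesz f * sigma f ^+ 2))).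
  by rewrite gridE_lin gridE_riesz// E_riesz_sigma2; field.
by move=> f _; rewrite /stop; ring.
Qed.

(** Without the density a cosine has mean zero, so [sigma] has mean [- n / 2] and a square of order
    [n ^ 2]: under the uniform law a block stops with probability at least 1 / 9. *)
Lemma E_stop_le : (0 < n)%N -> gridE q n (fun f => 1 - stop f) >= 9^-1.
Proof.
move=> n0; have nR : 0 < n%:R :> R by rewrite ltr0n.
rewrite (@eq_gridE R q n _ (fun f => 4 / 9 / n%:R ^+ 2 * sigma f ^+ 2)); last first.
  by move=> f _; rewrite /stop; ring.
rewrite gridEZ E_sigma2.
have -> : 4 / 9 / n%:R ^+ 2 * (n%:R / 2 + n%:R ^+ 2 / 4) = 9^-1 + 2 / 9 / n%:R :> R.
  by field; rewrite gt_eqF.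
by rewrite lerDl divr_ge0// ltW.
Qed.

Lemma E_uhead B : (0 < n)%N -> 9^-1 <= gridE q (B * Lb) (fun s => 1 - uhead B s).
Proof.
move=> n0; case: B => [|B]; first by rewrite /= gridE_cst// subr0; lra.
rewrite gridE_block (@eq_gridE R q n _ (fun f => 1 - stop f)); first exact: E_stop_le.
move=> f fn; rewrite -[RHS](@gridE_cst R q m _ q0); apply: eq_gridE => p pm.
rewrite -[RHS](@gridE_cst R q (B * Lb) _ q0); apply: eq_gridE => t tN.
by rewrite /= take_size_cat.
Qed.

(** [ypart] keeps the [k] odd indices, each of which contributes at least [dl / 2]. When [dl] is the
    inverse square root of [k] this is of order [sqrt k], although [gtest] stays bounded. *)
Lemma E_ypart_gtest : 0 <= dl ->
  k%:R * (dl / 2) <= gridE q m (fun p => ypart p * gtest p).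
Proof.
move=> dl0.
rewrite (@eq_gridE R q m _ (fun p => \sum_(j < m) (odd j)%:R * (cos p`_j * riesz (take j p) * gtest p))); last first.
  by move=> p _; rewrite /ypart mulr_suml; apply: eq_bigr => j _; ring.
rewrite gridE_sum.
apply: (@le_trans _ _ (\sum_(j < m) (odd j)%:R * (dl / 2))).
  rewrite -mulr_suml ler_wpM2r ?divr_ge0//.
  rewrite (_ : \sum_(j < m) _ = k%:R)//.
  elim: k => [|k' IH]; first by rewrite big_ord0.
  rewrite (_ : (k'.+1 * 2 = (k' * 2).+2)%N)// !big_ord_recr /= IH.
  by rewrite oddM andbF /= addr0 natr1.
apply: ler_sum => j _; rewrite gridEZ.
case oj : (odd j); last by rewrite !mul0r.
by rewrite !mul1r; exact: gridE_cos_moment.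
Qed.

(** Of the four products of a head or tail term of [TT] with one of [GG], two have mean zero.
    Testing in the head block gives at least [r * (kap * x) / 9]: the next block carries no Riesz
    density in this term, so [1 - uhead] has mean at least 1 / 9. The two tail terms give [r] times
    the quantity for one block less. The stated bound satisfies the resulting recursive inequality
    because [r <= 1]. *)
Lemma E_TTy_GG B : (0 < n)%N -> 0 <= dl ->
  kap * (k%:R * (dl / 2)) / 9 * B%:R * (1 - (9 * n%:R)^-1) ^+ B <=
  gridE q (B * Lb) (fun s => TT 0 0 1 B s * GG B s).
Proof.
move=> n0 dl0; have mu := E_ypart_gtest dl0.
set x := k%:R * (dl / 2) in mu *.
have x0 : 0 <= x by rewrite mulr_ge0// divr_ge0.
set r := 1 - (9 * n%:R)^-1.
have r01 : 0 <= r <= 1.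
  have h1 : (9 * n%:R)^-1 <= 1 :> R by rewrite invf_le1 ?mulr_gt0 ?ltr0n// -natrM ler1n muln_gt0.
  by rewrite subr_ge0 h1 /= lerBlDr lerDl invr_ge0 mulr_ge0.
have /andP[r0 r1] := r01.
elim: B => [|B IH]; first by rewrite mulr0 mul0r /TT /= gridE_cst// mul0r.
rewrite gridE_block.
rewrite (@eq_gridE R q n _ (fun f =>
   (gridE q m (fun p => gridE q (B * Lb) (fun t =>
      riesz f * stop f * (kap * (ypart p * gtest p)) * (1 - uhead B t))) +
    gridE q m (fun p => gridE q (B * Lb) (fun t =>
      riesz f * stop f * (kap * ypart p) * GG B t))) +
   (gridE q m (fun p => gridE q (B * Lb) (fun t =>
      riesz f * stop f * ((1 - kap * ypart p) * gtest p) * (TT 0 0 1 B t * (1 - uhead B t)))) +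
    gridE q m (fun p => gridE q (B * Lb) (fun t =>
      riesz f * stop f * (1 - kap * ypart p) * (TT 0 0 1 B t * GG B t)))))); last first.
  move=> f fn; rewrite -!gridED; apply: eq_gridE => p pm.
  rewrite -!gridED; apply: eq_gridE => t tN.
  rewrite /TT block_rec_cat// -/(TT _ _ _ _ _) /Zb /incr /=.
  rewrite take_size_cat// drop_size_cat// take_size_cat// catA drop_size_cat; last first.
    by rewrite size_cat fn pm.
  by ring.
rewrite !gridED !gridE_prod3 E_riesz_stop// -/r !gridEZ E_ypart E_TTy_uhead E_1ky.
rewrite !(mulr0, mul0r, addr0, add0r) mulr1.
have u9 := E_uhead B n0.
apply: (@le_trans _ _ (r * (kap * x) / 9 + r * (kap * x / 9 * B%:R * r ^+ B))); last first.
  rewrite lerD//; last by rewrite ler_wpM2l.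
  rewrite ler_pM ?mulr_ge0 ?invr_ge0//.
  by rewrite ler_wpM2l// ler_wpM2l.
have rB : r ^+ B <= 1 by rewrite exprn_ile1.
have -> : kap * x / 9 * B.+1%:R * r ^+ B.+1 =
   r * (kap * x) / 9 * r ^+ B + r * (kap * x / 9 * B%:R * r ^+ B).
  by rewrite exprS -natr1; ring.
rewrite lerD2r ler_piMr// !mulr_ge0 ?invr_ge0//.
Qed.

End even_process.

(** * Equality of the limits along non-parallel directions *)

Section even_limit.
Variables (R : realType) (d : nat).
Local Notation C := (Rcomplex R).
Local Notation E := 'rV[R]_d.
Local Notation nC z := (`|(z : C)|).

Section tpC_even.
Variables (n k : nat) (kap dl : R).
Local Notation m := (k * 2)%N.
Local Notation Lb := (n + m)%N.

Lemma tpC_ypart : tpC m (fun p : seq R => rC (ypart k p)).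
Proof.
apply: (@eq_tpC _ _ (fun p => \sum_(j < m) rC ((odd j)%:R) * rC (cos p`_j) * rC (riesz (take j p)))).
  by move=> p _; rewrite /ypart rC_sum; apply: eq_bigr => j _; rewrite !rCM.
apply: tpC_sum => j _; apply: tpCM; first (apply: tpCM; [exact: tpC_cst|exact: tpC_cos]).
exact/tpC_riesz/ltnW.
Qed.

Lemma tpC_Zb : tpC Lb (fun s : seq R => rC (Zb k kap (take n s) (take m (drop n s)))).
Proof.
apply: (@eq_tpC _ _ (fun s => rC (riesz (take n s)) * (1 + rC (- kap) * rC (ypart k (drop n s))))).
  move=> s sL; rewrite (take_oversize (n := m)); last by rewrite size_drop sL addKn.
  by rewrite /Zb -mulNr rCM rCD rCM.
apply: tpCM; first exact/tpC_riesz/leq_addr.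
apply: tpCD; first exact: tpC_cst.
by apply: tpCM; [exact: tpC_cst|exact: (tpC_drop n tpC_ypart)].
Qed.

Lemma tpC_coef0 i : (i < Lb)%N ->
  tpC i (fun s : seq R => rC (coef0 n kap (take n s) (drop n s))).
Proof.
move=> iL; have [ni|ni] := ltnP i n.
  apply: eq_tpC (@tpC_riesz R i i (leqnn i)) => s si.
  by rewrite /coef0 (@take_oversize _ i) ?si// (@take_oversize _ n) ?si ?(ltnW ni)// ni.
apply: (@eq_tpC _ _ (fun s => rC (riesz (take n s)) * (rC kap * rC (riesz (take (i - n) (drop n s)))))).
  move=> s si; rewrite (take_oversize (n := i - n)) ?size_drop ?si//.
  by rewrite /coef0 size_takel ?si// ltnn !rCM.
apply: tpCM; first exact: tpC_riesz.
apply: tpCM; first exact: tpC_cst.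
rewrite -{1}(subnKC ni); apply: (tpC_drop n (F := fun s => rC (riesz (take (i - n) s)))).
exact: tpC_riesz.
Qed.

Lemma tpC_stop N : (n <= N)%N -> tpC N (fun s : seq R => rC (stop n (take n s))).
Proof.
move=> nN; apply: (tpC_take (F := fun s => rC (stop n s)) nN).
apply: (@eq_tpC _ _ (fun s => 1 + rC (- (4 / 9 / n%:R ^+ 2)) *
   ((\sum_(i < n) (rC (cos s`_i) + rC (- 2^-1))) * \sum_(i < n) (rC (cos s`_i) + rC (- 2^-1))))).
  move=> s sn; have <- : rC (sigma s) = \sum_(i < n) (rC (cos s`_i) + rC (- 2^-1)) :> C.
    by rewrite /sigma (big_nth 0) big_mkord sn rC_sum; apply: eq_bigr => i _; rewrite rCD.
  by rewrite -!rCM -[1 in LHS]/(rC 1) -rCD /stop expr2 mulNr.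
have h : tpC n (fun s => \sum_(i < n) (rC (cos s`_i) + rC (- 2^-1)) : C).
  by apply: tpC_sum => i _; apply: tpCD; [exact: tpC_cos|exact: tpC_cst].
apply: tpCD; first exact: tpC_cst.
by apply: tpCM; [exact: tpC_cst|apply: tpCM].
Qed.

Lemma tpC_gtest : tpC m (fun p : seq R => rC (gtest k dl p)).
Proof.
apply: tpC_Im; apply: tpC_prod => i _.
apply: (@eq_tpC _ _ (fun s => 1 + Complex 0 (dl * (-1) ^+ (~~ odd i)) * rC (cos s`_i))).
  by move=> s _; apply: C_eqP => /=; ring.
by apply: tpCD; [exact: tpC_cst|apply: tpCM; [exact: tpC_cst|exact: tpC_cos]].
Qed.

Lemma tpC_uhead B : tpC (B * Lb) (fun s : seq R => rC (uhead n B s)).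
Proof.
case: B => [|B]; first exact: (tpC_cst _ (rC 0)).
by apply: tpC_stop; rewrite mulSn -addnA leq_addr.
Qed.

Lemma tpC_GG B : tpC (B * Lb) (fun s : seq R => rC (GG n k dl B s)).
Proof.
elim: B => [|B IH]; first exact: (tpC_cst _ (rC 0)).
apply: (@eq_tpC _ _ (fun s => rC (stop n (take n s)) *
   (rC (gtest k dl (drop n (take Lb s))) * (1 + rC (-1) * rC (uhead n B (drop Lb s))) +
    rC (GG n k dl B (drop Lb s))))).
  move=> s sN /=; rewrite -!rCM -[1 in LHS]/(rC 1) -!(rCD, rCM) mulN1r.
  by rewrite (addnC n m) -take_drop.
apply: tpCM; first by apply: tpC_stop; rewrite mulSn -addnA leq_addr.
have LbN : (Lb <= B.+1 * Lb)%N by rewrite mulSn leq_addr.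
apply: tpCD; last by rewrite mulSn; exact: (tpC_drop Lb IH).
apply: tpCM.
  exact: (tpC_take (F := fun s => rC (gtest k dl (drop n s))) LbN (tpC_drop n tpC_gtest)).
apply: tpCD; first exact: tpC_cst.
apply: tpCM; first exact: tpC_cst.
by rewrite mulSn; exact: (tpC_drop Lb (tpC_uhead B)).
Qed.

Lemma tpC_riesz_block : tpC Lb (fun s : seq R => rC (riesz (take n s))).
Proof. exact/tpC_riesz/leq_addr. Qed.

Lemma tpC_YY B : tpC (B * Lb) (fun s : seq R => rC (YY n k kap B s)).
Proof. by apply: tpC_block_rec; [exact: (tpC_cst _ (rC 0))|exact: tpC_Zb]. Qed.

Lemma tpC_DD B : tpC (B * Lb) (fun s : seq R => rC (DD n k kap B s)).
Proof.
apply: tpC_block_rec; last exact: tpC_Zb.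
apply: (@eq_tpC _ _ (fun s => rC kap * rC (riesz (take n s)) * (rC (riesz (take m (drop n s))) + 1))).
  by move=> s _; rewrite -[1 in LHS]/(rC 1) -!(rCD, rCM).
apply: tpCM; first by apply: tpCM; [exact: tpC_cst|exact: tpC_riesz_block].
apply: tpCD; last exact: tpC_cst.
by apply: (tpC_drop n (F := fun s => rC (riesz (take m s)))); exact: tpC_riesz.
Qed.

Lemma ypart_le (p : seq R) : size p = m -> `|ypart k p| <= (m * 2 ^ m)%:R.
Proof.
move=> pm; rewrite (le_trans (ler_norm_sum _ _ _))//.
apply: (@le_trans _ _ (\sum_(j < m) (2 ^ m)%:R)); last first.
  by rewrite sumr_const card_ord -mulrnA mulnC.
apply: ler_sum => j _; rewrite !normrM -[leRHS]mul1r ler_pM//.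
- rewrite -[leRHS]mul1r ler_pM//; first by case: (odd j); rewrite ?normr1 ?normr0.
  by rewrite ler_norml cos_geN1 cos_le1.
- rewrite ger0_norm ?riesz_ge0// (le_trans (riesz_le _))// natrX.
  rewrite size_takel ?pm ?(ltnW (ltn_ord j))// ler_eXn2l// ?ltr1n//.
  exact/ltnW.
Qed.

End tpC_even.

Lemma bernoulli_le (y : R) b : 0 <= y <= 1 -> 1 - b%:R * y <= (1 - y) ^+ b.
Proof.
move=> /andP[y0 y1]; elim: b => [|b IH]; first by rewrite mul0r subr0 expr0.
rewrite exprS; apply: (@le_trans _ _ ((1 - y) * (1 - b%:R * y))); last first.
  by rewrite ler_wpM2l// subr_ge0.
rewrite -natr1; have : 0 <= b%:R * y * y by rewrite !mulr_ge0.
lra.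
Qed.

(** Moves along [- e2] need frequencies in that direction, which evenness supplies. *)
Lemma tangentN (M : E -> C) (P : C -> Prop) v : (forall x, M (- x) = M x) ->
  tangent [set a | P (M a)] v -> tangent [set a | P (M a)] (- v).
Proof.
move=> Mev H tau tau0; have [a [r [h1 h2 h3 h4 h5]]] := H _ tau0.
exists (- a), r; split => //; rewrite ?oppr_eq0 ?normrN//=; first by rewrite Mev.
by rewrite scalerN -opprD normrN.
Qed.

Lemma tangentT v : v != 0 -> tangent [set: E] v.
Proof.
move=> v0 tau tau0; have nv : 0 < `|v| by rewrite normr_gt0.
pose r := tau / 2 / `|v|; have r0 : 0 < r by rewrite !divr_gt0.
exists (r *: v), r; split => //.
- by rewrite scaler_eq0 negb_or v0 gt_eqF.
- by rewrite normrZ gtr0_norm// /r divfK ?gt_eqF// ltr_pdivrMr// ltr_pMr// ltr1n.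
- by rewrite scalerA mulVf ?gt_eqF// scale1r subrr normr0.
Qed.

(** The functional [fl] kills e1, so the moves along e1, where nothing is known about [M], drop out.
    On the other moves [M] is near [ga] or [be], and the sum becomes [ga] times the mean of
    [(YY - 1) * GG] plus [ga - be] times the mean of [TT 0 0 1 * GG]. The first mean is bounded
    since [YY] is nonnegative of mean one; the second grows like [mm]. *)
Lemma even_tangent (c B : R) (M : E -> C) : bohr c M -> 0 <= c ->
  (forall x, nC (M x) <= B) -> cont_off0 M -> (forall x, M (- x) = M x) ->
  forall (e1 e2 : E) (fl : 'I_d -> R) (be ga : R), e1 != 0 ->
  \sum_l fl l * e1 ord0 l = 0 -> \sum_l fl l * e2 ord0 l = 1 ->
  (forall eta, 0 < eta -> tangent [set a | `|complex.Re (M a) - be| <= eta] e2) ->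
  (forall eta, 0 < eta -> tangent [set a | `|complex.Re (M a) - ga| <= eta] (e1 + e2)) ->
  be = ga.
Proof.
move=> bM c0 MB Mc Mev e1 e2 fl be ga e10 fl1 fl2 tbe tga.
apply/eqP/negPn/negP => bg.
have bg0 : 0 < `|ga - be| by rewrite normr_gt0 subr_eq0 eq_sym.
pose K : R := expR 2; have K0 : 0 <= K by rewrite expR_ge0.
pose V := `|e1| + `|e2|; have V0 : 0 <= V by rewrite addr_ge0.
pose Fl := \sum_l `|fl l|; have Fl0 : 0 <= Fl by apply: sumr_ge0.
pose cst := Fl * (c * K * (V * 4) + 1) + 1 + `|ga| * (K * 2).
have cst0 : 0 <= cst by rewrite !addr_ge0 ?mulr_ge0// addr_ge0// !mulr_ge0.
(* 4 / 81 is the product of 1 / 2 from [E_ypart_gtest], 1 / 9 from [E_uhead], and 8 / 9, a lower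
   bound for [(1 - 1 / (9 b)) ^ b]. *)
pose mm := (Num.bound (cst / (`|ga - be| * (4 / 81)))).+1.
have mbig : cst < `|ga - be| * (4 / 81) * mm%:R.
  rewrite mulrC -ltr_pdivrMr ?mulr_gt0 ?divr_gt0//.
  rewrite (lt_trans (archi_boundP _))// ?ltr_nat// divr_ge0// mulr_ge0//.
pose k := (mm ^ 2)%N; pose dl : R := mm%:R^-1.
have mR : mm%:R != 0 :> R by rewrite pnatr_eq0.
(* [b] is large enough for [kap * ypart] to be at most 1 in absolute value. It is also both the
   number of blocks and the number of opening moves of a block: then [b * kap = 1], and the loss
   [1 / (9 b)] per block stays bounded over [b] blocks. *)
pose m := (k * 2)%N; pose b := (m * 2 ^ m).+1; pose kap : R := b%:R^-1.
have bR : 0 < b%:R :> R by rewrite ltr0n.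
have kap0 : 0 <= kap by rewrite invr_ge0 ltW.
have kapy (p : seq R) : size p = m -> kap * `|ypart k p| <= 1.
  move=> pm; rewrite mulrC ler_pdivrMr// mul1r (le_trans (ypart_le pm))//.
  by rewrite ler_nat /b.
have dl0 : 0 <= dl by rewrite invr_ge0.
have gK (p : seq R) : size p = m -> `|gtest k dl p| <= K.
  move=> pm; apply: le_trans (normC_Im _) _.
  apply: (@nC_prod_1i R m k (fun i => dl * (-1) ^+ (~~ odd i) * cos p`_i) dl) => //.
  + move=> i; rewrite !normrM normr_sign mulr1 [`|dl|]ger0_norm// ler_piMr//.
    by rewrite ler_norml cos_geN1 cos_le1.
  + by rewrite /dl /k natrX exprVn.
have L0 : (0 < b + m)%N by [].
pose N := (b * (b + m))%N.
have UH (s : seq R) : size s = N -> uhead b b s <= 1.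
  move=> sN; have sz : size (take b s) = b.
    by rewrite size_takel// sN /N {3}/b mulSn -addnA leq_addr.
  by have /andP[] := @stop_bounds R b (take b s) isT sz.
pose W := @wgt R b k.
pose v (j : nat) : E := \row_l W (e1 ord0 l + e2 ord0 l) (e1 ord0 l) (- e2 ord0 l) j.
pose A := proc_rec b m (coef0 b kap) (Zb k kap) b.
pose S s := V * (YY b k kap b s + 1 + DD b k kap b s).
have [|||||q0 H] := @transfer R d c B M bM c0 MB Mc N v A (GG b k dl b) S K.
- move=> j jN; apply: tpC_tpoly; apply: tpC_proc_rec jN => //.
    by move=> i iL; exact: (tpC_coef0 kap (k := k) iL).
  exact: tpC_Zb.
- by apply: tpC_tpoly; exact: tpC_GG.
- apply: tpC_tpoly.
  apply: (@eq_tpC _ _ (fun s => rC V * (rC (YY b k kap b s) + 1 + rC (DD b k kap b s)))).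
    by move=> s _; rewrite -[1 in LHS]/(rC 1) -!(rCD, rCM).
  apply: tpCM; first exact: tpC_cst.
  apply: tpCD; last exact: tpC_DD.
  by apply: tpCD; [exact: tpC_YY|exact: tpC_cst].
- move=> s sN; apply: le_trans (GG_le (K := K) _ _ _ sN) _ => //.
  by rewrite ler_piMr// UH.
- move=> l s sN.
  under eq_bigr do rewrite mxE.
  rewrite (TT_sum kap _ _ _ L0 sN) TT_lin//.
  have := TT_YY kap sN; have := TT_lin kap 0 1 1 sN; rewrite mul0r add0r !mul1r => h1 h2.
  (* Regrouping exhibits the cancellation: the e2 component is [YY - 1], and the e1 component
     differs from it by [TT 0 1 1], which [DD] controls. *)
  have -> : (e1 ord0 l + e2 ord0 l) * TT b k kap 1 0 0 b s +
     e1 ord0 l * TT b k kap 0 1 0 b s + - e2 ord0 l * TT b k kap 0 0 1 b s =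
     e1 ord0 l * (TT b k kap 1 0 0 b s - TT b k kap 0 0 1 b s + TT b k kap 0 1 1 b s) +
     e2 ord0 l * (TT b k kap 1 0 0 b s - TT b k kap 0 0 1 b s).
    by rewrite h1; ring.
  rewrite h2 /S /V.
  have Y0 := YY_ge0 kap0 kapy sN; have D0 := TT_DD kap0 kapy sN.
  have Y1 : `|YY b k kap b s - 1| <= YY b k kap b s + 1.
    by rewrite (le_trans (ler_normB _ _))// normr1 ger0_norm.
  have DD0 : 0 <= DD b k kap b s by apply: le_trans D0.
  rewrite (le_trans (ler_normD _ _))// !normrM mulrDl lerD// ler_pM ?ler_entry//.
    by rewrite (le_trans (ler_normD _ _))// lerD.
  by rewrite (le_trans Y1)// lerDl.
pose q := maxn q0 4.
have q3 : (3 < q)%N by rewrite leq_max orbT.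
have qq0 : (0 < q)%N by rewrite (leq_trans _ q3).
pose cj (j : nat) := gridE q N (fun s => cos s`_j * A (take j s) * GG b k dl b s).
(* So small that replacing the real parts of [M (a j)] by their limits changes the sum by at most
   1. *)
pose eta := (1 + \sum_(j < N) `|cj j|)^-1.
have sc0 : 0 <= \sum_(j < N) `|cj j| by apply: sumr_ge0.
have eta0 : 0 < eta by rewrite invr_gt0 ltr_wpDr.
(* The weight is 0 on moves along e1, where the condition is therefore void. *)
pose Lam (j : nat) := [set a | `|W 1 0 (-1) j * (complex.Re (M a) - W ga 0 be j)| <= eta].
have [j jN tau tau0|a [La Ha]] := H q (leq_maxl _ _) 1 ltr01 Lam.
  have vE (x : E) : (forall l, v j ord0 l = x ord0 l) -> v j = x.
    by move=> h; apply/rowP => l; rewrite h.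
  rewrite /Lam; case jb : (j %% (b + m) < b)%N.
    have -> : v j = e1 + e2 by apply: vE => l; rewrite !mxE /W /wgt jb.
    have [x [r [h1 h2 h3 h4 h5]]] := tga _ eta0 _ tau0.
    by exists x, r; split => //=; rewrite /W /wgt jb mul1r.
  case jo : (odd (j %% (b + m) - b)).
    have -> : v j = - e2 by apply: vE => l; rewrite !mxE /W /wgt jb jo.
    have [x [r [h1 h2 h3 h4 h5]]] := tangentN (P := fun z => `|complex.Re z - be| <= eta) Mev (tbe _ eta0) tau0.
    by exists x, r; split => //=; rewrite /W /wgt jb jo mulN1r normrN.
  have -> : v j = e1 by apply: vE => l; rewrite !mxE /W /wgt jb jo.
  have [x [r [h1 h2 h3 h4 h5]]] := tangentT e10 tau0.
  by exists x, r; split => //=; rewrite /W /wgt jb jo mul0r normr0 ltW.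
have EYN : gridE q N (fun s => YY b k kap b s) = 1 by exact: E_YY.
have EDN : gridE q N (fun s => DD b k kap b s) = 2 * kap * b%:R by exact: E_DD.
have ES : gridE q N S = V * 4.
  have -> : gridE q N S = V * (gridE q N (fun s => YY b k kap b s) + 1 +
      gridE q N (fun s => DD b k kap b s)).
    by rewrite -[1](gridE_cst N 1 qq0) -!gridED -gridEZ.
  rewrite EYN EDN.
  by rewrite -mulrA mulVf ?gt_eqF//; ring.
have lb : kap * (k%:R * (dl / 2)) / 9 * b%:R * (1 - (9 * b%:R)^-1) ^+ b <=
    gridE q N (fun s => TT b k kap 0 0 1 b s * GG b k dl b s) by exact: E_TTy_GG.
set X := gridE q N (fun s => TT b k kap 0 0 1 b s * GG b k dl b s) in lb.
have X_ge : 4 / 81 * mm%:R <= X.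
  apply: le_trans lb.
  have -> : kap * (k%:R * (dl / 2)) / 9 * b%:R = mm%:R / 18.
    rewrite /k natrX /dl /kap; field.
    by rewrite mR gt_eqF.
  have r01 : 0 <= ((9 * b%:R)^-1 : R) <= 1.
    have p9 : 0 < 9 * b%:R :> R by rewrite mulr_gt0.
    apply/andP; split; first by rewrite invr_ge0 ltW.
    by rewrite invf_le1// -natrM ler1n muln_gt0.
  have := bernoulli_le b r01.
  have -> : 1 - b%:R * (9 * b%:R)^-1 = 8 / 9 :> R by field; rewrite gt_eqF.
  move=> h; apply: (@le_trans _ _ (mm%:R / 18 * (8 / 9))); first by rewrite le_eqVlt; apply/orP; left; apply/eqP; field.
  by rewrite ler_wpM2l// divr_ge0.
have HS (l : 'I_d) : nC (\sum_(j < N) rC (v j ord0 l * cj j) * M (a j)) <= c * K * (V * 4) + 1.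
  have := Ha l; rewrite ES; congr (nC _ <= _); apply: eq_bigr => j _.
  rewrite Mev -mulrDr -/(cj j); set y := gridE _ _ _.
  by case: (M (a j)) => u w; apply: C_eqP => /=; field.
have HF : nC (\sum_(j < N) rC (W 1 0 (-1) j * cj j) * M (a j)) <= Fl * (c * K * (V * 4) + 1).
  have -> : \sum_(j < N) rC (W 1 0 (-1) j * cj j) * M (a j) =
     \sum_l rC (fl l) * \sum_(j < N) rC (v j ord0 l * cj j) * M (a j).
    under [RHS]eq_bigr do rewrite mulr_sumr.
    rewrite exchange_big; apply: eq_bigr => j _ /=.
    under eq_bigr do rewrite mulrA -rCM.
    rewrite -mulr_suml -rC_sum; congr (rC _ * _).
    under eq_bigr do rewrite mulrA.
    rewrite -mulr_suml; congr (_ * _).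
    under eq_bigr do rewrite mxE.
    rewrite /W /wgt; case: ifP => _.
      by under eq_bigr do rewrite mulrDr; rewrite big_split /= fl1 fl2 add0r.
    case: ifP => _; last by rewrite fl1.
    by under eq_bigr do rewrite mulrN; rewrite sumrN fl2.
  rewrite (le_trans (ler_norm_sum _ _ _))// /Fl mulr_suml; apply: ler_sum => l _.
  by rewrite normC_mul normC_real ler_wpM2l.
pose T := \sum_(j < N) W ga 0 (- be) j * cj j.
have TE : T = ga * gridE q N (fun s => (YY b k kap b s - 1) * GG b k dl b s) + (ga - be) * X.
  have -> : T = gridE q N (fun s => TT b k kap ga 0 (- be) b s * GG b k dl b s).
    rewrite /T /cj; under eq_bigr do rewrite -gridEZ.
    rewrite -gridE_sum; apply: eq_gridE => s sN.
    rewrite -(TT_sum kap _ _ _ L0 sN) mulr_suml; apply: eq_bigr => j _.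
    by rewrite !mulrA.
  rewrite /X -!gridEZ -gridED; apply: eq_gridE => s sN.
  by rewrite TT_lin// -(TT_YY kap sN); ring.
have Y1 : `|gridE q N (fun s => (YY b k kap b s - 1) * GG b k dl b s)| <= K * 2.
  have GK s : size s = N -> `|GG b k dl b s| <= K.
    move=> sN; apply: le_trans (GG_le (K := K) _ _ _ sN) _ => //.
    by rewrite ler_piMr// UH.
  have bd s : size s = N -> `|(YY b k kap b s - 1) * GG b k dl b s| <= K * (YY b k kap b s + 1).
    move=> sN; rewrite normrM mulrC ler_pM ?GK//.
    by rewrite (le_trans (ler_normB _ _))// normr1 ger0_norm// (YY_ge0 kap0 kapy sN).
  have EY : gridE q N (fun s => K * (YY b k kap b s + 1)) = K * 2.
    have -> : gridE q N (fun s => K * (YY b k kap b s + 1)) =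
        K * (gridE q N (fun s => YY b k kap b s) + 1).
      by rewrite -[1 in RHS](gridE_cst N 1 qq0) -gridED -gridEZ.
    by rewrite EYN.
  rewrite ler_norml -EY; apply/andP; split.
    rewrite -[leLHS]mulN1r -gridEZ; apply: gridE_le => s sN.
    by rewrite mulN1r; have := bd s sN; rewrite ler_norml => /andP[].
  by apply: gridE_le => s sN; have := bd s sN; rewrite ler_norml => /andP[].
have TF : `|T| <= Fl * (c * K * (V * 4) + 1) + 1.
  pose T' := \sum_(j < N) W 1 0 (-1) j * complex.Re (M (a j)) * cj j.
  have T'F : `|T'| <= Fl * (c * K * (V * 4) + 1).
    apply: le_trans HF; apply: le_trans (normC_Re _); rewrite Re_sum.
    rewrite /T' (eq_bigr (fun j : 'I_N => complex.Re (rC (W 1 0 (-1) j * cj j) * M (a j))))//.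
    by move=> j _; rewrite Re_mul /=; ring.
  have TT' : `|T' - T| <= 1.
    rewrite /T' /T -sumrB (le_trans (ler_norm_sum _ _ _))//.
    apply: (@le_trans _ _ (\sum_(j < N) eta * `|cj j|)).
      apply: ler_sum => j _; rewrite -mulrBl normrM ler_wpM2r//.
      have := La j (ltn_ord j); rewrite /Lam /=; congr (`|_| <= _).
      by rewrite /W /wgt; case: ifP => _; [|case: ifP => _]; ring.
    rewrite -mulr_sumr /eta mulrC ler_pdivrMr ?mul1r ?lerDr//.
    by rewrite ltr_wpDr.
  have -> : T = T' - (T' - T) by ring.
  by rewrite (le_trans (ler_normB _ _))// lerD.
have : `|ga - be| * X <= cst.
  have X0 : 0 <= X by apply: le_trans X_ge; rewrite mulr_ge0// divr_ge0.
  have -> : `|ga - be| * X = `|T - ga * gridE q N (fun s => (YY b k kap b s - 1) * GG b k dl b s)|.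
    by rewrite TE addrAC subrr add0r normrM (ger0_norm X0).
  rewrite (le_trans (ler_normB _ _))// /cst lerD// normrM ler_wpM2l//.
apply/negP; rewrite -ltNge (lt_le_trans mbig)// -mulrA ler_wpM2l//.
Qed.

End even_limit.

(** * Existence of the limit at 0 for even and for odd multipliers *)

Section limit_at_zero.
Variables (R : realType) (d : nat).
Local Notation C := (Rcomplex R).
Local Notation E := 'rV[R]_d.
Local Notation nC z := (`|(z : C)|).

Definition adherent0 (L : set E) := forall h, 0 < h ->
  exists z, [/\ L z, z != 0 & `|z| < h].

(** The images of the points of [L] in shrinking punctured balls generate a proper filter on the
    compact [K], and [t] is a cluster point of it. *)
Lemma adherent0_cluster (T : pseudoMetricType R) (K : set T) (f : E -> T)
    (L : set E) : compact K -> adherent0 L -> (forall z, L z -> z != 0 -> K (f z)) ->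
  exists t, K t /\ forall eta, 0 < eta -> adherent0 [set z | L z /\ ball t eta (f z)].
Proof.
move=> cK aL LK.
pose F := filter_from [set h : R | 0 < h] (fun h => f @` [set z | [/\ L z, z != 0 & `|z| < h]]).
have FF : Filter F.
  apply: filter_from_filter; first by exists 1 => /=.
  move=> i j /= i0 j0; exists (Num.min i j); first by rewrite /= lt_min i0.
  move=> t [z [Lz z0]]; rewrite lt_min => /andP[zi zj] <-.
  by split; exists z.
have PF : ProperFilter F.
  apply: filter_from_proper => h h0.
  by have [z zP] := aL _ h0; exists (f z), z.
have FK : F K.
  exists 1 => //= t [z [Lz z0 _] <-]; exact: LK.
have [t [Kt ct]] := cK _ PF FK.
exists t; split => // eta eta0 h h0.
have [] := ct (f @` [set z | [/\ L z, z != 0 & `|z| < h]]) (ball t eta).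
- by exists h.
- exact: nbhsx_ballx.
- by move=> x [[z [Lz z0 zh] <-] bz]; exists z.
Qed.

Lemma bounded_compact_rV (r : R) : compact [set v : E | `|v| <= r].
Proof.
apply: bounded_closed_compact.
  exists r; split; first exact: num_real.
  by move=> x rx v /= vr; apply: le_trans vr (ltW rx).
rewrite (_ : [set v : E | _] = (fun v : E => `|v|) @^-1` [set x | x <= r])//.
apply: closed_comp; last exact: closed_le.
by move=> v _; exact: norm_continuous.
Qed.

Lemma unit_dir (z : E) : z != 0 -> `| `|z|^-1 *: z | = 1.
Proof. by move=> z0; rewrite normrZ normfV normr_id mulVf// normr_eq0. Qed.

(** The pair formed by the unit direction of [z] and the value [f z] stays in a compact set, so one
    cluster point yields a direction and a value attained along the same points. *)
Lemma tangent_of_adherent0 (L : set E) (f : E -> R) (B : R) : adherent0 L ->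
  (forall z, `|f z| <= B) ->
  exists v be, v != 0 /\ forall eta, 0 < eta ->
    tangent [set a | L a /\ `|f a - be| <= eta] v.
Proof.
move=> aL fB.
have [||[v be] /= [[/= v1 _] H]] := @adherent0_cluster
    (E * R)%type ([set v : E | `|v| <= 1] `*` [set` `[- B, B]])
    (fun z => (`|z|^-1 *: z, f z)) L _ aL.
- by apply: compact_setX; [exact: bounded_compact_rV|exact: segment_compact].
- move=> z Lz z0; split => /=; first by rewrite unit_dir.
  by rewrite in_itv /= -ler_norml.
have near tau h : 0 < tau -> 0 < h -> exists z, [/\ L z, z != 0, `|z| < h,
    `|v - `|z|^-1 *: z| < tau & `|be - f z| < tau].
  move=> tau0 h0; have [z [[Lz [b1 b2]] z0 zh]] := H _ tau0 _ h0.
  exists z; split => //.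
  by move: b1; rewrite -ball_normE.
exists v, be; split.
  apply/negP => /eqP v0; have [z [_ z0 _ + _]] := near 1 1 ltr01 ltr01.
  by rewrite v0 sub0r normrN unit_dir// ltxx.
move=> eta eta0 tau tau0.
have m0 : 0 < Num.min eta tau by rewrite lt_min eta0.
have [z [Lz z0 zt]] := near _ _ m0 tau0.
rewrite !lt_min => /andP[_ h1] /andP[h2 _].
exists z, `|z|; split => //; rewrite ?normr_gt0//.
  by split => //=; rewrite distrC ltW.
by rewrite distrC.
Qed.

(** Here the direction is prescribed, so the points are taken on the ray of [v] itself. *)
Lemma tangent_value (v : E) (f : E -> R) (B : R) : v != 0 ->
  (forall z, `|f z| <= B) ->
  exists be, forall eta, 0 < eta -> tangent [set a | `|f a - be| <= eta] v.
Proof.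
move=> v0 fB; pose L := [set z | exists2 r : R, 0 < r & z = r *: v].
have nv : 0 < `|v| by rewrite normr_gt0.
have aL : adherent0 L.
  move=> h h0; have [a [r [_ a0 r0 ah _]]] := tangentT v0 h0.
  pose s := h / 2 / `|v|; have s0 : 0 < s by rewrite !divr_gt0.
  exists (s *: v); split; first by exists s.
    by rewrite scaler_eq0 negb_or v0 gt_eqF.
  by rewrite normrZ gtr0_norm// /s divfK ?gt_eqF// ltr_pdivrMr// ltr_pMr// ltr1n.
have [|t [_ H]] := @adherent0_cluster R [set` `[- B, B]] f L (@segment_compact _ _ _) aL.
  by move=> z _ _ /=; rewrite in_itv /= -ler_norml.
exists t => eta eta0 tau tau0.
have [z [[[r r0 zE] bz] z0 zt]] := H _ eta0 _ tau0.
exists z, r; split => //.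
  by move: bz; rewrite -ball_normE /= distrC => /ltW.
by rewrite zE scalerA mulVf ?gt_eqF// scale1r subrr normr0.
Qed.

Lemma tangentW (L L' : set E) v : L `<=` L' -> tangent L v -> tangent L' v.
Proof.
move=> LL H tau tau0; have [a [r [h1 h2 h3 h4 h5]]] := H _ tau0.
by exists a, r; split => //; apply: LL.
Qed.

(** Cluster values along two non-parallel directions agree by [even_tangent]. When the determinant
    test does not separate the two directions, a coordinate direction parallel to neither serves as
    intermediary. *)
Lemma even_limit (c B : R) (M : E -> C) : (2 <= d)%N -> bohr c M -> 0 <= c ->
  (forall x, nC (M x) <= B) -> cont_off0 M -> (forall x, M (- x) = M x) ->
  exists L : R, forall e, 0 < e -> exists2 h, 0 < h & forall z, z != 0 ->
    `|z| < h -> `|complex.Re (M z) - L| < e.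
Proof.
move=> d2 bM c0 MB Mc Mev.
pose f z := complex.Re (M z).
have fB z : `|f z| <= B by apply: le_trans (normC_Re _) (MB z).
have pair (v1 v2 : E) b1 b2 i j : v1 ord0 i * v2 ord0 j - v1 ord0 j * v2 ord0 i != 0 ->
    (forall eta, 0 < eta -> tangent [set a | `|f a - b1| <= eta] v1) ->
    (forall eta, 0 < eta -> tangent [set a | `|f a - b2| <= eta] v2) -> b1 = b2.
  move=> D0 t1 t2.
  have ij : i != j by apply: contra_neq D0 => ->; rewrite subrr.
  have v12 : v2 - v1 != 0.
    by apply: contra_neq D0 => /eqP; rewrite subr_eq0 => /eqP ->; rewrite mulrC subrr.
  set D := _ - _ in D0.
  (* Cramer's rule in coordinates [i] and [j]: the linear form that vanishes at [v2 - v1] and equals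
     1 at [v1]. *)
  pose fl l := if l == i then (v2 ord0 j - v1 ord0 j) / D else
     if l == j then (v1 ord0 i - v2 ord0 i) / D else 0.
  have flE (x : E) : \sum_l fl l * x ord0 l = ((v2 ord0 j - v1 ord0 j) * x ord0 i +
      (v1 ord0 i - v2 ord0 i) * x ord0 j) / D.
    rewrite (bigD1 i)//= (bigD1 j)/=; last by rewrite eq_sym.
    rewrite big1 => [|l /andP[/negbTE li /negbTE lj]]; last by rewrite /fl li lj mul0r.
    by rewrite /fl eqxx (eq_sym j i) (negbTE ij) eqxx addr0; ring.
  apply: (even_tangent bM c0 MB Mc Mev (e1 := v2 - v1) (e2 := v1) (fl := fl)) => //.
  - by rewrite flE !entryB; ring.
  - rewrite flE (_ : _ + _ = D) ?divff//; rewrite /D; ring.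
  - by rewrite subrK.
have d0 : (0 < d)%N by rewrite ltnW.
pose i0 := Ordinal d0.
have aT : adherent0 [set: E].
  move=> h h0; have v0 : (delta_mx ord0 i0 : E) != 0.
    by apply/eqP => /rowP /(_ i0) /eqP; rewrite !mxE !eqxx oner_eq0.
  by have [a [r [_ a0 _ ah _]]] := tangentT v0 h0; exists a.
have [v1 [b1 [v10 t1]]] := tangent_of_adherent0 aT fB.
have {}t1 eta : 0 < eta -> tangent [set a | `|f a - b1| <= eta] v1.
  by move=> eta0; apply: tangentW (t1 _ eta0) => a [].
exists b1 => e e0.
apply: contrapT => hno.
have aL : adherent0 [set z | e <= `|f z - b1|].
  move=> h h0; apply: contrapT => hn; apply: hno; exists h => // z z0 zh.
  by rewrite ltNge; apply/negP => ez; apply: hn; exists z.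
have [v2 [b2 [v20 t2]]] := tangent_of_adherent0 aL fB.
have b12 : b1 != b2.
  apply/eqP => b12; have e2 : 0 < e / 2 by rewrite divr_gt0.
  have [a [r [[/= h1 h2] _ _ _ _]]] := t2 _ e2 _ ltr01.
  rewrite -b12 in h2; have := le_trans h1 h2.
  by rewrite leNgt ltr_pdivrMr// ltr_pMr// ltr1n.
have {}t2 eta : 0 < eta -> tangent [set a | `|f a - b2| <= eta] v2.
  by move=> eta0; apply: tangentW (t2 _ eta0) => a [].
move/eqP : b12; apply.
have [i v1i] := entry_neq0 v10.
have [v2i|v2i] := eqVneq (v2 ord0 i) 0.
  have [j v2j] := entry_neq0 v20.
  apply: (pair v1 v2 b1 b2 i j _ t1 t2).
  by rewrite v2i mulr0 subr0 mulf_neq0.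
have [j ji] : exists j : 'I_d, j != i.
  have [i_0|i_0] := eqVneq i i0; last by exists i0; rewrite eq_sym.
  by exists (Ordinal d2); rewrite i_0.
pose v3 : E := delta_mx ord0 j.
have v30 : v3 != 0.
  by apply/eqP => /rowP /(_ j) /eqP; rewrite !mxE !eqxx oner_eq0.
have [b3 t3] := tangent_value v30 fB.
have mn (v : E) : v ord0 i != 0 -> v ord0 i * v3 ord0 j - v ord0 j * v3 ord0 i != 0.
  have ij : (i == j) = false by rewrite eq_sym (negbTE ji).
  by move=> vi; rewrite /v3 !mxE !eqxx ij /= mulr1 mulr0 subr0.
by rewrite (pair v1 v3 b1 b3 i j (mn _ v1i) t1 t3) (pair v2 v3 b2 b3 i j (mn _ v2i) t2 t3).
Qed.

(** Where the real part of [M] is not small, it is positive at [z] or, by oddness, at [- z];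
    compactness gives a direction for [odd_tangent]. *)
Lemma odd_limit (c B : R) (M : E -> C) : bohr c M -> 0 <= c ->
  (forall x, nC (M x) <= B) -> cont_off0 M -> (forall x, M (- x) = - M x) ->
  forall e, 0 < e -> exists2 h, 0 < h & forall z, z != 0 ->
    `|z| < h -> `|complex.Re (M z)| < e.
Proof.
move=> bM c0 MB Mc Modd e e0; apply: contrapT => hno.
have aL : adherent0 [set z | e <= complex.Re (M z)].
  move=> h h0; apply: contrapT => hn; apply: hno; exists h => // z z0 zh.
  rewrite ltr_norml ltrNl; apply/andP; split; rewrite ltNge; apply/negP => ez; apply: hn.
    exists (- z); rewrite oppr_eq0 normrN; split => //=.
    by rewrite Modd; move: ez; case: (M z).
  by exists z.
have [v [be [v0 tv]]] := tangent_of_adherent0 aL (fun z => le_trans (normC_Re _) (MB z)).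
apply: (odd_tangent bM c0 MB Mc Modd v0 e0).
by apply: tangentW (tv _ ltr01) => a [].
Qed.

End limit_at_zero.

(** * Reduction to real parts of even and odd multipliers *)

Section removable_singularity.
Variables (R : realType) (d : nat).
Local Notation C := (Rcomplex R).
Local Notation E := 'rV[R]_d.
Local Notation nC z := (`|(z : C)|).

Lemma dot_oppl (x y : E) : dot (- x) y = - dot x y.
Proof. by rewrite /dot -sumrN; apply: eq_bigr => i _; rewrite mxE mulNr. Qed.

Definition reflect_seq (P : seq (C * E)) : seq (C * E) := [seq (p.1, - p.2) | p : C * E <- P].

Lemma trig_reflect P (x : E) : trig (reflect_seq P) x = trig P (- x).
Proof.
rewrite /trig /reflect_seq big_map; apply: eq_bigr => p _ /=.
by rewrite dotN dot_oppl.
Qed.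

(** All three lists of frequencies are reflected; the factor [xi_l] changes sign, which the modulus
    does not see. *)
Lemma bohr_opp c (M : E -> C) : bohr c M -> bohr c (fun x => M (- x)).
Proof.
move=> bM P Q S K PS QK l.
have := bM (reflect_seq P) (reflect_seq Q) (reflect_seq S) K.
have H1 x l' : nC (trig (dtrig l' (reflect_seq P)) x) <= complex.Re (trig (reflect_seq S) x).
  rewrite trig_reflect; apply: le_trans (PS (- x) l').
  rewrite (_ : trig _ x = - trig (dtrig l' P) (- x)) ?normrN//.
  rewrite -trig_reflect /trig /reflect_seq /dtrig !big_map -sumrN; apply: eq_bigr => p _ /=.
  by rewrite mxE rCN !mulNr.
have H2 x : nC (trig (reflect_seq Q) x) <= K by rewrite trig_reflect.
move=> /(_ H1 H2 l) h.
have E1 : \sum_(p <- P) \sum_(g <- Q)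
     (if p.2 + g.2 == 0 then p.1 * g.1 * (M (- p.2) * rC (p.2 ord0 l)) else 0) =
   - \sum_(p <- reflect_seq P) \sum_(g <- reflect_seq Q)
     (if p.2 + g.2 == 0 then p.1 * g.1 * (M p.2 * rC (p.2 ord0 l)) else 0).
  rewrite /reflect_seq big_map -sumrN; apply: eq_bigr => p _.
  rewrite big_map -sumrN; apply: eq_bigr => g _ /=.
  rewrite -opprD oppr_eq0; case: ifP => _; last by rewrite oppr0.
  by rewrite [(- p.2) ord0 l]mxE rCN; ring.
rewrite E1 normrN; apply: le_trans h _.
by rewrite /reflect_seq big_map; under eq_bigl do rewrite oppr_eq0.
Qed.

Lemma bohr_lin c (M N : E -> C) (a b : C) : bohr c M -> bohr c N ->
  bohr ((nC a + nC b) * c) (fun x => a * M x + b * N x).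
Proof.
move=> bM bN P Q S K PS QK l.
have hM := bM P Q S K PS QK l; have hN := bN P Q S K PS QK l.
have -> : \sum_(p <- P) \sum_(g <- Q)
     (if p.2 + g.2 == 0 then p.1 * g.1 * ((a * M p.2 + b * N p.2) * rC (p.2 ord0 l)) else 0) =
  a * \sum_(p <- P) \sum_(g <- Q)
     (if p.2 + g.2 == 0 then p.1 * g.1 * (M p.2 * rC (p.2 ord0 l)) else 0) +
  b * \sum_(p <- P) \sum_(g <- Q)
     (if p.2 + g.2 == 0 then p.1 * g.1 * (N p.2 * rC (p.2 ord0 l)) else 0) :> C.
  rewrite !mulr_sumr -big_split; apply: eq_bigr => p _.
  rewrite !mulr_sumr -big_split; apply: eq_bigr => g _ /=.
  by case: ifP => _; [ring|rewrite !mulr0 addr0].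
rewrite (le_trans (ler_normD _ _))// !normC_mul -!mulrA mulrDl.
by rewrite lerD// ler_wpM2l// mulrA.
Qed.

Lemma cont_off0_lin (M N : E -> C) (a b : C) : cont_off0 M -> cont_off0 N ->
  cont_off0 (fun x => a * M x + b * N x).
Proof.
move=> cM cN x x0 e e0.
pose s := nC a + nC b + 1; have s0 : 0 < s by rewrite ltr_wpDl// addr_ge0.
have es : 0 < e / s by rewrite divr_gt0.
have [h1 h10 H1] := cM x x0 _ es; have [h2 h20 H2] := cN x x0 _ es.
exists (Num.min h1 h2) => [|z]; first by rewrite lt_min h10.
rewrite lt_min => /andP[z1 z2].
rewrite (_ : _ - _ = a * (M (x + z) - M x) + b * (N (x + z) - N x)); last by ring.
rewrite (le_lt_trans (ler_normD _ _))// !normC_mul.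
apply: (@le_lt_trans _ _ ((nC a + nC b) * (e / s))).
  by rewrite mulrDl lerD// ler_wpM2l// ltW// (H1, H2).
by rewrite mulrCA gtr_pMr// ltr_pdivrMr// mul1r /s ltrDl.
Qed.

Lemma cont_off0_opp (M : E -> C) : cont_off0 M -> cont_off0 (fun x => M (- x)).
Proof.
move=> cM x x0 e e0; have [|h h0 H] := cM (- x) _ _ e0; first by rewrite oppr_eq0.
by exists h => // z zh; rewrite opprD; apply: H; rewrite normrN.
Qed.

(** The combinations [a * M x + b * M (- x)] satisfy the same hypotheses, with other constants. For
    [b = a] they are even and for [b = - a] odd; the values 1 / 2 and -i / 2 of [a] then give the
    real and the imaginary part of [M]. *)
Theorem bohr_limit0 (c B : R) (M : E -> C) : (2 <= d)%N -> bohr c M -> 0 <= c ->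
  (forall x, nC (M x) <= B) -> cont_off0 M ->
  exists L : C, forall e, 0 < e -> exists2 h, 0 < h & forall z, z != 0 ->
    `|z| < h -> nC (M z - L) < e.
Proof.
move=> d2 bM c0 MB Mc.
have gen (a b : C) : [/\ bohr ((nC a + nC b) * c) (fun x => a * M x + b * M (- x)),
    0 <= (nC a + nC b) * c, (forall x, nC (a * M x + b * M (- x)) <= (nC a + nC b) * B) &
    cont_off0 (fun x => a * M x + b * M (- x))].
  split.
  - exact: (bohr_lin a b bM (bohr_opp bM)).
  - by rewrite mulr_ge0// addr_ge0.
  - move=> x; rewrite (le_trans (ler_normD _ _))// !normC_mul mulrDl.
    by rewrite lerD// ler_wpM2l.
  - exact: (cont_off0_lin a b Mc (cont_off0_opp Mc)).
have ev (a : C) : exists L : R, forall e, 0 < e -> exists2 h, 0 < h & forall z, z != 0 ->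
    `|z| < h -> `|complex.Re (a * M z + a * M (- z)) - L| < e.
  have [g1 g2 g3 g4] := gen a a.
  by apply: (even_limit d2 g1 g2 g3 g4) => x; rewrite opprK addrC.
have od (a : C) : forall e, 0 < e -> exists2 h, 0 < h & forall z, z != 0 ->
    `|z| < h -> `|complex.Re (a * M z + - a * M (- z))| < e.
  have [g1 g2 g3 g4] := gen a (- a).
  by apply: (odd_limit g1 g2 g3 g4) => x; rewrite opprK; ring.
have one (a : C) : exists L : R, forall e, 0 < e -> exists2 h, 0 < h & forall z, z != 0 ->
    `|z| < h -> `|complex.Re (a * M z) - L| < e.
  have [L HL] := ev (a * rC (2^-1)); exists L => e e0.
  have e2 : 0 < e / 2 by rewrite divr_gt0.
  have [h1 h10 H1] := HL _ e2; have [h2 h20 H2] := od (a * rC (2^-1)) _ e2.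
  exists (Num.min h1 h2) => [|z z0]; first by rewrite lt_min h10.
  rewrite lt_min => /andP[z1 z2].
  have := H1 z z0 z1; have := H2 z z0 z2.
  set x := complex.Re _; set y := complex.Re _ => hx hy.
  have -> : complex.Re (a * M z) - L = (y - L) + x.
    rewrite addrAC /x /y -Re_add; congr (complex.Re _ - _).
    have -> : a * M z = a * (rC (2^-1) + rC (2^-1)) * M z.
      have -> : rC (2^-1) + rC (2^-1) = 1 :> C by rewrite -rCD; apply: C_eqP => //=; field.
      by rewrite mulr1.
    by ring.
  by rewrite (splitr e) (le_lt_trans (ler_normD _ _))// ltrD.
have [L1 H1] := one 1; have [L2 H2] := one (Complex 0 (-1)).
exists (Complex L1 L2) => e e0.
have e2 : 0 < e / 2 by rewrite divr_gt0.
have [h1 h10 {}H1] := H1 _ e2; have [h2 h20 {}H2] := H2 _ e2.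
exists (Num.min h1 h2) => [|z z0]; first by rewrite lt_min h10.
rewrite lt_min => /andP[z1 z2].
have := H1 z z0 z1; have := H2 z z0 z2.
rewrite mul1r Re_mul /= mul0r sub0r mulN1r opprK => hi hr.
rewrite (le_lt_trans (normC_ReIm _))// (splitr e) ltrD//.
  by move: hr; case: (M z).
by move: hi; case: (M z).
Qed.

End removable_singularity.

(** * Integrals of complex-valued functions *)

Section complex_integral.
Context d (T : measurableType d) (R : realType).
Variable mu : {measure set T -> \bar R}.
Local Notation C := (Rcomplex R).
Local Notation nC z := (`|(z : C)|).
Local Notation intg f := (mu.-integrable setT (fun x => (f x)%:E)).
Implicit Types (f g : T -> C) (u v : T -> R).

Definition cintg f := intg (fun x => complex.Re (f x)) /\ intg (fun x => complex.Im (f x)).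
Definition cmeas f := measurable_fun setT (fun x => complex.Re (f x)) /\
  measurable_fun setT (fun x => complex.Im (f x)).
Definition cI f : C := Complex (\int[mu]_x complex.Re (f x)) (\int[mu]_x complex.Im (f x)).

Lemma intg_meas u : intg u -> measurable_fun setT u.
Proof. by move=> /measurable_int iu; exact/measurable_EFinP. Qed.

Lemma intg_dom u v : measurable_fun setT u -> intg v -> (forall x, `|u x| <= v x) ->
  intg u.
Proof.
move=> mu_ iv uv; apply: le_integrable iv => //; first exact/measurable_EFinP.
by move=> x _ /=; rewrite lee_fin (le_trans (uv x))// ler_norm.
Qed.

Lemma cmeas_cst (c : C) : cmeas (fun=> c).
Proof. by split; exact: measurable_cst. Qed.

Lemma cmeas_real u : measurable_fun setT u -> cmeas (fun x => rC (u x)).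
Proof. by split => //; exact: measurable_cst. Qed.

Lemma cmeasD f g : cmeas f -> cmeas g -> cmeas (fun x => f x + g x).
Proof.
move=> [f1 f2] [g1 g2]; split.
  by under eq_fun do rewrite Re_add; exact: measurable_funD.
by under eq_fun do rewrite Im_add; exact: measurable_funD.
Qed.

Lemma cmeasM f g : cmeas f -> cmeas g -> cmeas (fun x => f x * g x).
Proof.
move=> [f1 f2] [g1 g2]; split.
  by under eq_fun do rewrite Re_mul; apply: measurable_funB; exact: measurable_funM.
by under eq_fun do rewrite Im_mul; apply: measurable_funD; exact: measurable_funM.
Qed.

Lemma cmeas_sum (I : Type) (r : seq I) (F : I -> T -> C) :
  (forall i, cmeas (F i)) -> cmeas (fun x => \sum_(i <- r) F i x).
Proof.
move=> h; elim: r => [|i r IH].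
  by under eq_fun do rewrite big_nil; exact: cmeas_cst.
by under eq_fun do rewrite big_cons; exact: cmeasD.
Qed.

Lemma cmeas_prod (I : Type) (r : seq I) (F : I -> T -> C) :
  (forall i, cmeas (F i)) -> cmeas (fun x => \prod_(i <- r) F i x).
Proof.
move=> h; elim: r => [|i r IH].
  by under eq_fun do rewrite big_nil; exact: cmeas_cst.
by under eq_fun do rewrite big_cons; exact: cmeasM.
Qed.

Lemma cmeas_cis u : measurable_fun setT u -> cmeas (fun x => cis (u x)).
Proof.
move=> mu_; split => /=.
  apply: (measurableT_comp (f := cos)) mu_.
  by apply: continuous_measurable_fun; exact: continuous_cos.
apply: (measurableT_comp (f := sin)) mu_.
by apply: continuous_measurable_fun; exact: continuous_sin.
Qed.

Lemma cmeas_norm f : cmeas f -> measurable_fun setT (fun x => nC (f x)).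
Proof.
move=> [f1 f2]; under eq_fun do rewrite normCE.
have h : measurable_fun setT (fun x => complex.Re (f x) ^+ 2 + complex.Im (f x) ^+ 2).
  by apply: measurable_funD; exact: measurable_funX.
apply: (measurableT_comp _ h).
by apply: continuous_measurable_fun; exact: sqrt_continuous.
Qed.

Lemma cintg_cmeas f : cintg f -> cmeas f.
Proof. by move=> [/intg_meas ? /intg_meas ?]. Qed.

Lemma cintg_dom f u : cmeas f -> intg u -> (forall x, nC (f x) <= u x) -> cintg f.
Proof.
move=> [f1 f2] iu fu; split; apply: intg_dom iu _ => // x; apply: le_trans (fu x).
  exact: normC_Re.
exact: normC_Im.
Qed.

Lemma cintg_norm f : cintg f -> intg (fun x => nC (f x)).
Proof.
move=> cf; have [f1 f2] := cf.
apply: (@intg_dom _ (fun x => `|complex.Re (f x)| + `|complex.Im (f x)|)).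
- exact/cmeas_norm/cintg_cmeas.
- under eq_fun do rewrite EFinD.
  by apply: integrableD => //; [exact: (integrable_abse f1)|exact: (integrable_abse f2)].
- by move=> x; rewrite normr_id normC_ReIm.
Qed.

Lemma cintgD f g : cintg f -> cintg g -> cintg (fun x => f x + g x).
Proof.
move=> [f1 f2] [g1 g2]; split.
  by under eq_fun do rewrite Re_add EFinD; exact: integrableD.
by under eq_fun do rewrite Im_add EFinD; exact: integrableD.
Qed.

Lemma intgZ u (c : R) : intg u -> intg (fun x => c * u x).
Proof. by move=> iu; under eq_fun do rewrite EFinM; exact: integrableZl. Qed.

Lemma cintgZ f (c : C) : cintg f -> cintg (fun x => c * f x).
Proof.
move=> cf; have ifn := cintg_norm cf.
apply: (cintg_dom (u := fun x => nC c * nC (f x))).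
- by apply: cmeasM; [exact: cmeas_cst|exact: cintg_cmeas].
- exact: intgZ.
- by move=> x; rewrite normC_mul.
Qed.

Lemma cID f g : cintg f -> cintg g -> cI (fun x => f x + g x) = cI f + cI g.
Proof.
move=> [f1 f2] [g1 g2]; rewrite /cI.
under eq_Rintegral do rewrite Re_add.
rewrite RintegralD//; apply: C_eqP => //=.
by under eq_Rintegral do rewrite Im_add; rewrite RintegralD.
Qed.

Lemma cIZ f (c : C) : cintg f -> cI (fun x => c * f x) = c * cI f.
Proof.
move=> [f1 f2]; have f1' r := intgZ r f1; have f2' r := intgZ r f2.
apply: C_eqP; rewrite ?Re_mul ?Im_mul /=.
  under eq_Rintegral do rewrite Re_mul.
  by rewrite (RintegralB measurableT (f1' _) (f2' _)) !RintegralZl.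
under eq_Rintegral do rewrite Im_mul.
by rewrite (RintegralD measurableT (f2' _) (f1' _)) !RintegralZl.
Qed.

Lemma cintg0 : cintg (fun=> 0).
Proof. by split; exact: integrable0. Qed.

Lemma cI0 : cI (fun=> 0) = 0.
Proof. by apply: C_eqP; rewrite /= /Rintegral integral0. Qed.

Lemma cintg_sum (I : Type) (r : seq I) (F : I -> T -> C) :
  (forall i, cintg (F i)) -> cintg (fun x => \sum_(i <- r) F i x).
Proof.
move=> h; elim: r => [|i r IH].
  by under eq_fun do rewrite big_nil; exact: cintg0.
by under eq_fun do rewrite big_cons; exact: cintgD.
Qed.

Lemma cI_sum (I : Type) (r : seq I) (F : I -> T -> C) :
  (forall i, cintg (F i)) -> cI (fun x => \sum_(i <- r) F i x) = \sum_(i <- r) cI (F i).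
Proof.
move=> h; elim: r => [|i r IH].
  rewrite big_nil (_ : (fun x => _) = (fun=> 0)) ?cI0//.
  by apply/funext => x; rewrite big_nil.
rewrite big_cons -IH -cID//; last exact: cintg_sum.
by congr (cI _); apply/funext => x; rewrite big_cons.
Qed.

(** The factor 2 comes from bounding the real and the imaginary part separately. *)
Lemma cI_le f u : cintg f -> intg u -> (forall x, nC (f x) <= u x) ->
  nC (cI f) <= 2 * \int[mu]_x u x.
Proof.
move=> [f1 f2] iu fu.
have aux w : intg w -> (forall x, `|w x| <= u x) -> `|\int[mu]_x w x| <= \int[mu]_x u x.
  move=> iw wu; apply: le_trans (le_normr_Rintegral measurableT iw) _.
  by apply: le_Rintegral => //; exact: (integrable_abse iw).
rewrite (le_trans (normC_ReIm _))//= mulr2n mulrDl mul1r.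
apply: lerD; apply: aux => // x; apply: le_trans (fu x).
  exact: normC_Re.
exact: normC_Im.
Qed.

Definition ccvg (z : nat -> C) (l : C) :=
  (fun n => complex.Re (z n)) @ \oo --> complex.Re l /\
  (fun n => complex.Im (z n)) @ \oo --> complex.Im l.

Lemma Rintegral_dct (un : nat -> T -> R) u v :
  (forall n, measurable_fun setT (un n)) -> (forall x, un ^~ x @ \oo --> u x) ->
  intg v -> (forall n x, `|un n x| <= v x) ->
  intg u /\ (fun n => \int[mu]_x un n x) @ \oo --> \int[mu]_x u x.
Proof.
move=> mun cu iv uv.
have mu_ : measurable_fun setT u by apply: measurable_fun_cvg => //; exact: mun.
have [|||||iu _ cvgI] := @dominated_convergence _ _ _ mu setT measurableT
   (fun n x => (un n x)%:E) (fun x => (u x)%:E) (fun x => (v x)%:E).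
- by move=> n; exact/measurable_EFinP.
- exact/measurable_EFinP.
- by apply: aeW => x _; apply: cvg_EFin; [exact: nearW|exact: cu].
- exact: iv.
- by apply: aeW => x n _ /=; rewrite lee_fin.
split => //.
have in_ n : intg (un n) by apply: intg_dom iv _.
apply: fine_cvg; rewrite /Rintegral fineK; last exact: integrable_fin_num.
exact: cvgI.
Qed.

Lemma cI_dct (fn : nat -> T -> C) f v :
  (forall n, cmeas (fn n)) -> (forall x, ccvg (fn ^~ x) (f x)) ->
  intg v -> (forall n x, nC (fn n x) <= v x) ->
  cintg f /\ ccvg (fun n => cI (fn n)) (cI f).
Proof.
move=> mf cf iv fv.
have [|x|//|n x|i1 c1] := @Rintegral_dct (fun n x => complex.Re (fn n x)) (fun x => complex.Re (f x)) v.
- by move=> n; have [] := mf n.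
- by have [] := cf x.
- by apply: le_trans (normC_Re _) (fv n x).
have [|x|//|n x|i2 c2] := @Rintegral_dct (fun n x => complex.Im (fn n x)) (fun x => complex.Im (f x)) v.
- by move=> n; have [] := mf n.
- by have [] := cf x.
- by apply: le_trans (normC_Im _) (fv n x).
by split.
Qed.

End complex_integral.

Lemma ae_integrable d (T : measurableType d) (R : realType)
    (mu : {measure set T -> \bar R}) (f g : T -> \bar R) :
  measurable_fun setT g -> ae_eq mu setT f g -> mu.-integrable setT f ->
  mu.-integrable setT g.
Proof.
move=> mg fg /integrableP[mf ioo]; apply/integrableP; split => //.
rewrite (le_lt_trans _ ioo)// le_eqVlt; apply/orP; left; apply/eqP.
apply: ge0_ae_eq_integral => //; [exact: measurableT_comp|exact: measurableT_comp|].
by apply: filterS fg => x + xT => /(_ xT) ->.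
Qed.

(** * Fubini for complex integrands *)

Section complex_fubini.
Context d1 d2 (T1 : measurableType d1) (T2 : measurableType d2) (R : realType).
Variables (m1 : {sigma_finite_measure set T1 -> \bar R})
  (m2 : {sigma_finite_measure set T2 -> \bar R}).
Local Notation C := (Rcomplex R).
Local Notation nC z := (`|(z : C)|).

Lemma intg_prod (u : T1 -> R) (v : T2 -> R) :
  m1.-integrable setT (fun x => (u x)%:E) -> m2.-integrable setT (fun x => (v x)%:E) ->
  (m1 \x m2)%E.-integrable setT (fun z => (u z.1 * v z.2)%:E).
Proof.
move=> iu iv.
apply/(integrable12ltyP m1 m2).
  apply/measurable_EFinP/measurable_funM.
    exact: (measurableT_comp (intg_meas iu) measurable_fst).
  exact: (measurableT_comp (intg_meas iv) measurable_snd).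
have mv : measurable_fun setT (fun y => `|v y|%:E).
  by apply/measurable_EFinP/measurableT_comp => //; exact: intg_meas iv.
have mu_ : measurable_fun setT (fun y => `|u y|%:E).
  by apply/measurable_EFinP/measurableT_comp => //; exact: intg_meas iu.
under eq_integral do under eq_integral do rewrite /= normrM EFinM.
have h x : (\int[m2]_y (`|u x|%:E * `|v y|%:E) = (\int[m2]_y `|v y|%:E) * `|u x|%:E)%E.
  by rewrite ge0_integralZl_EFin// muleC.
under eq_integral do rewrite h.
have/integrableP[_ ku] := iu; have/integrableP[_ kv] := iv.
have v0 : (0 <= \int[m2]_y `|v y|%:E)%E by exact: integral_ge0.
rewrite ge0_integralZl//.
by apply: lte_mul_pinfty => //; rewrite ge0_fin_numE.
Qed.

(** The real inner integral agrees with the extended one where the slice is integrable, which is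
    almost everywhere; integrability and the value of the outer integral pass along this
    equality. *)
Lemma Rintegral_fubini1 (G : T1 * T2 -> R) :
  (m1 \x m2)%E.-integrable setT (fun z => (G z)%:E) ->
  m1.-integrable setT (fun x => (\int[m2]_y G (x, y))%:E) /\
  \int[m1]_x \int[m2]_y G (x, y) = \int[(m1 \x m2)%E]_z G z.
Proof.
move=> iG; have iF := integrable_fubini_F iG.
have mF := measurable_int _ iF.
have mfF : measurable_fun setT (fun x => (fine (\int[m2]_y (G (x, y))%:E))%:E).
  by apply/measurable_EFinP; apply: measurableT_comp => //; exact: mF.
have ae : ae_eq m1 setT (fubini_F m2 (fun z => (G z)%:E))
    (fun x => (fine (\int[m2]_y (G (x, y))%:E))%:E).
  have := ae_integrable1 iG; apply: filterS => x /= ix _.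
  by rewrite /fubini_F fineK// integrable_fin_num.
split; first exact: (ae_integrable mfF ae iF).
rewrite /Rintegral -(integral12_prod_meas1 iG); congr fine.
by apply/esym; exact: ae_eq_integral.
Qed.

Lemma Rintegral_fubini2 (G : T1 * T2 -> R) :
  (m1 \x m2)%E.-integrable setT (fun z => (G z)%:E) ->
  m2.-integrable setT (fun y => (\int[m1]_x G (x, y))%:E) /\
  \int[m2]_y \int[m1]_x G (x, y) = \int[(m1 \x m2)%E]_z G z.
Proof.
move=> iG; have mG := measurable_int _ iG.
have iF : m2.-integrable setT (fubini_G m1 (fun z => (G z)%:E)).
  apply/integrableP; split; first exact: (measurable_fubini_G iG).
  have [h _] := integrable21ltyP m1 m2 mG; apply: le_lt_trans (h iG).
  apply: ge0_le_integral => //.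
  - by apply: measurableT_comp => //; exact: (measurable_fubini_G iG).
  - apply: (measurable_fun_fubini_tonelli_G (abse \o (fun z => (G z)%:E))) => //=.
    exact: measurableT_comp.
  - by move=> y _; apply: le_abse_integral => //; exact: (measurableT_comp mG (pair2_measurable y)).
have mF := measurable_int _ iF.
have mfF : measurable_fun setT (fun y => (fine (\int[m1]_x (G (x, y))%:E))%:E).
  by apply/measurable_EFinP; apply: measurableT_comp => //; exact: mF.
have ae : ae_eq m2 setT (fubini_G m1 (fun z => (G z)%:E))
    (fun y => (fine (\int[m1]_x (G (x, y))%:E))%:E).
  have := ae_integrable2 iG; apply: filterS => x /= ix _.
  by rewrite /fubini_G fineK// integrable_fin_num.
split; first exact: (ae_integrable mfF ae iF).
rewrite /Rintegral -(integral21_prod_meas1 iG); congr fine.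
by apply/esym; exact: ae_eq_integral.
Qed.

Lemma cI_fubini (F : T1 * T2 -> C) : cintg (m1 \x m2)%E F ->
  [/\ cintg m1 (fun x => cI m2 (fun y => F (x, y))),
    cintg m2 (fun y => cI m1 (fun x => F (x, y))),
    cI m1 (fun x => cI m2 (fun y => F (x, y))) = cI (m1 \x m2)%E F &
    cI m2 (fun y => cI m1 (fun x => F (x, y))) = cI (m1 \x m2)%E F].
Proof.
move=> [i1 i2].
have [a1 b1] := Rintegral_fubini1 i1; have [a2 b2] := Rintegral_fubini1 i2.
have [a3 b3] := Rintegral_fubini2 i1; have [a4 b4] := Rintegral_fubini2 i2.
by split => //; exact: C_eqP.
Qed.

Lemma cintg_prod (F : T1 * T2 -> C) (u : T1 -> R) (v : T2 -> R) : cmeas F ->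
  m1.-integrable setT (fun x => (u x)%:E) -> m2.-integrable setT (fun x => (v x)%:E) ->
  (forall x y, nC (F (x, y)) <= u x * v y) -> cintg (m1 \x m2)%E F.
Proof.
move=> mF iu iv Fuv; apply: (cintg_dom (u := fun z => u z.1 * v z.2)) => //.
  exact: intg_prod.
by move=> [x y].
Qed.

End complex_fubini.

(** * Lebesgue integration on R^n, one coordinate at a time *)

Section rV_integral.
Variable R : realType.
Local Notation C := (Rcomplex R).
Local Notation nC z := (`|(z : C)|).
Local Notation leb := (@lebesgue_measure R).
Local Notation muE n := (lebesgue_rV R n).
Local Notation intg m f := (m.-integrable setT (fun x => (f x)%:E)).

Lemma intg_rVS n (F : 'rV[R]_n.+1 -> R) : measurable_fun setT F ->
  intg (leb \x muE n)%E (fun p => F (consrV p)) -> intg (muE n.+1) F.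
Proof.
move=> mF iF; have mF' : measurable_fun setT (fun x => (F x)%:E) by exact/measurable_EFinP.
exact: (@integrable_pushforward _ _ (measurableTypeR R * 'rV[R]_n)%type 'rV[R]_n.+1 R
  (@consrV R n) (@measurable_consrV R n) (leb \x muE n)%E setT _ mF' iF measurableT).
Qed.

Lemma Rintegral_rVS n (F : 'rV[R]_n.+1 -> R) : measurable_fun setT F ->
  intg (leb \x muE n)%E (fun p => F (consrV p)) ->
  \int[muE n.+1]_x F x = \int[(leb \x muE n)%E]_p F (consrV p).
Proof.
move=> mF iF; rewrite /Rintegral; congr fine.
have mF' : measurable_fun setT (fun x => (F x)%:E) by exact/measurable_EFinP.
exact: (@integral_pushforward _ _ (measurableTypeR R * 'rV[R]_n)%type 'rV[R]_n.+1 R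
  (@consrV R n) (@measurable_consrV R n) (leb \x muE n)%E setT _ mF' iF measurableT).
Qed.

Lemma cintg_rVS n (F : 'rV[R]_n.+1 -> C) : cmeas F ->
  cintg (leb \x muE n)%E (fun p => F (consrV p)) -> cintg (muE n.+1) F.
Proof. by move=> [? ?] [? ?]; split; exact: intg_rVS. Qed.

Lemma cI_rVS n (F : 'rV[R]_n.+1 -> C) : cmeas F ->
  cintg (leb \x muE n)%E (fun p => F (consrV p)) ->
  cI (muE n.+1) F = cI (leb \x muE n)%E (fun p => F (consrV p)).
Proof. by move=> [? ?] [? ?]; apply: C_eqP => /=; exact: Rintegral_rVS. Qed.

Lemma cmeas_comp d d' (T : measurableType d) (T' : measurableType d') (f : T -> C)
  (g : T' -> T) : cmeas f -> measurable_fun setT g -> cmeas (f \o g).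
Proof.
by move=> [f1 f2] mg; split; [exact: (measurableT_comp f1)|exact: (measurableT_comp f2)].
Qed.

Lemma prod_consrV n (u : 'I_n.+1 -> R -> C) p :
  \prod_i u i (consrV p ord0 i) = u ord0 p.1 * \prod_i u (lift ord0 i) (p.2 ord0 i).
Proof.
by rewrite big_ord_recl consrV0; congr (_ * _); apply: eq_bigr => i _; rewrite consrVS.
Qed.

Lemma cI_rV0 (F : 'rV[R]_0 -> C) : cI (muE 0) F = F 0.
Proof.
have h (G : 'rV[R]_0 -> R) : \int[muE 0]_x G x = G 0.
  have e : (fun x : 'rV[R]_0 => (G x)%:E) = cst (G 0)%:E.
    by apply/funext => x; congr (G _)%:E; apply/rowP => -[].
  by rewrite /Rintegral e integral_cst// /= /dirac indicT /= mulr1.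
by apply: C_eqP; rewrite /= h.
Qed.

Lemma intg_rV0 (F : 'rV[R]_0 -> R) : intg (muE 0) F.
Proof.
have -> : (fun x : 'rV[R]_0 => (F x)%:E) = cst (F 0)%:E.
  by apply/funext => x; congr (F _)%:E; apply/rowP => -[].
apply/integrableP; split; first exact: measurable_cst.
by rewrite integral_cst// /= /dirac indicT /= ltry.
Qed.

Lemma cmeas_rV_prod n (u : 'I_n -> R -> C) : (forall i, cmeas (u i)) ->
  cmeas (fun x : 'rV[R]_n => \prod_i u i (x ord0 i)).
Proof.
move=> mu_; apply: cmeas_prod => i.
exact: (cmeas_comp (mu_ i) (measurable_coord i)).
Qed.

Lemma cI_rV_prod n (u : 'I_n -> R -> C) : (forall i, cintg leb (u i)) ->
  cintg (muE n) (fun x : 'rV[R]_n => \prod_i u i (x ord0 i)) /\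
  cI (muE n) (fun x : 'rV[R]_n => \prod_i u i (x ord0 i)) = \prod_i cI leb (u i).
Proof.
elim: n u => [|n IH] u iu.
  rewrite cI_rV0 !big_ord0; split => //.
  by split; exact: intg_rV0.
have [IH1 IH2] := IH (fun i => u (lift ord0 i)) (fun i => iu (lift ord0 i)).
set F := fun x => _.
have mF : cmeas F by apply: cmeas_rV_prod => i; exact: (cintg_cmeas (iu i)).
have iF : cintg (leb \x muE n)%E (fun p => F (consrV p)).
  apply: (cintg_prod _ (cintg_norm (iu ord0)) (cintg_norm IH1)).
    exact: (cmeas_comp mF (@measurable_consrV R n)).
  by move=> a v; rewrite /F prod_consrV normC_mul.
split; first exact: cintg_rVS.
rewrite (cI_rVS mF iF); have [_ _ <- _] := cI_fubini iF.
under [in LHS]eq_fun do under eq_fun do rewrite /F prod_consrV /=.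
rewrite big_ord_recl -IH2 [RHS]mulrC -cIZ; last exact: iu.
by congr (cI _); apply/funext => a; rewrite cIZ 1?mulrC.
Qed.

(** The sigma-algebra is generated by the coordinates, so an open set is written as the countable
    union of the rational boxes that it contains. *)
Lemma open_measurable_rV n (U : set 'rV[R]_n) : open U -> measurable U.
Proof.
move=> oU.
pose bx (i : 'rV[rat]_n * nat) := [set x : 'rV[R]_n | forall j : 'I_n,
   `]ratr (i.1 ord0 j) - i.2.+1%:R^-1, ratr (i.1 ord0 j) + i.2.+1%:R^-1[%classic (x ord0 j)].
have -> : U = \bigcup_i (if pselect (bx i `<=` U) then bx i else set0).
  apply/seteqP; split => [x Ux|x [i _]]; last by case: pselect => // h; exact: h.
  have : nbhs x U by exact: open_nbhs_nbhs.
  move=> /nbhs_ballP[e /= e0 eU].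
  have [k ke] : exists k : nat, k.+1%:R^-1 < e / 2.
    exists (Num.truncn (e / 2)^-1).
    rewrite -[ltRHS]invrK ltf_pV2 ?posrE ?invr_gt0 ?divr_gt0//.
    by rewrite truncnS_gt.
  have k0 : (0 : R) < k.+1%:R^-1 by rewrite invr_gt0.
  have /boolp.choice[q hq] (j : 'I_n) : exists q : rat,
      (ratr q : R) \in `]x ord0 j - k.+1%:R^-1, x ord0 j + k.+1%:R^-1[.
    by apply: rat_in_itvoo; rewrite ltrD2l gtrN.
  have hx : bx (\row_j q j, k) x.
    by move=> j; have := hq j; rewrite !in_itv /= => /andP[h1 h2]; rewrite mxE in_itv /=;
    by rewrite ltrBlDr h2 -ltrBlDr h1.
  have hU : bx (\row_j q j, k) `<=` U.
    move=> y hy; apply: eU.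
    have : `|x - y| < e.
      apply: (@le_lt_trans _ _ (2 * k.+1%:R^-1)); last first.
        by clear -ke; move: (k.+1%:R^-1 : R) ke => w; lra.
      rewrite /Num.norm /= mx_normrE.
      apply: bigmax_le => [|[i j] _]; first by rewrite mulr_ge0// ltW.
      have := hq j; have := hy j; rewrite /= !mxE !in_itv /= (ord1 i).
      move: (ratr (q j) : R) (k.+1%:R^-1 : R) => s w /andP[h1 h2] /andP[h3 h4].
      by rewrite ler_norml; apply/andP; split; lra.
    by rewrite -ball_normE.
  exists (\row_j q j, k) => //; case: pselect => //.
apply: countable_bigcupT_measurable; first exact: countableP.
move=> i; case: pselect => h /=; last exact: measurable0.
apply: (measurable_box (A := fun j => `]_, _[%classic)) => j; exact: measurable_itv.
Qed.

Lemma continuous_measurable_rV n (f : 'rV[R]_n -> R) : continuous f -> measurable_fun setT f.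
Proof.
move=> cf; apply: (measurability _ (RGenOpens.measurableE R)) => //.
move=> _ [_ [a [b ->] <-]]; rewrite setTI.
apply: open_measurable_rV; move/continuousP : cf; apply; exact: interval_open.
Qed.

End rV_integral.

(** * Vanishing of the integral of a partial derivative *)

Section rV_parts.
Variable R : realType.
Local Notation C := (Rcomplex R).
Local Notation nC z := (`|(z : C)|).
Local Notation leb := (@lebesgue_measure R).
Local Notation muE n := (lebesgue_rV R n).
Local Notation intg m f := (m.-integrable setT (fun x => (f x)%:E)).

Lemma rC_prod (I : Type) (r : seq I) (F : I -> R) :
  rC (\prod_(i <- r) F i) = \prod_(i <- r) rC (F i).
Proof. exact: (big_morph (@rC R) (@rCM R) (erefl : rC 1 = 1)). Qed.

Lemma cintg_real d (T : measurableType d) (mu : {measure set T -> \bar R}) (u : T -> R) :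
  intg mu u -> cintg mu (fun x => rC (u x)).
Proof. by move=> iu; split => //=; exact: integrable0. Qed.

Lemma cI_real d (T : measurableType d) (mu : {measure set T -> \bar R}) (u : T -> R) :
  cI mu (fun x => rC (u x)) = rC (\int[mu]_x u x).
Proof. by apply: C_eqP => //=; rewrite /Rintegral integral0. Qed.

Lemma intg_rV_prod n (w : 'I_n -> R -> R) : (forall i, intg leb (w i)) ->
  intg (muE n) (fun x : 'rV[R]_n => \prod_i w i (x ord0 i)) /\
  \int[muE n]_x \prod_i w i (x ord0 i) = \prod_i \int[leb]_t w i t.
Proof.
move=> iw; have [[h1 _] h2] := cI_rV_prod (fun i => cintg_real (iw i)).
split.
  rewrite (_ : (fun x => _) = (fun x : 'rV[R]_n => (complex.Re (\prod_i rC (w i (x ord0 i))))%:E))//.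
  by apply/funext => x; rewrite -rC_prod.
have e : (fun x : 'rV[R]_n => \prod_i rC (w i (x ord0 i))) =
    (fun x => rC (\prod_i w i (x ord0 i))).
  by apply/funext => x; rewrite rC_prod.
move: h2; rewrite e cI_real; under [X in _ = X -> _]eq_bigr do rewrite cI_real.
by rewrite -rC_prod => /(congr1 (@complex.Re R)).
Qed.

Lemma intg_rV_dom n (G : 'rV[R]_n -> R) (w : R -> R) (B : R) :
  measurable_fun setT G -> intg leb w ->
  (forall x, `|G x| <= B * \prod_i w (x ord0 i)) -> intg (muE n) G.
Proof.
move=> mG iw Gw; have [i1 _] := intg_rV_prod (fun _ : 'I_n => iw).
exact: (intg_dom mG (intgZ B i1)).
Qed.

Definition upd n (x : 'rV[R]_n) (j : 'I_n) (t : R) : 'rV[R]_n :=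
  \row_i if i == j then t else x ord0 i.

(** Fubini with the integral over coordinate [j] innermost. The product majorant survives fixing a
    coordinate, [B] becoming [B * w a], and so the induction on the dimension reaches [j]. *)
Lemma Rintegral_slices n (G : 'rV[R]_n -> R) (w : R -> R) (B : R) (j : 'I_n) :
  measurable_fun setT G -> intg leb w -> 0 <= B -> (forall t, 0 <= w t) ->
  (forall x, `|G x| <= B * \prod_i w (x ord0 i)) ->
  (forall x, \int[leb]_t G (upd x j t) = 0) ->
  \int[muE n]_x G x = 0.
Proof.
elim: n G B j => [|n IH] G B j mG iw B0 w0 Gw; first by case: j.
move=> G0.
have [i1 _] := intg_rV_prod (fun _ : 'I_n => iw).
have mG' : measurable_fun setT (fun p : measurableTypeR R * 'rV[R]_n => G (consrV p)).
  exact: (measurableT_comp mG (@measurable_consrV R n)).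
have Gp p : `|G (consrV p)| <= (B * w p.1) * \prod_i w (p.2 ord0 i).
  apply: le_trans (Gw _) _; rewrite big_ord_recl consrV0 mulrA.
  by rewrite (eq_bigr (fun i => w (p.2 ord0 i)))// => i _; rewrite consrVS.
have iG : intg (leb \x muE n)%E (fun p => G (consrV p)).
  apply: (intg_dom mG' (intg_prod (intgZ B iw) i1)).
  exact: Gp.
rewrite Rintegral_rVS//.
have zero d (T : measurableType d) (mu : {measure set T -> \bar R}) (H : T -> R) :
    (forall y, H y = 0) -> \int[mu]_y H y = 0.
  move=> H0; rewrite /Rintegral (_ : (fun y => _) = cst 0%E) ?integral0//.
  by apply/funext => y; rewrite H0.
case: (unliftP ord0 j) G0 => [j' -> G0|-> G0]; last first.
  rewrite -(Rintegral_fubini2 iG).2; apply: zero => v.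
  rewrite -[RHS](G0 (consrV (0, v))); congr (Rintegral _ _ _); apply/funext => t.
  congr G; apply/rowP => i; rewrite [RHS]mxE.
  by case: (unliftP ord0 i) => [k ->|->]; rewrite ?consrVS ?consrV0 ?eqxx.
rewrite -(Rintegral_fubini1 iG).2; apply: zero => a.
apply: (IH (fun v => G (consrV (a, v))) (B * w a) j') => //.
- exact: (measurable_fun_pair2 a mG').
- by rewrite mulr_ge0.
- move=> v; rewrite -[RHS](G0 (consrV (a, v))); congr (Rintegral _ _ _).
  apply/funext => t; congr G; apply/rowP => i; rewrite [RHS]mxE.
  case: (unliftP ord0 i) => [k ->|->]; rewrite ?consrVS ?consrV0//=.
  by rewrite mxE (inj_eq lift_inj).
Qed.

Lemma Rintegral_compact_deriv (F G : R -> R) (N : R) :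
  0 < N -> (forall t : R, is_derive t (1 : R) F (G t)) -> continuous G ->
  (forall t, N <= `|t| -> F t = 0) -> (forall t, N < `|t| -> G t = 0) ->
  \int[leb]_t G t = 0.
Proof.
move=> N0 dF cG F0 G0.
have cF : continuous F.
  move=> t; apply: differentiable_continuous; apply/derivable1_diffP.
  by have [] := dF t.
have NN : - N < N by rewrite gtrN.
have -> : \int[leb]_t G t = \int[leb]_(t in `[- N, N]) G t.
  rewrite [RHS]Rintegral_mkcond; congr (Rintegral _ _ _); apply/funext => t.
  rewrite patchE; case: ifPn => // h; apply: G0; rewrite ltNge; apply: contra h => h.
  by rewrite inE /= in_itv /= -ler_norml.
rewrite /Rintegral (@continuous_FTC2 R G F (- N) N NN).
- by rewrite /= !F0 ?subrr ?normrN ?gtr0_norm.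
- exact: continuous_subspaceT.
- split => [t _||]; first by have [] := dF t.
    by apply: cvg_at_right_filter; exact: cF.
  by apply: cvg_at_left_filter; exact: cF.
- by move=> t _; rewrite derive1E; exact: derive_val.
Qed.

Lemma updE n (x : 'rV[R]_n) j t : upd x j t = x + (t - x ord0 j) *: delta_mx ord0 j.
Proof.
apply/rowP => i; rewrite !mxE eqxx /= eq_sym; case: eqP => [->|_]; rewrite /=; lra.
Qed.

Lemma bounded_continuous_rV n (G : 'rV[R]_n -> R) (N : R) : continuous G ->
  exists2 B, 0 <= B & forall x, `|x| <= N -> `|G x| <= B.
Proof.
move=> cG.
have /compact_bounded[B [_ hB]] : compact [set G x | x in [set x : 'rV[R]_n | `|x| <= N]].
  apply: continuous_compact; last exact: bounded_compact_rV.
  exact: continuous_subspaceT.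
exists (`|B| + 1); first by rewrite addr_ge0.
move=> x xN; apply: hB => /=; last by exists x.
by rewrite (le_lt_trans (ler_norm B))// ltrDl.
Qed.

Lemma norm_rV_gt n (x : 'rV[R]_n) (N : R) : 0 <= N -> N < `|x| -> exists i, N < `|x ord0 i|.
Proof.
move=> N0 Nx; apply/not_existsP => h; move: Nx; apply/negP; rewrite -leNgt.
rewrite /Num.norm /= mx_normrE; apply: bigmax_le => // -[i j] _ /=.
by rewrite (ord1 i) leNgt; apply/negP; exact: h.
Qed.

Lemma intg_ind (N : R) : intg leb (\1_`[- N, N] : R -> R).
Proof.
apply/integrableP; split.
  by apply/measurable_EFinP; apply: measurable_indic; exact: measurable_itv.
under eq_integral do rewrite /= ger0_norm//.
rewrite integral_indic//.
rewrite setIT; apply: (@le_lt_trans _ _ (lebesgue_measure (`[- N, N]%classic : set R))) => //.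
by rewrite lebesgue_measure_itv /=; case: ifP => // _; rewrite -EFinD ltry.
Qed.

Lemma ind_bound n (G : 'rV[R]_n -> R) (N : R) : 0 <= N -> continuous G ->
  (forall x, N < `|x| -> G x = 0) ->
  exists2 B, 0 <= B & forall x, `|G x| <= B * \prod_i \1_`[- N, N] (x ord0 i).
Proof.
move=> N0 cG G0; have [B B0 hB] := bounded_continuous_rV N cG.
exists B => // x; have [xN|Nx] := leP `|x| N.
  rewrite big1 ?mulr1 ?hB// => i _; rewrite indicE mem_set//= in_itv /= -ler_norml.
  by rewrite (le_trans (ler_entry _ _)).
by rewrite G0// normr0 mulr_ge0// prodr_ge0.
Qed.

Lemma intg_compact n (G : 'rV[R]_n -> R) (N : R) : 0 <= N -> continuous G ->
  (forall x, N < `|x| -> G x = 0) -> intg (muE n) G.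
Proof.
move=> N0 cG G0; have [B B0 hB] := ind_bound N0 cG G0.
by apply: (intg_rV_dom _ (intg_ind N) hB); exact: continuous_measurable_rV.
Qed.

Lemma Rintegral_partial n (u : 'rV[R]_n -> R) (j : 'I_n) (N : R) : 0 < N ->
  (forall x, derivable u x (delta_mx ord0 j)) -> continuous ('D_(delta_mx ord0 j) u) ->
  (forall x, N <= `|x| -> u x = 0) -> (forall x, N < `|x| -> 'D_(delta_mx ord0 j) u x = 0) ->
  \int[muE n]_x 'D_(delta_mx ord0 j) u x = 0.
Proof.
set G := 'D_(delta_mx ord0 j) u => N0 du cG u0 G0.
have [B B0 hB] := ind_bound (ltW N0) cG G0.
apply: (Rintegral_slices (j := j) _ (intg_ind N) B0 _ hB) => //.
  exact: continuous_measurable_rV.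
move=> x.
have big t : `|t| <= `|upd x j t|.
  by apply: le_trans (ler_entry _ j); rewrite mxE eqxx.
apply: (@Rintegral_compact_deriv (fun t => u (upd x j t)) _ N) => //.
- move=> t.
  have e : (fun h : R => h^-1 *: (((fun t => u (upd x j t)) \o shift t) (h *: 1) - u (upd x j t)))
     = (fun h : R => h^-1 *: ((u \o shift (upd x j t)) (h *: delta_mx ord0 j) - u (upd x j t))).
    apply/funext => h /=; congr (_ *: (u _ - _)).
    by rewrite !updE; apply/rowP => i; rewrite !mxE /= [h%:A]mulr1; ring.
  apply: DeriveDef; first by rewrite /derivable e; exact: du.
  by rewrite /derive e.
- move=> t; apply: (@continuous_comp _ _ _ (upd x j) G); last exact: cG.
  rewrite (_ : upd x j = fun t => x + (t - x ord0 j) *: delta_mx ord0 j); last first.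
    by apply/funext => s; exact: updE.
  apply: cvgD; first exact: cvg_cst.
  by apply: cvgZr_tmp; apply: cvgB; [exact: cvg_id|exact: cvg_cst].
- by move=> t Nt; apply: u0; exact: le_trans (big t).
- by move=> t Nt; apply: G0; exact: lt_le_trans (big t).
Qed.

End rV_parts.

(** * Differentiation of complex-valued maps *)

Section complex_derivative.
Variables (R : realType) (V : normedModType R).
Local Notation C := (Rcomplex R).
Local Notation nC z := (`|(z : C)|).
Implicit Types (f g : V -> C) (x v : V).
Local Notation "'re' f" := (fun x => complex.Re (f x)) (at level 10).
Local Notation "'im' f" := (fun x => complex.Im (f x)) (at level 10).

Lemma Re_continuous : continuous (@complex.Re R : C -> R).
Proof.
apply: bounded_linear_continuous; apply/linear_boundedP.
near=> r => z; apply: le_trans (normC_Re z) _.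
by rewrite ler_peMl//; near: r; apply: nbhs_pinfty_ge; rewrite num_real.
Unshelve. all: by end_near. Qed.

Lemma Im_continuous : continuous (@complex.Im R : C -> R).
Proof.
apply: bounded_linear_continuous; apply/linear_boundedP.
near=> r => z; apply: le_trans (normC_Im z) _.
by rewrite ler_peMl//; near: r; apply: nbhs_pinfty_ge; rewrite num_real.
Unshelve. all: by end_near. Qed.

Lemma cdiffP f x : differentiable f x <-> differentiable (re f) x /\ differentiable (im f) x.
Proof.
split=> [df|[d1 d2]].
  split; apply: (differentiable_comp df).
    exact: (linear_differentiable _ Re_continuous).
  exact: (linear_differentiable _ Im_continuous).
have [s1 _] := is_diff_scalel (complex.Re (f x)) (1 : C).
have [s2 _] := is_diff_scalel (complex.Im (f x)) (Complex 0 1 : C).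
have h1 := differentiable_comp d1 s1; have h2 := differentiable_comp d2 s2.
have := differentiableD h1 h2; congr (differentiable _ x); apply/funext => y.
by apply: C_eqP; rewrite [LHS]/= /=; ring.
Qed.

Lemma cderiveE f x v : differentiable f x ->
  'D_v f x = Complex ('D_v (re f) x) ('D_v (im f) x).
Proof.
move=> df; have [d1 d2] := (cdiffP f x).1 df.
have e1 : 'D_v (re f) x = complex.Re ('D_v f x).
  rewrite !deriveE// (diff_comp df (linear_differentiable _ Re_continuous)) /=.
  by rewrite (diff_lin _ Re_continuous).
have e2 : 'D_v (im f) x = complex.Im ('D_v f x).
  rewrite !deriveE// (diff_comp df (linear_differentiable _ Im_continuous)) /=.
  by rewrite (diff_lin _ Im_continuous).
by rewrite e1 e2; case: ('D_v f x).
Qed.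

(** Complex multiplication is bilinear in the real components, to which the real product rule
    applies. *)
Lemma cdiffM f g x v : differentiable f x -> differentiable g x ->
  differentiable (fun y => f y * g y) x /\
  'D_v (fun y => f y * g y) x = 'D_v f x * g x + f x * 'D_v g x.
Proof.
move=> df dg; have [f1 f2] := (cdiffP f x).1 df; have [g1 g2] := (cdiffP g x).1 dg.
have e1 : (re (fun y => f y * g y)) = (re f) * (re g) - (im f) * (im g).
  by apply/funext => y; rewrite Re_mul.
have e2 : (im (fun y => f y * g y)) = (re f) * (im g) + (im f) * (re g).
  by apply/funext => y; rewrite Im_mul.
have d : differentiable (fun y => f y * g y) x.
  apply/cdiffP; rewrite e1 e2; split.
    by apply: differentiableB; exact: differentiableM.
  by apply: differentiableD; exact: differentiableM.
split => //; rewrite !cderiveE// e1 e2.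
have dd h : differentiable h x -> derivable h x v by exact: diff_derivable.
rewrite deriveB ?deriveD ?deriveM//; try (by apply: dd => //; exact: differentiableM).
have sE (a b : R) : a *: b = a * b by [].
move: ('D_v (re f) x : R) ('D_v (im f) x : R) ('D_v (re g) x : R) ('D_v (im g) x : R).
move: (f x) (g x) => [f1x f2x] [g1x g2x] a b p q.
by rewrite !sE; apply: C_eqP; rewrite /=; ring.
Qed.

Lemma cdiffD f g x v : differentiable f x -> differentiable g x ->
  differentiable (fun y => f y + g y) x /\
  'D_v (fun y => f y + g y) x = 'D_v f x + 'D_v g x.
Proof.
move=> df dg; split; first exact: differentiableD.
by rewrite -deriveD//; exact: diff_derivable.
Qed.

Lemma cdiffZ (c : C) f x v : differentiable f x ->
  differentiable (fun y => c * f y) x /\ 'D_v (fun y => c * f y) x = c * 'D_v f x.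
Proof.
move=> df; have [d e] := cdiffM v (differentiable_cst c x) df.
by split=> //; rewrite e /= derive_cst mul0r add0r.
Qed.

Lemma cdiff_sum (I : Type) (r : seq I) (F : I -> V -> C) x v :
  (forall i, differentiable (F i) x) ->
  differentiable (fun y => \sum_(i <- r) F i y) x /\
  'D_v (fun y => \sum_(i <- r) F i y) x = \sum_(i <- r) 'D_v (F i) x.
Proof.
move=> dF; elim: r => [|i r [IH1 IH2]].
  rewrite (_ : (fun y => _) = cst 0); last by apply/funext => y; rewrite big_nil.
  by rewrite big_nil derive_cst; split.
rewrite (_ : (fun y => _) = (fun y => F i y + \sum_(j <- r) F j y)); last first.
  by apply/funext => y; rewrite big_cons.
by have [h1 h2] := cdiffD v (dF i) IH1; rewrite big_cons h2 IH2.
Qed.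

End complex_derivative.

(** * Smoothness from sequences of one-variable derivatives *)

Section jets.
Variable R : realType.
Local Notation C := (Rcomplex R).
Local Notation nC z := (`|(z : C)|).
Implicit Types (f g : R -> C).

Definition cder f g := forall t : R,
  is_derive t (1 : R) (fun s => complex.Re (f s)) (complex.Re (g t)) /\
  is_derive t (1 : R) (fun s => complex.Im (f s)) (complex.Im (g t)).

Lemma cder_diff f g (t : R) : cder f g -> differentiable f t /\ 'D_(1 : R) f t = g t.
Proof.
move=> /(_ t)[d1 d2].
have df : differentiable f t.
  by apply/cdiffP; split; apply/derivable1_diffP; [case: d1|case: d2].
by split => //; rewrite cderiveE// !derive_val; case: (g t).
Qed.

Lemma cderP f g : (forall t : R, differentiable f t /\ 'D_(1 : R) f t = g t) -> cder f g.
Proof.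
move=> h t; have [df <-] := h t; have [d1 d2] := (cdiffP f t).1 df.
rewrite cderiveE//=; split; apply: derivableP; exact/derivable1_diffP.
Qed.

Lemma cderD f f' g g' : cder f f' -> cder g g' ->
  cder (fun t => f t + g t) (fun t => f' t + g' t).
Proof.
move=> df dg; apply: cderP => t.
have [d1 e1] := cder_diff t df; have [d2 e2] := cder_diff t dg.
by have [? ->] := cdiffD (1 : R) d1 d2; rewrite e1 e2.
Qed.

Lemma cderM f f' g g' : cder f f' -> cder g g' ->
  cder (fun t => f t * g t) (fun t => f' t * g t + f t * g' t).
Proof.
move=> df dg; apply: cderP => t.
have [d1 e1] := cder_diff t df; have [d2 e2] := cder_diff t dg.
by have [? ->] := cdiffM (1 : R) d1 d2; rewrite e1 e2.
Qed.

Lemma cderZ (c : C) f f' : cder f f' -> cder (fun t => c * f t) (fun t => c * f' t).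
Proof.
move=> df; apply: cderP => t; have [d1 e1] := cder_diff t df.
by have [? ->] := cdiffZ c (1 : R) d1; rewrite e1.
Qed.

Lemma cder_real (u v : R -> R) : (forall t : R, is_derive t (1 : R) u (v t)) ->
  cder (fun t => rC (u t)) (fun t => rC (v t)).
Proof. by move=> du t; split => //=; exact: is_derive_cst. Qed.

(* [U k] is the derivative of order [k] of [U 0]. *)
Definition jet (U : nat -> R -> C) := forall k, cder (U k) (U k.+1).

(** A choice of derivative inside the class is iterated, so stability under one differentiation
    yields all orders at once. *)
Lemma jet_of_class (P : (R -> C) -> Prop) :
  (forall f, P f -> exists2 g, P g & cder f g) ->
  forall f, P f -> exists U, [/\ U 0%N = f, jet U & forall k, P (U k)].
Proof.
move=> hP f Pf.
have /boolp.choice[nx hnx] (h : {h | P h}) : exists g : {h | P h}, cder (sval h) (sval g).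
  by case: h => h Ph; have [g Pg hg] := hP h Ph; exists (exist _ g Pg).
pose W k := iter k nx (exist _ f Pf).
exists (fun k => sval (W k)); split => [//|k|k]; first exact: (hnx (W k)).
by case: (W k).
Qed.

(** Sums of products of derivatives. The product rule stays inside this class, which replaces the
    Leibniz formula with its binomial coefficients. *)
Inductive prod_class (U V : nat -> R -> C) : (R -> C) -> Prop :=
| prod_class_base i j : prod_class U V (fun t => U i t * V j t)
| prod_class_add f g : prod_class U V f -> prod_class U V g ->
    prod_class U V (fun t => f t + g t).

Lemma jetM U V : jet U -> jet V -> exists W, W 0%N = (fun t => U 0%N t * V 0%N t) /\ jet W.
Proof.
move=> jU jV.
have hP f : prod_class U V f -> exists2 g, prod_class U V g & cder f g.
  elim=> [i j|f1 f2 _ [g1 h1 d1] _ [g2 h2 d2]].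
    exists (fun t => U i.+1 t * V j t + U i t * V j.+1 t); last exact: cderM.
    by apply: prod_class_add; exact: prod_class_base.
  by exists (fun t => g1 t + g2 t); [exact: prod_class_add|exact: cderD].
have [W [W0 jW _]] := jet_of_class hP (prod_class_base U V 0 0).
by exists W.
Qed.

Section space.
Variable d : nat.
Local Notation E := 'rV[R]_d.
Implicit Types (x : E) (i j : 'I_d).

Lemma cder_coord f g i j x : cder f g ->
  differentiable (fun x : E => f (x ord0 i)) x /\
  'D_(delta_mx ord0 j) (fun x : E => f (x ord0 i)) x = if i == j then g (x ord0 i) else 0.
Proof.
move=> df; have [d1 e1] := cder_diff (x ord0 i) df.
split; first exact: (differentiable_comp (differentiable_coord _ _ _) d1).
case: (altP (i =P j)) => [ij|ij].
  subst j; have e : (fun h : R => h^-1 *: (((fun x : E => f (x ord0 i)) \o shift x)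
      (h *: delta_mx ord0 i) - f (x ord0 i))) =
      (fun h => h^-1 *: ((f \o shift (x ord0 i)) (h *: (1 : R)) - f (x ord0 i))).
    by apply/funext => h /=; rewrite !mxE !eqxx /= [h%:A]mulr1 mulr1.
  by rewrite -e1 /derive e.
rewrite /derive (_ : (fun h => _) = cst 0) ?lim_cst//.
apply/funext => h /=; rewrite !mxE eqxx (negbTE ij) /= mulr0 add0r subrr scaler0//.
Qed.

Lemma diff_prod (U U' : 'I_d -> R -> C) (r : seq 'I_d) (P : pred 'I_d) x :
  (forall i, cder (U i) (U' i)) ->
  differentiable (fun x : E => \prod_(i <- r | P i) U i (x ord0 i)) x.
Proof.
move=> dU; elim: r => [|i r IH].
  rewrite (_ : (fun x : E => _) = cst 1); first exact: differentiable_cst.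
  by apply/funext => y; rewrite big_nil.
under eq_fun do rewrite big_cons; case: (P i) => //.
have [d1 _] := cder_coord i i x (dU i).
by have [] := cdiffM 0 d1 IH.
Qed.

Lemma cder_prod (U U' : 'I_d -> R -> C) j x : (forall i, cder (U i) (U' i)) ->
  differentiable (fun x : E => \prod_i U i (x ord0 i)) x /\
  'D_(delta_mx ord0 j) (fun x : E => \prod_i U i (x ord0 i)) x =
    \prod_i (if i == j then U' i else U i) (x ord0 i).
Proof.
move=> dU.
have dF (P : pred 'I_d) := diff_prod (index_enum 'I_d) P x dU.
have aux (r : seq 'I_d) (P : pred 'I_d) : (forall i, P i -> i != j) ->
    'D_(delta_mx ord0 j) (fun x : E => \prod_(i <- r | P i) U i (x ord0 i)) x = 0.
  move=> nP; elim: r => [|i r IH].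
    rewrite (_ : (fun x : E => _) = cst 1); last by apply/funext => y; rewrite big_nil.
    by rewrite derive_cst.
  case Pi: (P i); last first.
    by under eq_fun do rewrite big_cons Pi.
  under eq_fun do rewrite big_cons Pi.
  have [d1 e1] := cder_coord i j x (dU i).
  have [_ ->] := cdiffM (delta_mx ord0 j) d1 (diff_prod r P x dU).
  rewrite e1 IH (negbTE (nP _ Pi)); ring.
rewrite (_ : (fun x : E => _) = (fun x : E => U j (x ord0 j) *
  \prod_(i <- index_enum 'I_d | i != j) U i (x ord0 i))); last first.
  by apply/funext => y; rewrite (bigD1 j).
have [d1 e1] := cder_coord j j x (dU j).
have [h1 h2] := cdiffM (delta_mx ord0 j) d1 (dF (fun i => i != j)).
split=> //; rewrite h2 e1 aux// eqxx mulr0 addr0 [RHS](bigD1 j)//= eqxx.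
by congr (_ * _); apply: eq_bigr => i /negbTE ->.
Qed.

Definition jprod (U : 'I_d -> nat -> R -> C) (k : 'I_d -> nat) (x : E) : C :=
  \prod_i U i (k i) (x ord0 i).

(** Each partial derivative acts on a single factor, so only the number of occurrences of each index
    in [s] matters. *)
Lemma iter_jprod (U : 'I_d -> nat -> R -> C) s k : (forall i, jet (U i)) ->
  iter_partial s (jprod U k) = jprod U (fun i => k i + count_mem i s)%N.
Proof.
move=> jU; elim: s => [|j s IH] /=.
  by congr jprod; apply/funext => i; rewrite addn0.
rewrite IH; apply/funext => x; rewrite /partial.
have [_ ->] := cder_prod j x (fun i => jU i (k i + count_mem i s)%N).
apply: eq_bigr => i _; rewrite eq_sym.
by case: eqP => _; rewrite ?addnS ?add0n // add1n addnS.
Qed.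

Lemma smooth_jprod (U : 'I_d -> nat -> R -> C) k : (forall i, jet (U i)) -> smooth (jprod U k).
Proof.
move=> jU s x; rewrite iter_jprod//.
exact: diff_prod (fun i => jU i (k i + count_mem i s)%N).
Qed.

End space.

End jets.

(** * Smooth functions, test functions, and integration by parts *)

Section smooth_functions.
Variables (R : realType) (d : nat).
Local Notation C := (Rcomplex R).
Local Notation E := 'rV[R]_d.
Local Notation nC z := (`|(z : C)|).
Local Notation mu := (lebesgue_rV R d).
Implicit Types (f g phi : E -> C) (s : seq 'I_d) (j : 'I_d).

Lemma smooth_sum (I : Type) (r : seq I) (F : I -> E -> C) : (forall i, smooth (F i)) ->
  smooth (fun x => \sum_(i <- r) F i x) /\
  forall s, iter_partial s (fun x => \sum_(i <- r) F i x) =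
    (fun x => \sum_(i <- r) iter_partial s (F i) x).
Proof.
move=> sF; have e s : iter_partial s (fun x => \sum_(i <- r) F i x) =
    (fun x => \sum_(i <- r) iter_partial s (F i) x).
  elim: s => [//|j s IH] /=; rewrite IH; apply/funext => x.
  by rewrite /partial; have [_ ->] := cdiff_sum r (delta_mx ord0 j) (fun i => sF i s x).
split => // s x; rewrite e.
by have [] := cdiff_sum r 0 (fun i => sF i s x).
Qed.

Lemma smoothZ (c : C) f : smooth f -> smooth (fun x => c * f x) /\
  forall s, iter_partial s (fun x => c * f x) = (fun x => c * iter_partial s f x).
Proof.
move=> sf; have e s : iter_partial s (fun x => c * f x) = (fun x => c * iter_partial s f x).
  elim: s => [//|j s IH] /=; rewrite IH; apply/funext => x.
  by rewrite /partial; have [_ ->] := cdiffZ c (delta_mx ord0 j) (sf s x).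
split => // s x; rewrite e.
by have [] := cdiffZ c 0 (sf s x).
Qed.

Lemma iter_partial_cat s s' f : iter_partial (s ++ s') f = iter_partial s (iter_partial s' f).
Proof. by rewrite /iter_partial foldr_cat. Qed.

Lemma smooth_partial j f : smooth f -> smooth (partial j f).
Proof.
move=> sf s x; have := sf (s ++ [:: j]) x.
by rewrite iter_partial_cat.
Qed.

Lemma smooth_diff f x : smooth f -> differentiable f x.
Proof. by move=> sf; exact: (sf [::] x). Qed.

Definition ccont f := continuous (fun x => complex.Re (f x)) /\
  continuous (fun x => complex.Im (f x)).

Lemma smooth_ccont f : smooth f -> ccont f.
Proof.
move=> sf; split=> x; have [] := (cdiffP f x).1 (smooth_diff x sf) => d1 d2.
  exact: (differentiable_continuous d1).
exact: (differentiable_continuous d2).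
Qed.

Lemma ccont_cmeas f : ccont f -> cmeas f.
Proof. by move=> [? ?]; split; exact: continuous_measurable_rV. Qed.

Lemma vanishes_off_partial (K : set E) j f : closed K -> vanishes_off K f ->
  vanishes_off K (partial j f).
Proof.
move=> cK vf x Kx; rewrite /partial.
rewrite (@near_eq_derive _ _ _ f (cst 0)) ?derive_cst//.
have : nbhs x (~` K) by apply: open_nbhs_nbhs; split => //; exact: closed_openC.
by apply: filterS => y; exact: vf.
Qed.

Lemma test_partial j phi : test_function phi -> test_function (partial j phi).
Proof.
move=> [sp [K cK vK]]; split; first exact: smooth_partial.
by exists K => //; apply: vanishes_off_partial => //; exact: compact_closed.
Qed.

Lemma test_radius phi : test_function phi ->
  exists2 N : R, 0 < N & forall x, N <= `|x| -> phi x = 0.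
Proof.
move=> [_ [K /compact_bounded[B [_ hB]] vK]].
exists (`|B| + 2); first by rewrite ltr_wpDl.
move=> x Nx; apply: vK => Kx.
have := hB (`|B| + 1) _ x Kx; rewrite (le_lt_trans (ler_norm B)) ?ltrDl// => /(_ isT) /=.
by apply/negP; rewrite -ltNge (lt_le_trans _ Nx)// ltrD2l ltr1n.
Qed.

Lemma norm_closed (N : R) : closed [set x : E | `|x| <= N].
Proof. by apply: compact_closed; [exact: norm_hausdorff|exact: bounded_compact_rV]. Qed.

Lemma cintg_compact f (N : R) : ccont f -> 0 <= N -> (forall x, N < `|x| -> f x = 0) ->
  cintg mu f.
Proof.
move=> [c1 c2] N0 f0; split; apply: (intg_compact N0) => // x Nx; by rewrite f0.
Qed.

Lemma test_cintg phi : test_function phi -> cintg mu phi.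
Proof.
move=> tp; have [N N0 hN] := test_radius tp.
apply: (cintg_compact _ (ltW N0)); first exact: smooth_ccont tp.1.
by move=> x /ltW; exact: hN.
Qed.

Lemma cbounded_on f (N : R) : ccont f ->
  exists2 B, 0 <= B & forall x, `|x| <= N -> nC (f x) <= B.
Proof.
move=> [c1 c2]; have [B1 p1 h1] := bounded_continuous_rV N c1.
have [B2 p2 h2] := bounded_continuous_rV N c2.
exists (B1 + B2); first exact: addr_ge0.
move=> x xN; apply: le_trans (normC_ReIm _) _.
by apply: lerD; [exact: h1|exact: h2].
Qed.

Lemma test_bounded phi : test_function phi -> exists2 B, 0 <= B & forall x, nC (phi x) <= B.
Proof.
move=> tp; have [N N0 hN] := test_radius tp.
have [B B0 hB] := cbounded_on N (smooth_ccont tp.1).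
exists B => // x; have [xN|/ltW/hN ->] := leP `|x| N; first exact: hB.
by rewrite normr0.
Qed.

Lemma cI_partial0 j f (N : R) : 0 < N -> (forall x, differentiable f x) -> ccont (partial j f) ->
  (forall x, N <= `|x| -> f x = 0) -> cI mu (partial j f) = 0.
Proof.
move=> N0 df [c1 c2] f0.
have vf : vanishes_off [set x : E | `|x| <= N] f.
  by move=> x /= /negP; rewrite -ltNge => /ltW; exact: f0.
have vp := vanishes_off_partial j (@norm_closed N) vf.
have nK (x : E) : N < `|x| -> ~ [set x : E | `|x| <= N] x.
  by move=> Nx /=; apply/negP; rewrite -ltNge.
have e x : partial j f x = Complex ('D_(delta_mx ord0 j) (fun x => complex.Re (f x)) x)
   ('D_(delta_mx ord0 j) (fun x => complex.Im (f x)) x).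
  by rewrite /partial cderiveE.
apply: C_eqP => /=.
  under eq_Rintegral do rewrite e /=.
  apply: (@Rintegral_partial R d _ j N N0).
  - by move=> x; have [d1 _] := (cdiffP f x).1 (df x); exact: diff_derivable.
  - by move: c1; under eq_fun do rewrite e /=.
  - by move=> x Nx; rewrite f0.
  - by move=> x /nK/vp; rewrite e => -[].
under eq_Rintegral do rewrite e /=.
apply: (@Rintegral_partial R d _ j N N0).
- by move=> x; have [_ d2] := (cdiffP f x).1 (df x); exact: diff_derivable.
- by move: c2; under eq_fun do rewrite e /=.
- by move=> x Nx; rewrite f0.
- by move=> x /nK/vp; rewrite e => -[].
Qed.

Lemma ccontM f g : ccont f -> ccont g -> ccont (fun x => f x * g x).
Proof.
move=> [f1 f2] [g1 g2]; split => x.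
  under eq_fun do rewrite Re_mul.
  exact: (cvgB (cvgM (f1 x) (g1 x)) (cvgM (f2 x) (g2 x))).
under eq_fun do rewrite Im_mul.
exact: (cvgD (cvgM (f1 x) (g2 x)) (cvgM (f2 x) (g1 x))).
Qed.

Lemma ccontD f g : ccont f -> ccont g -> ccont (fun x => f x + g x).
Proof.
move=> [f1 f2] [g1 g2]; split => x.
  by under eq_fun do rewrite Re_add; exact: (cvgD (f1 x) (g1 x)).
by under eq_fun do rewrite Im_add; exact: (cvgD (f2 x) (g2 x)).
Qed.

Lemma cI_parts j f phi : smooth f -> test_function phi ->
  cI mu (fun x => partial j f x * phi x) = - cI mu (fun x => f x * partial j phi x).
Proof.
move=> sf tp; have [N N0 hN] := test_radius tp.
have tp' := test_partial j tp; have [N' N'0 hN'] := test_radius tp'.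
have cf := smooth_ccont sf; have cp := smooth_ccont tp.1.
have cf' := smooth_ccont (smooth_partial j sf); have cp' := smooth_ccont tp'.1.
have i1 : cintg mu (fun x => partial j f x * phi x).
  apply: (cintg_compact _ (ltW N0)); first exact: ccontM.
  by move=> x /ltW/hN ->; rewrite mulr0.
have i2 : cintg mu (fun x => f x * partial j phi x).
  apply: (cintg_compact _ (ltW N'0)); first exact: ccontM.
  by move=> x /ltW/hN' ->; rewrite mulr0.
apply/eqP; rewrite -addr_eq0 -cID//; apply/eqP.
have e : partial j (fun x => f x * phi x) =
    (fun x => partial j f x * phi x + f x * partial j phi x).
  apply/funext => x.
  by rewrite /partial; have [_ ->] := cdiffM (delta_mx ord0 j) (smooth_diff x sf) (smooth_diff x tp.1).
rewrite -e; apply: (cI_partial0 N0).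
- by move=> x; have [] := cdiffM 0 (smooth_diff x sf) (smooth_diff x tp.1).
- by rewrite e; apply: ccontD; exact: ccontM.
- by move=> x /hN ->; rewrite mulr0.
Qed.

End smooth_functions.

(** * Flat functions and Gaussians in one variable *)

Section one_variable.
Variable R : realType.
Local Notation C := (Rcomplex R).
Local Notation nC z := (`|(z : C)|).

Lemma pow_expR_le (k : nat) (y : R) : 0 <= y -> y ^+ k * expR (- y) <= k`!%:R.
Proof.
move=> y0; rewrite expRN ler_pdivrMr ?expR_gt0//; case: k => [|k].
  by rewrite expr0 mul1r (le_trans _ (expR_ge1Dx y))// lerDl.
rewrite mulrC -ler_pdivrMr ?ltr0n ?fact_gt0//.
by apply: le_trans (expR_ge1Dxn k y0); rewrite lerDr.
Qed.

Lemma horner_expR_le (p : {poly R}) (k : nat) :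
  exists2 c, 0 <= c & forall y, 0 < y -> `|p.[y]| * y ^+ k * expR (- y) <= c.
Proof.
elim/poly_ind: p k => [|p a IH] k.
  by exists 0 => // y _; rewrite horner0 normr0 !mul0r.
have [c c0 hc] := IH k.+1; exists (c + `|a| * k`!%:R).
  by rewrite addr_ge0// mulr_ge0.
move=> y y0; rewrite hornerMXaddC.
have ye : 0 <= y ^+ k * expR (- y) by rewrite mulr_ge0 ?exprn_ge0 ?expR_ge0// ltW.
have h1 : `|p.[y] * y + a| <= `|p.[y]| * y + `|a|.
  by rewrite (le_trans (ler_normD _ _))// normrM (gtr0_norm y0).
have h2 := pow_expR_le k (ltW y0); have h3 := hc y y0.
have h4 : `|a| * (y ^+ k * expR (- y)) <= `|a| * k`!%:R by rewrite ler_wpM2l.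
apply: le_trans (lerD h3 h4).
rewrite -mulrA (le_trans (ler_wpM2r ye h1))//.
by rewrite le_eqVlt; apply/orP; left; apply/eqP; rewrite exprS; ring.
Qed.

Lemma near_is_derive (f g : R -> R) (t v : R) : (\near t, f t = g t) ->
  is_derive t (1 : R) f v -> is_derive t (1 : R) g v.
Proof.
move=> fg [df <-]; split; first exact: (near_eq_derivable fg df).
by apply/esym; exact: near_eq_derive.
Qed.

Lemma is_derive_congr (f g : R -> R) (t a b : R) : is_derive t (1 : R) f a ->
  f =1 g -> a = b -> is_derive t (1 : R) g b.
Proof. by move=> + /funext <- <-. Qed.

(* The flat functions p(1/t) exp(-1/t) are closed under differentiation. *)
Definition flat (p : {poly R}) (t : R) : R := if 0 < t then p.[t^-1] * expR (- t^-1) else 0.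

(** For [t > 0] this is the chain rule; at 0 the exponential decay beats every power of [1 / t]. *)
Lemma is_derive_flat p (t : R) : is_derive t (1 : R) (flat p) (flat ((p - p^`()) * 'X^2) t).
Proof.
have [t0|t0|t0] := ltrgtP 0 t.
- apply: (@near_is_derive (fun s => p.[s^-1] * expR (- s^-1))).
    by near=> s; rewrite /flat ifT//; near: s; exact: lt_nbhsr.
  have tn0 : t != 0 by rewrite gt_eqF.
  have dV : is_derive t (1 : R) (fun s : R => s^-1) (- t ^- 2 *: (1 : R)) by exact: is_deriveV.
  have d1 := is_derive1_comp (is_derive_poly p t^-1) dV.
  have d2 := @is_derive1_comp _ expR (fun s : R => - s^-1) _ _ _ (is_derive_expR (- t^-1)) (is_deriveN dV).
  apply: (is_derive_congr (is_deriveM d1 d2)) => [s //|/=].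
  rewrite -[LHS]/(p.[t^-1] * (expR (- t^-1) * - (- t ^- 2 * 1)) +
    expR (- t^-1) * (p^`().[t^-1] * (- t ^- 2 * 1))) /flat t0 !hornerE -exprVn.
  move: (t^-1 : R) => w; move: (p.[w] : R) (p^`().[w] : R) (expR (- w) : R) => x y z.
  by rewrite /=; ring.
- apply: (@near_is_derive (cst 0)).
    by near=> s; rewrite /flat ifF//; apply/negbTE; rewrite -leNgt ltW//; near: s; exact: lt_nbhsl.
  by rewrite /flat ltNge (ltW t0) /=; exact: is_derive_cst.
(* Exponent 2: one power of [1 / h] is the difference quotient, and the other leaves a factor [h]
   that tends to 0. *)
- subst t; have [c c0 hc] := horner_expR_le p 2.
  have hcv : h^-1 *: ((flat p \o shift 0) (h *: (1 : R)) - flat p 0) @[h --> (0 : R)^'] --> (0 : R).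
    apply/cvgr0Pnorm_lt => e e0; near=> h.
    rewrite /flat /= ltxx subr0 addr0 [h%:A]mulr1.
    have hn0 : h != 0 by near: h; exact: nbhs_dnbhs_neq.
    case: ifP => h0; last by rewrite scaler0 normr0.
    rewrite normrZ normrM (ger0_norm (expR_ge0 _)) normfV (gtr0_norm h0).
    have h1 := hc h^-1; rewrite invr_gt0 in h1; have {}h1 := h1 h0.
    have -> : h^-1 * (`|p.[h^-1]| * expR (- h^-1)) = h * (`|p.[h^-1]| * h^-1 ^+ 2 * expR (- h^-1)).
      by field.
    apply: (@le_lt_trans _ _ (h * c)); first by rewrite ler_wpM2l// ltW.
    rewrite (@le_lt_trans _ _ (h * (c + 1)))//; first by rewrite ler_wpM2l ?lerDl// ltW.
    rewrite -ltr_pdivlMr ?ltr_wpDl//.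
    rewrite -(gtr0_norm h0) -[h]subr0 distrC; near: h; apply: nbhs_dnbhs; apply: nbhsx_ballx.
    by rewrite divr_gt0 ?ltr_wpDl.
  rewrite {2}/flat ltxx; apply: DeriveDef; first by apply/cvg_ex; exists 0.
  exact: cvg_lim hcv.
Unshelve. all: by end_near. Qed.

Lemma jet_flat (a b : R) : exists U : nat -> R -> C,
  U 0%N = (fun t => rC (flat 1 (a * t + b))) /\ jet U.
Proof.
have hP f : (exists p, f = (fun t => rC (flat p (a * t + b)))) ->
    exists2 g, (exists p, g = (fun t => rC (flat p (a * t + b)))) & cder f g.
  move=> [p ->]; exists (fun t => rC (flat (a *: ((p - p^`()) * 'X^2)) (a * t + b))).
    by exists (a *: ((p - p^`()) * 'X^2)).
  apply: cder_real => t.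
  have d0 : is_derive t (1 : R) (fun t : R => a * t + b) a.
    apply: (is_derive_congr (is_deriveD (is_deriveZ a (is_derive_id t (1 : R)))
      (is_derive_cst b t (1 : R)))) => //.
    by rewrite addr0 [LHS]mulr1.
  apply: (is_derive_congr (@is_derive1_comp _ (flat p) (fun t => a * t + b) _ _ _
    (is_derive_flat p (a * t + b)) d0)) => //.
  rewrite /flat; case: ifP => _; last by rewrite mul0r.
  by rewrite hornerZ; ring.
have [U [U0 jU _]] := jet_of_class hP (ex_intro _ 1 erefl).
by exists U.
Qed.

Definition gs (A t : R) : R := expR (- (pi * A * t ^+ 2)).

Definition gsc (A c t : R) : C := rC (gs A t) * cis (c * t).

(** Polynomials times [gsc A c], generated in such a way that derivatives visibly remain in the
    class. *)
Inductive gauss_class (A c : R) : (R -> C) -> Prop :=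
| gauss_base : gauss_class A c (gsc A c)
| gauss_mul f : gauss_class A c f -> gauss_class A c (fun t => rC t * f t)
| gauss_scale (z : C) f : gauss_class A c f -> gauss_class A c (fun t => z * f t)
| gauss_add f g : gauss_class A c f -> gauss_class A c g ->
    gauss_class A c (fun t => f t + g t).

Lemma is_derive_gs (A t : R) : is_derive t (1 : R) (gs A) (- (2 * pi * A * t) * gs A t).
Proof.
have d0 : is_derive t (1 : R) (fun t : R => - (pi * A * t ^+ 2)) (- (2 * pi * A * t)).
  apply: (is_derive_congr (is_deriveN (is_deriveZ (pi * A) (is_deriveX 2 (is_derive_id t (1 : R)))))) => //.
  have sE (a b : R) : a *: b = a * b by [].
  by rewrite !sE expr1 mulr1; ring.
apply: (is_derive_congr (@is_derive1_comp _ expR (fun t => - (pi * A * t ^+ 2)) _ _ _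
  (is_derive_expR _) d0)) => //.
by rewrite mulrC.
Qed.

Lemma cder_cis (c : R) : cder (fun t => cis (c * t)) (fun t => Complex 0 c * cis (c * t)).
Proof.
move=> t.
have d0 : is_derive t (1 : R) (fun t : R => c * t) c.
  by apply: (is_derive_congr (is_deriveZ c (is_derive_id t (1 : R)))) => //; exact: mulr1.
split => /=.
  by apply: (is_derive_congr (is_derive1_comp (is_derive_cos (c * t)) d0)) => //; ring.
by apply: (is_derive_congr (is_derive1_comp (is_derive_sin (c * t)) d0)) => //; ring.
Qed.

Lemma cder_gsc (A c : R) :
  cder (gsc A c) (fun t => (rC (- (2 * pi * A)) * (rC t * gsc A c t)) + Complex 0 c * gsc A c t).
Proof.
have := cderM (cder_real (is_derive_gs A)) (cder_cis c).
rewrite /gsc => h.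
set g := (fun t => _ + _) in h; suff <- : g = (fun t => (rC (- (2 * pi * A)) * (rC t *
  (rC (gs A t) * cis (c * t)))) + Complex 0 c * (rC (gs A t) * cis (c * t))) by [].
by apply/funext => s; rewrite /g -(mulNr (2 * pi * A) s) (rCM _ (gs A s)) (rCM _ s); ring.
Qed.

Lemma cder_id : cder (fun t : R => rC t) (fun=> 1).
Proof. exact: (cder_real (fun t : R => is_derive_id t (1 : R))). Qed.

Lemma jet_gauss (A c : R) : exists U : nat -> R -> C,
  [/\ U 0%N = gsc A c, jet U & forall k, gauss_class A c (U k)].
Proof.
apply: jet_of_class; last exact: gauss_base.
move=> f; elim=> [|g Pg [g' hg' dg]|z g _ [g' hg' dg]|g1 g2 _ [h1 k1 d1] _ [h2 k2 d2]].
- eexists; last exact: cder_gsc.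
  by apply: gauss_add; apply: gauss_scale; [apply: gauss_mul|]; exact: gauss_base.
- exists (fun t => g t + rC t * g' t).
    by apply: gauss_add => //; exact: gauss_mul.
  by have := cderM cder_id dg; under [X in cder _ X -> _]eq_fun do rewrite mul1r.
- by exists (fun t => z * g' t); [exact: gauss_scale|exact: cderZ].
- by exists (fun t => h1 t + h2 t); [exact: gauss_add|exact: cderD].
Qed.

(** All powers [k] are treated together because multiplication by [t] costs one power in the
    induction. *)
Lemma gauss_decay (A c : R) f : 0 < A -> gauss_class A c f -> forall k,
  exists2 M, 0 <= M & forall t, (1 + `|t|) ^+ k * nC (f t) <= M.
Proof.
move=> A0; elim=> [|g _ IH|z g _ IH|g1 g2 _ IH1 _ IH2] k.
- have pA : 0 < pi * A by rewrite mulr_gt0 ?pi_gt0.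
  exists (2 ^+ k + 2 ^+ k * ((pi * A) ^- k * k`!%:R)).
    by rewrite addr_ge0// ?mulr_ge0// ?exprn_ge0// ?invr_ge0 ?exprn_ge0// ltW.
  move=> t; rewrite normC_mul normC_cis mulr1 normC_real (ger0_norm (expR_ge0 _)) -/(gs A t).
  have tk : 0 <= (t ^+ 2) ^+ k := exprn_ge0 k (sqr_ge0 t).
  have h1 : (1 + `|t|) ^+ k <= 2 ^+ k + 2 ^+ k * (t ^+ 2) ^+ k.
    have [t1|t1] := leP `|t| 1.
      apply: (@le_trans _ _ (2 ^+ k)).
        by apply: lerXn2r; rewrite ?nnegrE ?addr_ge0//; lra.
      by rewrite lerDl mulr_ge0// exprn_ge0.
    apply: (@le_trans _ _ (2 ^+ k * (t ^+ 2) ^+ k)); last by rewrite lerDr exprn_ge0.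
    rewrite -exprMn; apply: lerXn2r; rewrite ?nnegrE; [by rewrite addr_ge0|by rewrite mulr_ge0 ?sqr_ge0|].
    by rewrite -[t ^+ 2]real_normK ?num_real//; nra.
  have g1 : gs A t <= 1 by rewrite -expR0 ler_expR oppr_le0 mulr_ge0 ?sqr_ge0// ltW.
  have h2 := @pow_expR_le k (pi * A * t ^+ 2).
  have {}h2 := h2 (mulr_ge0 (ltW pA) (sqr_ge0 t)).
  have h3 : (t ^+ 2) ^+ k * gs A t <= (pi * A) ^- k * k`!%:R.
    rewrite ler_pdivlMl ?exprn_gt0// mulrA -exprMn //.
  apply: le_trans (ler_wpM2r (expR_ge0 _) h1) _.
  rewrite mulrDl; apply: lerD.
    by rewrite ler_piMr ?exprn_ge0.
  by rewrite -/(gs A t) -(mulrA (2 ^+ k)) ler_wpM2l// exprn_ge0.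
- have [M M0 hM] := IH k.+1; exists M => // t; apply: le_trans (hM t).
  rewrite normC_mul normC_real exprSr -mulrA ler_wpM2l ?exprn_ge0 ?addr_ge0//.
  by rewrite ler_wpM2r// lerDr.
- have [M M0 hM] := IH k; exists (nC z * M); first by rewrite mulr_ge0.
  by move=> t; rewrite normC_mul mulrCA ler_wpM2l.
- have [M1 M10 h1] := IH1 k; have [M2 M20 h2] := IH2 k.
  exists (M1 + M2); first exact: addr_ge0.
  move=> t; apply: le_trans (lerD (h1 t) (h2 t)).
  by rewrite -mulrDr ler_wpM2l ?exprn_ge0 ?addr_ge0// ler_normD.
Qed.

End one_variable.

(** * Integrals of Gaussians over the line *)

Section gaussian_line.
Variable R : realType.
Local Notation C := (Rcomplex R).
Local Notation nC z := (`|(z : C)|).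
Local Notation leb := (@lebesgue_measure R).
Local Notation intg m f := (m.-integrable setT (fun x => (f x)%:E)).

Lemma gauss_split (A B c : R) f : gauss_class A c f ->
  exists2 g, gauss_class (A - B) c g & forall t, f t = rC (gs B t) * g t.
Proof.
elim=> [|g _ [g' h' e]|z g _ [g' h' e]|g1 g2 _ [h1 k1 e1] _ [h2 k2 e2]].
- exists (gsc (A - B) c); first exact: gauss_base.
  move=> t; rewrite /gsc mulrA -rCM /gs -expRD; congr (rC (expR _) * _); ring.
- by exists (fun t => rC t * g' t); [exact: gauss_mul|move=> t; rewrite e; ring].
- by exists (fun t => z * g' t); [exact: gauss_scale|move=> t; rewrite e; ring].
- by exists (fun t => h1 t + h2 t); [exact: gauss_add|move=> t; rewrite e1 e2; ring].
Qed.

Lemma gs_ge0 (A t : R) : 0 <= gs A t. Proof. exact: expR_ge0. Qed.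
Lemma gs_gt0 (A t : R) : 0 < gs A t. Proof. exact: expR_gt0. Qed.
Lemma gs0 (A : R) : gs A 0 = 1. Proof. by rewrite /gs expr0n mulr0 oppr0 expR0. Qed.
Lemma gs_le1 (A t : R) : 0 <= A -> gs A t <= 1.
Proof. by move=> A0; rewrite /gs -[leRHS]expR0 ler_expR oppr_le0 mulr_ge0 ?sqr_ge0 ?mulr_ge0 ?pi_ge0. Qed.

(** Half of the exponent absorbs the polynomial factor, and the other half remains as a majorant. *)
Lemma gauss_dom (A c : R) f : 0 < A -> gauss_class A c f ->
  exists2 M, 0 <= M & forall t, nC (f t) <= M * gs (A / 2) t.
Proof.
move=> A0 /(gauss_split (A / 2))[g hg e].
have A2 : 0 < A - A / 2 by lra.
have [M M0 hM] := gauss_decay A2 hg 0; exists M => // t.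
rewrite e normC_mul normC_real ger0_norm ?gs_ge0// mulrC ler_wpM2r ?gs_ge0//.
by have := hM t; rewrite expr0 mul1r.
Qed.

Lemma gs_normal (A s t : R) : 0 < A ->
  gs A (t - s) = (Num.sqrt A)^-1 * normal_pdf s (Num.sqrt (2 * pi * A)^-1) t.
Proof.
move=> A0; have pA : 0 < 2 * pi * A by rewrite !mulr_gt0 ?pi_gt0.
have s2 : (Num.sqrt (2 * pi * A)^-1) ^+ 2 = (2 * pi * A)^-1 :> R.
  by rewrite sqr_sqrtr// invr_ge0 ltW.
rewrite /normal_pdf gt_eqF ?sqrtr_gt0 ?invr_gt0//.
rewrite /normal_peak /normal_fun s2.
have -> : (2 * pi * A)^-1 * pi *+ 2 = A^-1 :> R.
  by rewrite -(mulr_natr (_ * pi) 2); move: (pi : R) (@pi_gt0 R) => p p0; field; rewrite !gt_eqF.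
rewrite sqrtrV ?invrK 1?ltW// mulrA mulVf ?gt_eqF ?sqrtr_gt0// mul1r.
congr expR; rewrite -mulr_natr; move: (pi : R) (@pi_gt0 R) => p p0; field; rewrite !gt_eqF//.
Qed.

Lemma intg_gs (A s : R) : 0 < A -> intg leb (fun t => gs A (t - s)).
Proof.
move=> A0; under eq_fun do rewrite gs_normal// EFinM.
by apply: integrableZl => //; exact: integrable_normal_pdf.
Qed.

Lemma Rintegral_gs (A s : R) : 0 < A -> \int[leb]_t gs A (t - s) = (Num.sqrt A)^-1.
Proof.
move=> A0; under eq_Rintegral do rewrite gs_normal//.
rewrite RintegralZl//; last exact: integrable_normal_pdf.
by rewrite /Rintegral integral_normal_pdf /= mulr1.
Qed.

(** The fundamental theorem of calculus on [[-n, n]], then dominated convergence. *)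
Lemma Rintegral_deriv0 (F G : R -> R) : (forall t : R, is_derive t (1 : R) F (G t)) ->
  continuous G -> intg leb G -> (fun n : nat => F n%:R) @ \oo --> 0 ->
  (fun n : nat => F (- n%:R)) @ \oo --> 0 -> \int[leb]_t G t = 0.
Proof.
move=> dF cG iG F1 F2.
have cF : continuous F.
  move=> t; apply: differentiable_continuous; apply/derivable1_diffP.
  by have [] := dF t.
pose un (n : nat) (t : R) := G t * \1_`[- n%:R, n%:R] t.
have mG := intg_meas iG.
have [||||iu c1] := @Rintegral_dct _ _ _ leb un G (fun t => `|G t|).
- by move=> n; apply: measurable_funM => //; apply: measurable_indic; exact: measurable_itv.
- move=> t; apply: (@cvg_near_cst _ _ (G t)); near=> n.
  rewrite /un indicE mem_set ?mulr1//= in_itv /= -ler_norml.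
  by near: n; exact: nbhs_infty_ger.
- exact: (integrable_abse iG).
- move=> n t; rewrite /un normrM ler_piMr// indicE ger0_norm//.
  by case: (_ \in _).
have e n : \int[leb]_t un n t = F n%:R - F (- n%:R).
  case: n => [|n].
    rewrite oppr0 subrr /un /Rintegral.
    transitivity (\int[leb]_(t in `[0, 0]) G t).
      rewrite [RHS]Rintegral_mkcond; congr fine; apply: eq_integral => t _.
      by rewrite patchE indicE oppr0; case: (_ \in _); rewrite ?mulr1 ?mulr0.
    by rewrite set_itv1 Rintegral_set1.
  have NN : - n.+1%:R < n.+1%:R :> R by rewrite gtrN.
  transitivity (\int[leb]_(t in `[- n.+1%:R, n.+1%:R]) G t).
    rewrite [RHS]Rintegral_mkcond; congr fine; apply: eq_integral => t _.
    by rewrite /un patchE indicE; case: (_ \in _); rewrite ?mulr1 ?mulr0.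
  rewrite /Rintegral (@continuous_FTC2 R G F _ _ NN)//.
  - exact: continuous_subspaceT.
  - split => [t _||]; first by have [] := dF t.
      by apply: cvg_at_right_filter; exact: cF.
    by apply: cvg_at_left_filter; exact: cF.
  - by move=> t _; rewrite derive1E; exact: derive_val.
move: c1; under eq_fun do rewrite e; move=> c1.
have c2 : F n%:R - F (- n%:R) @[n --> \oo] --> (0 : R).
  by rewrite -[X in _ --> X](subr0 0); exact: cvgB.
exact: (cvg_unique _ c1 c2).
Unshelve. all: by end_near. Qed.

End gaussian_line.

(** * The Fourier transform of a Gaussian *)

Section gaussian_fourier.
Variable R : realType.
Local Notation C := (Rcomplex R).
Local Notation nC z := (`|(z : C)|).
Local Notation leb := (@lebesgue_measure R).
Local Notation intg m f := (m.-integrable setT (fun x => (f x)%:E)).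

Let cosw (A w c t : R) := gs A t * cos (c * t + w).
Let sinw (A w c t : R) := gs A t * sin (c * t + w).

Let is_derive_affine (c w t : R) : is_derive t (1 : R) (fun t : R => c * t + w) c.
Proof.
apply: (is_derive_congr (is_deriveD (is_deriveZ c (is_derive_id t (1 : R)))
  (is_derive_cst w t (1 : R)))) => //.
by rewrite addr0 [LHS]mulr1.
Qed.

(** With [y = sqrt A * |t|] one has [y <= 1 + y ^ 2 <= exp (pi * y ^ 2 / 2)], because
    [pi / 2 >= 1]. *)
Lemma mul_gs_le (A t : R) : 0 < A -> `|t| * gs A t <= (Num.sqrt A)^-1 * gs (A / 2) t.
Proof.
move=> A0; have sA : 0 < Num.sqrt A by rewrite sqrtr_gt0.
rewrite ler_pdivlMl// mulrA.
have -> : gs A t = gs (A / 2) t * gs (A / 2) t.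
  by rewrite /gs -expRD; congr expR; field.
rewrite mulrA ler_piMl ?gs_ge0//.
have h : Num.sqrt A * `|t| <= expR (pi * (A / 2) * t ^+ 2).
  have tA : (Num.sqrt A * `|t|) ^+ 2 = A * t ^+ 2.
    by rewrite exprMn sqr_sqrtr ?(ltW A0)// real_normK ?num_real.
  have p1 : 1 <= pi / 2 :> R by have := @pi_ge2 R; lra.
  apply: le_trans (expR_ge1Dx _).
  apply: (@le_trans _ _ (1 + (Num.sqrt A * `|t|) ^+ 2)).
    move: (Num.sqrt A * `|t|) => y; nra.
  rewrite lerD2l tA.
  have : 0 <= A * t ^+ 2 by rewrite mulr_ge0 ?sqr_ge0// ltW.
  by have := p1; nra.
apply: le_trans (ler_wpM2r (gs_ge0 _ _) h) _.
by rewrite /gs -expRD addrN expR0.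
Qed.

Lemma cvg0_harmonic (u : nat -> R) (K : R) : (forall n, `|u n| <= K * (1 + `|n%:R|)^-1) ->
  u @ \oo --> 0.
Proof.
move=> h; apply/norm_cvg0P; apply: (@squeeze_cvgr _ _ _ _ (cst 0) (fun n => K * (1 + `|n%:R|)^-1)).
- by near=> n; rewrite normr_ge0 h.
- exact: cvg_cst.
- rewrite (_ : (fun n => _) = (fun n => K * harmonic n)).
    by rewrite -[X in _ --> X](mulr0 K); apply: cvgM; [exact: cvg_cst|exact: cvg_harmonic].
  by apply/funext => n; rewrite /harmonic /= ger0_norm// nat1r.
Unshelve. all: by end_near. Qed.

(** Differentiation under the integral produces the integral of [- t * sinw], which integration by
    parts turns into a multiple of the original one. The shift [w] treats cosine and sine
    together. *)
Lemma gauss_cos_ode (A w c : R) : 0 < A ->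
  is_derive c (1 : R) (fun c => \int[leb]_t cosw A w c t)
    (- (c / (2 * pi * A)) * \int[leb]_t cosw A w c t).
Proof.
move=> A0.
have pA : 0 < 2 * pi * A by rewrite !mulr_gt0 ?pi_gt0.
have igs : intg leb (gs A) by have := intg_gs 0 A0; under eq_fun do rewrite subr0.
have A2 : 0 < A / 2 by rewrite divr_gt0.
have igs2 : intg leb (gs (A / 2)) by have := intg_gs 0 A2; under eq_fun do rewrite subr0.
have cgs : continuous (gs A).
  move=> t; apply: differentiable_continuous; apply/derivable1_diffP.
  by have [] := is_derive_gs A t.
have ctrig (f : R -> R) (e : R) : continuous f -> continuous (fun t : R => f (e * t + w)).
  move=> cf t; apply: continuous_comp; last exact: cf.
  apply: differentiable_continuous; apply/derivable1_diffP.
  by have [] := is_derive_affine e w t.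
have ccos (e : R) : continuous (cosw A w e).
  by move=> t; apply: cvgM; [exact: cgs|exact/ctrig/continuous_cos].
have csin (e : R) : continuous (sinw A w e).
  by move=> t; apply: cvgM; [exact: cgs|exact/ctrig/continuous_sin].
have icos e : intg leb (cosw A w e).
  apply: intg_dom igs _; first exact: continuous_measurable_fun.
  move=> t; rewrite normrM (ger0_norm (gs_ge0 _ _)) ler_piMr ?gs_ge0//.
  by rewrite ler_norml cos_geN1 cos_le1.
have tsin_le e (t : R) : `|t * sinw A w e t| <= (Num.sqrt A)^-1 * gs (A / 2) t.
  apply: le_trans (mul_gs_le t A0).
  rewrite !normrM (ger0_norm (gs_ge0 _ _)) mulrA ler_piMr ?mulr_ge0 ?gs_ge0//.
  by rewrite ler_norml sin_geN1 sin_le1.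
have ctsin e : continuous (fun t : R => t * sinw A w e t).
  by move=> t; apply: cvgM; [exact: cvg_id|exact: csin].
have itsin e : intg leb (fun t => t * sinw A w e t).
  by apply: intg_dom (intgZ _ igs2) (tsin_le e); exact: continuous_measurable_fun.
have dcos e t : is_derive e (1 : R) (fun e => cosw A w e t) (- (t * sinw A w e t)).
  have d0 : is_derive e (1 : R) (fun e : R => e * t + w) t.
    apply: (is_derive_congr (is_derive_affine t w e)) => // s.
    by rewrite mulrC.
  have d1 := @is_derive1_comp _ cos (fun e => e * t + w) _ _ _ (is_derive_cos _) d0.
  apply: (is_derive_congr (is_deriveZ (gs A t) d1)) => //.
  by rewrite -[LHS]/(gs A t * (- sin (e * t + w) * t)) /sinw; ring.
have cI : (`]c - 1, c + 1[%classic : set R) c by rewrite /= in_itv /= gtrBl ltrDl ltr01.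
have hsin (t : R) : `|sinw A w c t| <= ((Num.sqrt A)^-1 + 1) * (1 + `|t|)^-1.
  rewrite ler_pdivlMr ?ltr_pwDl// normrM (ger0_norm (gs_ge0 _ _)).
  apply: (@le_trans _ _ (gs A t * (1 + `|t|))).
    rewrite ler_wpM2r ?addr_ge0// ler_piMr ?gs_ge0//.
    by rewrite ler_norml sin_geN1 sin_le1.
  rewrite mulrDr mulr1 addrC lerD// ?gs_le1 ?(ltW A0)// mulrC.
  apply: le_trans (mul_gs_le t A0) _.
  by rewrite ler_piMr ?invr_ge0 ?sqrtr_ge0// gs_le1// ltW.
(* The integrand is the derivative in [t] of [sinw A w c], which vanishes at infinity. *)
have zero : \int[leb]_t (- (2 * pi * A) * (t * sinw A w c t) + c * cosw A w c t) = 0.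
  pose G (t : R) := - (2 * pi * A) * (t * sinw A w c t) + c * cosw A w c t.
  have dG t : is_derive t (1 : R) (sinw A w c) (G t).
    have d1 := @is_derive1_comp _ sin (fun t => c * t + w) _ _ _ (is_derive_sin _) (is_derive_affine c w t).
    apply: (is_derive_congr (is_deriveM (is_derive_gs A t) d1)) => //.
    rewrite -[LHS]/(gs A t * (cos (c * t + w) * c) + sin (c * t + w) * (- (2 * pi * A * t) * gs A t)).
    by rewrite /G /sinw /cosw; ring.
  have cG : continuous G.
    by move=> t; apply: cvgD; apply: cvgM; [exact: cvg_cst|exact: ctsin|exact: cvg_cst|exact: ccos].
  have iG : intg leb G.
    have i1 := intgZ (- (2 * pi * A)) (itsin c); have i2 := intgZ c (icos c).
    by rewrite /G; under eq_fun do rewrite EFinD; exact: integrableD.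
  apply: (Rintegral_deriv0 dG cG iG).
    by apply: cvg0_harmonic => n; exact: (hsin n%:R).
  apply: (@cvg0_harmonic _ ((Num.sqrt A)^-1 + 1)) => n.
  by have := hsin (- n%:R); rewrite (normrN n%:R).
rewrite RintegralD// in zero; [|exact: intgZ|exact: intgZ].
rewrite (RintegralZl _ measurableT (itsin c)) (RintegralZl _ measurableT (icos c)) in zero.
have -> : - (c / (2 * pi * A)) * \int[leb]_t cosw A w c t = \int[leb]_t (- 1 * (t * sinw A w c t)).
  rewrite (RintegralZl _ measurableT (itsin c)); move: (\int[leb]_t (t * sinw A w c t)) (\int[leb]_t cosw A w c t) zero => x y h.
  have -> : x = c / (2 * pi * A) * y.
    by apply: (mulfI (lt0r_neq0 pA)); rewrite -[LHS]opprK -mulNr; move/eqP: h;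
      rewrite addr_eq0 => /eqP ->; rewrite opprK; move: (pi : R) (@pi_gt0 R) => p p0; field; rewrite !gt_eqF.
  by rewrite mulN1r mulNr.
clear zero.
have p1 e t : partial1of2 (fun e t => cosw A w e t) e t = - (t * sinw A w e t).
  by rewrite /partial1of2 derive1E; exact: derive_val.
have df e t : derivable (fun e => cosw A w e t) e 1 by have [] := dcos e t.
have iG : intg leb (fun t => (Num.sqrt A)^-1 * gs (A / 2) t) by exact: intgZ.
have G0 t : 0 <= (Num.sqrt A)^-1 * gs (A / 2) t by rewrite mulr_ge0 ?gs_ge0// invr_ge0 sqrtr_ge0.
have Gu e t : `|partial1of2 (fun e t => cosw A w e t) e t| <= (Num.sqrt A)^-1 * gs (A / 2) t.
  by rewrite p1 normrN.
apply: DeriveDef.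
  exact: (@derivable_under_integral R _ _ leb (fun e t => cosw A w e t) setT measurableT c (c - 1) (c + 1) cI
    (fun e _ => icos e) (fun e t _ _ => df e t) _ G0 iG (fun e t _ _ => Gu e t)).
have := @differentiation_under_integral R _ _ leb (fun e t => cosw A w e t) setT measurableT c (c - 1) (c + 1) cI
    (fun e _ => icos e) (fun e t _ _ => df e t) _ G0 iG (fun e t _ _ => Gu e t).
rewrite derive1E => ->; apply: eq_Rintegral => t _.
by rewrite p1 mulN1r.
Qed.

(** By the differential equation the product with [exp (c ^ 2 / (4 pi A))] is constant in [c]; its
    value is read off at [c = 0]. *)
Lemma gauss_cos_int (A w c : R) : 0 < A ->
  \int[leb]_t cosw A w c t = (Num.sqrt A)^-1 * expR (- (c ^+ 2 / (4 * pi * A))) * cos w.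
Proof.
move=> A0; have pA : 0 < 4 * pi * A by rewrite !mulr_gt0 ?pi_gt0.
pose u c := \int[leb]_t cosw A w c t; pose q (c : R) := expR (c ^+ 2 / (4 * pi * A)).
have dq (e : R) : is_derive e (1 : R) q (e / (2 * pi * A) * q e).
  have d0 := is_deriveZ (4 * pi * A)^-1 (is_deriveX 2 (is_derive_id e (1 : R))).
  have d1 := is_derive1_comp (is_derive_expR _) d0.
  apply: (is_derive_congr d1) => [s|].
    by rewrite /q /= [LHS]/(expR ((4 * pi * A)^-1 * s ^+ 2)) mulrC.
  rewrite -[LHS]/(expR ((4 * pi * A)^-1 * e ^+ 2) * ((4 * pi * A)^-1 * ((2 * e ^+ 1) * 1))).
  rewrite /q (mulrC (e ^+ 2)) expr1; move: (pi : R) (@pi_gt0 R) => p p0; field.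
  by rewrite !gt_eqF.
have dz (e : R) : is_derive e (1 : R) (fun e => u e * q e) 0.
  apply: (is_derive_congr (is_deriveM (gauss_cos_ode w e A0) (dq e))) => //.
  rewrite -[LHS]/(u e * (e / (2 * pi * A) * q e) + q e * (- (e / (2 * pi * A)) * u e)); ring.
have := is_derive_0_is_cst c 0 dz.
have u0 : u 0 = (Num.sqrt A)^-1 * cos w.
  rewrite /u /cosw; under eq_Rintegral do rewrite mul0r add0r mulrC.
  rewrite RintegralZl//; last by have := intg_gs 0 A0; under eq_fun do rewrite subr0.
  by have := Rintegral_gs 0 A0; under eq_Rintegral do rewrite subr0; move=> ->; rewrite mulrC.
rewrite u0 /q expr0n mul0r expR0 mulr1 expRN => h.
by rewrite mulrAC -h mulfK// gt_eqF// expR_gt0.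
Qed.

Lemma cI_gsc (A c : R) : 0 < A ->
  cintg leb (gsc A c) /\
  cI leb (gsc A c) = rC ((Num.sqrt A)^-1 * expR (- (c ^+ 2 / (4 * pi * A)))).
Proof.
move=> A0; have igs : intg leb (gs A) by have := intg_gs 0 A0; under eq_fun do rewrite subr0.
have mgs := intg_meas igs.
split.
  apply: (cintg_dom _ igs).
    apply: cmeasM; first exact: cmeas_real.
    by apply: cmeas_cis; apply: measurable_funM.
  by move=> t; rewrite normC_mul normC_cis mulr1 normC_real ger0_norm ?gs_ge0.
apply: C_eqP => /=.
  have := gauss_cos_int 0 c A0; rewrite cos0 mulr1 => <-.
  by apply: eq_Rintegral => t _; rewrite /cosw addr0 mul0r subr0.
have := gauss_cos_int (- (pi / 2)) c A0; rewrite cosN cos_pihalf mulr0 => e; rewrite -[RHS]e.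
by apply: eq_Rintegral => t _; rewrite /cosw cosBpihalf mul0r addr0.
Qed.

End gaussian_fourier.

(** * Gaussian wave packets and their Fourier transforms *)

Section waves.
Variables (R : realType) (d : nat).
Local Notation C := (Rcomplex R).
Local Notation E := 'rV[R]_d.
Local Notation nC z := (`|(z : C)|).
Local Notation leb := (@lebesgue_measure R).
Local Notation mu := (lebesgue_rV R d).
Local Notation intg m f := (m.-integrable setT (fun x => (f x)%:E)).
Implicit Types (x xi eta : E) (A : R).

(** This is [exp (- pi A |x| ^ 2)] for the Euclidean norm, kept as a product so that estimates and
    integrals split by coordinates; the norm on rows is the sup norm. *)
Definition gam A x : R := \prod_(i < d) gs A (x ord0 i).

Definition wave A eta x : C := \prod_(i < d) gsc A (2 * pi * eta ord0 i) (x ord0 i).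

Lemma gam_ge0 A x : 0 <= gam A x. Proof. by apply: prodr_ge0 => i _; exact: gs_ge0. Qed.
Lemma gam_gt0 A x : 0 < gam A x. Proof. by apply: prodr_gt0 => i _; exact: gs_gt0. Qed.
Lemma gam_le1 A x : 0 <= A -> gam A x <= 1.
Proof. by move=> A0; apply: prodr_ile1 => i _; rewrite gs_ge0 gs_le1. Qed.

Lemma cis_sum (I : Type) (r : seq I) (F : I -> R) :
  cis (\sum_(i <- r) F i) = \prod_(i <- r) cis (F i) :> C.
Proof. exact: (big_morph (@cis R) (@cisD R) (@cis0 R)). Qed.

Lemma waveE A eta x : wave A eta x = cis (2 * pi * dot x eta) * rC (gam A x).
Proof.
rewrite /dot mulr_sumr cis_sum /gam rC_prod -big_split; apply: eq_bigr => i _ /=.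
by rewrite /gsc mulrC; congr (cis _ * _); ring.
Qed.

Lemma norm_wave A eta x : nC (wave A eta x) = gam A x.
Proof. by rewrite waveE normC_mul normC_cis mul1r normC_real ger0_norm ?gam_ge0. Qed.

Lemma wave_cis A eta xi x : wave A eta x * cis (- (2 * pi * dot x xi)) = wave A (eta - xi) x.
Proof.
rewrite !waveE mulrAC -cisD; congr (cis _ * _).
have -> : dot x (eta - xi) = dot x eta - dot x xi.
  rewrite /dot -sumrB; apply: eq_bigr => i _; rewrite !mxE; ring.
ring.
Qed.

Lemma wave_jet A eta : exists U : 'I_d -> nat -> R -> C,
  [/\ forall i, jet (U i), wave A eta = jprod U (fun=> 0%N) &
   forall i k, gauss_class A (2 * pi * eta ord0 i) (U i k)].
Proof.
have /boolp.choice[U hU] (i : 'I_d) := jet_gauss A (2 * pi * eta ord0 i).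
exists U; split => [i||i k]; [by have [] := hU i| |by have [] := hU i].
by apply/funext => x; apply: eq_bigr => i _; have [-> _ _] := hU i.
Qed.

Lemma wave_smooth A eta : 0 < A -> smooth (wave A eta) /\
  forall s, exists2 M, 0 <= M & forall x, nC (iter_partial s (wave A eta) x) <= M * gam (A / 2) x.
Proof.
move=> A0; have [U [jU -> hU]] := wave_jet A eta; split; first exact: smooth_jprod.
move=> s; rewrite iter_jprod//.
have /boolp.choice[M hM] (i : 'I_d) : exists M, 0 <= M /\
    forall t, nC (U i (0 + count_mem i s)%N t) <= M * gs (A / 2) t.
  by have [M M0 h] := gauss_dom A0 (hU i (0 + count_mem i s)%N); exists M.
exists (\prod_i M i); first by apply: prodr_ge0 => i _; have [] := hM i.
move=> x; rewrite /jprod /gam -big_split /=.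
rewrite (big_morph (fun z : C => nC z) (@normC_mul R) (_ : nC 1 = 1)); last first.
  by rewrite -[1]/(rC 1) normC_real normr1.
by apply: ler_prod => i _; rewrite normr_ge0 (hM i).2.
Qed.

(** Reduces decay in the sup norm to decay of each one-variable factor. *)
Lemma norm_le_prod x : `|x| <= \prod_i (1 + `|x ord0 i|).
Proof.
have p0 : 0 <= \prod_i (1 + `|x ord0 i|) by apply: prodr_ge0 => i _; rewrite addr_ge0.
rewrite [leLHS]/Num.norm /= mx_normrE; apply: bigmax_le => // -[i j] _ /=.
rewrite (ord1 i) (bigD1 j)//= -[leLHS]mulr1; apply: ler_pM => //; first by rewrite lerDr.
apply: (big_ind (fun z : R => 1 <= z)) => // [a b a1 b1|k _]; last by rewrite lerDl.
by rewrite -[1]mulr1; apply: ler_pM.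
Qed.

Lemma gam_decay A (k : nat) : 0 < A -> exists2 M, 0 <= M & forall x, `|x| ^+ k * gam A x <= M.
Proof.
move=> A0; have [M M0 hM] := gauss_decay A0 (gauss_base A 0) k.
exists (\prod_(i < d) M); first by apply: prodr_ge0.
move=> x; apply: (@le_trans _ _ ((\prod_i (1 + `|x ord0 i|)) ^+ k * gam A x)).
  rewrite ler_wpM2r ?gam_ge0// lerXn2r ?nnegrE//; last exact: norm_le_prod.
  by apply: prodr_ge0 => i _; rewrite addr_ge0.
rewrite -prodrXl -big_split /=; apply: ler_prod => i _.
rewrite mulr_ge0 ?exprn_ge0 ?addr_ge0 ?gs_ge0//=.
by have := hM (x ord0 i); rewrite normC_mul normC_cis mulr1 normC_real (ger0_norm (gs_ge0 _ _)).
Qed.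

Lemma gam_int A xi : 0 < A -> intg mu (fun x => gam A (x - xi)) /\
  \int[mu]_x gam A (x - xi) = (Num.sqrt A)^-1 ^+ d.
Proof.
move=> A0; have [h1 h2] := intg_rV_prod (fun i : 'I_d => intg_gs (xi ord0 i) A0).
have e x : gam A (x - xi) = \prod_i gs A (x ord0 i - xi ord0 i).
  by apply: eq_bigr => i _; rewrite !mxE.
split; first by under eq_fun do rewrite e.
under eq_Rintegral do rewrite e.
rewrite h2.
under eq_bigr do rewrite Rintegral_gs//.
by rewrite prodr_const card_ord.
Qed.

Lemma gam_intg A : 0 < A -> intg mu (gam A).
Proof. by move=> A0; have [h _] := gam_int 0 A0; under eq_fun do rewrite -[x in gam A x]subr0. Qed.

Lemma wave_cintg A eta : 0 < A -> cintg mu (wave A eta) /\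
  cI mu (wave A eta) = rC ((Num.sqrt A)^-1 ^+ d * gam A^-1 eta).
Proof.
move=> A0; have [h1 h2] := cI_rV_prod (fun i : 'I_d => (cI_gsc (2 * pi * eta ord0 i) A0).1).
split => //; rewrite [LHS]h2.
under eq_bigr do rewrite (cI_gsc _ A0).2.
rewrite -rC_prod big_split /= prodr_const card_ord; congr (rC (_ * _)).
apply: eq_bigr => i _; rewrite /gs; congr (expR (- _)).
by move: (pi : R) (@pi_gt0 R) => p p0; field; rewrite !gt_eqF.
Qed.

Definition packet A (P : seq (C * E)) x : C := \sum_(p <- P) p.1 * wave A p.2 x.

Lemma packetE A P x : packet A P x = trig P x * rC (gam A x).
Proof. by rewrite /packet /trig mulr_suml; apply: eq_bigr => p _; rewrite waveE mulrA. Qed.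

Lemma packet_smooth A P : 0 < A -> smooth (packet A P) /\
  forall s, exists2 M, 0 <= M & forall x, nC (iter_partial s (packet A P) x) <= M * gam (A / 2) x.
Proof.
move=> A0.
have sF (p : C * E) := smoothZ p.1 (wave_smooth p.2 A0).1.
have [sm e] := smooth_sum P (fun p => (sF p).1).
split => // s; rewrite e.
elim: P {sm e} => [|p P [M M0 hM]].
  by exists 0 => // x; rewrite big_nil normr0 mul0r.
have [N N0 hN] := (wave_smooth p.2 A0).2 s.
exists (nC p.1 * N + M); first by rewrite addr_ge0 ?mulr_ge0.
move=> x; rewrite big_cons mulrDl (le_trans (ler_normD _ _))// lerD ?hM//.
by rewrite (sF p).2 normC_mul -mulrA ler_wpM2l.
Qed.

Lemma packet_schwartz A P : 0 < A -> schwartz (packet A P).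
Proof.
move=> A0; have [sm h] := packet_smooth P A0; split => // k s.
have [M M0 hM] := h s; have [N N0 hN] := gam_decay k (divr_gt0 A0 (ltr0n _ 2)).
exists (M * N) => x.
apply: (@le_trans _ _ (`|x| ^+ k * (M * gam (A / 2) x))); first by rewrite ler_wpM2l ?exprn_ge0.
by rewrite mulrCA ler_wpM2l.
Qed.

Lemma packet_iter_cintg A P s : 0 < A -> cintg mu (iter_partial s (packet A P)).
Proof.
move=> A0; have [sm h] := packet_smooth P A0; have [M M0 hM] := h s.
apply: (cintg_dom _ (intgZ M (gam_intg (divr_gt0 A0 (ltr0n _ 2))))) => //.
apply: ccont_cmeas; apply: smooth_ccont => s' x.
by rewrite -iter_partial_cat; exact: sm.
Qed.

Lemma fourier_packet A P xi : 0 < A -> fourier (packet A P) xi =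
  \sum_(p <- P) p.1 * rC ((Num.sqrt A)^-1 ^+ d * gam A^-1 (p.2 - xi)).
Proof.
move=> A0; transitivity (cI mu (fun x => \sum_(p <- P) p.1 * wave A (p.2 - xi) x)).
  congr (cI _ _); apply/funext => x; rewrite /packet mulr_suml; apply: eq_bigr => p _.
  by rewrite -mulrA wave_cis.
rewrite cI_sum => [|p]; last exact: cintgZ (wave_cintg _ A0).1.
by apply: eq_bigr => p _; rewrite cIZ ?(wave_cintg _ A0).2//; exact: (wave_cintg _ A0).1.
Qed.

End waves.

(** * Smooth cut-offs *)

Section bumps.
Variables (R : realType).
Local Notation C := (Rcomplex R).
Local Notation nC z := (`|(z : C)|).

(** For [n > 0] this is positive exactly on []a, b[]. The parameter [n] does not move the support
    but steepens the edges, so that the limit is an indicator. *)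
Definition bump (n a b t : R) : R := flat 1 (n * t + - (n * a)) * flat 1 (- n * t + n * b).

Lemma flat1_01 (t : R) : 0 <= flat 1 t <= 1.
Proof.
rewrite /flat; case: ifP => [t0|_]; last by rewrite lexx ler01.
by rewrite hornerC mul1r expR_ge0 -[leRHS]expR0 ler_expR oppr_le0 invr_ge0 ltW.
Qed.

Lemma flat1_le0 (t : R) : t <= 0 -> flat 1 t = 0.
Proof. by move=> t0; rewrite /flat ltNge t0. Qed.

Lemma bump_01 n a b t : 0 <= bump n a b t <= 1.
Proof.
have /andP[a1 a2] := flat1_01 (n * t + - (n * a)).
have /andP[b1 b2] := flat1_01 (- n * t + n * b).
by rewrite mulr_ge0//= mulr_ile1.
Qed.

Lemma bump_out n a b t : 0 <= n -> ~~ (a < t < b) -> bump n a b t = 0.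
Proof.
move=> n0; rewrite negb_and -!leNgt => /orP[h|h]; rewrite /bump.
  by rewrite flat1_le0 ?mul0r//; nra.
by rewrite [X in _ * X]flat1_le0 ?mulr0//; nra.
Qed.

Lemma flat1_cvg (u : nat -> R) (c : R) : 0 < c -> (\forall n \near \oo, c * n%:R <= u n) ->
  (fun n => flat 1 (u n)) @ \oo --> (1 : R).
Proof.
(* Here [exp (- 1 / u) >= 1 - 1 / u], and the factor 2 comes from [n + 1 <= 2 n]. *)
move=> c0 hu; apply: (@squeeze_cvgr _ _ _ _ (fun n => 1 - 2 / c * harmonic n) (cst 1)).
- near=> n.
  have n0 : 1 <= n%:R :> R by rewrite ler1n; near: n; exists 1%N.
  have un : c * n%:R <= u n by near: n.
  have u0 : 0 < u n by apply: lt_le_trans un; rewrite mulr_gt0//; lra.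
  have /andP[_ ->] := flat1_01 (u n); rewrite andbT /flat u0 hornerC mul1r.
  apply: le_trans (expR_ge1Dx _); rewrite lerD2l lerN2.
  rewrite -[leLHS]mul1r ler_pdivrMr// /harmonic /=.
  have n1 : 0 < n.+1%:R :> R by rewrite ltr0n.
  have -> : 2 / c * n.+1%:R^-1 * u n = (2 * u n) / (c * n.+1%:R).
    by field; rewrite !gt_eqF.
  rewrite ler_pdivlMr ?mulr_gt0// mul1r -natr1; nra.
- rewrite -[X in _ --> X]subr0 -[X in _ - X](mulr0 (2 / c)).
  by apply: cvgB; [exact: cvg_cst|apply: cvgM; [exact: cvg_cst|exact: cvg_harmonic]].
- exact: cvg_cst.
Unshelve. all: by end_near. Qed.

Lemma bump_cvg a b t : (fun n : nat => bump n%:R a b t) @ \oo --> (\1_`]a, b[ t : R).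
Proof.
rewrite indicE; have [h|h] := boolP (a < t < b); last first.
  rewrite memNset /=; last by rewrite in_itv /=; exact/negP.
  by apply: cvg_near_cst; near=> n; rewrite bump_out.
rewrite mem_set /= ?in_itv//; have /andP[h1 h2] := h.
rewrite -[X in _ --> X]mulr1 /bump; apply: cvgM.
  apply: (@flat1_cvg _ (t - a)); first by rewrite subr_gt0.
  by near=> n; lra.
apply: (@flat1_cvg _ (b - t)); first by rewrite subr_gt0.
by near=> n; lra.
Unshelve. all: by end_near. Qed.

Lemma bump_cvg1 t : (fun n : nat => bump n%:R (- n%:R) n%:R t) @ \oo --> (1 : R).
Proof.
rewrite -[X in _ --> X]mulr1 /bump; apply: cvgM; apply: (@flat1_cvg _ 1) => //.
  near=> n; have : `|t| + 1 <= n%:R by near: n; exact: nbhs_infty_ger.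
  by have := ler_norm t; have := ler_norm (- t); rewrite normrN; nra.
near=> n; have : `|t| + 1 <= n%:R by near: n; exact: nbhs_infty_ger.
by have := ler_norm t; have := ler_norm (- t); rewrite normrN; nra.
Unshelve. all: by end_near. Qed.

Section space.
Variable d : nat.
Local Notation E := 'rV[R]_d.

Lemma test_bump (n : R) (a b : 'I_d -> R) (g : 'I_d -> R -> C) : 0 <= n ->
  (forall i, exists2 U, U 0%N = g i & jet U) ->
  test_function (fun x : E => \prod_i (rC (bump n (a i) (b i) (x ord0 i)) * g i (x ord0 i))).
Proof.
move=> n0 hg.
have /boolp.choice[W hW] (i : 'I_d) : exists W : nat -> R -> C,
    W 0%N = (fun t => rC (bump n (a i) (b i) t) * g i t) /\ jet W.
  have [U U0 jU] := hg i.
  have [V1 [e1 j1]] := jet_flat n (- (n * a i)).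
  have [V2 [e2 j2]] := jet_flat (- n) (n * b i).
  have [V [e jV]] := jetM j1 j2.
  have [W [eW jW]] := jetM jV jU.
  exists W; split => //; rewrite eW e e1 e2 U0; apply/funext => t.
  by rewrite /bump rCM.
have -> : (fun x : E => \prod_i (rC (bump n (a i) (b i) (x ord0 i)) * g i (x ord0 i))) =
    jprod W (fun=> 0%N).
  by apply/funext => x; apply: eq_bigr => i _; have [-> _] := hW i.
split; first by apply: smooth_jprod => i; have [] := hW i.
pose N := \sum_i (`|a i| + `|b i|).
exists [set x : E | `|x| <= N]; first exact: bounded_compact_rV.
move=> x /= /negP; rewrite -ltNge => Nx.
have N0 : 0 <= N by apply: sumr_ge0 => i _; rewrite addr_ge0.
have [i hi] := norm_rV_gt N0 Nx.
rewrite /jprod (bigD1 i)//= (hW i).1 bump_out ?mul0r//.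
have : `|a i| + `|b i| <= N.
  by rewrite /N (bigD1 i)//= lerDl; apply: sumr_ge0 => j _; rewrite addr_ge0.
move=> h; apply/negP => /andP[h1 h2].
have := ler_norm (b i); have := ler_norm (- a i); rewrite normrN => h3 h4.
have : `|x ord0 i| <= N by rewrite ler_norml; apply/andP; split; have := normr_ge0 (a i); have := normr_ge0 (b i); lra.
by rewrite leNgt hi.
Qed.

End space.
End bumps.

(** * An integrable function orthogonal to all cut-offs vanishes almost everywhere *)

Section du_bois_reymond.
Variables (R : realType) (d : nat).
Local Notation C := (Rcomplex R).
Local Notation E := 'rV[R]_d.
Local Notation nC z := (`|(z : C)|).
Local Notation mu := (lebesgue_rV R d).
Local Notation intg m f := (m.-integrable setT (fun x => (f x)%:E)).
Implicit Types (a b : 'I_d -> R) (h : E -> R).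

Definition bb (n : R) a b (x : E) : R := \prod_i bump n (a i) (b i) (x ord0 i).

Lemma bb_01 n a b x : 0 <= bb n a b x <= 1.
Proof.
apply/andP; split; first by apply: prodr_ge0 => i _; have /andP[] := bump_01 n (a i) (b i) (x ord0 i).
by apply: prodr_ile1 => i _; exact: bump_01.
Qed.

Lemma cvg_prod (I : Type) (r : seq I) (F : I -> nat -> R) (l : I -> R) :
  (forall i, F i @ \oo --> l i) ->
  (fun n => \prod_(i <- r) F i n) @ \oo --> \prod_(i <- r) l i.
Proof.
move=> h; elim: r => [|i r IH].
  by rewrite big_nil; under eq_fun do rewrite big_nil; exact: cvg_cst.
rewrite big_cons; under eq_fun do rewrite big_cons.
by apply: cvgM; [exact: h|exact: IH].
Qed.

Definition obox a b : set E := [set x | forall i, `]a i, b i[%classic (x ord0 i)].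

Lemma bb_cvg a b x : (fun n : nat => bb n%:R a b x) @ \oo --> (\1_(obox a b) x : R).
Proof.
have -> : (\1_(obox a b) x : R) = \prod_i \1_`]a i, b i[ (x ord0 i).
  rewrite indicE; have [h|h] := pselect (obox a b x).
    by rewrite mem_set// big1// => i _; rewrite indicE mem_set//; exact: h.
  rewrite memNset//; move/existsNP : h => [i hi].
  by rewrite (bigD1 i)//= indicE memNset// mul0r.
by apply: cvg_prod => i; exact: bump_cvg.
Qed.

Lemma bb_test (n : R) a b : 0 <= n -> test_function (fun x : E => rC (bb n a b x)).
Proof.
move=> n0.
have := @test_bump R d n a b (fun _ _ => 1) n0.
have -> : (fun x : E => \prod_i (rC (bump n (a i) (b i) (x ord0 i)) * 1)) = (fun x => rC (bb n a b x)).
  apply/funext => x; rewrite /bb rC_prod; apply: eq_bigr => i _; exact: mulr1.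
apply=> i; exists (fun k _ => if k == 0%N then 1 else 0) => // k t; split => /=.
  by case: k => [|k] /=; exact: is_derive_cst.
by case: k => [|k] /=; exact: is_derive_cst.
Qed.

Lemma obox_measurable a b : measurable (obox a b).
Proof.
apply: (measurable_box (A := fun i => `]a i, b i[%classic)) => i; exact: measurable_itv.
Qed.

(** It is enough that each coordinate be measurable for the sigma-algebra of boxes: a strip is a
    countable union of growing boxes. *)
Lemma obox_gen : (measurable : set (set E)) `<=` <<s [set A | exists a b, A = obox a b] >>.
Proof.
apply: smallest_sub; first exact: smallest_sigma_algebra.
move=> A; rewrite -bigcup_seq => -[i _ [Y mY <-]]; rewrite setTI.
set G := [set A | _].
pose T := g_sigma_algebraType G.
suff : measurable_fun (setT : set T) (fun x : T => (x : E) ord0 i).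
  by move=> /(_ measurableT Y mY); rewrite setTI.
apply: (measurability _ (RGenOpens.measurableE R)) => //.
move=> _ [_ [u [v ->] <-]]; rewrite setTI.
have -> : (fun x : T => (x : E) ord0 i) @^-1` `]u, v[%classic =
    \bigcup_(k : nat) obox (fun j => if j == i then u else - k%:R) (fun j => if j == i then v else k%:R).
  apply/seteqP; split => [x /= hx|x [k _] /= /(_ i)]; last by rewrite eqxx.
  exists (Num.truncn (`|(x : E)|)).+1 => // j /=; case: eqP => [->//|_].
  rewrite in_itv /= -ltr_norml; apply: le_lt_trans (ler_entry _ _) _.
  exact: truncnS_gt.
apply: bigcup_measurable => k _; apply: sub_sigma_algebra.
by eexists; eexists.
Qed.

Lemma obox_setI a b a' b' : obox a b `&` obox a' b' =
  obox (fun i => Num.max (a i) (a' i)) (fun i => Num.min (b i) (b' i)).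
Proof.
apply/seteqP; split => x /=.
  move=> [h1 h2] i; have := h1 i; have := h2 i; rewrite /= !in_itv /=.
  by move=> /andP[? ?] /andP[? ?]; rewrite gt_max lt_min; apply/and3P; split => //; apply/andP.
move=> h; split => i; have := h i; rewrite /= !in_itv /= gt_max lt_min.
  by move=> /andP[/andP[-> _] /andP[-> _]].
by move=> /andP[/andP[_ ->] /andP[_ ->]].
Qed.

Lemma Rintegral_obox h a b : intg mu h ->
  (forall n : nat, \int[mu]_x (h x * bb n%:R a b x) = 0) ->
  \int[mu]_x (h x * \1_(obox a b) x) = 0.
Proof.
move=> ih h0; have mh := intg_meas ih.
have [||||_ c1] := @Rintegral_dct _ _ _ mu (fun (n : nat) x => h x * bb n%:R a b x)
   (fun x => h x * \1_(obox a b) x) (fun x => `|h x|).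
- move=> n; apply: measurable_funM => //.
  by have [m _] := ccont_cmeas (smooth_ccont (bb_test a b (ler0n R n)).1).
- by move=> x; apply: cvgM; [exact: cvg_cst|exact: bb_cvg].
- exact: (integrable_abse ih).
- move=> n x; rewrite normrM ler_piMr// ger0_norm; first by have /andP[] := bb_01 n%:R a b x.
  by have /andP[] := bb_01 n%:R a b x.
move: c1; under eq_fun do rewrite h0; move=> c1.
exact: (cvg_unique _ c1 (cvg_cst _)).
Qed.

(** The measurable sets over which [h] has integral 0 form a lambda-system. It contains the open
    boxes, which are stable under intersection and generate the Borel sets. *)
Lemma Rintegral_ind_sets h : intg mu h ->
  (forall a b (n : nat), \int[mu]_x (h x * bb n%:R a b x) = 0) ->
  forall A : set E, measurable A -> \int[mu]_x (h x * \1_A x) = 0.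
Proof.
move=> ih h0; have mh := intg_meas ih.
have iA (A : set E) : measurable A -> intg mu (fun x => h x * \1_A x).
  move=> mA; apply: (intg_dom _ (integrable_abse ih)).
    by apply: measurable_funM => //; exact: measurable_indic.
  move=> x; rewrite normrM ler_piMr// indicE ger0_norm//; by case: (_ \in _).
have dct (F : (set E)^nat) : (forall n, measurable (F n)) -> nondecreasing_seq F ->
    (forall n, \int[mu]_x (h x * \1_(F n) x) = 0) -> \int[mu]_x (h x * \1_(\bigcup_n F n) x) = 0.
  move=> mF ndF F0.
  have [||||_ c1] := @Rintegral_dct _ _ _ mu (fun (n : nat) x => h x * \1_(F n) x)
     (fun x => h x * \1_(\bigcup_n F n) x) (fun x => `|h x|).
  - by move=> n; apply: measurable_funM => //; exact: measurable_indic.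
  - move=> x; apply: cvgM; first exact: cvg_cst.
    apply: cvg_near_cst; have [[k _ Fk]|nF] := pselect ((\bigcup_n F n) x).
      near=> n; rewrite !indicE !mem_set//; first by exists k.
      have : (F k `<=` F n)%classic by apply/subsetPset/ndF; near: n; exact: nbhs_infty_ge.
      exact.
    near=> n; rewrite !indicE !memNset// => Fn; by apply: nF; exists n.
  - exact: (integrable_abse ih).
  - move=> n x; rewrite normrM ler_piMr// indicE ger0_norm//; by case: (_ \in _).
  move: c1; under eq_fun do rewrite F0; move=> c1.
  exact: (cvg_unique _ c1 (cvg_cst _)).
have box0 a b := Rintegral_obox ih (h0 a b).
pose H := [set A : set E | measurable A /\ \int[mu]_x (h x * \1_A x) = 0].
have HT : H setT.
  split; first exact: measurableT.
  have e : setT = \bigcup_(n : nat) obox (fun=> - n%:R) (fun=> n%:R).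
    apply/seteqP; split => // x _; exists (Num.truncn (`|x|)).+1 => // j /=.
    rewrite in_itv /= -ltr_norml; apply: le_lt_trans (ler_entry _ _) _.
    exact: truncnS_gt.
  under eq_Rintegral do rewrite [X in \1_X]e.
  apply: dct => //; first by move=> n; exact: obox_measurable.
  move=> n k nk; apply/subsetPset => x hx i; have := hx i; rewrite /= !in_itv /=.
  have : n%:R <= k%:R :> R by rewrite ler_nat.
  by move=> ? /andP[? ?]; apply/andP; split; lra.
have lam : lambda_system setT H.
  split; [by move=> A _|exact: HT| |].
  - move=> A B BA [mA A0] [mB B0]; split; first exact: measurableD.
    have e x : h x * \1_(A `\` B) x = h x * \1_A x - h x * \1_B x.
      rewrite -mulrBr !indicE in_setD; congr (_ * _).
      case: (boolP (x \in B)) => xB /=; last by rewrite andbT subr0.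
      by rewrite (mem_set (BA _ (set_mem xB))) subrr.
    by under eq_Rintegral do rewrite e; rewrite RintegralB//= ?A0 ?B0 ?subrr//; exact: iA.
  - move=> F ndF HF; split; first by apply: bigcup_measurable => n _; have [] := HF n.
    by apply: dct => // n; have [] := HF n.
move=> A mA.
suff : H A by case.
apply: (@lambda_system_subset _ [set A | exists a b, A = obox a b] _ setT H lam) => //.
- by move=> _ _ [a [b ->]] [a' [b' ->]]; rewrite obox_setI; eexists; eexists.
- by move=> _ [a [b ->]]; split; [exact: obox_measurable|exact: box0].
- exact: obox_gen.
Unshelve. all: by end_near. Qed.

Lemma ae0_of_bb h : intg mu h ->
  (forall a b (n : nat), \int[mu]_x (h x * bb n%:R a b x) = 0) ->
  {ae mu, forall x, h x = 0}.
Proof.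
move=> ih h0; have := Rintegral_ind_sets ih h0 => hA.
have hA' : forall A : set E, A `<=` setT -> measurable A ->
    (\int[mu]_(x in A) (h x)%:E = \int[mu]_(x in A) 0%:E)%E.
  move=> A _ mA; rewrite integral0 integral_mkcond.
  have e x : (((fun x => (h x)%:E) \_ A) x = (h x * \1_A x)%:E)%E.
    by rewrite patchE indicE; case: (_ \in _); rewrite ?mulr1 ?mulr0.
  under eq_integral do rewrite e.
  have i1 : intg mu (fun x => h x * \1_A x).
    apply: (intg_dom _ (integrable_abse ih)).
      by apply: measurable_funM; [exact: intg_meas ih|exact: measurable_indic].
    move=> x; rewrite normrM ler_piMr// indicE ger0_norm//; by case: (_ \in _).
  have := hA A mA; rewrite /Rintegral => h1.
  by rewrite -[LHS]fineK ?h1//; exact: integrable_fin_num.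
have := integral_ae_eq measurableT ih _ hA'.
move=> /(_ (measurable_cst _)); apply: filterS => x + => /(_ I) [] //.

Qed.

End du_bois_reymond.

(** * The Sobolev space on smooth functions, and bounded representatives *)

Section sobolev_facts.
Variables (R : realType) (d : nat).
Local Notation C := (Rcomplex R).
Local Notation E := 'rV[R]_d.
Local Notation nC z := (`|(z : C)|).
Local Notation mu := (lebesgue_rV R d).
Local Notation intg m f := (m.-integrable setT (fun x => (f x)%:E)).
Implicit Types (f g phi psi : E -> C) (j : 'I_d).

Lemma cintgM_bounded f phi (B : R) : cintg mu f -> cmeas phi -> (forall x, nC (phi x) <= B) ->
  cintg mu (fun x => f x * phi x).
Proof.
move=> cf mp hB; apply: (cintg_dom (u := fun x => B * nC (f x))).
- exact: cmeasM (cintg_cmeas cf) mp.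
- by apply: intgZ; exact: cintg_norm.
- by move=> x; rewrite normC_mul mulrC ler_wpM2r.
Qed.

Lemma cintgM_test f phi : cintg mu f -> test_function phi -> cintg mu (fun x => f x * phi x).
Proof.
move=> cf tp; have [B _ hB] := test_bounded tp.
by apply: (cintgM_bounded cf _ hB); apply: ccont_cmeas; exact: smooth_ccont tp.1.
Qed.

Lemma ae0_of_test f : cintg mu f -> (forall phi, test_function phi -> cI mu (fun x => f x * phi x) = 0) ->
  {ae mu, forall x, f x = 0}.
Proof.
move=> [f1 f2] h.
have a1 : {ae mu, forall x, complex.Re (f x) = 0}.
  apply: (ae0_of_bb f1) => a b n.
  have := h _ (bb_test a b (ler0n R n)) => /(congr1 (@complex.Re R)) /=.
  by move=> <-; apply: eq_Rintegral => x _; rewrite Re_mul /= mulr0 subr0.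
have a2 : {ae mu, forall x, complex.Im (f x) = 0}.
  apply: (ae0_of_bb f2) => a b n.
  have := h _ (bb_test a b (ler0n R n)) => /(congr1 (@complex.Im R)) /=.
  by move=> <-; apply: eq_Rintegral => x _; rewrite Im_mul /= mulr0 add0r.
by apply: filterS2 a1 a2 => x h1 h2; exact: C_eqP.
Qed.

Lemma ae_eq_Rintegral (u v : E -> R) : measurable_fun setT u -> measurable_fun setT v ->
  {ae mu, forall x, u x = v x} -> \int[mu]_x u x = \int[mu]_x v x.
Proof.
move=> mu_ mv uv; rewrite /Rintegral; congr fine.
apply: ae_eq_integral => //; [exact/measurable_EFinP|exact/measurable_EFinP|].
by apply: filterS uv => x + _ => ->.
Qed.

Lemma ae_eq_cI f g : cmeas f -> cmeas g -> {ae mu, forall x, f x = g x} -> cI mu f = cI mu g.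
Proof.
move=> [f1 f2] [g1 g2] fg; apply: C_eqP => /=; apply: ae_eq_Rintegral => //.
  by apply: filterS fg => x ->.
by apply: filterS fg => x ->.
Qed.

Lemma density_unique (v : functional R d) g g' : L1_density v g -> L1_density v g' ->
  {ae mu, forall x, g x = g' x}.
Proof.
move=> [cg eg] [cg' eg'].
have cN : cintg mu (fun x => -1 * g' x) by exact: cintgZ.
suff : {ae mu, forall x, g x + -1 * g' x = 0}.
  by apply: filterS => x /eqP; rewrite mulN1r subr_eq0 => /eqP.
apply: ae0_of_test; first exact: cintgD.
move=> phi tp.
have e : (fun x => (g x + -1 * g' x) * phi x) = (fun x => g x * phi x + -1 * (g' x * phi x)).
  by apply/funext => x; ring.
rewrite e cID ?cIZ; [|exact: cintgM_test|exact: cintgM_test|by apply: cintgZ; exact: cintgM_test].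
have := eg phi tp; rewrite eg'// /regular -!/(cI mu _) => h.
by rewrite [X in _ * X]h mulN1r subrr.
Qed.

Lemma smooth_density j f : smooth f -> cintg mu (partial j f) ->
  L1_density (dpartial j (regular f)) (partial j f).
Proof.
move=> sf ci; split => // phi tp.
by rewrite /dpartial /regular -[RHS]/(cI mu _) cI_parts.
Qed.

Lemma smooth_sobolev f : smooth f -> cintg mu f -> (forall j, cintg mu (partial j f)) ->
  homogeneous_sobolev (regular f).
Proof.
move=> sf cf cp; split; last first.
  by move=> j; exists (partial j f); exact: smooth_density.
split.
  move=> a phi psi tp tq; rewrite /regular -!/(cI mu _).
  rewrite -cIZ; last exact: cintgM_test.
  rewrite -cID; [|by apply: cintgZ; exact: cintgM_test|exact: cintgM_test].
  by congr (cI _ _); apply/funext => x; ring.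
move=> K cK; exists 0%N, (2 * \int[mu]_x nC (f x)) => phi tp _ B hB.
have hB0 x : nC (phi x) <= B by exact: (hB [::] x).
have i1 := cintg_norm cf.
apply: le_trans (cI_le (cintgM_test cf tp) (intgZ B i1) _) _.
  by move=> x; rewrite normC_mul mulrC ler_wpM2r.
by rewrite RintegralZl//; lra.
Qed.

Lemma weak_partialP j (u : functional R d) : homogeneous_sobolev u ->
  L1_density (dpartial j u) (weak_partial j u).
Proof.
move=> [_ /(_ j)[g hg]]; rewrite /weak_partial; case: xgetP => //.
by move=> /(_ g).
Qed.

(** The chosen weak derivatives agree almost everywhere with the classical ones, by uniqueness of
    densities. *)
Lemma smooth_norm f : smooth f -> cintg mu f -> (forall j, cintg mu (partial j f)) ->
  homogeneous_sobolev_norm (regular f) = \sum_(j < d) \int[mu]_x nC (partial j f x).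
Proof.
move=> sf cf cp; apply: eq_bigr => j _.
have hw := weak_partialP j (smooth_sobolev sf cf cp).
have := density_unique hw (smooth_density sf (cp j)) => ae.
apply: ae_eq_Rintegral.
- by apply: cmeas_norm; apply: cintg_cmeas; exact: hw.1.
- by apply: cmeas_norm; exact: cintg_cmeas.
- by apply: filterS ae => x ->.
Qed.

Lemma Lfun_oo_bounded (u : E -> R) : u \in Lfun mu +oo%E ->
  measurable_fun setT u /\ exists B, {ae mu, forall x, `|u x| <= B}.
Proof.
move=> /andP[/set_mem mu_ fu]; split => //.
move: fu => /set_mem; rewrite /= /finite_norm unlock /=.
case: ifPn => [mu0 h|mu0 _].
  have [B hB] := ess_supr_bounded (f := fun x => `|u x|) h.
  by exists B.
(* In this branch the whole space has measure zero and is itself the exceptional set. *)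
exists 0; exists setT; split => //.
by apply/eqP; rewrite -measure_le0 leNgt.
Qed.

(** Setting [m] to 0 where it exceeds its essential bounds gives a function that is bounded at every
    point. *)
Lemma ess_bounded_repr (m : E -> C) : essentially_bounded m ->
  exists m' B, [/\ cmeas m', 0 <= B, forall x, nC (m' x) <= B & {ae mu, forall x, m x = m' x}].
Proof.
move=> [/Lfun_oo_bounded[m1 [B1 h1]] /Lfun_oo_bounded[m2 [B2 h2]]].
pose A := [set x | `|complex.Re (m x)| <= B1] `&` [set x | `|complex.Im (m x)| <= B2].
have mA : measurable A.
  have aux (u : E -> R) (B : R) : measurable_fun setT u -> measurable [set x | `|u x| <= B].
    move=> mu_; have -> : [set x | `|u x| <= B] = u @^-1` `[- B, B].
      by apply/seteqP; split => x /=; rewrite in_itv /= ler_norml.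
    by rewrite -[X in measurable X]setTI; apply: mu_ => //; exact: measurable_itv.
  by apply: measurableI; exact: aux.
exists (fun x => rC (\1_A x) * m x), (`|B1| + `|B2|); split.
- by apply: cmeasM => //; apply: cmeas_real; exact: measurable_indic.
- by rewrite addr_ge0.
- move=> x; rewrite normC_mul normC_real indicE; case: (boolP (x \in A)) => xA.
    rewrite normr1 mul1r; apply: le_trans (normC_ReIm _) _.
    have [/= a1 a2] := set_mem xA.
    by rewrite lerD// (le_trans _ (ler_norm _)).
  by rewrite normr0 mul0r addr_ge0.
- apply: filterS2 h1 h2 => x h1 h2.
  by rewrite indicE mem_set// -[rC _]/(1 : C) mul1r.
Qed.

Definition plane (xi x : E) : C := cis (2 * pi * dot x xi).

Lemma plane_smooth xi : smooth (plane xi) /\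
  forall j x, partial j (plane xi) x = Complex 0 (2 * pi * xi ord0 j) * plane xi x.
Proof.
pose w (i : 'I_d) : R := 2 * pi * xi ord0 i.
pose U (i : 'I_d) (k : nat) (t : R) : C := Complex 0 (w i) ^+ k * cis (w i * t).
have jU i : jet (U i).
  move=> k; have := cderZ (Complex 0 (w i) ^+ k) (cder_cis (w i)).
  by rewrite /U; under [X in cder _ X -> _]eq_fun do rewrite mulrA -exprSr.
have e : plane xi = jprod U (fun=> 0%N).
  apply/funext => x; rewrite /plane /dot mulr_sumr cis_sum; apply: eq_bigr => i _.
  by rewrite /U expr0 mul1r; congr cis; rewrite /w; ring.
split; first by rewrite e; exact: smooth_jprod.
move=> j x; rewrite e; have := iter_jprod [:: j] (fun=> 0%N) jU => /= ->.
rewrite /jprod (bigD1 j)//= [in RHS](bigD1 j)//= mulrA; congr (_ * _).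
  by rewrite eqxx /U /= expr1 expr0 mul1r.
by apply: eq_bigr => i /negbTE ij; rewrite eq_sym ij.
Qed.

Lemma norm_plane xi x : nC (plane xi x) = 1. Proof. exact: normC_cis. Qed.

Lemma measurable_dot2 : measurable_fun setT (fun p : E * E => dot p.1 p.2).
Proof.
apply: measurable_sum => i; apply: measurable_funM.
  exact: (measurableT_comp (measurable_coord i) measurable_fst).
exact: (measurableT_comp (measurable_coord i) measurable_snd).
Qed.

Lemma cmeas_plane2 : cmeas (fun p : E * E => plane p.2 p.1).
Proof. by apply: cmeas_cis; apply: measurable_funM => //; exact: measurable_dot2. Qed.

Lemma cI_plane_parts xi phi j : test_function phi ->
  cI mu (fun x => plane xi x * partial j phi x) =
  - (Complex 0 (2 * pi * xi ord0 j) * cI mu (fun x => plane xi x * phi x)).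
Proof.
move=> tp; have [sp ep] := plane_smooth xi.
apply/eqP; rewrite -eqr_oppLR -cI_parts//; apply/eqP.
have bp : cintg mu (fun x => plane xi x * phi x).
  have := cintgM_bounded (test_cintg tp) (ccont_cmeas (smooth_ccont sp)) (fun x => _ : _ <= 1).
  under eq_fun do rewrite mulrC; apply => x; by rewrite norm_plane.
rewrite -cIZ//; congr (cI _ _); apply/funext => x; rewrite ep; ring.
Qed.

Lemma inverse_fourier_pair (W phi : E -> C) : cintg mu W -> cintg mu phi ->
  cI mu (fun x => inverse_fourier W x * phi x) =
  cI mu (fun xi => W xi * cI mu (fun x => plane xi x * phi x)).
Proof.
move=> cW cp.
pose F (p : E * E) := (W p.2 * plane p.2 p.1) * phi p.1.
have mF : cmeas F.
  apply: cmeasM; last exact: (cmeas_comp (cintg_cmeas cp) measurable_fst).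
  apply: cmeasM; last exact: cmeas_plane2.
  exact: (cmeas_comp (cintg_cmeas cW) measurable_snd).
have iF : cintg (mu \x mu)%E F.
  apply: (cintg_prod mF (cintg_norm cp) (cintg_norm cW)) => x xi.
  by rewrite /F !normC_mul norm_plane mulr1 mulrC.
have [_ _ e1 e2] := cI_fubini iF.
transitivity (cI mu (fun x => cI mu (fun xi => F (x, xi)))).
  congr (cI _ _); apply/funext => x; rewrite /inverse_fourier -/(cI mu _) mulrC -cIZ.
    by congr (cI _ _); apply/funext => xi; rewrite /F /= mulrC.
  apply: (cintgM_bounded (B := 1) cW).
    by have := cmeas_comp cmeas_plane2 (pair1_measurable x).
  by move=> xi; rewrite normC_cis.
rewrite e1 -e2; congr (cI _ _); apply/funext => xi.
rewrite /F /= -cIZ; first by congr (cI _ _); apply/funext => x; rewrite mulrA.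
have := cintgM_bounded (B := 1) cp (ccont_cmeas (smooth_ccont (plane_smooth xi).1)).
under eq_fun do rewrite mulrC; apply => x; by rewrite norm_plane.
Qed.

End sobolev_facts.

(** * Gaussian approximate identities *)

Section averages.
Variables (R : realType) (d : nat).
Local Notation C := (Rcomplex R).
Local Notation E := 'rV[R]_d.
Local Notation nC z := (`|(z : C)|).
Local Notation mu := (lebesgue_rV R d).
Local Notation intg m f := (m.-integrable setT (fun x => (f x)%:E)).

Lemma gs_anti (A B t : R) : A <= B -> gs B t <= gs A t.
Proof.
move=> AB; rewrite ler_expR lerN2 ler_wpM2r ?sqr_ge0//.
by rewrite ler_wpM2l ?pi_ge0.
Qed.

Lemma sqr_gs_le (b t : R) : 0 < b -> t ^+ 2 * gs b t <= b^-1 * gs (b / 2) t.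
Proof.
move=> b0; rewrite ler_pdivlMl// mulrA.
have -> : gs b t = gs (b / 2) t * gs (b / 2) t.
  by rewrite /gs -expRD; congr expR; field.
rewrite mulrA ler_piMl ?gs_ge0//.
have h : b * t ^+ 2 <= expR (pi * (b / 2) * t ^+ 2).
  have p1 : 1 <= pi / 2 :> R by have := @pi_ge2 R; lra.
  apply: le_trans (expR_ge1Dx _).
  have : 0 <= b * t ^+ 2 by rewrite mulr_ge0 ?sqr_ge0// ltW.
  by have := p1; nra.
apply: le_trans (ler_wpM2r (gs_ge0 _ _) h) _.
by rewrite /gs -expRD addrN expR0.
Qed.

Lemma coord_gam_le (f : R -> R) (c b : R) (i : 'I_d) (x : E) : 0 < b -> 0 <= c ->
  (forall t, 0 <= f t) -> (forall t, f t * gs b t <= c * gs (b / 2) t) ->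
  f (x ord0 i) * gam b x <= c * gam (b / 2) x.
Proof.
move=> b0 c0 f0 h; rewrite /gam (bigD1 i)//= [in leRHS](bigD1 i)//= !mulrA.
apply: ler_pM.
- by rewrite mulr_ge0 ?gs_ge0.
- by apply: prodr_ge0 => j _; exact: gs_ge0.
- exact: h.
- by apply: ler_prod => j _; rewrite gs_ge0 gs_anti//; lra.
Qed.

Lemma norm_sqr_le (v : E) : `|v| ^+ 2 <= \sum_i v ord0 i ^+ 2.
Proof.
rewrite leNgt; apply/negP => h.
have s0 : 0 <= \sum_i v ord0 i ^+ 2 by apply: sumr_ge0 => i _; exact: sqr_ge0.
have : Num.sqrt (\sum_i v ord0 i ^+ 2) < `|v|.
  by rewrite -[ltRHS]ger0_norm// -sqrtr_sqr ltr_sqrt// (le_lt_trans s0 h).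
move=> hv; have [i hi] := norm_rV_gt (sqrtr_ge0 _) hv; move: hi; apply/negP; rewrite -leNgt -sqrtr_sqr ler_sqrt//.
by rewrite (bigD1 i)//= lerDl; apply: sumr_ge0 => j _; exact: sqr_ge0.
Qed.

(** The kernel concentrates at [u] as [b] grows. Linear growth is allowed because this is applied to
    [m xi_l]. Away from [u] the difference of values is at most quadratic in [z - u], and the mean
    of this quadratic under the kernel is of order [1 / b]. *)
Lemma gauss_average (W : E -> C) (K : R) (u : E) : cmeas W -> 0 <= K ->
  (forall z, nC (W z) <= K * (1 + `|z|)) ->
  (forall e, 0 < e -> exists2 h, 0 < h & forall z, `|z - u| < h -> nC (W z - W u) < e) ->
  forall e, 0 < e -> exists2 b0, 0 < b0 & forall b, b0 <= b ->
    cintg mu (fun z => W z * rC (Num.sqrt b ^+ d * gam b (z - u))) /\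
    nC (cI mu (fun z => W z * rC (Num.sqrt b ^+ d * gam b (z - u))) - W u) < e.
Proof.
move=> mW K0 hK cW e e0.
(* A quarter of [e] for the near part and a quarter for the far part, since [cI_le] doubles the
   sum. *)
have e40 : 0 < e / 4 by lra.
have [h h0 hh] := cW _ e40.
pose L := K * ((2 + 2 * `|u|) / h ^+ 2 + h^-1).
have L0 : 0 <= L by rewrite mulr_ge0// addr_ge0 ?divr_ge0 ?addr_ge0 ?mulr_ge0 ?invr_ge0 ?sqr_ge0// ltW.
have bW z : nC (W z - W u) <= e / 4 + L * \sum_i (z - u) ord0 i ^+ 2.
  have := norm_sqr_le (z - u); set s := \sum_i _ => hs.
  have s0 : 0 <= s by apply: le_trans hs; exact: sqr_ge0.
  have [zh|zh] := ltP `|z - u| h.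
    apply: (le_trans (ltW (hh _ zh))).
    by rewrite lerDl mulr_ge0.
  apply: (@le_trans _ _ (L * s)); last by rewrite lerDr ltW.
  apply: (@le_trans _ _ (L * `|z - u| ^+ 2)); last by rewrite ler_wpM2l.
  rewrite (le_trans (ler_normB _ _))// (le_trans (lerD (hK z) (hK u)))//.
  rewrite -mulrDr /L -mulrA ler_wpM2l//.
  have zu : `|z| <= `|z - u| + `|u| by rewrite -{1}(subrK u z) ler_normD.
  have r1 : 1 <= `|z - u| / h by rewrite ler_pdivlMr// mul1r.
  have -> : ((2 + 2 * `|u|) / h ^+ 2 + h^-1) * `|z - u| ^+ 2 =
      (2 + 2 * `|u|) * (`|z - u| / h) ^+ 2 + `|z - u| * (`|z - u| / h).
    by field; rewrite gt_eqF.
  have r2 : 1 <= (`|z - u| / h) ^+ 2 by rewrite expr_ge1// (le_trans ler01).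
  have n1 := normr_ge0 u; have n2 := normr_ge0 (z - u).
  have : `|z - u| <= `|z - u| * (`|z - u| / h) by rewrite ler_peMr.
  have : 2 + 2 * `|u| <= (2 + 2 * `|u|) * (`|z - u| / h) ^+ 2 by rewrite ler_peMr// addr_ge0 ?mulr_ge0.
  lra.
(* [Num.sqrt 2 ^+ d] is the mass of the kernel once its exponent has been halved to absorb the
   quadratic factor. *)
pose D := L * d%:R * Num.sqrt 2 ^+ d.
have D0 : 0 <= D by rewrite mulr_ge0 ?exprn_ge0 ?sqrtr_ge0// mulr_ge0.
have De : 0 <= 4 * D / e by apply: divr_ge0 (ltW e0); exact: mulr_ge0.
exists (4 * D / e + 1); first by rewrite ltr_wpDl.
move=> b hb.
have b0 : 0 < b by apply: lt_le_trans hb; rewrite ltr_wpDl.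
have b20 : 0 < b / 2 by rewrite divr_gt0.
have sb0 : 0 <= Num.sqrt b ^+ d by rewrite exprn_ge0 ?sqrtr_ge0.
pose kb z := Num.sqrt b ^+ d * gam b (z - u).
pose k2 z := Num.sqrt b ^+ d * gam (b / 2) (z - u).
have kb0 z : 0 <= kb z by rewrite mulr_ge0 ?gam_ge0.
have [ik Ik] := gam_int u b0; have [ik2 Ik2] := gam_int u b20.
have ikb : intg mu kb by exact: intgZ.
have ikb2 : intg mu k2 by exact: intgZ.
have Ikb : \int[mu]_z kb z = 1.
  by rewrite /kb RintegralZl// Ik -exprMn mulfV ?expr1n// gt_eqF// sqrtr_gt0.
have Ikb2 : \int[mu]_z k2 z = Num.sqrt 2 ^+ d.
  rewrite /k2 RintegralZl// Ik2 -exprMn; congr (_ ^+ d).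
  by rewrite sqrtrM ?(ltW b0)// sqrtrV// invfM invrK mulrA mulfV ?mul1r// gt_eqF// sqrtr_gt0.
have hk z : nC (W z - W u) * kb z <= e / 4 * kb z + L * d%:R / b * k2 z.
  apply: le_trans (ler_wpM2r (kb0 z) (bW z)) _.
  rewrite mulrDl lerD2l -[leLHS]mulrA -(mulrA L) -mulrA ler_wpM2l//.
  rewrite /kb /k2 mulrCA [leRHS]mulrCA ler_wpM2l// mulr_suml.
  apply: (@le_trans _ _ (\sum_(i < d) b^-1 * gam (b / 2) (z - u))).
    apply: ler_sum => i _.
    apply: (@coord_gam_le (fun t => t ^+ 2) b^-1 b i (z - u)) => //.
    - by rewrite invr_ge0 ltW.
    - by move=> t; exact: sqr_ge0.
    - by move=> t; exact: sqr_gs_le.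
  by rewrite sumr_const card_ord -[leLHS]mulr_natl mulrA.
have i3 : intg mu (fun z => e / 4 * kb z + L * d%:R / b * k2 z).
  under eq_fun do rewrite EFinD.
  by apply: integrableD => //; [exact: intgZ ikb|exact: intgZ ikb2].
have mkb : cmeas (fun z => rC (kb z)) by apply: cmeas_real; exact: intg_meas ikb.
have c1 : cintg mu (fun z => (W z + -1 * W u) * rC (kb z)).
  apply: (cintg_dom _ i3).
    by apply: cmeasM => //; apply: cmeasD => //; exact: cmeas_cst.
  by move=> z; rewrite normC_mul normC_real (ger0_norm (kb0 z)) mulN1r.
have c2 : cintg mu (fun z => W u * rC (kb z)) by apply: cintgZ; exact: cintg_real.
have eW z : W z * rC (kb z) = (W z + -1 * W u) * rC (kb z) + W u * rC (kb z) by ring.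
have -> : (fun z => W z * rC (Num.sqrt b ^+ d * gam b (z - u))) =
    (fun z => (W z + -1 * W u) * rC (kb z) + W u * rC (kb z)).
  by apply/funext => z; rewrite -eW.
split; first exact: cintgD.
rewrite cID// (cIZ (W u)); last exact: cintg_real.
rewrite cI_real Ikb mulr1 addrK.
apply: (le_lt_trans (cI_le c1 i3 _)).
  by move=> z; rewrite normC_mul normC_real (ger0_norm (kb0 z)) mulN1r.
rewrite RintegralD//; [|exact: intgZ ikb|exact: intgZ ikb2].
have -> : \int[mu]_x (e / 4 * kb x) = e / 4.
  by rewrite RintegralZl// -[RHS]mulr1; congr (_ * _); exact: Ikb.
have -> : \int[mu]_x (L * d%:R / b * k2 x) = L * d%:R / b * Num.sqrt 2 ^+ d.
  by rewrite RintegralZl//; congr (_ * _); exact: Ikb2.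
have : L * d%:R / b * Num.sqrt 2 ^+ d < e / 4.
  have -> : L * d%:R / b * Num.sqrt 2 ^+ d = D / b by rewrite /D; ring.
  rewrite ltr_pdivrMr// -ltr_pdivrMl//.
  have -> : (e / 4)^-1 * D = 4 * D / e by field; rewrite gt_eqF.
  by apply: lt_le_trans hb; rewrite ltrDl.
lra.
Qed.

(** A negative value would persist on an open box, and boxes have positive measure. *)
Lemma ae_everywhere (v : E -> R) : continuous v -> {ae mu, forall x, 0 <= v x} -> forall x, 0 <= v x.
Proof.
move=> cv [N [mN N0 hN]] x; rewrite leNgt; apply/negP => vx.
have : \forall y \near x, v y < 0.
  exact: (cv x _ (lt_nbhsl vx)).
move=> /nbhs_ballP[e /= e0 he].
have e2 : 0 < e / 2 by lra.
pose bx := [set y : E | forall i, `]x ord0 i - e / 2, x ord0 i + e / 2[%classic (y ord0 i)].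
have mbx : measurable bx.
  apply: (measurable_box (A := fun i => `]x ord0 i - e / 2, x ord0 i + e / 2[%classic)) => i.
  exact: measurable_itv.
have sub : bx `<=` N.
  move=> y hy; apply: hN => /=; apply/negP; rewrite -ltNge; apply: he.
  rewrite -ball_normE /=; have [//|ey] := ltP `|x - y| e.
  have : e / 2 < `|x - y| by lra.
  move=> hxy; have [i hi] := norm_rV_gt (ltW e2) hxy; move: hi; rewrite !mxE.
  have := hy i; rewrite /= in_itv /= => /andP[h1 h2].
  by rewrite ltNge ler_norml; move/negP; case; apply/andP; split; lra.
have : (mu bx <= mu N)%E by apply: le_measure; rewrite ?inE.
have hbox := lebesgue_rV_box (A := fun i : 'I_d => `]x ord0 i - e / 2, x ord0 i + e / 2[%classic)
  (fun i => measurable_itv _).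
rewrite N0 [mu bx]hbox.
apply/negP; rewrite -ltNge.
rewrite (eq_bigr (fun=> e%:E)); last first.
  move=> i _; rewrite lebesgue_measure_itv /= lte_fin.
  by rewrite ifT -?EFinB; [congr EFin; lra|lra].
apply: (big_ind (fun z => 0 < z)%E) => // a b; exact: mule_gt0.
Qed.

End averages.

(** * Convergence of complex sequences *)

Section complex_limits.
Variable R : realType.
Local Notation C := (Rcomplex R).
Local Notation nC z := (`|(z : C)|).

Lemma ccvg_unique (z : nat -> C) (a b : C) : ccvg z a -> ccvg z b -> a = b.
Proof. by move=> [a1 a2] [b1 b2]; apply: C_eqP; [exact: (cvg_unique _ a1 b1)|exact: (cvg_unique _ a2 b2)]. Qed.

Lemma ccvg_cst (a : C) : ccvg (fun=> a) a.
Proof. by split; exact: cvg_cst. Qed.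

Lemma ccvgM (z w : nat -> C) (a b : C) : ccvg z a -> ccvg w b -> ccvg (fun n => z n * w n) (a * b).
Proof.
move=> [a1 a2] [b1 b2]; split.
  under eq_fun do rewrite Re_mul; rewrite Re_mul; apply: cvgB; exact: cvgM.
under eq_fun do rewrite Im_mul; rewrite Im_mul; apply: cvgD; exact: cvgM.
Qed.

Lemma ccvg_real (u : nat -> R) (a : R) : u @ \oo --> a -> ccvg (fun n => rC (u n)) (rC a).
Proof. by move=> ua; split => //=; exact: cvg_cst. Qed.

Lemma ccvgP (z : nat -> C) (a : C) : (forall e, 0 < e -> \forall n \near \oo, nC (z n - a) < e) <-> ccvg z a.
Proof.
split=> [h|[h1 h2] e e0].
  split; apply/cvgrPdist_lt => e e0; have := h e e0; apply: filterS => n; apply: le_lt_trans.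
    by rewrite distrC; have := normC_Re (z n - a); rewrite Re_add; case: a {h}.
  by rewrite distrC; have := normC_Im (z n - a); rewrite Im_add; case: a {h}.
have e2 : 0 < e / 2 by lra.
move/cvgrPdist_lt : h1 => /(_ _ e2) h1; move/cvgrPdist_lt : h2 => /(_ _ e2) h2.
apply: filterS2 h1 h2 => n; rewrite distrC => h1; rewrite distrC => h2.
apply: le_lt_trans (normC_ReIm _) _.
have -> : complex.Re (z n - a) = complex.Re (z n) - complex.Re a by case: (z n) => ? ?; case: (a).
have -> : complex.Im (z n - a) = complex.Im (z n) - complex.Im a by case: (z n) => ? ?; case: (a).
lra.
Qed.

End complex_limits.

(** * The multiplier tested on wave packets *)

Section identity.
Variables (R : realType) (d : nat).
Local Notation C := (Rcomplex R).
Local Notation E := 'rV[R]_d.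
Local Notation nC z := (`|(z : C)|).
Local Notation mu := (lebesgue_rV R d).
Local Notation intg m f := (m.-integrable setT (fun x => (f x)%:E)).
Implicit Types (P Q : seq (C * E)).

Lemma gamN A (x : E) : gam A (- x) = gam A x.
Proof. by apply: eq_bigr => i _; rewrite mxE /gs sqrrN. Qed.

Lemma gam_sym A (x y : E) : gam A (x - y) = gam A (y - x).
Proof. by rewrite -opprB gamN. Qed.

Lemma gam_anti A B (x : E) : A <= B -> gam B x <= gam A x.
Proof. by move=> AB; apply: ler_prod => i _; rewrite gs_ge0 gs_anti. Qed.

Lemma lin_gam_le A (x : E) l : 0 < A -> `|x ord0 l| * gam A x <= (Num.sqrt A)^-1 * gam (A / 2) x.
Proof.
move=> A0; apply: (@coord_gam_le _ _ (fun t => `|t|)) => // t.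
exact: mul_gs_le.
Qed.

(** A single majorant serves the transform and its products with the coordinates, which arise from
    differentiation. *)
Lemma fourier_packet_bound A P : 0 < A -> cmeas (fourier (packet A P)) /\
  exists2 q, intg mu q & forall xi, nC (fourier (packet A P) xi) <= q xi /\
    forall l, nC (fourier (packet A P) xi) * `|xi ord0 l| <= q xi.
Proof.
move=> A0; have Ai : 0 < A^-1 by rewrite invr_gt0.
pose k := (Num.sqrt A)^-1 ^+ d.
have k0 : 0 <= k by rewrite exprn_ge0// invr_ge0 sqrtr_ge0.
have e : fourier (packet A P) = (fun xi => \sum_(p <- P) p.1 * rC (k * gam A^-1 (p.2 - xi))).
  by apply/funext => xi; exact: fourier_packet.
have ig (p : C * E) B : 0 < B -> intg mu (fun xi => gam B (p.2 - xi)).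
  by move=> B0; under eq_fun do rewrite gam_sym; have [] := gam_int p.2 B0.
rewrite e; split.
  apply: cmeas_sum => p; apply: cmeasM; first exact: cmeas_cst.
  by apply: cmeas_real; apply: intg_meas; apply: intgZ; exact: ig.
elim: P {e} => [|p P [q iq hq]].
  exists (fun=> 0); first exact: integrable0.
  by move=> xi; rewrite big_nil normr0; split => // l; rewrite mul0r.
pose c := nC p.1 * k; have c0 : 0 <= c by rewrite mulr_ge0.
pose D := 1 + (Num.sqrt A^-1)^-1 + `|p.2|.
exists (fun xi => c * D * gam (A^-1 / 2) (p.2 - xi) + q xi).
  under eq_fun do rewrite EFinD.
  by apply: integrableD => //; apply: intgZ; apply: ig; exact: divr_gt0.
move=> xi; have [h1 h2] := hq xi.
set g := \sum_(j <- P) _ in h1 h2.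
have g1 : gam A^-1 (p.2 - xi) <= gam (A^-1 / 2) (p.2 - xi) by apply: gam_anti; lra.
have sA : 0 <= (Num.sqrt A^-1)^-1 by rewrite invr_ge0 sqrtr_ge0.
have gg := gam_ge0 (A^-1 / 2) (p.2 - xi).
have nb : nC (\sum_(j <- p :: P) j.1 * rC (k * gam A^-1 (j.2 - xi))) <= c * gam A^-1 (p.2 - xi) + nC g.
  rewrite big_cons (le_trans (ler_normD _ _))// lerD2r normC_mul normC_real ger0_norm.
    by rewrite mulrA.
  by rewrite mulr_ge0 ?gam_ge0.
split.
  apply: (le_trans nb); apply: lerD => //.
  rewrite -[leRHS]mulrA ler_wpM2l// (le_trans g1)// ler_peMl// /D; have := normr_ge0 p.2; lra.
move=> l; apply: le_trans (ler_wpM2r (normr_ge0 _) nb) _.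
rewrite mulrDl; apply: lerD => //; rewrite -[leLHS]mulrA -[leRHS]mulrA ler_wpM2l//.
have x1 : `|xi ord0 l| <= `|(p.2 - xi) ord0 l| + `|p.2|.
  have := ler_entry p.2 l; rewrite !mxE => h3.
  rewrite -{1}(subKr (p.2 ord0 l) (xi ord0 l)).
  by apply: le_trans (ler_normB _ _) _; rewrite [leLHS]addrC lerD2l.
have := @lin_gam_le A^-1 (p.2 - xi) l Ai => h4.
have g0 := gam_ge0 A^-1 (p.2 - xi).
apply: (@le_trans _ _ (gam A^-1 (p.2 - xi) * (`|(p.2 - xi) ord0 l| + `|p.2|))).
  by rewrite ler_wpM2l.
rewrite mulrDr mulrC (mulrC _ `|p.2|) /D.
have : `|p.2| * gam A^-1 (p.2 - xi) <= `|p.2| * gam (A^-1 / 2) (p.2 - xi) by rewrite ler_wpM2l.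
lra.
Qed.

(** This isolates everything that is taken from the operator [T]: [g l] is the weak derivative of
    index [l] of the image of the packet under [T]. *)
Lemma multiplier_identity (m : E -> C) : sobolev_fourier_multiplier m ->
  exists m' B M, [/\ cmeas m', 0 <= B /\ 0 <= M, forall x, nC (m' x) <= B,
    {ae mu, forall x, m x = m' x} &
    forall P A, 0 < A -> exists g : 'I_d -> E -> C,
    [/\ forall l, cintg mu (g l),
      \sum_l \int[mu]_x nC (g l x) <= M * \sum_j \int[mu]_x nC (partial j (packet A P) x) &
      forall l phi, test_function phi -> cI mu (fun x => g l x * phi x) =
        cI mu (fun xi => (m' xi * fourier (packet A P) xi) *
          (Complex 0 (2 * pi * xi ord0 l) * cI mu (fun x => plane xi x * phi x)))]].
Proof.
move=> [mb [T [[T1 _ _ [M hM]] hT]]].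
have [m' [B [mm' B0 hB mae]]] := ess_bounded_repr mb.
have mm : cmeas m by case: mb => /Lfun_oo_bounded[? _] /Lfun_oo_bounded[? _].
exists m', B, `|M|; split => // P A A0.
set f := packet A P; have [sf _] := packet_smooth P A0.
have cf : cintg mu f := packet_iter_cintg P [::] A0.
have cp j : cintg mu (partial j f) := packet_iter_cintg P [:: j] A0.
have su := smooth_sobolev sf cf cp.
have sT := T1 _ su.
have hg l := weak_partialP l sT.
exists (fun l => weak_partial l (T (regular f))); split.
- by move=> l; have [] := hg l.
- rewrite -(smooth_norm sf cf cp).
  apply: le_trans (hM _ su) _; rewrite ler_wpM2r ?ler_norm//.
  by apply: sumr_ge0 => j _; apply: Rintegral_ge0.
move=> l phi tp.
have [_ eg] := hg l; have {}eg := eg phi tp.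
have [c hc] := hT f (packet_schwartz P A0).
have tp' := test_partial l tp.
have [mf [q iq hq]] := fourier_packet_bound P A0.
pose W xi := m' xi * fourier f xi.
have mW : cmeas W by exact: cmeasM.
have cW : cintg mu W.
  apply: (cintg_dom mW (intgZ B iq)) => xi; rewrite normC_mul.
  by apply: ler_pM => //; exact: (hq xi).1.
have eF : inverse_fourier (fun xi => m xi * fourier f xi) = inverse_fourier W.
  apply/funext => x; apply: ae_eq_cI.
  - apply: cmeasM; first exact: cmeasM.
    by have := cmeas_comp (@cmeas_plane2 R d) (pair1_measurable x).
  - apply: cmeasM => //.
    by have := cmeas_comp (@cmeas_plane2 R d) (pair1_measurable x).
  - by apply: filterS mae => xi ->.
(* This eliminates the unknown additive constant of the class [T f]. *)
have c0 : cI mu (partial l phi) = 0.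
  have [N N0 hN] := test_radius tp.
  apply: (cI_partial0 N0) => //; first by move=> x; exact: smooth_diff tp.1.
  exact: smooth_ccont tp'.1.
have e1 := hc _ tp'; rewrite eF in e1.
rewrite -[LHS]/(regular (weak_partial l (T (regular f))) phi) -eg /dpartial e1.
have r0 : regular (fun=> c) (partial l phi) = 0.
  rewrite -[LHS]/(cI mu (fun x => c * partial l phi x)) cIZ ?c0 ?mulr0//.
  exact: test_cintg.
rewrite r0 addr0 -[X in - X]/(cI mu (fun x => inverse_fourier W x * partial l phi x)).
rewrite inverse_fourier_pair//; last exact: test_cintg.
have -> : (fun xi => W xi * cI mu (fun x => plane xi x * partial l phi x)) =
   (fun xi => -1 * (W xi * (Complex 0 (2 * pi * xi ord0 l) * cI mu (fun x => plane xi x * phi x)))).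
  by apply/funext => xi; rewrite cI_plane_parts//; ring.
rewrite cIZ ?mulN1r ?opprK//.
pose F (p : E * E) := W p.1 * (Complex 0 (2 * pi * p.1 ord0 l) * (plane p.1 p.2 * phi p.2)).
have tpi := test_cintg tp.
have mF : cmeas F.
  apply: cmeasM; first exact: (cmeas_comp mW measurable_fst).
  apply: cmeasM.
    split => /=; first exact: measurable_cst.
    by apply: measurable_funM => //; exact: (measurableT_comp (measurable_coord l) measurable_fst).
  apply: cmeasM; last exact: (cmeas_comp (cintg_cmeas tpi) measurable_snd).
  apply: cmeas_cis; apply: measurable_funM => //.
  apply: measurable_sum => i; apply: measurable_funM.
    exact: (measurableT_comp (measurable_coord i) measurable_snd).
  exact: (measurableT_comp (measurable_coord i) measurable_fst).
have iF : cintg (mu \x mu)%E F.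
  apply: (cintg_prod mF (intgZ (B * (2 * pi)) iq) (cintg_norm tpi)) => xi x.
  rewrite /F /= !normC_mul norm_plane mul1r.
  have -> : nC (Complex 0 (2 * pi * xi ord0 l)) = 2 * pi * `|xi ord0 l|.
    by rewrite normCE /= expr0n add0r sqrtr_sqr normrM ger0_norm// mulr_ge0// pi_ge0.
  rewrite !mulrA ler_wpM2r//.
  have := (hq xi).2 l => h1.
  have pp : 0 <= 2 * pi :> R by rewrite mulr_ge0 ?pi_ge0.
  have -> : `|m' xi| * `|fourier f xi| * 2 * pi * `|xi ord0 l| =
    nC (m' xi) * ((2 * pi) * (nC (fourier f xi) * `|xi ord0 l|)) by ring.
  rewrite -[leRHS]mulrA -[leRHS]mulrA; apply: ler_pM => //; first by rewrite mulr_ge0// mulr_ge0.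
  by rewrite [leRHS]mulrA ler_wpM2l.
have [h _ _ _] := cI_fubini iF.
suff -> : (fun xi => W xi * (Complex 0 (2 * pi * xi ord0 l) * cI mu (fun x => plane xi x * phi x))) =
   (fun xi => cI mu (fun x => F (xi, x))) by [].
apply/funext => xi; rewrite /F /=.
have ip : cintg mu (fun x => plane xi x * phi x).
  have := cintgM_bounded (B := 1) tpi (ccont_cmeas (smooth_ccont (plane_smooth xi).1)).
  by under eq_fun do rewrite mulrC; apply => x; rewrite norm_plane.
by rewrite -cIZ// -cIZ//; exact: cintgZ.
Qed.

End identity.

(** * Fourier transforms of the L1 derivatives *)

Section limits.
Variables (R : realType) (d : nat).
Local Notation C := (Rcomplex R).
Local Notation E := 'rV[R]_d.
Local Notation nC z := (`|(z : C)|).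
Local Notation mu := (lebesgue_rV R d).
Local Notation intg m f := (m.-integrable setT (fun x => (f x)%:E)).

Lemma cvg_sumR (I : Type) (r : seq I) (F : I -> nat -> R) (l : I -> R) :
  (forall i, F i @ \oo --> l i) ->
  (fun n => \sum_(i <- r) F i n) @ \oo --> \sum_(i <- r) l i.
Proof.
move=> h; elim: r => [|i r IH].
  by rewrite big_nil; under eq_fun do rewrite big_nil; exact: cvg_cst.
rewrite big_cons; under eq_fun do rewrite big_cons.
by apply: cvgD; [exact: h|exact: IH].
Qed.

Lemma cintgM_boundedl (f phi : E -> C) (B : R) : cintg mu f -> cmeas phi ->
  (forall x, nC (phi x) <= B) -> cintg mu (fun x => phi x * f x).
Proof.
move=> cf mp hB; rewrite (_ : (fun x => _) = (fun x => f x * phi x)).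
  exact: cintgM_bounded hB.
by apply/funext => x; rewrite mulrC.
Qed.

Lemma cintg_plane (f : E -> C) xi : cintg mu f -> cintg mu (fun x => plane xi x * f x).
Proof.
move=> cf; have := cintgM_bounded (B := 1) cf (ccont_cmeas (smooth_ccont (plane_smooth xi).1)).
by under eq_fun do rewrite mulrC; apply => x; rewrite norm_plane.
Qed.

Lemma cmeas_plane_pair : cmeas (fun p : E * E => plane p.1 p.2).
Proof.
apply: cmeas_cis; apply: measurable_funM => //; apply: measurable_sum => i.
apply: measurable_funM.
  exact: (measurableT_comp (measurable_coord i) measurable_snd).
exact: (measurableT_comp (measurable_coord i) measurable_fst).
Qed.

Lemma cmeas_plane_int (V f : E -> C) : cintg mu V -> cintg mu f ->
  cintg mu (fun xi => V xi * cI mu (fun x => plane xi x * f x)).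
Proof.
move=> cV cf; pose F (p : E * E) := V p.1 * (plane p.1 p.2 * f p.2).
have mF : cmeas F.
  apply: cmeasM; first exact: (cmeas_comp (cintg_cmeas cV) measurable_fst).
  apply: cmeasM; last exact: (cmeas_comp (cintg_cmeas cf) measurable_snd).
  exact: cmeas_plane_pair.
have iF : cintg (mu \x mu)%E F.
  apply: (cintg_prod mF (cintg_norm cV) (cintg_norm cf)) => xi x.
  by rewrite /F /= !normC_mul norm_plane mul1r.
have [h _ _ _] := cI_fubini iF; rewrite (_ : (fun xi => _) = (fun xi => cI mu (fun x => F (xi, x))))//.
by apply/funext => xi; rewrite /F /= cIZ//; exact: cintg_plane.
Qed.

Lemma plane_wave a (eta xi x : E) : plane xi x * wave a eta x = wave a (eta + xi) x.
Proof.
have := wave_cis a eta (- xi) x; rewrite opprK mulrC => <-; congr (_ * _).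
by rewrite /plane; congr cis; rewrite dotN; ring.
Qed.

(** Waves have no compact support: they are cut off by bumps on growing cubes, and both sides pass
    to the limit by dominated convergence. *)
Lemma identity_wave (gl V : E -> C) : cintg mu gl -> cintg mu V ->
  (forall phi, test_function phi -> cI mu (fun x => gl x * phi x) =
     cI mu (fun xi => V xi * cI mu (fun x => plane xi x * phi x))) ->
  forall a eta, 0 < a -> cI mu (fun x => gl x * wave a eta x) =
    cI mu (fun xi => V xi * rC ((Num.sqrt a)^-1 ^+ d * gam a^-1 (eta + xi))).
Proof.
move=> cg cV h a eta a0.
pose beta (n : nat) (x : E) : R := \prod_i bump n%:R (- n%:R) n%:R (x ord0 i).
pose phi (n : nat) (x : E) := rC (beta n x) * wave a eta x.
have tphi n : test_function (phi n).
  have := @test_bump R d n%:R (fun=> - n%:R) (fun=> n%:R)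
    (fun i => gsc a (2 * pi * eta ord0 i)) (ler0n _ _).
  have -> : (fun x : E => \prod_i (rC (bump n%:R (- n%:R) n%:R (x ord0 i)) *
      gsc a (2 * pi * eta ord0 i) (x ord0 i))) = phi n.
    by apply/funext => x; rewrite /phi /beta /wave rC_prod -big_split.
  by apply=> i; have [U [U0 jU _]] := jet_gauss a (2 * pi * eta ord0 i); exists U.
have b01 n x : 0 <= beta n x <= 1.
  apply/andP; split; first by apply: prodr_ge0 => i _; have /andP[] := bump_01 n%:R (- n%:R) n%:R (x ord0 i).
  by apply: prodr_ile1 => i _; exact: bump_01.
have nphi n x : nC (phi n x) <= gam a x.
  have /andP[h1 h2] := b01 n x.
  by rewrite normC_mul normC_real norm_wave ger0_norm// ler_piMl ?gam_ge0.
have phic x : ccvg (phi ^~ x) (wave a eta x).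
  rewrite -[X in ccvg _ X]mul1r; apply: ccvgM; last exact: ccvg_cst.
  apply: ccvg_real; have e1 : \prod_(i < d) (1 : R) = 1 by rewrite big1.
  rewrite -[X in _ --> X]e1.
  by apply: cvg_prod => i; exact: bump_cvg1.
have ctest n : cintg mu (phi n) := test_cintg (tphi n).
have hb n x : nC (gl x * phi n x) <= nC (gl x).
  by rewrite normC_mul ler_piMr// (le_trans (nphi n x))// gam_le1// ltW.
have [_ c1] := @cI_dct _ _ _ mu (fun n x => gl x * phi n x) (fun x => gl x * wave a eta x)
   (fun x => nC (gl x)) (fun n => cmeasM (cintg_cmeas cg) (cintg_cmeas (ctest n)))
   (fun x => ccvgM (ccvg_cst (gl x)) (phic x)) (cintg_norm cg) hb.
pose G := 2 * \int[mu]_x gam a x.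
have inner xi : ccvg (fun n => cI mu (fun x => plane xi x * phi n x))
    (cI mu (fun x => plane xi x * wave a eta x)).
  have [|||_ //] := @cI_dct _ _ _ mu (fun n x => plane xi x * phi n x)
    (fun x => plane xi x * wave a eta x) (gam a) (fun n => cintg_cmeas (cintg_plane xi (ctest n))).
  - by move=> x; apply: ccvgM => //; exact: ccvg_cst.
  - exact: gam_intg.
  - by move=> n x; rewrite normC_mul norm_plane mul1r.
have [|||_ c2] := @cI_dct _ _ _ mu (fun n xi => V xi * cI mu (fun x => plane xi x * phi n x))
    (fun xi => V xi * cI mu (fun x => plane xi x * wave a eta x)) (fun xi => G * nC (V xi))
    (fun n => cintg_cmeas (cmeas_plane_int cV (ctest n))).
- by move=> xi; apply: ccvgM => //; exact: ccvg_cst.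
- by apply: intgZ; exact: cintg_norm.
- move=> n xi; rewrite normC_mul mulrC ler_wpM2r//.
  apply: cI_le; [exact: cintg_plane|exact: gam_intg|].
  by move=> x; rewrite normC_mul norm_plane mul1r.
have e n : cI mu (fun x => gl x * phi n x) = cI mu (fun xi => V xi * cI mu (fun x => plane xi x * phi n x)).
  exact: h.
rewrite (funext e) in c1.
rewrite (ccvg_unique c1 c2); congr (cI _ _); apply/funext => xi; congr (_ * _).
rewrite -(wave_cintg (eta + xi) a0).2; congr (cI _ _); apply/funext => x.
exact: plane_wave.
Qed.

Lemma ccontP (f : E -> C) : (forall a e, 0 < e -> exists2 h, 0 < h &
  forall z, `|z - a| < h -> nC (f z - f a) < e) <-> ccont f.
Proof.
have Ree (z w : C) : complex.Re (z - w) = complex.Re z - complex.Re w by case: z; case: w.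
have Ime (z w : C) : complex.Im (z - w) = complex.Im z - complex.Im w by case: z; case: w.
split=> [h|[h1 h2] a e e0].
  have near_rV (a : E) (r : R) (Q : E -> Prop) : 0 < r -> (forall z, `|z - a| < r -> Q z) ->
      \forall z \near a, Q z.
    move=> r0 hr; apply: filterS (nbhsx_ballx a r r0) => z.
    by rewrite -ball_normE /= distrC; exact: hr.
  split=> a; have FF : Filter (nbhs a) := nbhs_filter a;
    apply/cvgrPdist_lt => e e0; have [r r0 hr] := h a e e0;
    apply: (near_rV a r _ r0) => z /hr; apply: le_lt_trans; rewrite distrC.
    by rewrite -Ree; exact: normC_Re.
  by rewrite -Ime; exact: normC_Im.
have e2 : 0 < e / 2 by lra.
have /cvgrPdist_lt/(_ _ e2) k1 := h1 a; have /cvgrPdist_lt/(_ _ e2) k2 := h2 a.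
have : \forall z \near a, nC (f z - f a) < e.
  apply: filterS2 k1 k2 => z; rewrite distrC => k1; rewrite distrC => k2.
  by apply: le_lt_trans (normC_ReIm _) _; rewrite Ree Ime; lra.
move=> /nbhs_ballP[r /= r0 hr]; exists r => // z zr; apply: hr.
by rewrite -ball_normE /= distrC.
Qed.

Definition ft (gl : E -> C) (xi : E) : C := cI mu (fun x => plane (- xi) x * gl x).

(** Dominated convergence concerns sequences, so a failure of continuity is first turned into a
    sequence tending to [a]. *)
Lemma ft_ccont gl : cintg mu gl -> ccont (ft gl).
Proof.
move=> cg; apply/ccontP => a e e0; apply: contrapT => hn.
have /boolp.choice[z hz] (n : nat) : exists z, `|z - a| < n.+1%:R^-1 /\ e <= nC (ft gl z - ft gl a).
  apply: contrapT => hz; apply: hn; exists n.+1%:R^-1; first by rewrite invr_gt0 ltr0n.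
  move=> z za; rewrite ltNge; apply/negP => ez; apply: hz; by exists z.
have za i : (fun n => z n ord0 i) @ \oo --> a ord0 i.
  apply/cvgrPdist_lt => r r0; near=> n.
  have [h1 _] := hz n.
  have h2 : `|(a - z n) ord0 i| <= `|z n - a| by rewrite distrC ler_entry.
  rewrite !mxE in h2; apply: le_lt_trans h2 _; apply: lt_trans h1 _.
  by near: n; exact: near_infty_natSinv_lt (PosNum r0).
have [||||_ c1] := @cI_dct _ _ _ mu (fun n x => plane (- z n) x * gl x)
   (fun x => plane (- a) x * gl x) (fun x => nC (gl x)).
- by move=> n; exact: cintg_cmeas (cintg_plane _ cg).
- move=> x; apply: ccvgM; last exact: ccvg_cst.
  have dc : (fun n => 2 * pi * dot x (- z n)) @ \oo --> 2 * pi * dot x (- a).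
    apply: cvgM; first exact: cvg_cst.
    apply: cvg_sumR => i; apply: cvgM; first exact: cvg_cst.
    by under eq_fun do rewrite mxE; rewrite mxE; apply: cvgN; exact: za.
  split; rewrite /plane /=.
    exact: (continuous_cvg _ (@continuous_cos R _) dc).
  exact: (continuous_cvg _ (@continuous_sin R _) dc).
- exact: cintg_norm.
- by move=> n x; rewrite normC_mul norm_plane mul1r.
move/ccvgP : c1 => /(_ e e0)[n _ /(_ n (leqnn n))] /=.
have [_] := hz n; rewrite leNgt => /negP; apply.
Unshelve. all: by end_near. Qed.

Lemma gam_cvg1 (x : E) : (fun n : nat => gam n.+1%:R^-1 x) @ \oo --> (1 : R).
Proof.
have e1 : \prod_(i < d) (1 : R) = 1 by rewrite big1.
rewrite -[X in _ --> X]e1.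
apply: cvg_prod => i; rewrite -[X in _ --> X](gs0 1) /gs expr0n mulr0.
apply: continuous_cvg; first exact: continuous_expR.
rewrite (_ : - 0 = - (pi * 0 * x ord0 i ^+ 2)); last by rewrite mulr0 mul0r.
apply: cvgN; apply: cvgM; last exact: cvg_cst.
by apply: cvgM; [exact: cvg_cst|exact: cvg_harmonic].
Qed.

Lemma measurable_gam_diff b : measurable_fun setT (fun p : E * E => gam b (p.1 - p.2)).
Proof.
have -> : (fun p : E * E => gam b (p.1 - p.2)) = (fun p => \prod_i gs b (p.1 ord0 i - p.2 ord0 i)).
  by apply/funext => p; apply: eq_bigr => i _; rewrite !mxE.
have mgs : measurable_fun setT (gs b).
  apply: continuous_measurable_fun => t; apply: differentiable_continuous; apply/derivable1_diffP.
  by have [] := is_derive_gs b t.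
apply: measurable_prod => i _; apply: (measurableT_comp mgs); apply: measurable_funB.
  exact: (measurableT_comp (measurable_coord i) measurable_fst).
exact: (measurableT_comp (measurable_coord i) measurable_snd).
Qed.

(** Both sides are limits of one double integral of [V], [psi] and a Gaussian kernel. Integrated
    against [V] first, the kernel gives the transform of [gl] damped by a Gaussian that flattens;
    integrated against [psi] first, it is an approximate identity. *)
Lemma ft_pairing (gl V psi : E -> C) (K : R) : cintg mu gl -> cintg mu V ->
  (forall a eta, 0 < a -> cI mu (fun x => gl x * wave a eta x) =
    cI mu (fun xi => V xi * rC ((Num.sqrt a)^-1 ^+ d * gam a^-1 (eta + xi)))) ->
  cintg mu psi -> ccont psi -> 0 <= K -> (forall x, nC (psi x) <= K) ->
  cintg mu (fun xi => ft gl xi * psi xi) /\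
  cI mu (fun xi => ft gl xi * psi xi) = cI mu (fun xi => V xi * psi xi).
Proof.
move=> cg cV h cp ccp K0 hK.
pose b (n : nat) : R := n.+1%:R.
have b0 n : 0 < b n by rewrite ltr0n.
pose k n := Num.sqrt (b n) ^+ d.
have k0 n : 0 <= k n by rewrite exprn_ge0 ?sqrtr_ge0.
pose Gn n eta := cI mu (fun x => gl x * wave (b n)^-1 (- eta) x).
have eGn n eta : Gn n eta = cI mu (fun xi => V xi * rC (k n * gam (b n) (xi - eta))).
  have bi : 0 < (b n)^-1 by rewrite invr_gt0.
  rewrite /Gn (h _ (- eta) bi); congr (cI _ _); apply/funext => xi.
  by rewrite sqrtrV ?ltW// !invrK (addrC (- eta)).
pose F n (p : E * E) := V p.1 * (rC (k n * gam (b n) (p.1 - p.2)) * psi p.2).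
have mF n : cmeas (F n).
  apply: cmeasM; first exact: (cmeas_comp (cintg_cmeas cV) measurable_fst).
  apply: cmeasM; last exact: (cmeas_comp (cintg_cmeas cp) measurable_snd).
  by apply: cmeas_real; apply: measurable_funM => //; exact: measurable_gam_diff.
have iF n : cintg (mu \x mu)%E (F n).
  apply: (cintg_prod (mF n) (cintg_norm cV) (intgZ (k n) (cintg_norm cp))) => x y.
  rewrite /F /= !normC_mul normC_real ger0_norm ?mulr_ge0 ?gam_ge0//.
  rewrite ler_wpM2l// ler_wpM2r// ler_piMr// gam_le1// ltW.
have icV n eta : cintg mu (fun xi => V xi * rC (k n * gam (b n) (xi - eta))).
  apply: (cintgM_bounded (B := k n) cV).
    apply: cmeas_real; apply: measurable_funM => //.
    exact: (intg_meas (gam_int eta (b0 n)).1).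
  move=> xi; rewrite normC_real ger0_norm ?mulr_ge0 ?gam_ge0// ler_piMr// gam_le1// ltW.
have ipk n xi : cintg mu (fun eta => rC (k n * gam (b n) (xi - eta)) * psi eta).
  apply: (cintgM_boundedl (B := k n) cp).
    apply: cmeas_real; apply: measurable_funM => //; under eq_fun do rewrite gam_sym.
    exact: (intg_meas (gam_int xi (b0 n)).1).
  move=> eta; rewrite normC_real ger0_norm ?mulr_ge0 ?gam_ge0// ler_piMr// gam_le1// ltW.
have e1 n : (fun eta => cI mu (fun xi => F n (xi, eta))) = (fun eta => Gn n eta * psi eta).
  apply/funext => eta; rewrite eGn mulrC -cIZ//; congr (cI _ _); apply/funext => xi.
  rewrite /F /=; ring.
have e2 n : (fun xi => cI mu (fun eta => F n (xi, eta))) =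
    (fun xi => V xi * cI mu (fun eta => rC (k n * gam (b n) (xi - eta)) * psi eta)).
  by apply/funext => xi; rewrite -cIZ.
have fub n : cintg mu (fun eta => Gn n eta * psi eta) /\
    cintg mu (fun xi => V xi * cI mu (fun eta => rC (k n * gam (b n) (xi - eta)) * psi eta)) /\
    cI mu (fun eta => Gn n eta * psi eta) =
    cI mu (fun xi => V xi * cI mu (fun eta => rC (k n * gam (b n) (xi - eta)) * psi eta)).
  have [f1 f2 f3 f4] := cI_fubini (iF n).
  split; first exact: (eq_ind _ (cintg mu) f2 _ (e1 n)).
  split; first exact: (eq_ind _ (cintg mu) f1 _ (e2 n)).
  exact: (etrans (esym (congr1 (cI mu) (e1 n))) (etrans f4 (etrans (esym f3) (congr1 (cI mu) (e2 n))))).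
pose G := 2 * \int[mu]_x nC (gl x).
have wb a (eta x : E) : 0 < a -> nC (wave a eta x) <= 1.
  by move=> a0; rewrite norm_wave gam_le1// ltW.
have igw n eta : cintg mu (fun x => gl x * wave (b n)^-1 (- eta) x).
  apply: (cintgM_bounded (B := 1) cg).
    have bi : 0 < (b n)^-1 by rewrite invr_gt0.
    exact: (cintg_cmeas (wave_cintg (- eta) bi).1).
  by move=> x; apply: wb; rewrite invr_gt0.
have [||||i1 c1] := @cI_dct _ _ _ mu (fun n eta => Gn n eta * psi eta)
   (fun xi => ft gl xi * psi xi) (fun xi => G * nC (psi xi)).
- by move=> n; exact: (cintg_cmeas (fub n).1).
- move=> eta; apply: ccvgM; last exact: ccvg_cst.
  have [||||_ //] := @cI_dct _ _ _ mu (fun n x => gl x * wave (b n)^-1 (- eta) x)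
    (fun x => plane (- eta) x * gl x) (fun x => nC (gl x)).
  + by move=> n; exact: cintg_cmeas (igw n eta).
  + move=> x; rewrite [X in ccvg _ X]mulrC; apply: ccvgM; first exact: ccvg_cst.
    rewrite -[X in ccvg _ X]mulr1; under [X in ccvg X _]eq_fun do rewrite waveE.
    apply: ccvgM; first exact: ccvg_cst.
    apply: ccvg_real; exact: gam_cvg1.
  + exact: cintg_norm.
  + by move=> n x; rewrite normC_mul ler_piMr// wb// invr_gt0.
- by apply: intgZ; exact: cintg_norm.
- move=> n eta; rewrite normC_mul ler_wpM2r//.
  apply: (cI_le (igw n eta) (cintg_norm cg)) => x.
  by rewrite normC_mul ler_piMr// wb// invr_gt0.
split=> //.
have [||||_ c2] := @cI_dct _ _ _ mu
   (fun n xi => V xi * cI mu (fun eta => rC (k n * gam (b n) (xi - eta)) * psi eta))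
   (fun xi => V xi * psi xi) (fun xi => 2 * K * nC (V xi)).
- by move=> n; exact: (cintg_cmeas (fub n).2.1).
- move=> xi; apply: ccvgM; first exact: ccvg_cst.
  have cW e : 0 < e -> exists2 h, 0 < h & forall z, `|z - xi| < h -> nC (psi z - psi xi) < e.
    by move=> e0; have [r r0 hr] := (ccontP psi).2 ccp xi e e0; exists r.
  have bW z : nC (psi z) <= K * (1 + `|z|).
    by apply: (le_trans (hK z)); rewrite ler_peMr// lerDl.
  apply/ccvgP => e e0; have [B0 B00 hB] := gauss_average (cintg_cmeas cp) K0 bW cW e0.
  near=> n; have [] := hB (b n) _.
    by near: n; exists (Num.truncn B0) => // n /= hn; rewrite (le_trans (ltW (truncnS_gt _)))// ler_nat.
  move=> _; rewrite (_ : (fun z => _) = (fun eta => rC (k n * gam (b n) (xi - eta)) * psi eta))//.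
  by apply/funext => z; rewrite gam_sym mulrC.
- by apply: intgZ; exact: cintg_norm.
- move=> n xi; rewrite normC_mul mulrC ler_wpM2r//.
  have [ig Ig] := gam_int xi (b0 n).
  have -> : 2 * K = 2 * \int[mu]_z (K * k n * gam (b n) (z - xi)).
    rewrite RintegralZl// Ig -mulrA -exprMn mulfV ?expr1n ?mulr1// gt_eqF// sqrtr_gt0//.
  apply: (cI_le (ipk n xi) (intgZ _ ig)) => z.
  rewrite normC_mul normC_real ger0_norm ?mulr_ge0 ?gam_ge0//.
  by rewrite gam_sym -mulrA mulrC ler_wpM2r// mulr_ge0 ?gam_ge0.
have e n : cI mu (fun eta => Gn n eta * psi eta) =
    cI mu (fun xi => V xi * cI mu (fun eta => rC (k n * gam (b n) (xi - eta)) * psi eta)).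
  by have [_ []] := fub n.
rewrite (funext e) in c1; exact: (ccvg_unique c1 c2).
Unshelve. all: by end_near. Qed.

(** The transform of [gl] is bounded but need not be integrable, so both functions are multiplied by
    the positive Gaussian [gam 1] before the uniqueness lemma is applied. *)
Lemma ft_ae (gl V : E -> C) : cintg mu gl -> cintg mu V ->
  (forall a eta, 0 < a -> cI mu (fun x => gl x * wave a eta x) =
    cI mu (fun xi => V xi * rC ((Num.sqrt a)^-1 ^+ d * gam a^-1 (eta + xi)))) ->
  {ae mu, forall xi, ft gl xi = V xi}.
Proof.
move=> cg cV h.
have g1 : cintg mu (fun x => rC (gam 1 x)) by apply: cintg_real; exact: gam_intg.
have cg1 : ccont (fun x : E => rC (gam 1 x)).
  have := smooth_ccont (wave_smooth (0 : E) (@ltr01 R)).1.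
  rewrite (_ : wave 1 0 = (fun x : E => rC (gam 1 x)))//.
  by apply/funext => x; rewrite waveE dot0 mulr0 cis0 mul1r.
have b1 (x : E) : nC (rC (gam 1 x)) <= 1 by rewrite normC_real ger0_norm ?gam_ge0// gam_le1.
have [i1 _] := ft_pairing cg cV h g1 cg1 ler01 b1.
have i2 : cintg mu (fun xi => V xi * rC (gam 1 xi)) by exact: (cintgM_bounded cV (cintg_cmeas g1) b1).
suff : {ae mu, forall xi, ft gl xi * rC (gam 1 xi) + -1 * (V xi * rC (gam 1 xi)) = 0}.
  apply: filterS => xi.
  have -> : ft gl xi * rC (gam 1 xi) + -1 * (V xi * rC (gam 1 xi)) = (ft gl xi - V xi) * rC (gam 1 xi) by ring.
  move=> /eqP; rewrite mulf_eq0 subr_eq0 => /orP[/eqP//|/eqP/(congr1 (@complex.Re R)) /= g0].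
  by have := gam_gt0 1 xi; rewrite g0 ltxx.
apply: ae0_of_test; first by apply: cintgD => //; exact: cintgZ.
move=> phi tp; have [B B0 hB] := test_bounded tp.
have cph := smooth_ccont tp.1.
have ip : cintg mu (fun x => rC (gam 1 x) * phi x) by exact: (cintgM_bounded g1 (ccont_cmeas cph) hB).
have hp x : nC (rC (gam 1 x) * phi x) <= B.
  by rewrite normC_mul; apply: le_trans (hB x); rewrite ler_piMl.
have [j1 e1] := ft_pairing cg cV h ip (ccontM cg1 cph) B0 hp.
have -> : (fun x => (ft gl x * rC (gam 1 x) + -1 * (V x * rC (gam 1 x))) * phi x) =
  (fun x => ft gl x * (rC (gam 1 x) * phi x) + -1 * (V x * (rC (gam 1 x) * phi x))).
  by apply/funext => x; ring.
have j2 : cintg mu (fun x => V x * (rC (gam 1 x) * phi x)).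
  exact: (cintgM_bounded cV (cintg_cmeas ip) hp).
by rewrite cID// ?cIZ// ?e1 ?mulN1r ?subrr//; exact: cintgZ.
Qed.

End limits.

(** * A representative of the multiplier that is continuous off 0 *)

Section representative.
Variables (R : realType) (d : nat).
Local Notation C := (Rcomplex R).
Local Notation E := 'rV[R]_d.
Local Notation nC z := (`|(z : C)|).
Local Notation mu := (lebesgue_rV R d).
Local Notation intg m f := (m.-integrable setT (fun x => (f x)%:E)).

Lemma near_of_cvg (f : E -> C) (a : E) :
  (complex.Re (f x) @[x --> a] --> complex.Re (f a)) ->
  (complex.Im (f x) @[x --> a] --> complex.Im (f a)) ->
  forall e, 0 < e -> exists2 h, 0 < h & forall z, `|z - a| < h -> nC (f z - f a) < e.
Proof.
have Ree (z w : C) : complex.Re (z - w) = complex.Re z - complex.Re w by case: z; case: w.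
have Ime (z w : C) : complex.Im (z - w) = complex.Im z - complex.Im w by case: z; case: w.
move=> h1 h2 e e0; have e2 : 0 < e / 2 by lra.
have /cvgrPdist_lt/(_ _ e2) k1 := h1; have /cvgrPdist_lt/(_ _ e2) k2 := h2.
have : \forall z \near a, nC (f z - f a) < e.
  apply: filterS2 k1 k2 => z; rewrite distrC => k1; rewrite distrC => k2.
  by apply: le_lt_trans (normC_ReIm _) _; rewrite Ree Ime; lra.
move=> /nbhs_ballP[r /= r0 hr]; exists r => // z zr; apply: hr.
by rewrite -ball_normE /= distrC.
Qed.

Lemma ccont_cst (c : C) : ccont (fun _ : E => c).
Proof. by split; exact: cst_continuous. Qed.

Lemma ccont_sum (I : Type) (r : seq I) (F : I -> E -> C) : (forall i, ccont (F i)) ->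
  ccont (fun x => \sum_(i <- r) F i x).
Proof.
move=> h; elim: r => [|i r IH].
  by under eq_fun do rewrite big_nil; exact: ccont_cst.
by under eq_fun do rewrite big_cons; exact: ccontD.
Qed.

Lemma ccont_coord l : ccont (fun x : E => rC (x ord0 l)).
Proof. by split => /=; [exact: coord_continuous|exact: cst_continuous]. Qed.

Lemma ccont_norm (f : E -> C) : ccont f -> continuous (fun x => nC (f x)).
Proof.
move=> [f1 f2]; have -> : (fun x => nC (f x)) =
    (fun x => Num.sqrt (complex.Re (f x) ^+ 2 + complex.Im (f x) ^+ 2)).
  by apply/funext => x; rewrite normCE.
move=> x; apply: (@continuous_comp _ _ _ (fun x => complex.Re (f x) ^+ 2 + complex.Im (f x) ^+ 2)
  (@Num.sqrt R)); last exact: sqrt_continuous.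
exact: (cvgD (cvgM (f1 x) (f1 x)) (cvgM (f2 x) (f2 x))).
Qed.

Lemma cont_lin (B : R) (u v : E -> R) : continuous u -> continuous v ->
  continuous (fun x => B * u x - v x).
Proof.
have cr (w : E -> R) : continuous w -> ccont (fun x => rC (w x)).
  by move=> cw; split => //=; exact: cst_continuous.
move=> /cr cu /cr cv.
have [+ _] := ccontD (ccontM (ccont_cst (rC B)) cu) (ccontM (ccont_cst (-1)) cv).
rewrite (_ : (fun x => _) = (fun x => B * u x - v x))//.
by apply/funext => x; rewrite mulN1r /=; ring.
Qed.

Lemma cont_opp_norm (f g : E -> C) : ccont f -> ccont g ->
  continuous (fun x => - nC (f x - g x)).
Proof.
move=> cf cg; have cw := ccont_norm (ccontD cf (ccontM (ccont_cst (-1)) cg)).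
have e : (fun x : E => 0 * nC (f x + -1 * g x) - nC (f x + -1 * g x)) =
    (fun x : E => - nC (f x - g x)).
  by apply/funext => x; rewrite mul0r sub0r mulN1r.
exact: (eq_ind _ (fun h : E -> R => continuous h) (@cont_lin 0 _ _ cw cw) _ e).
Qed.

Lemma ccont_gam : ccont (fun x : E => rC (gam 1 x)).
Proof.
have := smooth_ccont (wave_smooth (0 : E) (@ltr01 R)).1.
rewrite (_ : wave 1 0 = (fun x : E => rC (gam 1 x)))//.
by apply/funext => x; rewrite waveE dot0 mulr0 cis0 mul1r.
Qed.

Lemma ccont_gamV : ccont (fun x : E => rC (gam 1 x)^-1).
Proof.
have [h _] := ccont_gam; split => /=; last exact: cst_continuous.
by move=> x; exact: (cvgV (lt0r_neq0 (gam_gt0 1 x)) (h x)).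
Qed.

Lemma norm_imag (t : R) : nC (Complex 0 t) = `|t|.
Proof. by rewrite normCE /= expr0n add0r sqrtr_sqr. Qed.

Lemma sqnorm_gt0 (x : E) : x != 0 -> 0 < \sum_l x ord0 l ^+ 2.
Proof.
move=> x0; rewrite lt_def sumr_ge0 ?andbT; last by move=> l _; exact: sqr_ge0.
rewrite psumr_eq0; last by move=> l _; exact: sqr_ge0.
apply: contra x0 => /allP h; apply/eqP/rowP => l; rewrite mxE.
by have := h l (mem_index_enum l); rewrite sqrf_eq0 => /eqP.
Qed.

Lemma ae_neq0 : (0 < d)%N -> {ae mu, forall x : E, x != 0}.
Proof.
move=> d0; exists [set x : E | forall i, [set 0] (x ord0 i)]; split.
- apply: (measurable_box (A := fun=> [set 0])) => i; exact: measurable_set1.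
- rewrite (lebesgue_rV_box (A := fun=> [set 0])); last by move=> i; exact: measurable_set1.
  case: d d0 => // k _; rewrite big_ord_recl lebesgue_measure_set1 mul0e//.
- by move=> x /= /negP; rewrite negbK => /eqP -> i; rewrite mxE.
Qed.

(* For f a Gaussian, the Fourier transform of the l-th derivative of T f is
   continuous and equal a.e. to a multiple of m xi_l times a Gaussian; this gives
   continuous functions S_l = m xi_l, from which m is recovered off 0 as the sum of
   the xi_l S_l / |xi|^2. *)
Lemma multiplier_repr (m' : E -> C) (B : R) : (0 < d)%N -> cmeas m' -> 0 <= B ->
  (forall x, nC (m' x) <= B) ->
  (exists g : 'I_d -> E -> C, (forall l, cintg mu (g l)) /\
    forall l phi, test_function phi -> cI mu (fun x => g l x * phi x) =
      cI mu (fun xi => (m' xi * fourier (packet 1 [:: (1, 0)]) xi) *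
        (Complex 0 (2 * pi * xi ord0 l) * cI mu (fun x => plane xi x * phi x)))) ->
  exists M : E -> C, [/\ forall x, nC (M x) <= B, cont_off0 M,
    {ae mu, forall x, m' x = M x} & forall l, ccont (fun xi => M xi * rC (xi ord0 l))].
Proof.
move=> d0 mm B0 hB [g [cg hg]].
have fe xi : fourier (packet 1 [:: (1 : C, 0 : E)]) xi = rC (gam 1 xi).
  rewrite fourier_packet// big_seq1 /= sqrtr1 invr1 expr1n !mul1r sub0r.
  by rewrite gamN.
have [mf [q iq hq]] := fourier_packet_bound [:: (1 : C, 0 : E)] (@ltr01 R).
have pp : 0 < 2 * pi :> R by rewrite mulr_gt0 ?pi_gt0.
pose V l xi := (m' xi * fourier (packet 1 [:: (1 : C, 0 : E)]) xi) * Complex 0 (2 * pi * xi ord0 l).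
have mim l : cmeas (fun xi : E => Complex 0 (2 * pi * xi ord0 l) : C).
  split => /=; first exact: measurable_cst.
  by apply: measurable_funM => //; exact: measurable_coord.
have cV l : cintg mu (V l).
  apply: (cintg_dom _ (intgZ (B * (2 * pi)) iq)).
    by apply: cmeasM => //; exact: cmeasM.
  move=> xi; rewrite /V !normC_mul norm_imag normrM (gtr0_norm pp).
  have [_ /(_ l) h] := hq xi.
  have -> : nC (m' xi) * nC (fourier (packet 1 [:: (1 : C, 0 : E)]) xi) * (2 * pi * `|xi ord0 l|) =
    nC (m' xi) * (2 * pi * (nC (fourier (packet 1 [:: (1 : C, 0 : E)]) xi) * `|xi ord0 l|)) by ring.
  rewrite -[leRHS]mulrA; apply: ler_pM => //.
    by rewrite mulr_ge0 ?(ltW pp)// mulr_ge0.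
  by rewrite ler_wpM2l// ltW.
have ae1 l : {ae mu, forall xi, ft (g l) xi = V l xi}.
  apply: ft_ae => //; apply: identity_wave => // phi tp.
  by rewrite hg//; congr (cI _ _); apply/funext => xi; rewrite /V -!mulrA.
(* The two factors undo the [2 pi i] of the derivative and the Gaussian of the transform. *)
pose S (l : 'I_d) (xi : E) : C := (Complex 0 (- (2 * pi)^-1) : C) * (ft (g l) xi * rC (gam 1 xi)^-1).
have cS l : ccont (S l).
  apply: ccontM; first exact: ccont_cst.
  by apply: ccontM; [exact: ft_ccont|exact: ccont_gamV].
have aeS l : {ae mu, forall xi, S l xi = m' xi * rC (xi ord0 l)}.
  apply: filterS (ae1 l) => xi; rewrite /S /V fe => ->.
  have g0 := lt0r_neq0 (gam_gt0 1 xi).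
  have -> : Complex 0 (2 * pi * xi ord0 l) = Complex 0 (2 * pi) * rC (xi ord0 l) :> C.
    by apply: C_eqP; rewrite /=; ring.
  have e1 : rC (gam 1 xi) * rC (gam 1 xi)^-1 = 1 :> C by rewrite -rCM mulfV.
  have e2 : Complex 0 (- (2 * pi)^-1) * Complex 0 (2 * pi) = 1 :> C.
    by apply: C_eqP; rewrite /= ?mul0r ?mulr0 ?add0r// mulNr opprK mulVf// gt_eqF.
  transitivity (m' xi * rC (xi ord0 l) * (rC (gam 1 xi) * rC (gam 1 xi)^-1) *
    (Complex 0 (- (2 * pi)^-1) * Complex 0 (2 * pi))); first by ring.
  by rewrite e1 e2 !mulr1.
(* An almost everywhere inequality between continuous functions holds everywhere; the same principle
   gives [sym]. *)
have bS l xi : nC (S l xi) <= B * `|xi ord0 l|.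
  rewrite -(normC_real (xi ord0 l)) -subr_ge0; move: xi; apply: ae_everywhere.
    by apply: cont_lin; apply: ccont_norm => //; exact: ccont_coord.
  apply: filterS (aeS l) => xi ->; rewrite subr_ge0 normC_mul normC_real.
  by rewrite ler_wpM2r.
have sym (k l : 'I_d) (xi : E) : rC (xi ord0 k) * S l xi = rC (xi ord0 l) * S k xi.
  apply/eqP; rewrite -subr_eq0 -normr_eq0 eq_le normr_ge0 andbT -oppr_ge0; move: xi.
  apply: ae_everywhere.
    have c1 := ccontM (ccont_coord k) (cS l); have c2 := ccontM (ccont_coord l) (cS k).
    exact: cont_opp_norm.
  apply: filterS2 (aeS k) (aeS l) => xi -> ->.
  by rewrite oppr_ge0 (_ : _ - _ = 0) ?normr0//; ring.
pose sg (xi : E) : R := \sum_l xi ord0 l ^+ 2.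
pose N (xi : E) : C := \sum_l rC (xi ord0 l) * S l xi.
pose M (xi : E) : C := rC (sg xi)^-1 * N xi.
have cN : ccont N by apply: ccont_sum => l; apply: ccontM => //; exact: ccont_coord.
(* Off 0, [sym] turns [xi_k S_k xi_l] into [xi_k ^ 2 S_l]. At 0 both sides vanish, by [bS]. *)
have MS l xi : M xi * rC (xi ord0 l) = S l xi.
  have [->|x0] := eqVneq xi 0.
    rewrite mxE -[rC 0]/(0 : C) mulr0; apply/esym/eqP; rewrite -normr_eq0 eq_le normr_ge0 andbT.
    by have := bS l 0; rewrite mxE normr0 mulr0.
  have s0 := lt0r_neq0 (sqnorm_gt0 x0).
  rewrite /M /N -mulrA mulr_suml.
  under eq_bigr => k _ do rewrite mulrAC -mulrA (mulrC (rC (xi ord0 k))) -[_ * S k xi]sym.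
  rewrite (eq_bigr (fun k => rC (xi ord0 k ^+ 2) * S l xi)); last first.
    move=> k _; rewrite expr2 rCM; have := sym k l xi => h.
    by transitivity (rC (xi ord0 k) * (rC (xi ord0 k) * S l xi)); [rewrite h; ring|ring].
  by rewrite -mulr_suml -rC_sum mulrA -rCM mulVf// -[rC 1]/(1 : C) mul1r.
exists M; split.
(* The inverse of 0 is 0, so [M] takes the value 0 at the origin. *)
- move=> xi; have [->|x0] := eqVneq xi 0.
    by rewrite /M /sg big1 ?invr0 => [|l _]; rewrite ?mxE ?expr0n// -[rC 0]/(0 : C) mul0r normr0.
  have s0 := sqnorm_gt0 x0.
  rewrite /M normC_mul normC_real ger0_norm ?invr_ge0 ?(ltW s0)//.
  rewrite ler_pdivrMl// mulrC mulr_sumr /N.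
  apply: le_trans (ler_norm_sum _ _ _) _; apply: ler_sum => l _.
  rewrite normC_mul normC_real -[xi ord0 l ^+ 2]real_normK ?num_real// expr2 mulrA mulrC.
  by apply: ler_wpM2l => //; exact: bS.
- move=> a a0 e e0.
  have s0 := lt0r_neq0 (sqnorm_gt0 a0).
  have csg : sg x @[x --> a] --> sg a.
    have [h _] := ccont_sum (index_enum 'I_d) (fun l => ccontM (ccont_coord l) (ccont_coord l)).
    have e1 (x : E) : complex.Re (\sum_i rC (x ord0 i) * rC (x ord0 i)) = sg x.
      by rewrite Re_sum; apply: eq_bigr => i _; rewrite Re_mul /= mulr0 subr0 -expr2.
    exact: (eq_ind _ (fun k : E -> R => k x @[x --> a] --> k a) (h a) _ (funext e1)).
  have csV : (sg x)^-1 @[x --> a] --> (sg a)^-1 by exact: (cvgV s0 csg).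
  have [N1 N2] := cN.
  have ReM x : complex.Re (M x) = (sg x)^-1 * complex.Re (N x) by rewrite Re_mul /= mul0r subr0.
  have ImM x : complex.Im (M x) = (sg x)^-1 * complex.Im (N x) by rewrite Im_mul /= mul0r addr0.
  have [||h h0 hh] := @near_of_cvg M a _ _ e e0.
  + by rewrite ReM; under eq_fun do rewrite ReM; exact: (cvgM csV (N1 a)).
  + by rewrite ImM; under eq_fun do rewrite ImM; exact: (cvgM csV (N2 a)).
  exists h => // z zh; apply: hh; by rewrite addrC addKr.
- have aeA : {ae mu, forall xi, forall l, S l xi = m' xi * rC (xi ord0 l)}.
    exact: filter_forall.
  apply: filterS2 aeA (ae_neq0 d0) => xi hS x0.
  have [l xl] := entry_neq0 x0.
  have : M xi * rC (xi ord0 l) = m' xi * rC (xi ord0 l) by rewrite MS hS.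
  move/mulIf => -> //; apply: contra xl => /eqP/(congr1 (@complex.Re R)) /= ->.
  exact: eqxx.
- by move=> l; rewrite (funext (MS l)).
Qed.

End representative.

(** * Wave packets under flattening Gaussians *)

Section bohr.
Variables (R : realType) (d : nat).
Local Notation C := (Rcomplex R).
Local Notation E := 'rV[R]_d.
Local Notation nC z := (`|(z : C)|).
Local Notation mu := (lebesgue_rV R d).
Local Notation intg m f := (m.-integrable setT (fun x => (f x)%:E)).
Implicit Types (P Q S : seq (C * E)).

Lemma ccvg_sum (I : Type) (r : seq I) (F : I -> nat -> C) (l : I -> C) :
  (forall i, ccvg (F i) (l i)) -> ccvg (fun n => \sum_(i <- r) F i n) (\sum_(i <- r) l i).
Proof.
move=> h; split.
  under eq_fun do rewrite Re_sum; rewrite Re_sum.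
  by apply: cvg_sumR => i; have [] := h i.
under eq_fun do rewrite Im_sum; rewrite Im_sum.
by apply: cvg_sumR => i; have [] := h i.
Qed.

Lemma ccvg_norm (z : nat -> C) (l : C) : ccvg z l -> (fun n => nC (z n)) @ \oo --> nC l.
Proof.
move=> /ccvgP h; apply/cvgrPdist_lt => e e0; apply: filterS (h e e0) => n.
by apply: le_lt_trans; rewrite distrC; exact: ler_dist_dist.
Qed.

(** Completing the square: the centres are [p] and [- q], with midpoint [(p - q) / 2]. As [b] grows,
    the first factor becomes the indicator of [p + q = 0], which is how resonances arise. *)
Lemma gam_mul b (p q x : E) : gam b (p - x) * gam b (q + x) =
  gam (b / 2) (p + q) * gam (2 * b) (x - 2^-1 *: (p - q)).
Proof.
rewrite /gam -!big_split; apply: eq_bigr => i _ /=.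
by rewrite !mxE /gs -!expRD; congr expR; field.
Qed.

Lemma cintg_lin (W : E -> C) (B b : R) l (u : E) : cmeas W -> 0 <= B -> 0 < b ->
  (forall z, nC (W z) <= B * `|z ord0 l|) -> cintg mu (fun z => W z * rC (gam b (z - u))).
Proof.
move=> mW B0 b0 hW; have [i1 _] := gam_int u b0.
have b20 : 0 < b / 2 by rewrite divr_gt0.
have [i2 _] := gam_int u b20.
have i3 : intg mu (fun z => B * (Num.sqrt b)^-1 * gam (b / 2) (z - u) + B * `|u| * gam b (z - u)).
  by under eq_fun do rewrite EFinD; apply: integrableD => //; exact: intgZ.
apply: (cintg_dom _ i3).
  by apply: cmeasM => //; apply: cmeas_real; exact: intg_meas i1.
move=> z; rewrite normC_mul normC_real ger0_norm ?gam_ge0//.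
apply: le_trans (ler_wpM2r (gam_ge0 _ _) (hW z)) _.
rewrite -!mulrA -mulrDr ler_wpM2l//.
have x1 : `|z ord0 l| <= `|(z - u) ord0 l| + `|u|.
  have := ler_entry u l; rewrite !mxE => h3.
  rewrite -{1}(subrK (u ord0 l) (z ord0 l)).
  by apply: le_trans (ler_normD _ _) _; rewrite lerD2l.
apply: le_trans (ler_wpM2r (gam_ge0 _ _) x1) _.
by rewrite mulrDl lerD2r; exact: lin_gam_le.
Qed.

Lemma wave_partial A (eta : E) j x : partial j (wave A eta) x =
  (rC (- (2 * pi * A) * x ord0 j) + Complex 0 (2 * pi * eta ord0 j)) * wave A eta x.
Proof.
have [_] := cder_prod j x (fun i => cder_gsc A (2 * pi * eta ord0 i)).
rewrite /partial /wave => ->; rewrite (bigD1 j)//= [in RHS](bigD1 j)//= eqxx [RHS]mulrA.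
congr (_ * _); first by rewrite rCM; ring.
by apply: eq_bigr => i /negbTE ->.
Qed.

Lemma wave_smooth_any A (eta : E) : smooth (wave A eta).
Proof. by have [U [jU -> _]] := wave_jet A eta; exact: smooth_jprod. Qed.

Lemma packet_partial A P j x : partial j (packet A P) x =
  rC (- (2 * pi * A) * x ord0 j) * packet A P x +
  Complex 0 (2 * pi) * (trig (dtrig j P) x * rC (gam A x)).
Proof.
have [sm e] := smooth_sum P (fun p : C * E => (smoothZ p.1 (wave_smooth_any A p.2)).1).
rewrite -[LHS]/(iter_partial [:: j] (packet A P) x) e.
rewrite /packet mulr_sumr /trig /dtrig big_map mulr_suml mulr_sumr -big_split.
apply: eq_bigr => p _ /=.
have [_ h] := smoothZ p.1 (wave_smooth_any A p.2).
rewrite -[LHS]/(iter_partial [:: j] (fun x => p.1 * wave A p.2 x) x) h /= wave_partial waveE.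
have -> : Complex 0 (2 * pi * p.2 ord0 j) = Complex 0 (2 * pi) * rC (p.2 ord0 j) :> C.
  by apply: C_eqP; rewrite /=; ring.
ring.
Qed.

Lemma norm_trig P x : nC (trig P x) <= \sum_(p <- P) nC p.1.
Proof.
apply: le_trans (ler_norm_sum _ _ _) _; apply: ler_sum => p _.
by rewrite normC_mul normC_cis mulr1.
Qed.

(** Differentiating the Gaussian costs [A |x_j|], of order [sqrt A] in the mean. The derivative of
    the trigonometric polynomial is dominated pointwise by [trig S], whose integral against the
    Gaussian is explicit. *)
Lemma packet_partial_int A P S j : 0 < A ->
  (forall x l, nC (trig (dtrig l P) x) <= complex.Re (trig S x)) ->
  Num.sqrt A ^+ d * \int[mu]_x nC (partial j (packet A P) x) <=
  2 * pi * (\sum_(p <- P) nC p.1) * Num.sqrt 2 ^+ d * Num.sqrt A +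
  2 * pi * complex.Re (\sum_(s <- S) s.1 * rC (gam A^-1 s.2)).
Proof.
move=> A0 hP; set c := \sum_(p <- P) _.
have c0 : 0 <= c by apply: sumr_ge0.
have A20 : 0 < A / 2 by rewrite divr_gt0.
have sA : 0 < Num.sqrt A by rewrite sqrtr_gt0.
have pp : 0 <= 2 * pi :> R by rewrite mulr_ge0 ?pi_ge0.
have [iS1 iS2] : cintg mu (packet A S) := packet_iter_cintg S [::] A0.
have i1 := gam_intg d A20.
have i2 : intg mu (fun x => 2 * pi * c * Num.sqrt A * gam (A / 2) x).
  exact: intgZ.
have i3 : intg mu (fun x => 2 * pi * complex.Re (packet A S x)) by exact: intgZ.
have b x : nC (partial j (packet A P) x) <=
    2 * pi * c * Num.sqrt A * gam (A / 2) x + 2 * pi * complex.Re (packet A S x).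
  rewrite packet_partial; apply: le_trans (ler_normD _ _) _; apply: lerD.
    rewrite packetE !normC_mul !normC_real (ger0_norm (gam_ge0 _ _)) normrM normrN.
    rewrite (ger0_norm (mulr_ge0 pp (ltW A0))).
    have h1 := norm_trig P x; have h2 := lin_gam_le x j A0.
    apply: (@le_trans _ _ (2 * pi * A * c * (`|x ord0 j| * gam A x))).
      have -> : 2 * pi * A * `|x ord0 j| * (nC (trig P x) * gam A x) =
        2 * pi * A * nC (trig P x) * (`|x ord0 j| * gam A x) by ring.
      rewrite ler_wpM2r ?mulr_ge0 ?gam_ge0// ler_wpM2l// mulr_ge0// ltW//.
    apply: le_trans (ler_wpM2l _ h2) _; first by rewrite !mulr_ge0 ?pi_ge0// ltW.
    rewrite mulrA ler_wpM2r ?gam_ge0// le_eqVlt; apply/orP; left; apply/eqP.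
    rewrite -{1}(sqr_sqrtr (ltW A0)); field; exact: lt0r_neq0.
  rewrite normC_mul norm_imag ger0_norm// ler_wpM2l// packetE normC_mul normC_real.
  rewrite ger0_norm ?gam_ge0// Re_mul /= mulr0 subr0 ler_wpM2r ?gam_ge0//.
have iN := cintg_norm (packet_iter_cintg P [:: j] A0).
have i4 : intg mu (fun x => 2 * pi * c * Num.sqrt A * gam (A / 2) x + 2 * pi * complex.Re (packet A S x)).
  by under eq_fun do rewrite EFinD; exact: integrableD.
have le1 : \int[mu]_x nC (partial j (packet A P) x) <=
    \int[mu]_x (2 * pi * c * Num.sqrt A * gam (A / 2) x + 2 * pi * complex.Re (packet A S x)).
  by apply: le_Rintegral => // x _; exact: b.
apply: le_trans (ler_wpM2l (exprn_ge0 _ (ltW sA)) le1) _.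
rewrite RintegralD// !RintegralZl//.
have [_ I1] := gam_int (0 : E) A20.
have {}I1 : \int[mu]_x gam (A / 2) x = (Num.sqrt (A / 2))^-1 ^+ d.
  by rewrite -I1; apply: eq_Rintegral => x _; rewrite subr0.
have I2 : \int[mu]_x complex.Re (packet A S x) =
    complex.Re (\sum_(s <- S) s.1 * rC ((Num.sqrt A)^-1 ^+ d * gam A^-1 s.2)).
  rewrite -[LHS]/(complex.Re (cI mu (packet A S))) /packet cI_sum => [|s]; last first.
    by apply: cintgZ; exact: (wave_cintg _ A0).1.
  congr complex.Re; apply: eq_bigr => s _.
  by rewrite cIZ ?(wave_cintg _ A0).2//; exact: (wave_cintg _ A0).1.
rewrite I1 I2 mulrDr; apply: lerD.
  have -> : Num.sqrt 2 ^+ d = Num.sqrt A ^+ d * (Num.sqrt (A / 2))^-1 ^+ d.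
    rewrite -exprMn; congr (_ ^+ d).
    by rewrite sqrtrM ?(ltW A0)// sqrtrV// invfM invrK mulrA mulfV ?mul1r// gt_eqF.
  by rewrite le_eqVlt; apply/orP; left; apply/eqP; ring.
rewrite mulrCA ler_wpM2l// le_eqVlt; apply/orP; left; apply/eqP.
have -> : Num.sqrt A ^+ d * complex.Re (\sum_(s <- S) s.1 * rC ((Num.sqrt A)^-1 ^+ d * gam A^-1 s.2)) =
  complex.Re (rC (Num.sqrt A ^+ d) * (\sum_(s <- S) s.1 * rC ((Num.sqrt A)^-1 ^+ d * gam A^-1 s.2))).
  by rewrite Re_mul /= mul0r subr0.
congr complex.Re; rewrite mulr_sumr; apply: eq_bigr => s _.
rewrite mulrCA -rCM mulrA -exprMn mulfV ?expr1n ?mul1r// gt_eqF//.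
Qed.

Lemma gam_cvg0 (c : R) (eta : E) : 0 < c -> 
  (fun n : nat => gam (c * n.+1%:R) eta) @ \oo --> ((eta == 0)%:R : R).
Proof.
move=> c0; have [->|e0] := eqVneq eta 0.
  rewrite (_ : (fun n => _) = cst 1); first exact: cvg_cst.
  by apply/funext => n; rewrite /gam big1// => i _; rewrite mxE gs0.
have [i ei] := entry_neq0 e0.
have t0 : 0 < pi * c * eta ord0 i ^+ 2.
  have e2 : 0 < eta ord0 i ^+ 2 by rewrite exprn_even_gt0.
  by rewrite mulr_gt0// mulr_gt0// pi_gt0.
apply: (@squeeze_cvgr _ _ _ _ (cst 0) (fun n => (pi * c * eta ord0 i ^+ 2)^-1 * harmonic n)).
- near=> n; rewrite gam_ge0/=.
  have n0 : 0 < n.+1%:R :> R by rewrite ltr0n.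
  apply: (@le_trans _ _ (gs (c * n.+1%:R) (eta ord0 i))).
    rewrite /gam (bigD1 i)//= ler_piMr ?gs_ge0// prodr_ile1// => k _.
    by rewrite gs_ge0 gs_le1// mulr_ge0// ltW.
  have tn := mulr_gt0 t0 n0.
  rewrite /gs expRN /harmonic /= -invfM lef_pV2 ?posrE ?expR_gt0//.
  apply: le_trans (expR_ge1Dx _).
  have -> : pi * (c * n.+1%:R) * eta ord0 i ^+ 2 = pi * c * eta ord0 i ^+ 2 * n.+1%:R by ring.
  by rewrite lerDr.
- exact: cvg_cst.
- rewrite -[X in _ --> X](mulr0 (pi * c * eta ord0 i ^+ 2)^-1).
  by apply: cvgM; [exact: cvg_cst|exact: cvg_harmonic].
Unshelve. all: by end_near. Qed.

End bohr.

(** * Limits of the pairings of two packets *)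

Section bohr_multiplier.
Variables (R : realType) (d : nat).
Local Notation C := (Rcomplex R).
Local Notation E := 'rV[R]_d.
Local Notation nC z := (`|(z : C)|).
Local Notation mu := (lebesgue_rV R d).
Local Notation intg m f := (m.-integrable setT (fun x => (f x)%:E)).
Implicit Types (P Q S : seq (C * E)).

Variables (W : E -> C) (B : R) (l : 'I_d).
Hypotheses (B0 : 0 <= B) (cW : ccont W) (hW : forall z, nC (W z) <= B * `|z ord0 l|).

(** The contribution of one pair of frequencies to the pairing of two packets, seen on the Fourier
    side; [W] stands for [M xi_l]. *)
Definition pairing (p q : E) (b : R) : C :=
  cI mu (fun x => W x * rC (Num.sqrt b ^+ d * (gam b (p - x) * gam b (q + x)))).

Lemma pairing_cintg p q b : 0 < b ->
  cintg mu (fun x => W x * rC (Num.sqrt b ^+ d * (gam b (p - x) * gam b (q + x)))).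
Proof.
move=> b0; have b2 : 0 < 2 * b by rewrite mulr_gt0.
have h := cintgZ (rC (Num.sqrt b ^+ d * gam (b / 2) (p + q)))
  (cintg_lin (2^-1 *: (p - q)) (ccont_cmeas cW) B0 b2 hW).
have e : (fun x => W x * rC (Num.sqrt b ^+ d * (gam b (p - x) * gam b (q + x)))) =
  (fun x => rC (Num.sqrt b ^+ d * gam (b / 2) (p + q)) *
    (W x * rC (gam (2 * b) (x - 2^-1 *: (p - q))))).
  by apply/funext => x; rewrite gam_mul !rCM; ring.
by rewrite e.
Qed.

Lemma pairingE p q b : 0 < b -> pairing p q b =
  rC ((Num.sqrt 2)^-1 ^+ d * gam (b / 2) (p + q)) *
  cI mu (fun x => W x * rC (Num.sqrt (2 * b) ^+ d * gam (2 * b) (x - 2^-1 *: (p - q)))).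
Proof.
move=> b0; have b2 : 0 < 2 * b by rewrite mulr_gt0.
have h := cintgZ (rC (Num.sqrt (2 * b) ^+ d))
  (cintg_lin (2^-1 *: (p - q)) (ccont_cmeas cW) B0 b2 hW).
have e2 : Num.sqrt b ^+ d = (Num.sqrt 2)^-1 ^+ d * Num.sqrt (2 * b) ^+ d.
  rewrite -exprMn; congr (_ ^+ d).
  by rewrite sqrtrM// mulrA mulVf ?mul1r// gt_eqF// sqrtr_gt0.
rewrite -cIZ.
  by congr (cI _ _); apply/funext => x; rewrite gam_mul e2 !rCM; ring.
have e : (fun x => W x * rC (Num.sqrt (2 * b) ^+ d * gam (2 * b) (x - 2^-1 *: (p - q)))) =
  (fun x => rC (Num.sqrt (2 * b) ^+ d) * (W x * rC (gam (2 * b) (x - 2^-1 *: (p - q))))).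
  by apply/funext => x; rewrite !rCM; ring.
by rewrite e.
Qed.

(** By [pairingE] this is an average of [W] around [(p - q) / 2], which is [p] when [p + q = 0]. The
    power of [sqrt 2] is the normalisation lost in multiplying two Gaussians. *)
Lemma pairing_cvg p q : ccvg (fun n => pairing p q n.+1%:R)
  (rC ((Num.sqrt 2)^-1 ^+ d) * (if p + q == 0 then W p else 0)).
Proof.
set u := 2^-1 *: (p - q).
have c1 : ccvg (fun n => cI mu (fun x => W x *
    rC (Num.sqrt (2 * n.+1%:R) ^+ d * gam (2 * n.+1%:R) (x - u)))) (W u).
  apply/ccvgP => e e0.
  have hW' z : nC (W z) <= B * (1 + `|z|).
    apply: le_trans (hW z) _; rewrite ler_wpM2l//.
    by apply: le_trans (ler_entry z l) _; rewrite lerDr.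
  have [b0 b00 hb] := gauss_average (ccont_cmeas cW) B0 hW' ((ccontP W).2 cW u) e0.
  have := nbhs_infty_ger b0; apply: filterS => n nb.
  have [|_ ->//] := hb (2 * n.+1%:R).
  have : (n%:R : R) <= n.+1%:R by rewrite ler_nat.
  by have : (0 : R) <= n%:R by []; lra.
have c2 : ccvg (fun n => rC ((Num.sqrt 2)^-1 ^+ d * gam (n.+1%:R / 2) (p + q)))
    (rC ((Num.sqrt 2)^-1 ^+ d * (p + q == 0)%:R)).
  apply: ccvg_real; apply: cvgM; first exact: cvg_cst.
  have h : 0 < 2^-1 :> R by [].
  by under eq_fun do rewrite [_ / 2]mulrC; exact: gam_cvg0.
have := ccvgM c2 c1; congr ccvg.
  by apply/funext => n; rewrite pairingE// ltr0n.
rewrite rCM -mulrA; congr (_ * _).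
have [pq|_] := eqVneq (p + q) 0; last by rewrite /= -[rC 0]/(0 : C) mul0r.
rewrite -[rC _]/(1 : C) mul1r; congr W.
have -> : u = 2^-1 *: (p + p).
  by rewrite /u; congr (_ *: (_ + _)); apply/eqP; rewrite eq_sym -addr_eq0 pq.
have -> : p + p = (2 : R) *: p by rewrite scaler_nat mulr2n.
by rewrite scalerA mulVf ?scale1r// pnatr_eq0.
Qed.

(* Multiplying by [sqrt A ^ d] normalises the Gaussians: with [b = 1 / A], the
   left-hand side tends to the sum over resonant pairs as [b] tends to infinity. *)
Lemma pairing_packet (m' gl : E -> C) (A : R) P Q : 0 < A ->
  cmeas m' -> (forall x, nC (m' x) <= B) ->
  {ae mu, forall x, m' x * rC (x ord0 l) = W x} -> cintg mu gl ->
  (forall phi, test_function phi -> cI mu (fun x => gl x * phi x) =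
    cI mu (fun xi => (m' xi * fourier (packet A P) xi) *
      (Complex 0 (2 * pi * xi ord0 l) * cI mu (fun x => plane xi x * phi x)))) ->
  rC (Num.sqrt A ^+ d) * cI mu (fun x => gl x * packet A Q x) =
  Complex 0 (2 * pi) * \sum_(q <- Q) \sum_(p <- P) p.1 * q.1 * pairing p.2 q.2 A^-1.
Proof.
move=> A0 mm hB aeW cg hg; have Ai : 0 < A^-1 by rewrite invr_gt0.
have sA : 0 < Num.sqrt A by rewrite sqrtr_gt0.
have pp : 0 < 2 * pi :> R by rewrite mulr_gt0 ?pi_gt0.
have [mf [u iu hu]] := fourier_packet_bound P A0.
pose V xi : C := (m' xi * fourier (packet A P) xi) * Complex 0 (2 * pi * xi ord0 l).
have mim : cmeas (fun xi : E => Complex 0 (2 * pi * xi ord0 l) : C).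
  split => /=; first exact: measurable_cst.
  by apply: measurable_funM => //; exact: measurable_coord.
have cV : cintg mu V.
  apply: (cintg_dom _ (intgZ (B * (2 * pi)) iu)).
    by apply: cmeasM => //; exact: cmeasM.
  move=> xi; rewrite /V !normC_mul norm_imag normrM (gtr0_norm pp).
  have [_ /(_ l) h] := hu xi.
  have -> : nC (m' xi) * nC (fourier (packet A P) xi) * (2 * pi * `|xi ord0 l|) =
    nC (m' xi) * (2 * pi * (nC (fourier (packet A P) xi) * `|xi ord0 l|)) by ring.
  rewrite -[leRHS]mulrA; apply: ler_pM => //.
    by rewrite mulr_ge0 ?(ltW pp)// mulr_ge0.
  by rewrite ler_wpM2l// ltW.
have cgw eta : cintg mu (fun x => gl x * wave A eta x).
  apply: (cintgM_bounded (B := 1) cg).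
    by apply: ccont_cmeas; apply: smooth_ccont; exact: wave_smooth_any.
  by move=> x; rewrite norm_wave gam_le1// ltW.
have e1 : cI mu (fun x => gl x * packet A Q x) =
    \sum_(q <- Q) q.1 * cI mu (fun x => gl x * wave A q.2 x).
  transitivity (cI mu (fun x => \sum_(q <- Q) q.1 * (gl x * wave A q.2 x))).
    congr (cI _ _); apply/funext => x; rewrite /packet mulr_sumr.
    by apply: eq_bigr => q _; ring.
  rewrite cI_sum => [|q]; last exact: cintgZ.
  by apply: eq_bigr => q _; rewrite cIZ.
rewrite e1 !mulr_sumr; apply: eq_bigr => q _.
have -> : cI mu (fun x => gl x * wave A q.2 x) =
    cI mu (fun xi => V xi * rC ((Num.sqrt A)^-1 ^+ d * gam A^-1 (q.2 + xi))).
  apply: identity_wave => // phi tp.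
  by rewrite hg//; congr (cI _ _); apply/funext => xi; rewrite /V -!mulrA.
have cVg : cintg mu (fun xi => V xi * rC ((Num.sqrt A)^-1 ^+ d * gam A^-1 (q.2 + xi))).
  apply: (cintgM_bounded (B := (Num.sqrt A)^-1 ^+ d) cV).
    apply: cmeas_real; apply: measurable_funM => //.
    have [h _] := gam_int (- q.2) Ai.
    have := intg_meas h; under eq_fun do rewrite opprK addrC; exact.
  move=> xi; rewrite normC_real ger0_norm ?mulr_ge0 ?gam_ge0 ?exprn_ge0 ?invr_ge0 ?sqrtr_ge0//.
  by rewrite ler_piMr ?gam_le1 ?(ltW Ai)// exprn_ge0// invr_ge0 sqrtr_ge0.
have cT p := pairing_cintg p q.2 Ai.
(* The transform of the packet times that of the wave is a sum of products of two Gaussians, and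
   [m' xi_l] may be replaced under the integral by the continuous [W]. *)
have e2 : rC (Num.sqrt A ^+ d) *
    cI mu (fun xi => V xi * rC ((Num.sqrt A)^-1 ^+ d * gam A^-1 (q.2 + xi))) =
    cI mu (fun xi => \sum_(p <- P) (Complex 0 (2 * pi) * p.1) *
      (W xi * rC (Num.sqrt A^-1 ^+ d * (gam A^-1 (p.2 - xi) * gam A^-1 (q.2 + xi))))).
  rewrite -cIZ//; apply: ae_eq_cI.
  - exact: cintg_cmeas (cintgZ _ cVg).
  - by apply: cintg_cmeas; apply: cintg_sum => p; apply: cintgZ; exact: cT.
  apply: filterS aeW => xi <-; rewrite /V fourier_packet// mulr_sumr !mulr_suml mulr_sumr.
  apply: eq_bigr => p _.
  have -> : Complex 0 (2 * pi * xi ord0 l) = Complex 0 (2 * pi) * rC (xi ord0 l) :> C.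
    by apply: C_eqP; rewrite /=; ring.
  rewrite sqrtrV ?(ltW A0)// !rCM.
  have e3 : rC (Num.sqrt A ^+ d) * rC ((Num.sqrt A)^-1 ^+ d) = 1 :> C.
    by rewrite -rCM -exprMn mulfV ?expr1n// gt_eqF.
  transitivity ((rC (Num.sqrt A ^+ d) * rC ((Num.sqrt A)^-1 ^+ d)) *
    ((Complex 0 (2 * pi) * p.1) * (m' xi * rC (xi ord0 l) * (rC ((Num.sqrt A)^-1 ^+ d) *
    (rC (gam A^-1 (p.2 - xi)) * rC (gam A^-1 (q.2 + xi))))))); first by ring.
  by rewrite e3 mul1r.
rewrite mulrCA e2 cI_sum => [|p]; last by apply: cintgZ; exact: cT.
rewrite !mulr_sumr; apply: eq_bigr => p _; rewrite cIZ; last exact: cT.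
by rewrite /pairing; ring.
Qed.

End bohr_multiplier.

(** * The discrete inequality for multipliers *)

Section bohr_of.
Variables (R : realType) (d : nat).
Local Notation C := (Rcomplex R).
Local Notation E := 'rV[R]_d.
Local Notation nC z := (`|(z : C)|).
Local Notation mu := (lebesgue_rV R d).
Local Notation intg m f := (m.-integrable setT (fun x => (f x)%:E)).

(** Origin of the constant: 2 comes from [cI_le], [K0] from the operator, [d] from summing [d]
    derivatives with the same majorant, and [sqrt 2 ^ d] from [pairing_cvg]. The factors [2 pi] of
    the two sides cancel. *)
Lemma bohr_of_multiplier (m' M : E -> C) (B K0 : R) : 0 <= B -> 0 <= K0 ->
  cmeas m' -> (forall x, nC (m' x) <= B) -> (forall x, nC (M x) <= B) ->
  {ae mu, forall x, m' x = M x} -> (forall l, ccont (fun xi => M xi * rC (xi ord0 l))) ->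
  (forall P A, 0 < A -> exists g : 'I_d -> E -> C, [/\ forall l, cintg mu (g l),
    \sum_l \int[mu]_x nC (g l x) <= K0 * \sum_j \int[mu]_x nC (partial j (packet A P) x) &
    forall l phi, test_function phi -> cI mu (fun x => g l x * phi x) =
      cI mu (fun xi => (m' xi * fourier (packet A P) xi) *
        (Complex 0 (2 * pi * xi ord0 l) * cI mu (fun x => plane xi x * phi x)))]) ->
  bohr (2 * K0 * d%:R * Num.sqrt 2 ^+ d) M.
Proof.
move=> B0 K00 mm hm hM aeM cM fam P Q S K hP hQ l.
have pp : 0 < 2 * pi :> R by rewrite mulr_gt0 ?pi_gt0.
have s2 : 0 < Num.sqrt 2 :> R by rewrite sqrtr_gt0.
have K1 : 0 <= K by apply: le_trans (hQ 0).
pose W xi := M xi * rC (xi ord0 l).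
have hW z : nC (W z) <= B * `|z ord0 l| by rewrite normC_mul normC_real ler_wpM2r.
have aeW : {ae mu, forall x, m' x * rC (x ord0 l) = W x} by apply: filterS aeM => x ->.
pose c := \sum_(p <- P) nC p.1.
pose SS A := complex.Re (\sum_(s <- S) s.1 * rC (gam A^-1 s.2)).
have bound A : 0 < A -> nC (Complex 0 (2 * pi) *
    \sum_(q <- Q) \sum_(p <- P) p.1 * q.1 * pairing W p.2 q.2 A^-1) <=
    2 * K * K0 * (d%:R * (2 * pi * c * Num.sqrt 2 ^+ d * Num.sqrt A + 2 * pi * SS A)).
  move=> A0; have [g [cg ng hg]] := fam P A A0.
  have sA : 0 < Num.sqrt A by rewrite sqrtr_gt0.
  rewrite -(pairing_packet (W := W) B0 (cM l) hW Q A0 mm hm aeW (cg l) (hg l)).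
  rewrite normC_mul normC_real ger0_norm ?exprn_ge0 ?(ltW sA)//.
  have pQ x : nC (packet A Q x) <= K.
    rewrite packetE normC_mul normC_real ger0_norm ?gam_ge0//; apply: le_trans (hQ x).
    by rewrite ler_piMr// gam_le1// ltW.
  have cgQ : cintg mu (fun x => g l x * packet A Q x).
    apply: (cintgM_bounded (B := K) (cg l)).
      by apply: ccont_cmeas; apply: smooth_ccont; exact: (packet_smooth Q A0).1.
    exact: pQ.
  have b1 : nC (cI mu (fun x => g l x * packet A Q x)) <= 2 * \int[mu]_x (K * nC (g l x)).
    apply: cI_le => //; first by apply: intgZ; exact: cintg_norm.
    by move=> x; rewrite normC_mul mulrC ler_wpM2r.
  rewrite RintegralZl// in b1; last exact: cintg_norm.
  have b2 : \int[mu]_x nC (g l x) <= K0 * \sum_j \int[mu]_x nC (partial j (packet A P) x).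
    apply: le_trans ng; rewrite (bigD1 l)//= lerDl sumr_ge0// => i _.
    by apply: Rintegral_ge0.
  have hZ j : Num.sqrt A ^+ d * \int[mu]_x nC (partial j (packet A P) x) <=
      2 * pi * c * Num.sqrt 2 ^+ d * Num.sqrt A + 2 * pi * SS A.
    exact: packet_partial_int.
  move: (2 * pi * c * _ * _ + _) hZ => Z hZ.
  apply: le_trans (ler_wpM2l (exprn_ge0 _ (ltW sA)) b1) _.
  rewrite mulrCA [leRHS]mulrA -[2 * K * K0]mulrA -!mulrA ler_wpM2l//.
  rewrite mulrCA ler_wpM2l//.
  apply: le_trans (ler_wpM2l (exprn_ge0 _ (ltW sA)) b2) _.
  rewrite mulrCA ler_wpM2l// mulr_sumr.
  have -> : d%:R * Z = \sum_(j < d) Z by rewrite sumr_const card_ord [LHS]mulr_natl.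
  by apply: ler_sum => j _.
pose Sg : C := \sum_(q <- Q) \sum_(p <- P) p.1 * q.1 *
  (rC ((Num.sqrt 2)^-1 ^+ d) * (if p.2 + q.2 == 0 then W p.2 else 0)).
(* The Gaussians flatten along [A = 1 / (n + 1)], and the inequality [bound] is taken to the limit;
   its term in [sqrt A] disappears. *)
have lim1 : (fun n : nat => nC (Complex 0 (2 * pi) *
    \sum_(q <- Q) \sum_(p <- P) p.1 * q.1 * pairing W p.2 q.2 n.+1%:R)) @ \oo -->
    nC (Complex 0 (2 * pi) * Sg).
  apply: ccvg_norm; apply: ccvgM; first exact: ccvg_cst.
  apply: ccvg_sum => q; apply: ccvg_sum => p; apply: ccvgM; first exact: ccvg_cst.
  exact: (pairing_cvg B0 (cM l) hW).
have lim2 : (fun n : nat => 2 * K * K0 * (d%:R * (2 * pi * c * Num.sqrt 2 ^+ d *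
    Num.sqrt n.+1%:R^-1 + 2 * pi * SS n.+1%:R^-1))) @ \oo -->
    2 * K * K0 * (d%:R * (2 * pi * c * Num.sqrt 2 ^+ d * 0 +
      2 * pi * complex.Re (\sum_(s <- S) s.1 * rC (s.2 == 0)%:R))).
  apply: cvgM; first exact: cvg_cst.
  apply: cvgM; first exact: cvg_cst.
  apply: cvgD; apply: cvgM; try exact: cvg_cst.
    rewrite -[X in _ --> X]sqrtr0; apply: continuous_cvg; first exact: sqrt_continuous.
    exact: cvg_harmonic.
  have [+ _] : ccvg (fun n : nat => \sum_(s <- S) s.1 * rC (gam n.+1%:R^-1^-1 s.2))
      (\sum_(s <- S) s.1 * rC (s.2 == 0)%:R).
    apply: ccvg_sum => s; apply: ccvgM; first exact: ccvg_cst.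
    have e : (fun n : nat => gam n.+1%:R^-1^-1 s.2) = (fun n : nat => gam (1 * n.+1%:R) s.2).
      by apply/funext => n; rewrite invrK mul1r.
    have h : (fun n : nat => gam n.+1%:R^-1^-1 s.2) @ \oo --> ((s.2 == 0)%:R : R).
      by rewrite e; exact: (@gam_cvg0 R d 1 s.2 ltr01).
    exact: ccvg_real h.
  exact.
have bn (n : nat) : nC (Complex 0 (2 * pi) *
    \sum_(q <- Q) \sum_(p <- P) p.1 * q.1 * pairing W p.2 q.2 n.+1%:R) <=
    2 * K * K0 * (d%:R * (2 * pi * c * Num.sqrt 2 ^+ d * Num.sqrt n.+1%:R^-1 +
      2 * pi * SS n.+1%:R^-1)).
  have n0 : 0 < n.+1%:R^-1 :> R by rewrite invr_gt0.
  by have := bound _ n0; rewrite invrK.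
have : nC (Complex 0 (2 * pi) * Sg) <= 2 * K * K0 * (d%:R * (2 * pi * c * Num.sqrt 2 ^+ d * 0 +
    2 * pi * complex.Re (\sum_(s <- S) s.1 * rC (s.2 == 0)%:R))).
  by apply: (ler_cvg_to lim1 lim2); exact: nearW.
rewrite [_ * 0]mulr0 add0r.
have -> : Sg = rC ((Num.sqrt 2)^-1 ^+ d) * \sum_(p <- P) \sum_(q <- Q)
    (if p.2 + q.2 == 0 then p.1 * q.1 * (M p.2 * rC (p.2 ord0 l)) else 0).
  rewrite /Sg exchange_big mulr_sumr; apply: eq_bigr => p _.
  rewrite mulr_sumr; apply: eq_bigr => q _.
  by case: eqP => _; rewrite ?mulr0// /W; ring.
have -> : \sum_(s <- S) s.1 * rC (s.2 == 0)%:R = \sum_(s <- S | s.2 == 0) s.1 :> C.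
  rewrite [RHS]big_mkcond; apply: eq_bigr => s _.
  by case: eqP => _; rewrite /= -?[rC 1]/(1 : C) -?[rC 0]/(0 : C) ?mulr1 ?mulr0.
rewrite !normC_mul norm_imag (gtr0_norm pp) normC_real ger0_norm ?exprn_ge0 ?invr_ge0 ?(ltW s2)//.
set X := nC _; set Y := complex.Re _ => h.
have s2d : 0 < Num.sqrt 2 ^+ d :> R by rewrite exprn_gt0.
rewrite exprVn in h; move: (Num.sqrt 2 ^+ d) s2d h => t t0 h.
rewrite -(ler_pM2l (divr_gt0 pp t0)) -mulrA; apply: le_trans h _.
rewrite le_eqVlt; apply/orP; left; apply/eqP.
by move: (pi : R) pp => p0 pp; field; exact: lt0r_neq0.
Qed.

End bohr_of.

(** * Assembly of the continuous representative *)

Theorem theorem1p1 (R : realType) (d : nat) (hd : (2 <= d)%N)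
    (m : 'rV[R]_d -> Rcomplex R) (hm : sobolev_fourier_multiplier m) :
  exists m0 : 'rV[R]_d -> Rcomplex R,
    [/\ continuous m0,
        exists B : R, forall x, `|m0 x| <= B &
        {ae lebesgue_rV R d, forall x, m x = m0 x}].
Proof.
have d0 : (0 < d)%N by exact: leq_trans hd.
have [m' [B [K0 [mm [B0 K00] hB aem fam]]]] := multiplier_identity hm.
have [|M [hM cM aeM cS]] := multiplier_repr d0 mm B0 hB.
  by have [g [cg _ hg]] := fam [:: (1, 0)] 1 ltr01; exists g.
have hb := bohr_of_multiplier B0 K00 mm hB hM aeM cS fam.
have c0 : 0 <= 2 * K0 * d%:R * Num.sqrt 2 ^+ d by rewrite !mulr_ge0.
have [L hL] := bohr_limit0 hd hb c0 hM cM.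
(* Only the value at 0 is corrected, and a point is a null set because [d > 0]. *)
pose m0 x := if x == 0 then L else M x.
exists m0; split.
- move=> a; have FF : Filter (nbhs a) := nbhs_filter a.
  apply/cvgrPdist_lt => e e0.
  have near_rV (r : R) (Q : 'rV[R]_d -> Prop) : 0 < r -> (forall z, `|z - a| < r -> Q z) ->
      \forall z \near a, Q z.
    move=> r0 hr; apply: filterS (nbhsx_ballx a r r0) => z.
    by rewrite -ball_normE /= distrC; exact: hr.
  have [a0|a0] := eqVneq a 0.
    have [h h0 hh] := hL e e0; apply: (near_rV h) => // z; rewrite a0 subr0 => zh.
    rewrite distrC /m0 eqxx; case: ifP => [_|/negbT z0]; first by rewrite subrr normr0.
    exact: hh.
  have [h h0 hh] := cM a a0 e e0.
  (* The radius [|a|] keeps [z] away from 0, so that [m0] coincides with [M] at [z]. *)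
  apply: (near_rV (Num.min h `|a|)); first by rewrite lt_min h0 normr_gt0.
  move=> z; rewrite lt_min => /andP[zh za].
  have z0 : z != 0 by apply: contraTneq za => ->; rewrite sub0r normrN ltxx.
  rewrite distrC /m0 (negbTE a0) (negbTE z0).
  by have := hh (z - a) zh; rewrite [a + _]addrC subrK.
- exists (B + `|L|) => x; rewrite /m0; case: ifP => _; first by rewrite lerDr.
  by apply: le_trans (hM x) _; rewrite lerDl.
- have ne0 := ae_neq0 R d0; apply: filterS3 aem aeM ne0 => x -> -> x0.
  by rewrite /m0 (negbTE x0).
Qed.
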